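(* There exist absolute constants $c,C>0$ such that the following holds. Let $\mu$ be an isotropic log-concave probability measure on $\mathbb{R}^n$, let $n\leq N\leq\exp(\sqrt{n})$, let $x_1,\ldots,x_N$ be independent random points distributed according to $\mu$, and let $K_N=\mathrm{conv}\{\pm x_1,\ldots,\pm x_N\}$. Then with probability greater than $1-\exp(-c\sqrt{n})$ the isotropic constant of $K_N$ satisfies $$L_{K_N}\leq C\sqrt{\log(2N/n)}.$$
   Context: A log-concave probability measure on $\mathbb{R}^n$ is isotropic if its center of mass is the origin and its covariance matrix is the identity. For a symmetric convex body $K$ in $\mathbb{R}^n$ the isotropic constant is the affine invariant $$L_K=|K|^{-1/n}\,[\det \mathrm{Cov}(K)]^{1/(2n)},\qquad \mathrm{Cov}(K)_{ij}=\frac{1}{|K|}\int_Kx_ix_j\,dx,$$ where $|\cdot|$ is volume; equivalently, if $\hat K$ is a linear image of $K$ with $|\hat K|=1$ and $\int_{\hat K}\langle x,\theta\rangle^2dx$ independent of $\theta\in S^{n-1}$, then this common value is $L_K^2$. *)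

(* Defs.v *)
From HB Require Import structures.
From mathcomp Require Import all_boot all_order all_algebra.
From mathcomp Require Import all_classical all_reals all_analysis.

Set Implicit Arguments.
Unset Strict Implicit.
Unset Printing Implicit Defensive.

Import Order.TTheory GRing.Theory Num.Theory.
Import numFieldNormedType.Exports.

Local Open Scope classical_set_scope.
Local Open Scope ring_scope.

Definition borel_display : measure_display.
Proof. exact: default_measure_display. Qed.

Section borel_rV.
Context {R : realType} {n : nat}.

Definition borel_rV : set (set 'rV[R]_n) := <<s @open 'rV[R]_n >>.

Let borel0 : borel_rV set0.
Proof. exact: sigma_algebra0. Qed.

Let borelC A : borel_rV A -> borel_rV (~` A).
Proof. exact: sigma_algebraC. Qed.

Let borel_bigcup (F : (set 'rV[R]_n)^nat) :
  (forall i, borel_rV (F i)) -> borel_rV (\bigcup_i F i).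
Proof. exact: sigma_algebra_bigcup. Qed.

HB.instance Definition _ := @isMeasurable.Build borel_display
  'rV[R]_n borel_rV borel0 borelC borel_bigcup.

End borel_rV.

Section measurable_rV.
Context {R : realType}.

Lemma open_measurable_rV n (U : set 'rV[R]_n) : open U -> measurable U.
Proof. by move=> oU; apply: sub_gen_smallest. Qed.

Lemma measurable_coord n (i : 'I_n) :
  measurable_fun [set: 'rV[R]_n] (fun x : 'rV[R]_n => x ord0 i).
Proof.
apply: (measurability _ (measurable_realfun.RGenOpens.measurableE R)).
move=> _ [_ [a [b ->]] <-]; rewrite setTI; apply: open_measurable_rV.
by apply: open_comp => [x _|]; [exact: coord_continuous|exact: interval_open].
Qed.

Lemma measurable_fun_rV d (T : measurableType d) n (f : T -> 'rV[R]_n) :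
  (forall i, measurable_fun [set: T] (fun t => f t ord0 i)) ->
  measurable_fun [set: T] f.
Proof.
move=> mf.
pose box (qk : 'rV[rat]_n * nat) : set 'rV[R]_n :=
  [set x | forall i, ball (ratr (qk.1 ord0 i) : R) (qk.2.+1%:R^-1) (x ord0 i)].
apply: (@measurability _ _ _ _ setT f (@open 'rV[R]_n)) => //.
move=> _ [U oU <-]; rewrite setTI.
have -> : f @^-1` U =
    \bigcup_(qk in [set: 'rV[rat]_n * nat])
      (if `[< box qk `<=` U >] then f @^-1` box qk else set0).
  apply/seteqP; split => t /=; last first.
    by move=> [qk _]; case: ifPn => // /asboolP bU /= /bU.
  move=> Uft.
  have /nbhs_ballP[e /= e0 beU] : nbhs (f t) U by exact: open_nbhs_nbhs.
  have [k _ /(_ _ (leqnn k)) ke] :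
      \forall k \near \oo, (k.+1%:R^-1 : R) < e / 2.
    by apply: near_infty_natSinv_lt (PosNum (divr_gt0 e0 (ltr0n _ 2))).
  have k0 : 0 < k.+1%:R^-1 :> R by rewrite invr_gt0.
  have /choice[q qP] : forall i, exists q : rat,
      ball (f t ord0 i) k.+1%:R^-1 (ratr q : R).
    move=> i.
    have /rat_in_itvoo[q] : f t ord0 i - k.+1%:R^-1 < f t ord0 i + k.+1%:R^-1.
      by rewrite ltrBlDr -addrA ltrDl addr_gt0.
    by move=> qi; exists q; rewrite ball_itv.
  exists (\row_i q i, k) => //; rewrite ifT; last first.
    apply/asboolP => x bx; apply: beU; split => // i j; rewrite (ord1 i).
    have := bx j; rewrite /= mxE => bxj.
    have := ball_triangle (qP j) bxj; apply: le_ball.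
    by rewrite (splitr e) lerD// ltW.
  by move=> i /=; rewrite mxE; exact: ball_sym.
apply: countable_bigcupT_measurable; first exact: countableP.
move=> qk; case: ifPn => // _.
have -> : f @^-1` box qk = \bigcap_(i in [set: 'I_n])
    ((fun t => f t ord0 i) @^-1` ball (ratr (qk.1 ord0 i) : R) qk.2.+1%:R^-1).
  by apply/seteqP; split => t /= ht i; [move=> _|]; exact: ht.
apply: fin_bigcap_measurable; first exact: finite_finset.
by move=> i _; rewrite -[X in measurable X]setTI; apply: mf => //;
  rewrite ball_itv; exact: measurable_itv.
Qed.

End measurable_rV.

Section lebesgue_rV.
Context {R : realType}.

Definition cons_rV n (p : measurableTypeR R * 'rV[R]_n) : 'rV[R]_n.+1 :=
  row_mx (p.1%:M : 'rV[R]_1) p.2.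

Lemma cons_rV0 n (p : measurableTypeR R * 'rV[R]_n) :
  cons_rV p ord0 ord0 = p.1.
Proof.
transitivity (cons_rV p ord0 (@lshift 1 n ord0)).
  by congr (cons_rV p _ _); exact: val_inj.
by rewrite [LHS]row_mxEl mxE eqxx mulr1n.
Qed.

Lemma cons_rVS n (p : measurableTypeR R * 'rV[R]_n) (j : 'I_n) :
  cons_rV p ord0 (lift ord0 j) = p.2 ord0 j.
Proof.
transitivity (cons_rV p ord0 (@rshift 1 n j)).
  by congr (cons_rV p _ _); exact: val_inj.
exact: row_mxEr.
Qed.

Lemma measurable_cons_rV n : measurable_fun setT (@cons_rV n).
Proof.
apply: measurable_fun_rV => i; have [j ->|->] := unliftP ord0 i.
  under eq_fun do rewrite cons_rVS.
  by apply: (measurableT_comp (measurable_coord j)); exact: measurable_snd.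
under eq_fun do rewrite cons_rV0.
exact: measurable_fst.
Qed.

HB.instance Definition _ n :=
  isMeasurableFun.Build _ _ _ _ (@cons_rV n) (@measurable_cons_rV n).

Section step.
Context n (m : {sigma_finite_measure set 'rV[R]_n -> \bar R}).

Let mu : {measure set (measurableTypeR R * 'rV[R]_n) -> \bar R} :=
  (@lebesgue_measure R \x m)%E.

Definition lebesgue_step : set 'rV[R]_n.+1 -> \bar R :=
  pushforward mu (@cons_rV n).

Let step0 : lebesgue_step set0 = 0%E.
Proof. exact: measure0. Qed.

Let step_ge0 A : (0 <= lebesgue_step A)%E.
Proof. exact: measure_ge0. Qed.

Let step_sigma_additive : semi_sigma_additive lebesgue_step.
Proof. exact: measure_semi_sigma_additive. Qed.

HB.instance Definition _ := isMeasure.Build _ _ _ lebesgue_step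
  step0 step_ge0 step_sigma_additive.

Lemma lebesgue_stepE (A : set R) (B : set 'rV[R]_n) :
  measurable (A : set (measurableTypeR R)) -> measurable B ->
  lebesgue_step [set x | A (x ord0 ord0) /\
    B (\row_j x ord0 (lift ord0 j))] = (lebesgue_measure A * m B)%E.
Proof.
move=> mA mB; rewrite -product_measure1E//.
congr (product_measure1 _ _ _); apply/seteqP; split => -[a b] /=;
  rewrite cons_rV0 (_ : \row_j _ = b)//; apply/rowP => j;
  by rewrite mxE cons_rVS.
Qed.

Let step_sigma_finite : sigma_finite setT lebesgue_step.
Proof.
have /sigma_finiteP[F [FT ndF Ffin]] := sigma_finiteT (@lebesgue_measure R).
have /sigma_finiteP[G [GT ndG Gfin]] := sigma_finiteT m.
exists (fun k => [set x : 'rV[R]_n.+1 | F k (x ord0 ord0) /\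
    G k (\row_j x ord0 (lift ord0 j))]).
  apply/seteqP; split => // x _.
  have [k _ Fk] : (\bigcup_i F i) (x ord0 ord0 : R) by rewrite -FT.
  have [l _ Gl] : (\bigcup_i G i) (\row_j x ord0 (lift ord0 j)) by rewrite -GT.
  exists (maxn k l) => //; split.
    by move: Fk; exact/subsetPset/ndF/leq_maxl.
  by move: Gl; exact/subsetPset/ndG/leq_maxr.
move=> k; have [mF Foo] := Ffin k; have [mG Goo] := Gfin k; split.
  apply: measurableI; rewrite -[X in measurable X]setTI.
    exact: (measurable_coord ord0).
  apply: (measurable_fun_rV (f := fun x : 'rV[R]_n.+1 =>
    \row_j x ord0 (lift ord0 j))) => // i.
  by under eq_fun do rewrite mxE; exact: measurable_coord.
by rewrite lebesgue_stepE// lte_mul_pinfty// ge0_fin_numE.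
Qed.

HB.instance Definition _ := Measure_isSigmaFinite.Build _ _ _ lebesgue_step
  step_sigma_finite.

End step.

(* Lebesgue measure on R^n, as the iterated product of lebesgue_measure *)
Fixpoint lebesgue_rV n : {sigma_finite_measure set 'rV[R]_n -> \bar R} :=
  match n with
  | 0 => dirac (0 : 'rV[R]_0)
  | n'.+1 => lebesgue_step (lebesgue_rV n')
  end.

Lemma lebesgue_rV_prod n (A : 'I_n -> set R) :
  (forall i, measurable (A i : set (measurableTypeR R))) ->
  lebesgue_rV n [set x | forall i, A i (x ord0 i)] =
    (\prod_(i < n) lebesgue_measure (A i))%E.
Proof.
elim: n A => [|n IH] A mA.
  by rewrite big_ord0 /= diracE mem_set//= => -[].
rewrite big_ord_recl -IH//=.
transitivity (lebesgue_step (lebesgue_rV n) [set x | A ord0 (x ord0 ord0) /\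
    [set y : 'rV[R]_n | forall j, A (lift ord0 j) (y ord0 j)]
    (\row_j x ord0 (lift ord0 j))]).
  congr (lebesgue_step _ _); apply/seteqP; split => x /= Ax.
    by split => // j; rewrite mxE.
  move=> i; have [j ->|->] := unliftP ord0 i; last by case: Ax.
  by case: Ax => _ /(_ j); rewrite mxE.
apply: lebesgue_stepE => //.
have -> : [set y : 'rV[R]_n | forall j, A (lift ord0 j) (y ord0 j)] =
    \bigcap_(j in [set: 'I_n])
      ((fun y : 'rV[R]_n => y ord0 j) @^-1` A (lift ord0 j)).
  by apply/seteqP; split => y /= Ay j; [move=> _|]; exact: Ay.
apply: fin_bigcap_measurable; first exact: finite_finset.
move=> j _; rewrite -[X in measurable X]setTI.
by apply: (measurable_coord j) => //; exact: mA.
Qed.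

End lebesgue_rV.

Section convex_bodies.
Context {R : realType} {n : nat}.
Implicit Types A K : set 'rV[R]_n.

Definition vol A : R := fine (lebesgue_rV n A).

Definition convex_hull A : set 'rV[R]_n := smallest (@convex_set R 'rV[R]_n) A.

Definition symmetric_convex_body K :=
  [/\ convex_set K, compact K, K° !=set0 & forall x, K x -> K (- x)].

(* Not centered: used for K = - K only, whose barycenter is 0 *)
Definition Cov K : 'M[R]_n :=
  \matrix_(i, j) ((vol K)^-1 *
    \int[lebesgue_rV n]_(x in K) (x ord0 i * x ord0 j)).

Definition isotropic_constant K : R :=
  vol K `^ (- n%:R^-1) * \det (Cov K) `^ ((2 * n)%:R^-1).

(* Minkowski combinations of compact sets are compact, hence Borel, so mu is
   only evaluated on measurable sets *)
Definition log_concave (mu : {measure set 'rV[R]_n -> \bar R}) :=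
  forall (A B : set 'rV[R]_n) (t : R), compact A -> compact B -> 0 < t < 1 ->
  (mu A `^ (1 - t)%R * mu B `^ t <=
     mu [set ((1 - t) *: a + t *: b)%R | a in A & b in B])%E.

(* As +oo - +oo = -oo, a finite value of these extended integrals forces the
   coordinates and their products to be integrable *)
Definition isotropic (mu : probability 'rV[R]_n R) :=
  (forall i, 'E_mu[fun x => x ord0 i] = 0)%E /\
  (forall i j, covariance mu (fun x => x ord0 i) (fun x => x ord0 j)
     = (i == j)%:R%:E).

End convex_bodies.

Definition mutually_independent {d d' : measure_display}
    {Omega : measurableType d} {T : measurableType d'} {R : realType}
    (P : probability Omega R) (I : finType) (X : I -> {RV P >-> T}) :=
  forall (J : {set I}) (A : I -> set T), (forall i, measurable (A i)) ->
  P (\bigcap_(i in [set` J]) X i @^-1` A i) =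
    (\prod_(i in J) P (X i @^-1` A i))%E.

Definition has_law {d d' : measure_display}
    {Omega : measurableType d} {T : measurableType d'} {R : realType}
    (P : probability Omega R) (X : {RV P >-> T}) (mu : probability T R) :=
  forall A, measurable A -> distribution P X A = mu A.

Definition symmetric_hull {R : realType} {n N : nat} (x : 'I_N -> 'rV[R]_n) :=
  convex_hull (range x `|` range (fun i => - x i)).

(* Main.v *)
(** Since L_K <= |K|^(-1/n) (tr Cov K / n)^(1/2), it suffices to show that, outside an event of
    probability at most 12 * 16^-n, the hull K has volume at least (c sqrt (L / n))^n and the
    average of |z|^2 over K is at most C L^2, where L = log (2N/n).

    Second moment. Up to a null set K is a disjoint union of simplices conv (0, y_1, ..., y_n) with
    y_i among the points +-x_j (almost surely the facets are simplices). On such a simplex the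
    average of |z|^2 is at most 2 n^-2 times the maximum of |sum_i +-y_i|^2 over all signs, and a
    net argument with the exponential moments of linear forms bounds every signed sum of n distinct
    sample points by C n L.

    Volume. If N is at most a multiple of n, the determinant of n sample points suffices. Otherwise
    the points of norm O(sqrt n) are divided into n slots. In each slot, weight the points +-x by
    exp (+-<xi, x> / l) and take the barycenter; the mean T(xi) of the n barycenters lies in K, and
    T is the gradient of a convex function. Hence the images of the cells of a fine grid are almost
    disjoint, and |K| is at least the sum of det DT over the grid. As DT is a sum of covariances,
    Cauchy-Binet bounds det DT from below by an average of squared determinants of differences
    x - x' of points of the slots. A negative moment of these is computed one slot at a time,
    projecting orthogonally to the previous rows; this rests on the anticoncentration of linear
    forms, P(|<x,u> - a| <= t) <= C t, and on the small-ball estimate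
    P(|P x - b| <= c sqrt k) <= C exp (-c' sqrt k) for projections P of rank k. *)
Require Import Defs.
From HB Require Import structures.
From mathcomp Require Import all_boot all_order all_algebra fingroup perm.
From mathcomp Require Import all_classical all_reals all_analysis.
From mathcomp Require Import measurable_realfun.
From mathcomp Require Import ring lra zify.

Set Implicit Arguments.
Unset Strict Implicit.
Unset Printing Implicit Defensive.

Import Order.TTheory GRing.Theory Num.Theory.
Import numFieldNormedType.Exports.

Local Open Scope classical_set_scope.
Local Open Scope ring_scope.

(** * Tuples of independent points *)

(** The tilt gains the factor sqrt L: one determinant of n sample points only yields volumes of
    order (c / sqrt n)^n. The obstacle is small rank. With k dimensions left, the small-ball bound
    is only exp (-c sqrt k), and a union bound over the pairs of points of a slot limits the number
    h k of points in use to exp (c sqrt k). Fewer points tolerate less tilt before the weights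
    concentrate on a few of them, while xi has to fill a cube of half-side rho of order sqrt (L /
    n). Hence a temperature l k = 1 + p / sqrt k that depends on the slot, where p is the logarithm
    of the number H of points in half a slot. Its price is the factor prod (l k)^-1 in the
    determinant; as sum_k p / sqrt k <= 2 p sqrt n, this is only exponential in n because p <= sqrt
    n, and here N <= exp (sqrt n) enters. The weights are controlled on average over the grid of xi,
    since a single xi may be badly aligned with the sample. Points of large norm are discarded, and
    a Chernoff bound for the number of good ones keeps the failure probability exponentially small
    in n. *)

Section tuple_measure.
Context {d : measure_display} {T : measurableType d} {R : realType}.

Definition cons_tup n (p : T * n.-tuple T) : n.+1.-tuple T :=
  [the n.+1.-tuple T of p.1 :: p.2].

Lemma measurable_cons_tup n : measurable_fun setT (@cons_tup n).
Proof. by apply: measurable_cons. Qed.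

HB.instance Definition _ n :=
  isMeasurableFun.Build _ _ _ _ (@cons_tup n) (@measurable_cons_tup n).

Context (mu : probability T R).

Fixpoint mtup n : probability (n.-tuple T) R :=
  match n with
  | 0 => dirac [tuple]
  | n'.+1 => distribution (mu \x mtup n')%E (@cons_tup n')
  end.

Lemma ge0_integral_mtupS n (f : n.+1.-tuple T -> \bar R) :
  measurable_fun [set: n.+1.-tuple T] f -> (forall t, 0 <= f t)%E ->
  (\int[mtup n.+1]_t f t = \int[mu]_x \int[mtup n]_t f (cons_tup (x, t)))%E.
Proof.
move=> mf f0; rewrite ge0_integral_distribution// fubini_tonelli1//.
  by apply: (measurableT_comp mf); exact: measurable_cons_tup.
by move=> x; exact: f0.
Qed.

Definition tup_box n (A : 'I_n -> set T) : set (n.-tuple T) :=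
  [set t | forall i, A i (tnth t i)].

Lemma measurable_tup_box n (A : 'I_n -> set T) :
  (forall i, measurable (A i)) -> measurable (tup_box A).
Proof.
move=> mA.
have -> : tup_box A = \bigcap_(i in [set: 'I_n]) ((@tnth n T ^~ i) @^-1` A i).
  by apply/seteqP; split => t /= At i; [move=> _|]; exact: At.
apply: fin_bigcap_measurable; first exact: finite_finset.
by move=> i _; rewrite -[X in measurable X]setTI; exact: measurable_tnth.
Qed.

Lemma mtup_box n (A : 'I_n -> set T) : (forall i, measurable (A i)) ->
  mtup n (tup_box A) = (\prod_(i < n) mu (A i))%E.
Proof.
elim: n A => [|n IH] A mA.
  by rewrite big_ord0 /= diracE mem_set//= => -[].
rewrite big_ord_recl -IH// /= /distribution /pushforward /=.
rewrite -product_measure1E//; last exact: measurable_tup_box.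
congr (product_measure1 _ _ _); apply/seteqP; split => -[x t] /=.
  move=> At; split; first by have := At ord0; rewrite (tnth_nth x).
  by move=> i; have := At (lift ord0 i); rewrite !(tnth_nth x).
move=> [Ax At] i; have [j ->|->] := unliftP ord0 i.
  by have := At j; rewrite !(tnth_nth x).
by rewrite (tnth_nth x).
Qed.

(** Boxes form a pi-system generating the product sigma-algebra, so the product formula on boxes
    determines the law of the tuple. *)
Lemma tuple_law d' (Om : measurableType d') (P : probability Om R) N
    (X : 'I_N -> Om -> T) : (forall i, measurable_fun setT (X i)) ->
  (forall A : 'I_N -> set T, (forall i, measurable (A i)) ->
    P (\bigcap_(i in [set: 'I_N]) X i @^-1` A i) = (\prod_i mu (A i))%E) ->
  forall B, measurable B ->
  P ((fun w => [tuple X i w | i < N]) @^-1` B) = mtup N B.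
Proof.
move=> mX XA B mB.
have mY : measurable_fun setT (fun w => [tuple X i w | i < N]).
  apply/measurable_fun_tnthP => i.
  by rewrite (_ : _ \o _ = X i)//; apply/funext => w /=; rewrite tnth_mktuple.
pose Y : {mfun Om >-> N.-tuple T} := HB.pack (fun w => [tuple X i w | i < N])
  (isMeasurableFun.Build _ _ _ _ _ mY).
rewrite -[LHS]/(distribution P Y B).
pose G := [set tup_box A | A in [set A : 'I_N -> set T | forall i, measurable (A i)]].
apply: (@measure_unique _ _ _ G (fun=> setT)) => //.
- apply/seteqP; split => /=.
    apply: smallest_sub; first exact: smallest_sigma_algebra.
    (* The generators are preimages under single coordinates, that is, boxes with all other sides
       equal to the whole space. *)
    apply: subset_trans (@sub_gen_smallest _ _ _) => C.
    rewrite -bigcup_seq => -[i _ [A mA <-]].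
    exists (fun j => if j == i then A else setT).
      by move=> j /=; case: ifP.
    apply/seteqP; split => t /=; first by move=> /(_ i); rewrite eqxx.
    by move=> [_ At] j; case: ifPn => // /eqP ->.
  apply: smallest_sub; first exact: sigma_algebra_measurable.
  by move=> _ [A mA <-]; exact: measurable_tup_box.
- move=> _ _ [A mA <-] [B' mB' <-]; exists (fun i => A i `&` B' i).
    by move=> i; exact: measurableI.
  by apply/seteqP; split => t /=; [move=> AB; split => i; have [] := AB i|
    move=> [At Bt] i; split].
- by move=> _; exists (fun=> setT) => //; apply/seteqP; split.
- by apply/seteqP; split => // t _; exists 0%N.
- move=> _ [A mA <-]; apply: etrans; last by apply/esym; exact: mtup_box.
  rewrite -XA//; congr (P _); apply/seteqP; split => w /=.
    by move=> + i _ => /(_ i); rewrite tnth_mktuple.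
  by move=> + i => /(_ i I); rewrite tnth_mktuple.
- move=> _; exact: (le_lt_trans (@probability_le1 _ _ _ (distribution P Y) setT measurableT) (ltry _)).
Qed.

Lemma ge0_integral_tuple_law d' (Om : measurableType d') (P : probability Om R) N
    (X : 'I_N -> Om -> T) (f : N.-tuple T -> \bar R) :
  (forall i, measurable_fun setT (X i)) ->
  (forall A : 'I_N -> set T, (forall i, measurable (A i)) ->
    P (\bigcap_(i in [set: 'I_N]) X i @^-1` A i) = (\prod_i mu (A i))%E) ->
  measurable_fun [set: N.-tuple T] f -> (forall t, 0 <= f t)%E ->
  (\int[P]_w f [tuple X i w | i < N] = \int[mtup N]_t f t)%E.
Proof.
move=> mX XA mf f0.
have mY : measurable_fun setT (fun w => [tuple X i w | i < N]).
  apply/measurable_fun_tnthP => i.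
  by rewrite (_ : _ \o _ = X i)//; apply/funext => w /=; rewrite tnth_mktuple.
pose Y : {mfun Om >-> N.-tuple T} := HB.pack (fun w => [tuple X i w | i < N])
  (isMeasurableFun.Build _ _ _ _ _ mY).
transitivity (\int[P]_w (f \o Y) w)%E; first by [].
rewrite -ge0_integral_distribution//; apply: eq_measure_integral => A mA _.
exact: (tuple_law mX XA mA).
Qed.

Lemma measurable_tnth_map N M (iota : 'I_M -> 'I_N) :
  measurable_fun [set: N.-tuple T] (fun t : N.-tuple T => [tuple tnth t (iota i) | i < M]).
Proof.
apply/measurable_fun_tnthP => i.
rewrite (_ : _ \o _ = @tnth N T ^~ (iota i)); first exact: measurable_tnth.
by apply/funext => w /=; rewrite tnth_mktuple.
Qed.

Lemma mtup_bigcap_inj N M (iota : 'I_M -> 'I_N) (A : 'I_M -> set T) :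
  injective iota -> (forall i, measurable (A i)) ->
  mtup N (\bigcap_(j in [set: 'I_M]) (@tnth N T ^~ (iota j)) @^-1` A j) =
  (\prod_j mu (A j))%E.
Proof.
move=> inj mA.
(* Coordinates outside the range of [iota] get the whole space, which contributes the factor 1. *)
pose A' i := if [pick j | iota j == i] is Some j then A j else setT.
have A'E j : A' (iota j) = A j.
  rewrite /A'; case: pickP => [j' /eqP/inj ->//|/(_ j)]; by rewrite eqxx.
have mA' i : measurable (A' i) by rewrite /A'; case: pickP.
transitivity (mtup N (tup_box A')).
  congr (mtup N _); apply/seteqP; split => t /=.
    move=> At i; rewrite /A'; case: pickP => //= j /eqP <-; exact: At.
  by move=> At j _; rewrite /= -A'E.
rewrite mtup_box//.
rewrite (bigID (fun i => i \in codom iota))/= [X in (_ * X)%E]big1 ?mule1.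
  rewrite (eq_bigl (mem [set x in codom iota])); last by move=> i; rewrite !inE.
  rewrite (_ : [set x in codom iota]%SET = iota @: finset.setT); last first.
    apply/setP => i; rewrite inE; apply/codomP/imsetP => [[j ->]|[j _ ->]].
      by exists j.
    by exists j.
  rewrite big_imset/=; last by move=> ? ? _ _; exact: inj.
  by apply: eq_big => [j|j _]; rewrite ?inE// A'E.
move=> i iN; rewrite /A'; case: pickP => [j /eqP ji|_].
  by rewrite -ji codom_f in iN.
exact: probability_setT.
Qed.

Lemma ge0_integral_mtup_inj N M (iota : 'I_M -> 'I_N) (f : M.-tuple T -> \bar R) :
  injective iota -> measurable_fun [set: M.-tuple T] f -> (forall t, 0 <= f t)%E ->
  (\int[mtup N]_t f [tuple tnth t (iota i) | i < M] = \int[mtup M]_t f t)%E.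
Proof.
move=> inj mf f0.
apply: (@ge0_integral_tuple_law _ _ (mtup N) M (fun i t => tnth t (iota i))) => //.
  by move=> i; exact: measurable_tnth.
by move=> A mA; exact: mtup_bigcap_inj.
Qed.

Lemma measurable_cat_tup a b :
  measurable_fun [set: a.-tuple T * b.-tuple T] (fun st : a.-tuple T * b.-tuple T => [tuple of st.1 ++ st.2]).
Proof.
apply/measurable_fun_tnthP => i; rewrite /comp.
have [j ij|j ij] := splitP i.
  rewrite (_ : (fun _ => _) = (fun st : a.-tuple T * b.-tuple T => tnth st.1 j)).
    by apply: (measurableT_comp (@measurable_tnth _ T a j)).
  apply/funext => -[s t]; rewrite /= (tnth_nth (tnth s j)) /= nth_cat size_tuple ij.
  by rewrite ltn_ord -tnth_nth.
rewrite (_ : (fun _ => _) = (fun st : a.-tuple T * b.-tuple T => tnth st.2 j)).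
  by apply: (measurableT_comp (@measurable_tnth _ T b j)).
apply/funext => -[s t]; rewrite /= (tnth_nth (tnth t j)) /= nth_cat size_tuple ij.
by rewrite ltnNge leq_addr/= addKn -tnth_nth.
Qed.

(** The coordinates of the concatenation are independent under the product of the two tuple
    measures, so [ge0_integral_tuple_law] identifies its law. *)
Lemma ge0_integral_mtup_cat a b (f : (a + b).-tuple T -> \bar R) :
  measurable_fun [set: (a + b).-tuple T] f -> (forall t, 0 <= f t)%E ->
  (\int[mtup (a + b)]_t f t =
   \int[mtup a]_s \int[mtup b]_t f [tuple of s ++ t])%E.
Proof.
move=> mf f0.
rewrite -(@fubini_tonelli1 _ _ _ _ _ (mtup a) (mtup b)
  (fun st => f [tuple of st.1 ++ st.2]))//; last first.
  by apply: (measurableT_comp mf); exact: measurable_cat_tup.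
pose X (i : 'I_(a + b)) (st : a.-tuple T * b.-tuple T) := tnth [tuple of st.1 ++ st.2] i.
rewrite -(@ge0_integral_tuple_law _ _ (mtup a \x mtup b)%E _ X)//.
- apply: eq_integral => st _; congr f; apply: eq_from_tnth => i.
  by rewrite tnth_mktuple.
- by move=> i; have /measurable_fun_tnthP := @measurable_cat_tup a b; apply.
- move=> A mA.
  pose Al i := A (lshift b i); pose Ar i := A (rshift a i).
  transitivity ((mtup a \x mtup b)%E (tup_box Al `*` tup_box Ar)).
    congr (product_measure1 _ _ _); apply/seteqP; split => -[s t] /=.
      move=> Ast; split => i.
        by have := Ast (lshift b i) I; rewrite /X /= tnth_lshift.
      by have := Ast (rshift a i) I; rewrite /X /= tnth_rshift.
    move=> [As At] i _; rewrite /X/=; case: (split_ordP i) => j ->.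
      by rewrite tnth_lshift; exact: As.
    by rewrite tnth_rshift; exact: At.
  rewrite product_measure1E; [|by apply: measurable_tup_box => i; exact: mA..].
  by rewrite big_split_ord/= !mtup_box// => i; exact: mA.
Qed.

Lemma ge0_integral_mtup_prod n (f : 'I_n -> T -> \bar R) :
  (forall i, measurable_fun setT (f i)) -> (forall i x, 0 <= f i x)%E ->
  (\int[mtup n]_t \prod_(i < n) f i (tnth t i) = \prod_(i < n) \int[mu]_x f i x)%E.
Proof.
move=> mf f0.
have mP m (g : 'I_m -> T -> \bar R) : (forall i, measurable_fun setT (g i)) ->
    measurable_fun [set: m.-tuple T] (fun t : m.-tuple T => \prod_(i < m) g i (tnth t i))%E.
  move=> mg; elim: (index_enum _) => [|i s IHs].
    by under eq_fun do rewrite big_nil; exact: measurable_cst.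
  under eq_fun do rewrite big_cons; apply: emeasurable_funM => //.
  by apply: (measurableT_comp (mg i)); exact: measurable_tnth.
elim: n f mf f0 => [|n IH] f mf f0.
  under eq_integral do rewrite big_ord0.
  by rewrite big_ord0 integral_cst// mul1e; exact: probability_setT.
rewrite ge0_integral_mtupS//; [|exact: mP|by move=> t; apply: prode_ge0].
rewrite big_ord_recl.
transitivity (\int[mu]_x (f ord0 x * \prod_(i < n) \int[mu]_x f (lift ord0 i) x))%E.
  apply: eq_integral => x _.
  rewrite -(IH (fun i => f (lift ord0 i)))//.
  rewrite -ge0_integralZl//; [|exact: (mP n (fun i => f (lift ord0 i)))|by move=> t _; apply: prode_ge0].
  apply: eq_integral => t _; rewrite big_ord_recl; congr (_ * _)%E.
  by apply: eq_bigr => i _; congr (f _ _); rewrite !(tnth_nth x).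
by rewrite ge0_integralZr//; apply: prode_ge0 => i _; apply: integral_ge0.
Qed.

Lemma ge0_integral_mtup1 n (i : 'I_n) (f : T -> \bar R) :
  measurable_fun setT f -> (forall x, 0 <= f x)%E ->
  (\int[mtup n]_t f (tnth t i) = \int[mu]_x f x)%E.
Proof.
move=> mf f0.
have := @ge0_integral_mtup_inj n 1 (fun=> i) (fun t => f (tnth t ord0)).
under eq_integral do rewrite tnth_mktuple.
move=> ->//; [|by move=> [[|//] ?] [[|//] ?] _; exact: val_inj|
  by apply: (measurableT_comp mf); exact: measurable_tnth].
have := @ge0_integral_mtup_prod 1 (fun=> f).
rewrite big_ord1 => <-//.
by apply: eq_integral => t _; rewrite big_ord1.
Qed.

End tuple_measure.

(** * Lebesgue measure and linear maps *)

Section lebesgue_line.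
Context {R : realType}.
Notation leb1 := (@lebesgue_measure R).

Lemma measurable_affine1 (a b : R) :
  measurable_fun [set: measurableTypeR R] (fun t : measurableTypeR R => a * t + b : measurableTypeR R).
Proof. by apply: measurable_funD => //; apply: measurable_funM. Qed.

(** The image of Lebesgue measure under the affine map, multiplied by |a|, gives every half-open
    interval its length, and this characterises Lebesgue measure. *)
Lemma lebesgue_measure_affine (a b : R) (S : set R) : a != 0 ->
  measurable (S : set (measurableTypeR R)) ->
  (leb1 ((fun t : R => (a * t + b)%R) @^-1` S) * `|a|%:E = leb1 S)%E.
Proof.
move=> a0 mS.
pose f : {mfun measurableTypeR R >-> measurableTypeR R} :=
  HB.pack (fun t : measurableTypeR R => a * t + b : measurableTypeR R)
  (isMeasurableFun.Build _ _ _ _ _ (measurable_affine1 a b)).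
have mf : measurable_fun setT f by [].
pose m : {measure set (measurableTypeR R) -> \bar R} :=
  mscale (NngNum (normr_ge0 a)) [the measure _ _ of pushforward leb1 f].
have mE A : m mf A = (`|a|%:E * leb1 (f @^-1` A))%E by [].
rewrite muleC -[LHS](mE S); apply/esym; apply: lebesgue_measure_unique => //.
move=> _ [[x y] _ <-]; rewrite mE /=.
have [xy|yx] := ltP x y; last first.
  rewrite (_ : f @^-1` _ = set0) ?measure0 ?mule0; last first.
    apply/seteqP; split => // t /=; rewrite in_itv/= => /andP[h1 h2].
    by move: (lt_le_trans h1 h2); rewrite ltNge yx.
  by rewrite lebesgue_measure_itv/= lte_fin ltNge yx.
rewrite lebesgue_measure_itv/= lte_fin xy.
case: (ltrgtP a 0) a0 => // ha _.
  rewrite (_ : f @^-1` _ = `[(y - b) / a, (x - b) / a[%classic); last first.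
    apply/seteqP; split => t /=; rewrite !in_itv/=.
      by rewrite ler_ndivrMr// ltr_ndivlMr// mulrC ltrBlDr lerBrDr => /andP[-> ->].
    by rewrite ler_ndivrMr// ltr_ndivlMr// mulrC ltrBlDr lerBrDr => /andP[-> ->].
  rewrite lebesgue_measure_itv/= lte_fin ltr_ndivlMr// divfK ?lt_eqF// ltrD2r xy.
  rewrite -!EFinD -EFinM; congr (_%:E); rewrite ltr0_norm//.
  by field; rewrite lt_eqF.
rewrite (_ : f @^-1` _ = `](x - b) / a, (y - b) / a]%classic); last first.
  apply/seteqP; split => t /=; rewrite !in_itv/=.
    by rewrite ler_pdivlMr// ltr_pdivrMr// mulrC ltrBlDr lerBrDr => /andP[-> ->].
  by rewrite ler_pdivlMr// ltr_pdivrMr// mulrC ltrBlDr lerBrDr => /andP[-> ->].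
rewrite lebesgue_measure_itv/= lte_fin ltr_pdivlMr// divfK ?gt_eqF// ltrD2r xy.
rewrite -!EFinD -EFinM; congr (_%:E); rewrite gtr0_norm//.
by field; rewrite gt_eqF.
Qed.

End lebesgue_line.

Section lebesgue_linear.
Context {R : realType}.
Notation leb := (@lebesgue_rV R).
Notation leb1 := (@lebesgue_measure R).

Lemma lebesgue_rVS n (S : set 'rV[R]_n.+1) :
  leb n.+1 S = (leb1 \x leb n)%E (@cons_rV R n @^-1` S).
Proof. by []. Qed.

Lemma measurable_mulmx_rV m n (A : 'M[R]_(m, n)) :
  measurable_fun [set: 'rV[R]_m] (fun x => x *m A).
Proof.
apply: measurable_fun_rV => i; under eq_fun do rewrite mxE.
apply: measurable_sum => j; apply: measurable_funM => //.
exact: measurable_coord.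
Qed.

Lemma measurable_addl_rV n (b : 'rV[R]_n) :
  measurable_fun [set: 'rV[R]_n] (fun x => b + x).
Proof.
apply: measurable_fun_rV => i; under eq_fun do rewrite mxE.
by apply: measurable_funD => //; exact: measurable_coord.
Qed.

Lemma measurable_preim_cons n (S : set 'rV[R]_n.+1) : measurable S ->
  measurable (@cons_rV R n @^-1` S).
Proof.
by move=> mS; rewrite -[X in measurable X]setTI; exact: measurable_cons_rV.
Qed.

Lemma lebesgue_rVS1 n (S : set 'rV[R]_n.+1) : measurable S ->
  (leb n.+1 S = \int[leb1]_t leb n [set y | S (cons_rV (t, y))])%E.
Proof.
move=> mS; rewrite lebesgue_rVS; apply: eq_integral => t _ /=.
by congr (leb n _); apply/seteqP; split => y /=; rewrite /xsection/= inE.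
Qed.

(** Slicing in the other order. Shears and dilations that move the first coordinate act inside these
    slices, those that move the other coordinates inside the slices of [lebesgue_rVS1]. *)
Lemma lebesgue_rVS2 n (S : set 'rV[R]_n.+1) : measurable S ->
  (leb n.+1 S = \int[leb n]_y leb1 [set t | S (cons_rV (t, y))])%E.
Proof.
move=> mS; rewrite lebesgue_rVS.
rewrite (@product_measure_unique _ _ _ _ _ leb1 (leb n) (leb1 \x^ leb n)%E).
- apply: eq_integral => y _ /=.
  by congr (leb1 _); apply/seteqP; split => t /=; rewrite /ysection/= inE.
- by move=> A B mA mB; exact: product_measure2E.
- exact: measurable_preim_cons.
Qed.

Lemma measurable_section1 n (S : set 'rV[R]_n.+1) t : measurable S ->
  measurable [set y | S (cons_rV (t, y))].
Proof.
move=> mS; rewrite (_ : [set _ | _] = xsection (@cons_rV R n @^-1` S) t).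
  by apply: measurable_xsection; exact: measurable_preim_cons.
by apply/seteqP; split => y /=; rewrite /xsection/= inE.
Qed.

Lemma measurable_section2 n (S : set 'rV[R]_n.+1) y : measurable S ->
  measurable ([set t | S (cons_rV (t, y))] : set (measurableTypeR R)).
Proof.
move=> mS; rewrite (_ : [set _ | _] = ysection (@cons_rV R n @^-1` S) y).
  by apply: measurable_ysection; exact: measurable_preim_cons.
by apply/seteqP; split => t /=; rewrite /ysection/= inE.
Qed.

Lemma measurable_fun_section1 n (S : set 'rV[R]_n.+1) : measurable S ->
  measurable_fun [set: measurableTypeR R] (fun t => leb n [set y | S (cons_rV (t, y))]).
Proof.
move=> mS; have := measurable_fun_xsection (leb n) (measurable_preim_cons mS).
by congr measurable_fun; apply/funext => t /=; congr (leb n _);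
  apply/seteqP; split => y /=; rewrite /xsection/= inE.
Qed.

Lemma measurable_fun_section2 n (S : set 'rV[R]_n.+1) : measurable S ->
  measurable_fun [set: 'rV[R]_n] (fun y => leb1 [set t | S (cons_rV (t, y))]).
Proof.
move=> mS; have := measurable_fun_ysection leb1 (measurable_preim_cons mS).
by congr measurable_fun; apply/funext => t /=; congr (leb1 _);
  apply/seteqP; split => y /=; rewrite /ysection/= inE.
Qed.

Lemma lebesgue_rV_translate n (b : 'rV[R]_n) (S : set 'rV[R]_n) : measurable S ->
  leb n ((fun x => b + x) @^-1` S) = leb n S.
Proof.
elim: n b S => [|n IH] b S mS.
  by congr (leb 0 _); apply/seteqP; split => x /=; rewrite !(thinmx0 _) ?(flatmx0 _)//;
    congr S; apply/rowP => -[].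
have mS' : measurable ((fun x => b + x) @^-1` S).
  by rewrite -[X in measurable X]setTI; exact: measurable_addl_rV.
rewrite !lebesgue_rVS1//.
pose b' := \row_j b ord0 (lift ord0 j).
have bE t y : b + cons_rV (t, y) = cons_rV (b ord0 ord0 + t, b' + y) :> 'rV_n.+1.
  apply/rowP => i; rewrite mxE; have [j ->|->] := unliftP ord0 i.
    by rewrite (cons_rVS (t, y) j) (cons_rVS (b ord0 ord0 + t, b' + y) j) /= !mxE.
  by rewrite (cons_rV0 (t, y)) (cons_rV0 (b ord0 ord0 + t, b' + y)).
pose b1 := row_mx (b ord0 ord0)%:M (0 : 'rV[R]_n) : 'rV_n.+1.
transitivity (\int[leb1]_t leb n [set y | S (cons_rV ((b ord0 ord0 + t)%R, y))])%E.
  apply: eq_integral => t _ /=.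
  under [X in leb n X]eq_set do rewrite bE.
  exact: (IH b' _ (measurable_section1 (b ord0 ord0 + t) mS)).
have mS1 : measurable ((fun x => b1 + x) @^-1` S).
  by rewrite -[X in measurable X]setTI; exact: measurable_addl_rV.
have b1E t y : b1 + cons_rV (t, y) = cons_rV (b ord0 ord0 + t, y) :> 'rV_n.+1.
  transitivity (row_mx (b ord0 ord0)%:M 0 + row_mx t%:M y : 'rV_(1 + n)); first by [].
  by rewrite add_row_mx add0r -raddfD.
transitivity (leb n.+1 ((fun x => b1 + x) @^-1` S)).
  rewrite lebesgue_rVS1//; apply: eq_integral => t _ /=.
  by congr (leb n _); apply/seteqP; split => y /=; rewrite b1E.
rewrite -lebesgue_rVS1// !lebesgue_rVS2//; apply: eq_integral => y _ /=.
have := lebesgue_measure_affine (b ord0 ord0) (oner_neq0 R) (measurable_section2 y mS).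
rewrite normr1 mule1 => <-; congr (leb1 _); apply/seteqP; split => t /=;
  by rewrite b1E mul1r addrC.
Qed.

(** Formulated with preimages, so that measurability comes from that of the linear map and products
    of matrices become compositions. *)
Definition scales_volume n (A : 'M[R]_n) := forall S : set 'rV[R]_n, measurable S ->
  (leb n ((fun x => x *m A) @^-1` S) * `|\det A|%:E = leb n S)%E.

Lemma scales_volumeM n (A B : 'M[R]_n) : scales_volume A -> scales_volume B ->
  scales_volume (A *m B).
Proof.
move=> hA hB S mS.
have mSB : measurable ((fun x : 'rV_n => x *m B) @^-1` S).
  by rewrite -[X in measurable X]setTI; exact: measurable_mulmx_rV.
rewrite -(hB _ mS) -(hA _ mSB) det_mulmx normrM EFinM muleA.
by congr (leb n _ * _ * _)%E; apply/seteqP; split => x /=; rewrite mulmxA.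
Qed.

Lemma cons_rV_mul n (a : R) (b : 'rV[R]_n) (c : 'cV[R]_n) (D : 'M[R]_n)
    (t : R) (y : 'rV[R]_n) :
  cons_rV (t, y) *m (block_mx a%:M b c D) =
  cons_rV ((t * a + (y *m c) ord0 ord0)%R, t *: b + y *m D).
Proof.
transitivity (row_mx t%:M y *m block_mx a%:M b c D); first by [].
rewrite mul_row_block; congr row_mx.
  by rewrite -scalar_mxM [y *m c]mx11_scalar -raddfD /= [in RHS]mxE.
by rewrite mul_scalar_mx.
Qed.

Lemma scales_volume_shear1 n (c : 'cV[R]_n) :
  @scales_volume (1 + n) (block_mx 1%:M 0 c 1%:M).
Proof.
move=> S mS; rewrite det_lblock !det1 mulr1 normr1 mule1.
have mS' : measurable ((fun x : 'rV_(1 + n) => x *m block_mx 1%:M 0 c 1%:M) @^-1` S).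
  by rewrite -[X in measurable X]setTI; exact: measurable_mulmx_rV.
rewrite !lebesgue_rVS2//; apply: eq_integral => y _ /=.
have := lebesgue_measure_affine ((y *m c) ord0 ord0) (oner_neq0 R) (measurable_section2 y mS).
rewrite normr1 mule1 => <-; congr (leb1 _); apply/seteqP; split => t /=;
  by rewrite cons_rV_mul mul1r mulr1 scaler0 add0r mulmx1.
Qed.

Lemma scales_volume_shear2 n (b : 'rV[R]_n) :
  @scales_volume (1 + n) (block_mx 1%:M b 0 1%:M).
Proof.
move=> S mS; rewrite det_ublock !det1 mulr1 normr1 mule1.
have mS' : measurable ((fun x : 'rV_(1 + n) => x *m block_mx 1%:M b 0 1%:M) @^-1` S).
  by rewrite -[X in measurable X]setTI; exact: measurable_mulmx_rV.
rewrite !lebesgue_rVS1//; apply: eq_integral => t _ /=.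
rewrite -(lebesgue_rV_translate (t *: b) (measurable_section1 t mS)).
congr (leb n _); apply/seteqP; split => y /=;
  by rewrite cons_rV_mul mulr1 mulmx0 mxE addr0 mulmx1.
Qed.

Lemma scales_volume_diag n (a : R) (D : 'M[R]_n) : a != 0 -> scales_volume D ->
  @scales_volume (1 + n) (block_mx a%:M 0 0 D).
Proof.
move=> a0 hD S mS; rewrite det_ublock det_scalar1 normrM EFinM.
have mS' (E : 'M[R]_n) :
    measurable ((fun x : 'rV_(1 + n) => x *m block_mx a%:M 0 0 E) @^-1` S).
  by rewrite -[X in measurable X]setTI; exact: measurable_mulmx_rV.
transitivity (leb n.+1 ((fun x : 'rV_(1 + n) => x *m block_mx a%:M 0 0 1%:M) @^-1` S) * `|a|%:E)%E.
  rewrite muleCA muleC; congr (_ * _)%E.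
  rewrite !lebesgue_rVS1// -ge0_integralZr//=; last first.
    exact: (measurable_fun_section1 (mS' D)).
  apply: eq_integral => t _ /=.
  transitivity (leb n [set y | S (cons_rV ((t * a)%R, y))]).
    rewrite -(hD _ (measurable_section1 (t * a) mS)).
    congr (leb n _ * _)%E; apply/seteqP; split => y /=;
      by rewrite cons_rV_mul scaler0 add0r mulmx0 mxE addr0.
  congr (leb n _); apply/seteqP; split => y /=;
    by rewrite cons_rV_mul scaler0 add0r mulmx0 mulmx1 mxE addr0.
rewrite !lebesgue_rVS2// -ge0_integralZr//=; last first.
  exact: (measurable_fun_section2 (mS' 1%:M)).
apply: eq_integral => y _ /=.
rewrite -(lebesgue_measure_affine 0 a0 (measurable_section2 y mS)).
congr (leb1 _ * _)%E; apply/seteqP; split => t /=;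
  by rewrite cons_rV_mul scaler0 add0r mulmx0 mxE addr0 mulmx1 addr0 mulrC.
Qed.

(** Gaussian elimination: a matrix with nonzero corner is a shear times a block-diagonal matrix
    times a shear, and induction treats the Schur complement. A zero corner is first made nonzero by
    adding another row to the first one. *)
Theorem lebesgue_rV_linear n (A : 'M[R]_n) : A \in unitmx -> scales_volume A.
Proof.
elim: n A => [|n IH] A uA.
  move=> S mS; rewrite det_mx00 normr1 mule1.
  by congr (leb 0 _); apply/seteqP; split => x /=; congr S; apply/rowP => -[].
suff pivot (B : 'M[R]_(1 + n)) : B \in unitmx -> B ord0 ord0 != 0 -> scales_volume B.
  have [/eqP A00|] := boolP (A ord0 ord0 == 0); last exact: pivot.
  have [i Ai] : exists i, A (lift ord0 i) ord0 != 0.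
    apply/existsP; apply: contraTT uA; rewrite negb_exists => /forallP h.
    rewrite unitmxE (_ : \det A = 0) ?unitr0//.
    rewrite (expand_det_col A ord0) big1// => k _.
    have [j ->|->] := unliftP ord0 k; last by rewrite A00 mul0r.
    by have := h j; rewrite negbK => /eqP ->; rewrite mul0r.
  pose E (s : R) : 'M[R]_(1 + n) := block_mx 1%:M (s *: delta_mx ord0 i) 0 1%:M.
  have EE s : E (- s) *m E s = 1%:M.
    rewrite /E mulmx_block !mulmx1 !mul1mx !mulmx0 !mul0mx !addr0 !add0r scaleNr subrr.
    by rewrite -scalar_mx_block.
  rewrite -[A]mul1mx -(EE 1) -mulmxA; apply: scales_volumeM.
    exact: scales_volume_shear2.
  apply: pivot.
    rewrite unitmx_mul uA andbT unitmxE det_ublock !det1 mulr1 unitr1//.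
  have E0 : E 1 ord0 ord0 = 1.
    transitivity (E 1 (lshift n (ord0 : 'I_1)) (lshift n (ord0 : 'I_1))).
      by congr (E 1 _ _); exact: val_inj.
    by rewrite block_mxEul !mxE eqxx.
  have E1 j : E 1 ord0 (lift ord0 j) = (j == i)%:R.
    transitivity (E 1 (lshift n (ord0 : 'I_1)) (rshift 1 j)).
      by congr (E 1 _ _); exact: val_inj.
    by rewrite block_mxEur !mxE eqxx mul1r.
  rewrite mxE (big_ord_recl n) A00 mulr0 add0r (bigD1 i)//= big1 ?addr0.
    by rewrite E1 eqxx mul1r.
  by move=> j ji; rewrite E1 (negbTE ji) mul0r.
move=> uB B00.
set a := B ord0 ord0 in B00.
set b := ursubmx B; set c := dlsubmx B; set D := drsubmx B.
have BE : B = block_mx a%:M b c D.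
  rewrite -[LHS]submxK; congr block_mx.
  rewrite [ulsubmx B]mx11_scalar; congr (_%:M); rewrite !mxE /a.
  by congr (B _ _); exact: val_inj.
have BF : B = block_mx 1%:M 0 (a^-1 *: c) 1%:M *m block_mx a%:M 0 0 (D - a^-1 *: (c *m b))
   *m block_mx 1%:M (a^-1 *: b) 0 1%:M.
  rewrite [LHS]BE !mulmx_block !mulmx1 !mul1mx !mulmx0 !mul0mx !addr0 !add0r.
  have -> : a%:M *m (a^-1 *: b) = b by rewrite mul_scalar_mx scalerA mulfV// scale1r.
  have -> : a^-1 *: c *m a%:M = c by rewrite mul_mx_scalar scalerA mulfV// scale1r.
  by rewrite -scalemxAr addrC subrK.
rewrite BF; apply: scales_volumeM; last exact: scales_volume_shear2.
apply: scales_volumeM; first exact: scales_volume_shear1.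
apply: scales_volume_diag => //; apply: IH.
move: uB; rewrite BF !unitmx_mul => /andP[/andP[_ +] _].
by rewrite !unitmxE det_ublock unitrM => /andP[].
Qed.

Lemma lebesgue_rV_image n (A : 'M[R]_n) (b : 'rV[R]_n) (S : set 'rV[R]_n) :
  A \in unitmx -> measurable S ->
  leb n [set b + x *m A | x in S] = (`|\det A|%:E * leb n S)%E.
Proof.
move=> uA mS.
have -> : [set b + x *m A | x in S] =
    (fun x => - b + x) @^-1` ((fun x => x *m invmx A) @^-1` S).
  apply/seteqP; split => [_ [x Sx <-]|x Sx] /=.
    by rewrite addKr mulmxK.
  by exists ((- b + x) *m invmx A) => //; rewrite mulmxKV// addNKr.
rewrite lebesgue_rV_translate; last first.
  by rewrite -[X in measurable X]setTI; exact: measurable_mulmx_rV.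
have uA' : invmx A \in unitmx by rewrite unitmx_inv.
rewrite -(lebesgue_rV_linear uA' mS) muleCA -EFinM -normrM -det_mulmx.
by rewrite mulmxV// det1 normr1 mule1.
Qed.

End lebesgue_linear.

(** * Log-concave probability measures *)

Section euclid.
Context {R : realType} {n : nat}.
Implicit Types u v w : 'rV[R]_n.

Definition dotp u v : R := \sum_i u 0 i * v 0 i.
Definition enorm u : R := Num.sqrt (dotp u u).

Lemma dotpC u v : dotp u v = dotp v u.
Proof. by apply: eq_bigr => i _; rewrite mulrC. Qed.

Lemma dotpDl u v w : dotp (u + v) w = dotp u w + dotp v w.
Proof. by rewrite -big_split; apply: eq_bigr => i _; rewrite mxE mulrDl. Qed.

Lemma dotpDr u v w : dotp w (u + v) = dotp w u + dotp w v.
Proof. by rewrite dotpC dotpDl !(dotpC w). Qed.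

Lemma dotpZl a u v : dotp (a *: u) v = a * dotp u v.
Proof. by rewrite mulr_sumr; apply: eq_bigr => i _; rewrite mxE mulrA. Qed.

Lemma dotpZr a u v : dotp v (a *: u) = a * dotp v u.
Proof. by rewrite dotpC dotpZl dotpC. Qed.

Lemma dotpNl u v : dotp (- u) v = - dotp u v.
Proof. by rewrite -scaleN1r dotpZl mulN1r. Qed.

Lemma dotpNr u v : dotp v (- u) = - dotp v u.
Proof. by rewrite dotpC dotpNl dotpC. Qed.

Lemma dotpBl u v w : dotp (u - v) w = dotp u w - dotp v w.
Proof. by rewrite dotpDl dotpNl. Qed.

Lemma dotpBr u v w : dotp w (u - v) = dotp w u - dotp w v.
Proof. by rewrite dotpDr dotpNr. Qed.

Lemma dotp0l v : dotp 0 v = 0.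
Proof. by rewrite -(scale0r 0) dotpZl mul0r. Qed.

Lemma dotp0r v : dotp v 0 = 0.
Proof. by rewrite dotpC dotp0l. Qed.

Lemma dotp_suml (I : Type) (r : seq I) (P : pred I) (F : I -> 'rV[R]_n) v :
  dotp (\sum_(i <- r | P i) F i) v = \sum_(i <- r | P i) dotp (F i) v.
Proof. by apply: (big_morph (dotp^~ v)) => [x y|]; rewrite ?dotpDl ?dotp0l. Qed.

Lemma dotp_sumr (I : Type) (r : seq I) (P : pred I) (F : I -> 'rV[R]_n) v :
  dotp v (\sum_(i <- r | P i) F i) = \sum_(i <- r | P i) dotp v (F i).
Proof. by rewrite dotpC dotp_suml; apply: eq_bigr => i _; rewrite dotpC. Qed.

Lemma dotp_ge0 u : 0 <= dotp u u.
Proof. by apply: sumr_ge0 => i _; rewrite -expr2 sqr_ge0. Qed.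

Lemma dotp_eq0 u : (dotp u u == 0) = (u == 0).
Proof.
apply/eqP/eqP => [|->]; last exact: dotp0l.
move=> /psumr_eq0P h; apply/rowP => i; rewrite mxE.
have /eqP : u 0 i * u 0 i = 0 by apply: h => // j _; rewrite -expr2 sqr_ge0.
by rewrite mulf_eq0 orbb => /eqP.
Qed.

Lemma dotp_gt0 u : (0 < dotp u u) = (u != 0).
Proof. by rewrite lt_def dotp_ge0 andbT dotp_eq0. Qed.

Lemma enorm_ge0 u : 0 <= enorm u. Proof. exact: sqrtr_ge0. Qed.

Lemma sqr_enorm u : enorm u ^+ 2 = dotp u u.
Proof. by rewrite sqr_sqrtr// dotp_ge0. Qed.

Lemma enorm_gt0 u : (0 < enorm u) = (u != 0).
Proof. by rewrite sqrtr_gt0 dotp_gt0. Qed.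

Lemma cauchy_schwarz_sqr u v : dotp u v ^+ 2 <= dotp u u * dotp v v.
Proof.
have [->|v0] := eqVneq v 0; first by rewrite !dotp0r expr0n mulr0.
have := dotp_ge0 (dotp v v *: u - dotp u v *: v).
rewrite dotpBl !dotpBr !dotpZl !dotpZr (dotpC v u).
rewrite (_ : _ - _ = dotp v v * (dotp u u * dotp v v - dotp u v ^+ 2)); last by ring.
by rewrite pmulr_rge0 ?dotp_gt0// subr_ge0.
Qed.

Lemma cauchy_schwarz u v : `|dotp u v| <= enorm u * enorm v.
Proof.
rewrite -ler_sqr ?nnegrE ?mulr_ge0 ?enorm_ge0//.
by rewrite exprMn !sqr_enorm real_normK ?num_real// cauchy_schwarz_sqr.
Qed.

Lemma measurable_dotp v : measurable_fun [set: 'rV[R]_n] (fun x => dotp x v).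
Proof.
apply: measurable_sum => i; apply: measurable_funM => //.
exact: measurable_coord.
Qed.

Lemma continuous_addR (f g : 'rV[R]_n -> R) :
  continuous f -> continuous g -> continuous (fun x => f x + g x : R).
Proof. by move=> cf cg x; exact: (@continuousD R R^o _ f g x (cf x) (cg x)). Qed.

Lemma continuous_coordM (i : 'I_n) (a : R) :
  continuous (fun x : 'rV[R]_n => x 0 i * a : R).
Proof.
move=> x; apply: continuousM; first exact: coord_continuous.
exact: cst_continuous.
Qed.

Lemma continuous_dotp v : continuous (fun x : 'rV[R]_n => dotp x v : R).
Proof.
rewrite /dotp; elim: (index_enum _) => [|i s IH].
  rewrite (_ : (fun _ => _) = cst 0); first exact: cst_continuous.
  by apply/funext => y; rewrite big_nil.
rewrite (_ : (fun _ => _) = (fun y : 'rV[R]_n => y 0 i * v 0 i + \sum_(j <- s) y 0 j * v 0 j)).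
  by apply: continuous_addR => //; exact: continuous_coordM.
by apply/funext => y; rewrite big_cons.
Qed.

End euclid.

Section nonneg_integral.
Context {d : measure_display} {T : measurableType d} {R : realType}.
Context (m : {measure set T -> \bar R}) (D : set T) (mD : measurable D).
Implicit Types f g : T -> R.

Lemma nng_int_ge0 f : (forall x, 0 <= f x) -> (0 <= \int[m]_(x in D) (f x)%:E)%E.
Proof. by move=> f0; apply: integral_ge0 => x _; rewrite lee_fin. Qed.

Lemma nng_int_le f g : measurable_fun D f -> measurable_fun D g ->
  (forall x, 0 <= f x) -> (forall x, f x <= g x) ->
  (\int[m]_(x in D) (f x)%:E <= \int[m]_(x in D) (g x)%:E)%E.
Proof.
move=> mf mg f0 fg; apply: ge0_le_integral => //; try exact/measurable_EFinP.
  by move=> x _; rewrite lee_fin.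
by move=> x _; rewrite lee_fin.
Qed.

Lemma nng_intD f g : measurable_fun D f -> measurable_fun D g ->
  (forall x, 0 <= f x) -> (forall x, 0 <= g x) ->
  (\int[m]_(x in D) (f x + g x)%:E =
   \int[m]_(x in D) (f x)%:E + \int[m]_(x in D) (g x)%:E)%E.
Proof.
move=> mf mg f0 g0; under eq_integral do rewrite EFinD.
by rewrite ge0_integralD//; try exact/measurable_EFinP; move=> x _; rewrite lee_fin.
Qed.

Lemma nng_intZ k f : measurable_fun D f -> (forall x, 0 <= f x) -> 0 <= k ->
  (\int[m]_(x in D) (k * f x)%:E = k%:E * \int[m]_(x in D) (f x)%:E)%E.
Proof.
move=> mf f0 k0; under eq_integral do rewrite EFinM.
by rewrite ge0_integralZl_EFin//; [move=> x _; rewrite lee_fin|exact/measurable_EFinP].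
Qed.

Lemma nng_int_sum (I : Type) (s : seq I) (F : I -> T -> R) :
  (forall i, measurable_fun D (F i)) -> (forall i x, 0 <= F i x) ->
  (\int[m]_(x in D) (\sum_(i <- s) F i x)%:E =
   \sum_(i <- s) \int[m]_(x in D) (F i x)%:E)%E.
Proof.
move=> mF F0; under eq_integral do rewrite -sumEFin.
rewrite ge0_integral_sum// => i; first exact/measurable_EFinP.
by move=> x _; rewrite lee_fin.
Qed.

End nonneg_integral.

Section pr.
Context {d : measure_display} {T : measurableType d} {R : realType} (P : probability T R).

Definition pr (A : set T) : R := fine (P A).

Lemma prK A : measurable A -> (pr A)%:E = P A.
Proof. by move=> mA; rewrite fineK// fin_num_measure. Qed.

Lemma pr_ge0 A : 0 <= pr A. Proof. exact: fine_ge0. Qed.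

Lemma pr_le A B : measurable A -> measurable B -> A `<=` B -> pr A <= pr B.
Proof.
by move=> mA mB AB; rewrite -lee_fin !prK// le_measure// inE.
Qed.

Lemma pr_le1 A : measurable A -> pr A <= 1.
Proof. by move=> mA; rewrite -lee_fin prK// probability_le1. Qed.

Lemma prC A : measurable A -> pr (~` A) = 1 - pr A.
Proof.
move=> mA; apply: EFin_inj; rewrite prK; last exact: measurableC.
by rewrite probability_setC// EFinB prK.
Qed.

Lemma prU A B : measurable A -> measurable B -> pr (A `|` B) <= pr A + pr B.
Proof.
move=> mA mB; rewrite -lee_fin EFinD !prK//; last exact: measurableU.
exact: measureU2.
Qed.

Lemma prI A B : measurable A -> measurable B -> pr A + pr B - 1 <= pr (A `&` B).
Proof.
move=> mA mB; have mAB := measurableI _ _ mA mB.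
have := prU (measurableC mA) (measurableC mB); rewrite -setCI !prC//; lra.
Qed.

Lemma integral_pr_cst (k : \bar R) : (\int[P]_x k = k)%E.
Proof.
rewrite integral_cst//; transitivity (k * 1)%E; last exact: mule1.
by congr (_ * _)%E; exact: probability_setT.
Qed.

Lemma integral_pr_indic A : measurable A -> (\int[P]_x (\1_A x)%:E = (pr A)%:E)%E.
Proof. by move=> mA; rewrite integral_indic// setIT; exact/esym/prK. Qed.

Lemma pr_markov (f : T -> R) (a K : R) : measurable_fun setT f ->
  (forall x, 0 <= f x) -> 0 < a -> (\int[P]_x (f x)%:E <= K%:E)%E ->
  pr [set x | a <= f x] <= K / a.
Proof.
move=> mf f0 a0 fK; rewrite ler_pdivlMr// mulrC -lee_fin.
have mA : measurable [set x | a <= f x].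
  rewrite (_ : [set _ | _] = f @^-1` `[a, +oo[%classic).
    by rewrite -[X in measurable X]setTI; exact: mf.
  by apply/seteqP; split => x /=; rewrite in_itv/= andbT.
rewrite EFinM prK//; apply: le_trans fK.
rewrite -integral_cst//.
apply: (@le_trans _ _ (\int[P]_(x in [set x | a <= f x]%R) (f x)%:E)%E).
  apply: ge0_le_integral => //.
  - by move=> x _; rewrite lee_fin ltW.
  - by apply/measurable_EFinP; exact: measurable_funTS.
apply: ge0_subset_integral => //; first exact/measurable_EFinP.
by move=> x _; rewrite lee_fin.
Qed.

(** Instead of Cauchy--Schwarz, the pointwise bound [f <= g] is integrated: on the event it is the
    AM-GM inequality f <= f^2 / (4Km) + Km, off the event f < m / 2. Of the mean m, at least m / 4
    remains for the event. *)
Lemma pr_paley_zygmund (f : T -> R) (m K : R) : measurable_fun setT f ->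
  (forall x, 0 <= f x) -> 0 < m -> 0 < K -> (\int[P]_x (f x)%:E = m%:E)%E ->
  (\int[P]_x (f x ^+ 2)%:E <= (K * m ^+ 2)%:E)%E ->
  (4 * K)^-1 <= pr [set x | m / 2 <= f x].
Proof.
move=> mf f0 m0 K0 fm fK.
have mA : measurable [set x | m / 2 <= f x].
  rewrite (_ : [set _ | _] = f @^-1` `[m / 2, +oo[%classic).
    by rewrite -[X in measurable X]setTI; exact: mf.
  by apply/seteqP; split => x /=; rewrite in_itv/= andbT.
set A := [set x | _] in mA *.
pose g x := m / 2 + (4 * K * m)^-1 * f x ^+ 2 + K * m * \1_A x.
have fg x : f x <= g x.
  rewrite /g indicE; have [xA|xA] := boolP (x \in A).
    rewrite mulr1.
    have : 0 <= (4 * K * m)^-1 * (f x - 2 * K * m) ^+ 2.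
      by rewrite mulr_ge0 ?sqr_ge0// invr_ge0 ?mulr_ge0 ?ltW.
    rewrite (_ : _ * _ = (4 * K * m)^-1 * f x ^+ 2 - f x + K * m); last first.
      by field; rewrite !gt_eqF.
    by move: m0; lra.
  rewrite mulr0 addr0; apply: ler_wpDr.
    by rewrite mulr_ge0 ?sqr_ge0// invr_ge0 ?mulr_ge0 ?ltW.
  by move: xA; rewrite notin_setE /A /= => /negP; rewrite -ltNge => /ltW.
have : (\int[P]_x (f x)%:E <= \int[P]_x (g x)%:E)%E.
  apply: ge0_le_integral => //.
  - by move=> x _; rewrite lee_fin.
  - exact/measurable_EFinP.
  - apply/measurable_EFinP; apply: measurable_funD.
      by apply: measurable_funD => //; apply: measurable_funM => //; exact: measurable_funX.
    by apply: measurable_funM => //; exact: measurable_indic.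
  - by move=> x _; rewrite lee_fin.
have mi : measurable_fun setT (\1_A : T -> R) by exact: measurable_indic.
have i0 x : 0 <= \1_A x :> R by rewrite indicE.
have c0 : 0 <= (4 * K * m)^-1 by rewrite invr_ge0 ?mulr_ge0 ?ltW.
have Km0 : 0 <= K * m by rewrite mulr_ge0 ?ltW.
have mf2 : measurable_fun setT (fun x => f x ^+ 2) by exact: measurable_funX.
have f20 x : 0 <= f x ^+ 2 by exact: sqr_ge0.
rewrite fm /g nng_intD//; first last.
- by move=> x; rewrite mulr_ge0.
- by move=> x; rewrite addr_ge0 ?mulr_ge0//; lra.
- exact: measurable_funM.
- by apply: measurable_funD => //; exact: measurable_funM.
rewrite nng_intD//; first last.
- by move=> x; rewrite mulr_ge0.
- by move=> x; lra.
- exact: measurable_funM.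
rewrite integral_pr_cst !nng_intZ// integral_pr_indic//.
move=> h.
have : (m%:E <= (m / 2)%:E + ((4 * K * m)^-1)%:E * (K * m ^+ 2)%:E + (K * m)%:E * (pr A)%:E)%E.
  apply: (le_trans h); apply: leeD => //; apply: leeD => //; apply: lee_pmul => //.
  exact: nng_int_ge0.
rewrite -!EFinM -!EFinD lee_fin.
rewrite (_ : (4 * K * m)^-1 * (K * m ^+ 2) = m / 4); last by field; rewrite !gt_eqF.
move=> {}h; rewrite -(@ler_pM2l _ (K * m)) ?mulr_gt0//.
rewrite (_ : K * m * (4 * K)^-1 = m / 4); last by field; rewrite gt_eqF.
lra.
Qed.

End pr.

Section log_concave_facts.
Context {R : realType} {n : nat}.
Context (mu : probability 'rV[R]_n R).
Hypothesis lc : log_concave mu.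
Local Notation pr := (pr mu).

Lemma measurable_closed_rV (A : set 'rV[R]_n) : closed A -> measurable A.
Proof.
move=> cA; rewrite -(setCK A); apply: measurableC; apply: open_measurable_rV.
exact: closed_openC.
Qed.

Lemma measurable_compact_rV (A : set 'rV[R]_n) : compact A -> measurable A.
Proof. move=> cA; apply: measurable_closed_rV; by apply: compact_closed. Qed.

Lemma compact_minkowski (A B : set 'rV[R]_n) (s t : R) : compact A -> compact B ->
  compact [set s *: a + t *: b | a in A & b in B].
Proof.
move=> cA cB.
have -> : [set s *: a + t *: b | a in A & b in B] =
    (fun p : 'rV[R]_n * 'rV[R]_n => s *: p.1 + t *: p.2) @` (A `*` B).
  apply/seteqP; split => [_ [a Aa [b Bb <-]]|_ [[a b] [/= Aa Bb] <-]].
    by exists (a, b).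
  by exists a => //; exists b.
apply: continuous_compact; last exact: compact_setX.
apply: continuous_subspaceT => p.
by apply: cvgD; apply: cvgZr; [exact: cvg_fst|exact: cvg_snd].
Qed.

Lemma lc_compact (A B C : set 'rV[R]_n) (t : R) : compact A -> compact B ->
  measurable C -> 0 < t < 1 ->
  (forall a b, A a -> B b -> C ((1 - t) *: a + t *: b)) ->
  pr A `^ (1 - t) * pr B `^ t <= pr C.
Proof.
move=> cA cB mC t01 ABC.
have mAB := measurable_compact_rV (@compact_minkowski A B (1 - t) t cA cB).
have key (D : set 'rV[R]_n) : measurable D ->
  (mu : {measure set 'rV[R]_n -> \bar R}) D = (pr D)%:E by move=> mD; exact/esym/prK.
have := lc cA cB t01.
rewrite (key A) ?(key B) ?(key _ mAB); [|exact: measurable_compact_rV..].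
rewrite !poweR_EFin -EFinM lee_fin => /le_trans; apply.
by apply: pr_le => // _ [a Aa [b Bb <-]]; exact: ABC.
Qed.

Definition cube_rV (k : nat) : set 'rV[R]_n := [set x | forall i, `|x 0 i| <= k%:R].

Lemma closed_cube k : closed (cube_rV k).
Proof.
have -> : cube_rV k = \bigcap_(i in [set: 'I_n]) ((fun x : 'rV[R]_n => `|x 0 i|) @^-1` [set y | y <= k%:R]).
  by apply/seteqP; split => x /= xk i; [move=> _|]; exact: xk.
apply: closed_bigI => i _; apply: preimage_closed; last exact: closed_le.
move=> x _; apply: (@continuous_comp _ _ _ (fun x : 'rV[R]_n => x 0 i) (fun y => `|y|)).
  exact: coord_continuous.
exact: norm_continuous.
Qed.

Lemma compact_closed_cube (A : set 'rV[R]_n) k : closed A -> compact (A `&` cube_rV k).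
Proof.
move=> cA; apply: bounded_closed_compact; last exact: (closedI cA (closed_cube (k := k))).
exists k%:R; split; first exact: num_real.
move=> M kM x [_ /= xk]; have M0 : 0 <= M by apply: le_trans (ltW kM).
rewrite [`|_|]mx_normrE; apply/bigmax_leP; split => // -[i j] _ /=.
by rewrite (ord1 i) (le_trans (xk j))// ltW.
Qed.

Lemma closed_approx (A : set 'rV[R]_n) (e : R) : closed A -> 0 < e ->
  exists k, pr A - e <= pr (A `&` cube_rV k).
Proof.
move=> cA e0.
have mAk k : measurable (A `&` cube_rV k).
  by apply: measurable_compact_rV; exact: compact_closed_cube.
have AE : \bigcup_k (A `&` cube_rV k) = A.
  apply/seteqP; split => [x [k _ []]//|x Ax].
  exists (Num.Def.trunc (\sum_i `|x 0 i|)).+1 => //; split => // i.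
  apply: (@le_trans _ _ (\sum_i `|x 0 i|)).
    by rewrite (bigD1 i)//= lerDl sumr_ge0.
  by rewrite ltW// truncnS_gt.
have mA : measurable A by exact: measurable_closed_rV.
have := @nondecreasing_cvg_mu _ _ _ mu (fun k => A `&` cube_rV k) mAk.
rewrite AE => /(_ mA) h.
have {}h : (mu \o (fun k => A `&` cube_rV k)) x @[x --> \oo] --> mu A.
  apply: h => k l kl; apply/subsetPset => x [Ax xk]; split => // i.
  by rewrite (le_trans (xk i))// ler_nat.
have h' : pr (A `&` cube_rV k) @[k --> \oo] --> pr A.
  apply: fine_cvg; rewrite fineK ?fin_num_measure//.
have /cvgrPdist_le /(_ _ e0)[k _ /(_ k (leqnn k))] := h'.
by rewrite ler_norml => /andP[_]; exists k; lra.
Qed.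

(** Log-concavity is assumed for compact sets only. Closed sets are exhausted by their intersections
    with cubes, at the price of a factor 1 - e that is then sent to 1. *)
Lemma lc_closed (A B C : set 'rV[R]_n) (t : R) : closed A -> closed B ->
  measurable C -> 0 < t < 1 ->
  (forall a b, A a -> B b -> C ((1 - t) *: a + t *: b)) ->
  pr A `^ (1 - t) * pr B `^ t <= pr C.
Proof.
move=> cA cB mC /[dup] t01 /andP[t0 t1] ABC.
have [A0|A0] := eqVneq (pr A) 0.
  by rewrite A0 powR0 ?mul0r ?pr_ge0// subr_eq0 gt_eqF.
have [B0|B0] := eqVneq (pr B) 0.
  by rewrite B0 powR0 ?mulr0 ?pr_ge0// gt_eqF.
have {}A0 : 0 < pr A by rewrite lt_def A0 pr_ge0.
have {}B0 : 0 < pr B by rewrite lt_def B0 pr_ge0.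
set v := _ * _.
suff h e : 0 < e -> e < 1 -> (1 - e) * v <= pr C.
  apply/ler_addgt0Pr => e e0.
  have v0 : 0 <= v by rewrite mulr_ge0 ?powR_ge0.
  pose d := Num.min (e / (v + 1)) (1 / 2).
  have d0 : 0 < d by rewrite lt_min divr_gt0 ?ltr_pwDr//= divr_gt0.
  have d1 : d < 1 by rewrite gt_min; apply/orP; right; lra.
  have := h d d0 d1; have : d * v <= e.
    apply: (@le_trans _ _ (e / (v + 1) * v)).
      by rewrite ler_wpM2r// ge_min lexx.
    by rewrite mulrAC ler_pdivrMr ?ltr_pwDr// ler_wpM2l ?ltW// ltrDl.
  lra.
move=> e0 e1.
have [k1 k1P] := closed_approx cA (mulr_gt0 e0 A0).
have [k2 k2P] := closed_approx cB (mulr_gt0 e0 B0).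
have := @lc_compact (A `&` cube_rV k1) (B `&` cube_rV k2) C t
  (compact_closed_cube (k:=k1) cA) (compact_closed_cube (k:=k2) cB) mC t01.
move=> /(_ (fun a b Aa Bb => ABC a b Aa.1 Bb.1)); apply: le_trans.
have -> : (1 - e) * v = ((1 - e) * pr A) `^ (1 - t) * ((1 - e) * pr B) `^ t.
  rewrite !powRM ?pr_ge0//; [|lra..].
  by rewrite mulrACA -powRD ?subrK ?oner_eq0// powRr1//; lra.
apply: ler_pM; rewrite ?powR_ge0//.
  apply: ge0_ler_powR; rewrite ?nnegrE ?mulr_ge0 ?pr_ge0//; lra.
apply: ge0_ler_powR; rewrite ?nnegrE ?mulr_ge0 ?pr_ge0//; lra.
Qed.

End log_concave_facts.

Section real_facts.
Context {R : realType}.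

Lemma powR_ge_base (a r : R) : 0 <= a <= 1 -> r <= 1 -> a <= a `^ r.
Proof.
move=> /andP[a0 a1] r1; have [->|an0] := eqVneq a 0; first exact: powR_ge0.
have {}a0 : 0 < a by rewrite lt_def an0.
rewrite /powR gt_eqF// -[X in X <= _](lnK a0) ler_expR.
by have := ln_le0 a1; nra.
Qed.

Lemma normrM_le_sqr (a b : R) : `|a * b| <= `|a * a + b * b|.
Proof.
rewrite [X in _ <= X]ger0_norm ?addr_ge0 -?expr2 ?sqr_ge0// ler_norml.
have := sqr_ge0 (a - b); have := sqr_ge0 (a + b); have := sqr_ge0 a; have := sqr_ge0 b.
by move=> *; apply/andP; split; nra.
Qed.

Lemma sum_geometric_le (r : R) m : 0 <= r < 1 -> \sum_(k < m) r ^+ k <= (1 - r)^-1.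
Proof.
move=> /andP[r0 r1]; rewrite -[_^-1]mul1r ler_pdivlMr ?subr_gt0// mulrC.
rewrite -opprB mulNr -subrX1 opprB.
by rewrite gerBl exprn_ge0.
Qed.

Lemma expR_quarter_ge : 5 / 4 <= expR (1 / 4) :> R.
Proof. by have := expR_ge1Dx (1 / 4 : R); lra. Qed.

Lemma expR_quarter_le : expR (1 / 4) <= 4 / 3 :> R.
Proof.
have h := expR_ge1Dx (- (1 / 4) : R); rewrite expRN in h.
have e0 := expR_gt0 (1 / 4 : R).
rewrite -[expR _]invrK -[4 / 3]invrK lef_pV2 ?posrE ?invr_gt0//; lra.
Qed.

Lemma expRN1_gt : 1 / 8 < expR (- 1) :> R.
Proof.
have h := expR_ge1Dx (- (1 / 2) : R).
have : expR (- (1 / 2)) * expR (- (1 / 2)) = expR (- 1) :> R.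
  by rewrite -expRD; congr expR; lra.
nra.
Qed.

Lemma pow4_le_expR (y : R) : 0 <= y -> y ^+ 4 <= 4 ^+ 4 * expR y.
Proof.
move=> y0; have h := expR_ge1Dx (y / 4).
have -> : expR y = expR (y / 4) ^+ 4 by rewrite -expRM_natl; congr expR; lra.
have : (y / 4) ^+ 4 <= expR (y / 4) ^+ 4.
  by rewrite lerXn2r ?nnegrE ?expR_ge0//; lra.
by rewrite expr_div_n; lra.
Qed.

End real_facts.

Section isotropic_moments.
Context {R : realType} {n : nat} (mu : probability 'rV[R]_n R).
Hypothesis iso : isotropic mu.

Lemma iso_mean i : (\int[mu]_x (x 0 i)%:E = 0)%E.
Proof. by have := iso.1 i; rewrite unlock. Qed.

Lemma iso_cov i j : (\int[mu]_x (x 0 i * x 0 j)%:E = (i == j)%:R%:E)%E.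
Proof.
rewrite -(iso.2 i j) unlock !(iso.1) unlock /=.
by apply: eq_integral => x _; congr (_%:E); rewrite /GRing.mul /= !subr0.
Qed.

Lemma measurable_coord0 (i : 'I_n) : measurable_fun [set: 'rV[R]_n] (fun x => x 0 i).
Proof. exact: measurable_coord. Qed.

Lemma iso_integrable_cov i j : mu.-integrable setT (fun x => (x 0 i * x 0 j)%:E).
Proof.
have mij k l : measurable_fun setT (fun x : 'rV[R]_n => (x 0 k * x 0 l)%:E).
  by apply/measurable_EFinP; apply: measurable_funM; exact: measurable_coord0.
have sq k : mu.-integrable setT (fun x => (x 0 k * x 0 k)%:E).
  apply/integrableP; split => //.
  under eq_integral do rewrite gee0_abs ?lee_fin -?expr2 ?sqr_ge0//.
  by under eq_integral do rewrite expr2; rewrite iso_cov ltry.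
apply: (le_integrable _ _ _ (integrableD _ (sq i) (sq j))) => // x _ /=.
rewrite lee_fin; exact: normrM_le_sqr.
Qed.

Lemma iso_integrable_coord i : mu.-integrable setT (fun x => (x 0 i)%:E).
Proof.
have h1 : mu.-integrable setT (cst 1%:E).
  apply/integrableP; split => //; under eq_integral do rewrite abse1.
  by rewrite integral_pr_cst ltry.
apply: (le_integrable _ _ _ (integrableD _ h1 (iso_integrable_cov i i))) => //.
  by apply/measurable_EFinP; exact: measurable_coord0.
move=> x _ /=; rewrite lee_fin; have := normrM_le_sqr 1 (x 0 i); rewrite !mul1r; exact.
Qed.

Lemma iso_affine_sqr (u : 'rV[R]_n) (a : R) :
  (\int[mu]_x ((dotp x u - a) ^+ 2)%:E = (dotp u u + a ^+ 2)%:E)%E.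
Proof.
pose h1 (x : 'rV[R]_n) : \bar R := (\sum_p ((u 0 p.1 * u 0 p.2)%:E * (x 0 p.1 * x 0 p.2)%:E))%E.
pose h2 (x : 'rV[R]_n) : \bar R := (\sum_i ((- (2 * a * u 0 i))%:E * (x 0 i)%:E))%E.
have i1 : mu.-integrable setT h1.
  by apply: integrable_sum => // p _; apply: integrableZl => //; exact: iso_integrable_cov.
have i2 : mu.-integrable setT h2.
  by apply: integrable_sum => // p _; apply: integrableZl => //; exact: iso_integrable_coord.
have i3 : mu.-integrable setT (cst (a ^+ 2)%:E).
  apply/integrableP; split => //=.
  by rewrite integral_pr_cst ltry.
transitivity (\int[mu]_x (h1 x + h2 x + cst (a ^+ 2)%:E x))%E.
  apply: eq_integral => x _.
  rewrite /h1 /h2 /=.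
  under eq_bigr do rewrite -EFinM.
  under [X in (_ + X + _)%E]eq_bigr do rewrite -EFinM.
  rewrite !sumEFin -!EFinD; congr (_%:E).
  rewrite sqrrB; congr (_ + _).
  rewrite expr2 /dotp big_distrlr pair_big /=; congr (_ + _).
    by apply: eq_bigr => -[i j] _ /=; ring.
  rewrite mulr_suml -sumrMnl -sumrN; apply: eq_bigr => i _; ring.
rewrite integralD//; last exact: integrableD.
rewrite integralD// integral_pr_cst.
rewrite integral_sum//; last first.
  by move=> p; apply: integrableZl => //; exact: iso_integrable_cov.
rewrite integral_sum//; last first.
  by move=> p; apply: integrableZl => //; exact: iso_integrable_coord.
rewrite [X in (_ + X + _)%E]big1; last first.
  by move=> i _; rewrite integralZl ?iso_mean ?mule0//; exact: iso_integrable_coord.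
rewrite adde0 EFinD; congr (_ + _)%E.
under eq_bigr do [rewrite integralZl//; [|exact: iso_integrable_cov]; rewrite iso_cov -EFinM].
rewrite sumEFin; congr (_%:E).
rewrite -(pair_big xpredT xpredT (fun i j => u 0 i * u 0 j * (i == j)%:R)) /=.
apply: eq_bigr => i _; rewrite (bigD1 i)//= eqxx mulr1 big1 ?addr0// => j ji.
by rewrite eq_sym (negbTE ji) mulr0.
Qed.

Lemma iso_sqr (u : 'rV[R]_n) : (\int[mu]_x (dotp x u ^+ 2)%:E = (dotp u u)%:E)%E.
Proof.
have := iso_affine_sqr u 0; rewrite expr0n addr0 => <-.
by apply: eq_integral => x _; rewrite subr0.
Qed.

Lemma closed_dotp_ge (u : 'rV[R]_n) (a b : R) : closed [set x : 'rV[R]_n | a <= `|dotp x u - b|].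
Proof.
apply: (@preimage_closed _ _ (fun x : 'rV[R]_n => `|dotp x u - b|) [set y | a <= y]); last exact: closed_ge.
move=> x _; apply: (@continuous_comp _ _ _ (fun x : 'rV[R]_n => dotp x u - b) (fun y => `|y|)).
  by apply: continuousB; [exact: continuous_dotp|exact: cst_continuous].
exact: norm_continuous.
Qed.

Lemma closed_dotp_le (u : 'rV[R]_n) (a b : R) : closed [set x : 'rV[R]_n | `|dotp x u - b| <= a].
Proof.
apply: (@preimage_closed _ _ (fun x : 'rV[R]_n => `|dotp x u - b|) [set y | y <= a]); last exact: closed_le.
move=> x _; apply: (@continuous_comp _ _ _ (fun x : 'rV[R]_n => dotp x u - b) (fun y => `|y|)).
  by apply: continuousB; [exact: continuous_dotp|exact: cst_continuous].
exact: norm_continuous.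
Qed.

Lemma pr_chebyshev (u : 'rV[R]_n) (s t : R) : 0 < t -> dotp u u <= s ^+ 2 ->
  pr mu [set x | t <= `|dotp x u|] <= s ^+ 2 / t ^+ 2.
Proof.
move=> t0 us.
have -> : [set x | t <= `|dotp x u|] = [set x | t ^+ 2 <= dotp x u ^+ 2].
  apply/seteqP; split => x /=; rewrite -(real_normK (num_real (dotp x u))) ler_sqr ?nnegrE//;
    exact: ltW.
apply: pr_markov => //.
- by apply: measurable_funX; exact: measurable_dotp.
- by move=> x; exact: sqr_ge0.
- by rewrite exprn_gt0.
- by rewrite iso_sqr lee_fin.
Qed.

Hypothesis lc : log_concave mu.

(* Borell's lemma *)
Lemma lc_tail (u : 'rV[R]_n) (s t : R) : 0 < s -> dotp u u <= s ^+ 2 -> 0 <= t ->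
  pr mu [set x | 3 * t * s <= `|dotp x u|] <= 2 * expR (- t / 2).
Proof.
move=> s0 us t0.
have cB : closed [set x : 'rV[R]_n | 3 * t * s <= `|dotp x u|].
  have := @closed_dotp_ge u (3 * t * s) 0.
  by congr closed; apply/seteqP; split => x /=; rewrite subr0.
have mB := measurable_closed_rV cB.
have [t1|t1] := leP t 1.
  apply: (le_trans (pr_le1 mu mB)); have := expR_ge1Dx (- t / 2); lra.
have cA : closed [set x : 'rV[R]_n | `|dotp x u| <= 3 * s].
  have := @closed_dotp_le u (3 * s) 0.
  by congr closed; apply/seteqP; split => x /=; rewrite subr0.
have cC : closed [set x : 'rV[R]_n | 3 * s <= `|dotp x u|].
  have := @closed_dotp_ge u (3 * s) 0.
  by congr closed; apply/seteqP; split => x /=; rewrite subr0.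
set A := [set x : 'rV[R]_n | _] in cA; set C := [set x : 'rV[R]_n | 3 * s <= _] in cC.
set B := [set x : 'rV[R]_n | _] in cB mB *.
have mA := measurable_closed_rV cA; have mC := measurable_closed_rV cC.
have C9 : pr mu C <= 1 / 9.
  apply: le_trans (pr_chebyshev _ us) _; first by rewrite mulr_gt0.
  by rewrite exprMn ler_pdivrMr ?mulr_gt0 ?exprn_gt0//; have := exprn_gt0 2 s0; lra.
have A9 : 8 / 9 <= pr mu A.
  have : pr mu (~` A) <= pr mu C.
    apply: pr_le => //; first exact: measurableC.
    by move=> x /=; rewrite /A /C /= => /negP; rewrite -ltNge => /ltW.
  rewrite prC//; lra.
suff : pr mu B <= expR (- (t + 1) / 2).
  move/le_trans; apply; apply: (@le_trans _ _ (expR (- t / 2))).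
    by rewrite ler_expR; lra.
  by have := expR_ge0 (- t / 2); lra.
rewrite leNgt; apply/negP => hB.
(* With this weight a point of [B] and a point of [A] combine to a value of modulus at least l (3ts)
   - (1 - l) (3s) = 3s, hence to a point of [C]. The mass of [C] would then be at least 8/9 exp (-1)
   > 1/9. *)
pose l := 2 / (t + 1).
have l01 : 0 < l < 1 by rewrite /l divr_gt0 ?ltr_pdivrMr//=; lra.
have lt1 : l * (t + 1) = 2 by rewrite /l divfK// gt_eqF//; lra.
have : pr mu A `^ (1 - l) * pr mu B `^ l <= pr mu C.
  apply: (lc_closed lc cA cB mC l01) => a b; rewrite /A /B /C /= => ha hb.
  rewrite dotpDl !dotpZl.
  have := lerB_normD (l * dotp b u) ((1 - l) * dotp a u).
  rewrite [X in _ <= `|X|]addrC => h0; apply: le_trans h0.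
  rewrite (normrM l) (normrM (1 - l)).
  rewrite (ger0_norm (_ : 0 <= l)) ?(ger0_norm (_ : 0 <= 1 - l)); [|lra|lra].
  have h1 : l * (3 * t * s) <= l * `|dotp b u| by rewrite ler_pM2l//; lra.
  have h2 : (1 - l) * `|dotp a u| <= (1 - l) * (3 * s) by rewrite ler_pM2l//; lra.
  have h3 : l * (3 * t * s) - (1 - l) * (3 * s) = 3 * s * (l * (t + 1) - 1) by ring.
  rewrite lt1 in h3; lra.
have hA : 8 / 9 <= pr mu A `^ (1 - l).
  by apply: (le_trans A9); apply: powR_ge_base; rewrite ?pr_ge0 ?pr_le1//; lra.
have hB1 : expR (- 1) <= pr mu B `^ l.
  have -> : expR (- 1) = expR (- (t + 1) / 2) `^ l :> R.
    by rewrite -expRM; congr expR; move: lt1; lra.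
  apply: ge0_ler_powR; rewrite ?nnegrE ?expR_ge0 ?pr_ge0 ?(ltW hB)//; lra.
have := expRN1_gt (R := R).
have : 8 / 9 * expR (- 1) <= pr mu A `^ (1 - l) * pr mu B `^ l.
  by apply: ler_pM => //; rewrite ?expR_ge0//; lra.
lra.
Qed.

(** Layers of width 3s: on the k-th one the integrand is at most exp ((k + 1) / 4) and the tail at
    most 2 exp (-k / 2). The geometric series of ratio exp (-1/4) sums to at most 2 (4/3) 5 < 14. *)
Lemma lc_expmoment (u : 'rV[R]_n) (s : R) : 0 < s -> dotp u u <= s ^+ 2 ->
  (\int[mu]_x (expR (`|dotp x u| / (12 * s)))%:E <= 14%:E)%E.
Proof.
move=> s0 us.
pose B k : set 'rV[R]_n := [set x | 3 * k%:R * s <= `|dotp x u|].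
have mB k : measurable (B k).
  apply: measurable_closed_rV; have := @closed_dotp_ge u (3 * k%:R * s) 0.
  by congr closed; apply/seteqP; split => x /=; rewrite subr0.
pose f k x : \bar R := ((expR ((k.+1)%:R / 4)) * \1_(B k) x)%:E.
have mf k : measurable_fun setT (f k).
  by apply/measurable_EFinP; apply: measurable_funM => //; exact: measurable_indic.
have f0 k x : (0 <= f k x)%E by rewrite lee_fin mulr_ge0 ?expR_ge0// indicE.
have mexp : measurable_fun setT (fun x : 'rV[R]_n => (expR (`|dotp x u| / (12 * s)))%:E).
  apply/measurable_EFinP; apply: measurableT_comp => //.
  apply: measurable_funM => //; apply: measurableT_comp => //; exact: measurable_dotp.
apply: (@le_trans _ _ (\int[mu]_x (\sum_(k <oo) f k x))%E).
  apply: ge0_le_integral => //.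
  - exact: (@ge0_emeasurable_sum _ _ _ setT f xpredT).
  - move=> x _; pose m := Num.Def.trunc (`|dotp x u| / (3 * s)).
    have y0 : 0 <= `|dotp x u| / (3 * s) by rewrite divr_ge0// mulr_ge0// ltW.
    have /andP[m1 m2] := truncn_itv y0.
    apply: (@le_trans _ _ (f m x)).
      rewrite lee_fin indicE mem_set ?mulr1; last first.
        rewrite /B /= -/m; move: m1; rewrite ler_pdivlMr ?mulr_gt0//; lra.
      rewrite ler_expR ler_pdivrMr ?mulr_gt0//; move: m2.
      rewrite ltr_pdivrMr ?mulr_gt0// -/m; lra.
    rewrite (nneseriesD1 (n := m))//.
    by apply: leeDl; apply: nneseries_ge0.
rewrite integral_nneseries//.
apply: lime_le.
  by apply: is_cvg_nneseries => k _ _; apply: integral_ge0.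
apply: nearW => m.
apply: (@le_trans _ _ (\sum_(0 <= k < m) ((2 * expR (1 / 4)) * expR (- (1 / 4)) ^+ k)%:E)%E).
  apply: lee_sum => k _.
  rewrite nng_intZ ?expR_ge0//.
  rewrite integral_pr_indic// -EFinM lee_fin.
  have := lc_tail s0 us (ler0n _ k) => hk.
  apply: (@le_trans _ _ (expR (k.+1%:R / 4) * (2 * expR (- k%:R / 2)))).
    by rewrite ler_pM2l ?expR_gt0.
  rewrite mulrCA mulrAC -mulrA -expRM_natl -!expRD ler_pM2l// ler_expR.
  by rewrite -natr1; lra.
rewrite sumEFin lee_fin -mulr_sumr big_mkord.
have r1 : expR (- (1 / 4)) <= 4 / 5 :> R.
  rewrite expRN -[4 / 5]invrK lef_pV2 ?posrE ?expR_gt0// ?invr_gt0//.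
  by have := expR_quarter_ge (R := R); lra.
have h := @sum_geometric_le R (expR (- (1 / 4))) m _.
apply: (@le_trans _ _ (2 * (4 / 3) * 5)); last by lra.
apply: ler_pM.
- by rewrite mulr_ge0 ?expR_ge0.
- by apply: sumr_ge0 => k _; rewrite exprn_ge0 ?expR_ge0.
- by rewrite ler_pM2l// expR_quarter_le.
apply: (le_trans (h _)); first by rewrite expR_ge0/=; lra.
by rewrite -[5]invrK lef_pV2 ?posrE; lra.
Qed.

(** Directional fourth-moment constant: [pow4_le_expR] at y = |<x, u>| / (12 s), with 14 coming from
    [lc_expmoment]. *)
Definition K4 : R := 12 ^+ 4 * 4 ^+ 4 * 14.

Lemma lc_moment4 (u : 'rV[R]_n) (s : R) : 0 < s -> dotp u u <= s ^+ 2 ->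
  (\int[mu]_x (dotp x u ^+ 4)%:E <= (K4 * s ^+ 4)%:E)%E.
Proof.
move=> s0 us.
apply: (@le_trans _ _ (\int[mu]_x ((12 ^+ 4 * s ^+ 4 * 4 ^+ 4)%:E * (expR (`|dotp x u| / (12 * s)))%:E))%E).
  have md := measurable_dotp u.
  apply: ge0_le_integral => //.
  - by move=> x _; rewrite lee_fin -[4%N]/((2 * 2)%N) exprM sqr_ge0.
  - by apply/measurable_EFinP; exact: measurable_funX.
  - apply/measurable_EFinP; apply: measurable_funM => //.
    apply: measurableT_comp => //.
    by apply: measurable_funM => //; apply: measurableT_comp.
  - move=> x _; rewrite -EFinM lee_fin.
    have y0 : 0 <= `|dotp x u| / (12 * s) by rewrite divr_ge0// mulr_ge0// ltW.
    have h := pow4_le_expR y0.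
    have -> : dotp x u ^+ 4 = (`|dotp x u| / (12 * s)) ^+ 4 * (12 * s) ^+ 4.
      rewrite -exprMn divfK ?gt_eqF ?mulr_gt0// -normrX ger0_norm//.
      by rewrite -[4%N]/((2 * 2)%N) exprM sqr_ge0.
    have s4 : 0 <= (12 * s) ^+ 4 by rewrite exprn_ge0// mulr_ge0// ltW.
    have := ler_wpM2r s4 h; rewrite exprMn; lra.
have c0 : 0 <= 12 ^+ 4 * s ^+ 4 * 4 ^+ 4 by rewrite !mulr_ge0// ltW.
under eq_integral do rewrite -EFinM.
rewrite nng_intZ//.
  rewrite /K4 (_ : 12 ^+ 4 * 4 ^+ 4 * 14 * s ^+ 4 = 12 ^+ 4 * s ^+ 4 * 4 ^+ 4 * 14); last by ring.
  rewrite (EFinM _ 14); apply: lee_pmul => //; last exact: lc_expmoment.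
  by apply: nng_int_ge0 => x; exact: expR_ge0.
apply: measurableT_comp => //.
by apply: measurable_funM => //; apply: measurableT_comp => //; exact: measurable_dotp.
Qed.

Lemma K4_ge1 : 1 <= K4. Proof. by rewrite /K4; lra. Qed.

Lemma pow4_sub_le (y a : R) : (y - a) ^+ 4 <= 8 * y ^+ 4 + 8 * a ^+ 4.
Proof.
have h (p q : R) : 0 <= p -> 0 <= q -> p <= q -> p ^+ 2 <= q ^+ 2 by move=> *; rewrite ler_sqr.
have h1 : (y - a) ^+ 2 <= 2 * (y ^+ 2 + a ^+ 2) by have := sqr_ge0 (y + a); nra.
have := h _ _ (sqr_ge0 _) (mulr_ge0 (ler0n _ 2) (addr_ge0 (sqr_ge0 y) (sqr_ge0 a))) h1.
rewrite -exprM; have := sqr_ge0 (y ^+ 2 - a ^+ 2).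
rewrite -![_ ^+ 4]/(_ ^+ (2 * 2)) !exprM; nra.
Qed.

(** Paley--Zygmund for (<x, u> - a)^2: its mean is 1 + a^2 and its second moment at most 8 K4 (1 +
    a^2)^2, so the bound is uniform in [a]. *)
Lemma lc_spread (u : 'rV[R]_n) (a : R) : dotp u u = 1 ->
  (32 * K4)^-1 <= pr mu [set x | 1 / 2 <= (dotp x u - a) ^+ 2].
Proof.
move=> u1; have K1 := K4_ge1.
have md : measurable_fun setT (fun x => (dotp x u - a) ^+ 2).
  by apply: measurable_funX; apply: measurable_funB => //; exact: measurable_dotp.
have a2 := sqr_ge0 a.
have mset c : measurable [set x | c <= (dotp x u - a) ^+ 2].
  rewrite (_ : [set _ | _] = (fun x => (dotp x u - a) ^+ 2) @^-1` `[c, +oo[%classic).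
    by rewrite -[X in measurable X]setTI; exact: md.
  by apply/seteqP; split => x /=; rewrite in_itv/= andbT.
have := @pr_paley_zygmund _ _ _ mu _ (1 + a ^+ 2) (8 * K4) md (fun x => sqr_ge0 _).
rewrite (_ : 4 * (8 * K4) = 32 * K4); last by ring.
move=> h; apply: (le_trans (h _ _ _ _)).
- lra.
- lra.
- by rewrite iso_affine_sqr u1.
- have p4 (y : R) : 0 <= y ^+ 4 by rewrite -[4%N]/((2 * 2)%N) exprM sqr_ge0.
  have m4 : measurable_fun setT (fun x : 'rV[R]_n => dotp x u ^+ 4).
    by apply: measurable_funX; exact: measurable_dotp.
  apply: (@le_trans _ _ (\int[mu]_x (8 * dotp x u ^+ 4 + 8 * a ^+ 4)%:E)%E).
    apply: nng_int_le => //.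
    + exact: measurable_funX.
    + by apply: measurable_funD => //; exact: measurable_funM.
    + by move=> x; exact: sqr_ge0.
    + by move=> x; rewrite -exprM; exact: pow4_sub_le.
  rewrite nng_intD//; first last.
  + by move=> x; rewrite mulr_ge0.
  + by move=> x; rewrite mulr_ge0.
  + exact: measurable_funM.
  rewrite nng_intZ// integral_pr_cst.
  have h4 : (\int[mu]_x (dotp x u ^+ 4)%:E <= (K4 * 1 ^+ 4)%:E)%E.
    by apply: lc_moment4; rewrite // u1 expr1n.
  apply: (@le_trans _ _ (8%:E * (K4 * 1 ^+ 4)%:E + (8 * a ^+ 4)%:E)%E).
    by apply: leeD => //; apply: lee_pmul => //; apply: nng_int_ge0 => x; exact: p4.
  rewrite -EFinM -EFinD lee_fin expr1n mulr1 mulrDl sqrrD.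
  have a40 := p4 a; rewrite -[4%N]/((2 * 2)%N) exprM in a40 *.
  set b := (a ^+ 2) ^+ 2 in a40 *.
  have : b <= K4 * b by rewrite ler_peMl.
  have : 0 <= K4 * a ^+ 2 by rewrite mulr_ge0//; lra.
  nra.
- apply: pr_le => //.
  by move=> x /=; move: a2; lra.
Qed.

End isotropic_moments.

#[global] Opaque K4.

Section indicator_sums.
Context {R : realType}.

Lemma sum_bool_le1 (I : finType) (P : pred I) :
  (forall i j, P i -> P j -> i = j) -> \sum_i (P i)%:R <= 1 :> R.
Proof.
move=> uP; have [[i Pi]|noP] := pselect (exists i, P i).
  rewrite (bigD1 i)//= Pi big1 ?addr0// => j ji.
  by case: (boolP (P j)) => // Pj; rewrite (uP _ _ Pj Pi) eqxx in ji.
rewrite big1// => i _; case: (boolP (P i)) => // Pi; exfalso; apply: noP; by exists i.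
Qed.

Lemma natr_dist_ge1 (a b : nat) : a <> b -> 1 <= `|a%:R - b%:R| :> R.
Proof.
move=> ab; wlog lab : a b ab / (a < b)%N.
  move=> h; have [|ba|//] := ltngtP a b; first exact: h.
  by rewrite distrC; apply: h => // /esym.
have : a.+1%:R <= b%:R :> R by rewrite ler_nat.
by rewrite -natr1 distrC => h; rewrite ger0_norm; lra.
Qed.

(* Split according to the residue of the index modulo 3. *)
Lemma sum_near_le3 (L : nat) (w : R) : \sum_(i < L) (`|w - i%:R| <= 1)%R%:R <= 3 :> R.
Proof.
pose P (i : 'I_L) := `|w - (i%:R : R)| <= 1.
have -> : \sum_(i < L) (P i)%:R = \sum_(r < 3) \sum_(i < L) (P i && (i %% 3 == r)%N)%:R :> R.
  rewrite exchange_big; apply: eq_bigr => i _ /=.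
  have r3 : (i %% 3 < 3)%N by rewrite ltn_mod.
  rewrite (bigD1 (Ordinal r3))//= eqxx andbT big1 ?addr0// => r rr.
  rewrite [_ == _ :> nat]eq_sym (_ : (nat_of_ord r == _) = false) ?andbF//.
  by apply/negbTE; apply: contra rr => /eqP rE; apply/eqP/val_inj.
apply: (@le_trans _ _ (\sum_(r < 3) 1)); last by rewrite sumr_const card_ord.
apply: ler_sum => r _; apply: sum_bool_le1 => i j.
move=> /andP[]; rewrite /P => Pi /eqP ir /andP[Pj /eqP jr].
apply: val_inj => /=.
have hij (a b : nat) : `|w - (a%:R : R)| <= 1 -> `|w - (b%:R : R)| <= 1 -> (a <= b + 2)%N.
  rewrite !ler_norml => /andP[h1 h2] /andP[h3 h4].
  rewrite -(ler_nat R) natrD; lra.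
have := hij _ _ Pi Pj; have := hij _ _ Pj Pi; move: ir jr => <-.
by move: (nat_of_ord i) (nat_of_ord j) => a b; lia.
Qed.

End indicator_sums.

Section pr_sums.
Context {d : measure_display} {T : measurableType d} {R : realType} (P : probability T R).
Local Notation pr := (pr P).

Lemma pr_sum_le (I : finType) (A : I -> set T) (K : R) : (forall i, measurable (A i)) ->
  (forall x, \sum_i \1_(A i) x <= K) -> \sum_i pr (A i) <= K.
Proof.
move=> mA hK; rewrite -lee_fin -sumEFin.
under eq_bigr do rewrite -integral_pr_indic//.
rewrite -nng_int_sum//; last by move=> i; exact: measurable_indic.
rewrite -(integral_pr_cst P K%:E); apply: nng_int_le => //.
  by apply: measurable_sum => i; exact: measurable_indic.
by move=> x; rewrite sumr_ge0// => i _; rewrite indicE.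
Qed.

Lemma pr_le_sum (I : finType) (Q : pred I) (B : set T) (A : I -> set T) : measurable B ->
  (forall i, measurable (A i)) ->
  (forall x, B x -> exists2 i, Q i & A i x) -> pr B <= \sum_(i | Q i) pr (A i).
Proof.
move=> mB mA hB; rewrite -lee_fin -sumEFin.
under eq_bigr do rewrite -integral_pr_indic//.
rewrite -(integral_pr_indic P mB) -big_filter -nng_int_sum//; last first.
  by move=> i; exact: measurable_indic.
apply: nng_int_le => //.
- by apply: measurable_sum => i; exact: measurable_indic.
- move=> x; rewrite indicE big_filter; case: (boolP (x \in B)) => [|_]; last first.
    by rewrite sumr_ge0// => i _; rewrite indicE.
  rewrite inE => /hB [i Qi Ai]; rewrite (bigD1 i)//= indicE mem_set// lerDl.
  by rewrite sumr_ge0// => j _; rewrite indicE.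
Qed.

End pr_sums.

(** * Anticoncentration of linear forms *)

Section anticoncentration_constants.
Context {R : realType}.

(** [anti_kappa] is the mass given by [lc_spread]; [anti_D] is a radius outside which Chebyshev
    leaves at most half of it; [anti_c] is a density (mass divided by t) that some interval of
    radius t away from [a] must then reach. *)
Definition anti_kappa : R := (32 * K4)^-1.
Definition anti_D : R := 8 * K4.
Definition anti_c : R := anti_kappa / (2 * (anti_D + 1)).
Definition Canti : R := 32 ^+ 2 / anti_c.

Lemma anti_kappa_gt0 : 0 < anti_kappa.
Proof. by have := @K4_ge1 R; rewrite invr_gt0; lra. Qed.

Lemma anti_D_ge : 8 <= anti_D.
Proof. by have := @K4_ge1 R; rewrite /anti_D; lra. Qed.

Lemma anti_c_gt0 : 0 < anti_c.
Proof. by have := anti_D_ge; have := anti_kappa_gt0 => ? ?; rewrite divr_gt0//; lra. Qed.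

Lemma anti_c_le1 : anti_c <= 1.
Proof.
have D8 := anti_D_ge; rewrite ler_pdivrMr; last by lra.
have : anti_kappa <= 1 by have := @K4_ge1 R => ?; rewrite invf_le1; lra.
lra.
Qed.

Lemma Canti_ge : 16 <= Canti.
Proof.
have c1 := anti_c_le1; have c0 := anti_c_gt0.
rewrite ler_pdivlMr//; apply: (@le_trans _ _ 16); last by rewrite expr2; lra.
by rewrite ler_piMr.
Qed.

End anticoncentration_constants.

Section anticoncentration.
Context {R : realType} {n : nat} (mu : probability 'rV[R]_n R).
Hypotheses (iso : isotropic mu) (lc : log_concave mu).

(** Some interval of radius t, centred at distance at least 2/5 from [a], carries mass at least ct.
    Log-concavity gives every interval of radius t centred between [a] and the midpoint at least the
    geometric mean of ct and the mass at [a]. About 1 / (16 t) such intervals are disjoint, so this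
    geometric mean is at most of order t. *)
Lemma lc_anticonc_aux (u : 'rV[R]_n) (a t kappa D c : R) : dotp u u = 1 -> 0 < t ->
  0 < kappa -> 8 <= D -> 0 < c -> c = kappa / (2 * (D + 1)) -> 1 / D ^+ 2 <= kappa / 2 ->
  kappa <= pr mu [set x | 1 / 2 <= (dotp x u - a) ^+ 2] ->
  t <= 1 / 16 -> c * t <= pr mu [set x | `|dotp x u - a| <= t] ->
  pr mu [set x | `|dotp x u - a| <= t] * (c * t) <= (32 * t) ^+ 2.
Proof.
move=> u1 t0 kappa0 D8 c0 cE D2 sp t16 ma.
pose I z : set 'rV[R]_n := [set x | `|dotp x u - z| <= t].
have cI z : closed (I z) by exact: closed_dotp_le.
have mI z : measurable (I z) by exact: measurable_closed_rV.
rewrite -/(I a) in ma *.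
have [z za pz] : exists2 z, 2 / 5 <= `|z - a| & c * t <= pr mu (I z).
  apply: contrapT => /forall2NP hz.
  (* Cells of width 2t, [L] on either side of the central one, cover |<x, u>| < D. If all cells away
     from [a] were light, they could not cover [S], whose mass is at least kappa / 2. *)
  pose L := (Num.Def.trunc (D / (2 * t))).+1.
  pose z (i : 'I_(2 * L).+1) : R := 2 * t * (i%:R - L%:R).
  pose S := [set x : 'rV[R]_n | 1 / 2 <= (dotp x u - a) ^+ 2] `&` ~` [set x | D <= `|dotp x u|].
  have D2t : 0 <= D / (2 * t) by rewrite divr_ge0//; lra.
  have /andP[L1 L2] := truncn_itv D2t.
  have mS1 : measurable [set x : 'rV[R]_n | 1 / 2 <= (dotp x u - a) ^+ 2].
    rewrite (_ : [set _ | _] = (fun x => (dotp x u - a) ^+ 2) @^-1` `[1 / 2, +oo[%classic).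
      rewrite -[X in measurable X]setTI.
      have : measurable_fun setT (fun x : 'rV[R]_n => (dotp x u - a) ^+ 2).
        by apply: measurable_funX; apply: measurable_funB => //; exact: measurable_dotp.
      exact.
    by apply/seteqP; split => x /=; rewrite in_itv/= andbT.
  have mS2 : measurable [set x : 'rV[R]_n | D <= `|dotp x u|].
    apply: measurable_closed_rV; have := @closed_dotp_ge _ _ u D 0.
    by congr closed; apply/seteqP; split => x /=; rewrite subr0.
  have mS : measurable S by apply: measurableI => //; exact: measurableC.
  have S1 : kappa / 2 <= pr mu S.
    apply: le_trans (prI mu mS1 (measurableC mS2)); rewrite prC//.
    have h2 : pr mu [set x | D <= `|dotp x u|] <= kappa / 2.
      apply: le_trans D2; rewrite -[1 in leRHS](expr1n _ 2).
      apply: (pr_chebyshev iso (s := 1)); [lra|by rewrite u1 expr1n].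
    lra.
  have : pr mu S <= \sum_(i | 2 / 5 <= `|z i - a|) pr mu (I (z i)).
    apply: pr_le_sum => // x [/= x1 /negP]; rewrite -ltNge ltr_norml => /andP[x2 x3].
    pose y := (dotp x u / t + 2 * L%:R + 1) / 2.
    have xt : - (D / (2 * t)) <= dotp x u / (2 * t) <= D / (2 * t).
      by rewrite -mulNr !ler_pM2r ?invr_gt0 ?mulr_gt0// !ltW.
    have xt2 : dotp x u / t = 2 * (dotp x u / (2 * t)) by field; rewrite gt_eqF.
    have y0 : 0 <= y by rewrite /y xt2; rewrite -/L in L2; lra.
    have /andP[y1 y2] := truncn_itv y0.
    have iL : (Num.Def.trunc y < (2 * L).+1)%N.
      rewrite -(ltr_nat R); apply: (le_lt_trans y1); rewrite -natr1 natrM /y xt2.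
      rewrite -/L in L2; lra.
    have Ix : I (z (Ordinal iL)) x.
      rewrite /I /z /=; set m := (Num.Def.trunc y)%:R in y1 *.
      have m2 : y < m + 1 by rewrite natr1.
      have xE : dotp x u = t * (2 * y - 2 * L%:R - 1).
        by rewrite /y; field; rewrite gt_eqF.
      rewrite xE ler_norml; nra.
    exists (Ordinal iL) => //.
    move: Ix; rewrite /I /= leNgt => Ix; apply/negP => za.
    move: Ix; rewrite -leNgt => Ix.
    have : `|dotp x u - a| <= 1 / 16 + 2 / 5.
      rewrite (_ : dotp x u - a = dotp x u - z (Ordinal iL) + (z (Ordinal iL) - a)); last by ring.
      apply: (le_trans (ler_normD _ _)); lra.
    rewrite -(@ler_sqr _ `|_|) ?nnegrE// real_normK ?num_real//; lra.
  move/(le_trans S1).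
  have : \sum_(i | 2 / 5 <= `|z i - a|) pr mu (I (z i)) <= \sum_(i : 'I_(2 * L).+1) c * t.
    rewrite [X in _ <= X](bigID (fun i => 2 / 5 <= `|z i - a|))/=; apply: ler_wpDr.
      by rewrite sumr_ge0// => i _; rewrite mulr_ge0// ltW.
    apply: ler_sum => i zi; have [|/negP] := hz (z i); first by rewrite zi.
    by rewrite -ltNge => /ltW.
  rewrite sumr_const card_ord -[_ *+ (2 * L).+1]mulr_natl (_ : (2 * L).+1%:R = 2 * L%:R + 1 :> R); last first.
    by rewrite -natr1 natrM.
  rewrite cE.
  have Lt : L%:R * t <= D / 2 + t.
    have : (Num.Def.trunc (D / (2 * t)))%:R * t <= D / (2 * t) * t by rewrite ler_pM2r.
    rewrite (_ : D / (2 * t) * t = D / 2); last by field; rewrite gt_eqF.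
    rewrite /L -natr1; lra.
  have -> : (2 * L%:R + 1) * (kappa / (2 * (D + 1)) * t) = (2 * (L%:R * t) + t) / (D + 1) * (kappa / 2).
    by field; lra.
  have : (2 * (L%:R * t) + t) / (D + 1) < 1 by rewrite ltr_pdivrMr; lra.
  nra.
pose J := Num.Def.trunc (1 / (16 * t)).
(* Consecutive centres [w j] are 3t apart, so intervals of radius t around them are disjoint; [J]
   keeps every [l j] below 1/2. *)
pose l (j : 'I_J) : R := 3 * t * (j%:R + 1) / `|z - a|.
have J0 : 0 <= 1 / (16 * t) by rewrite divr_ge0//; lra.
have /andP[J1 J2] := truncn_itv J0; rewrite -/J in J1 J2.
have za0 : 0 < `|z - a| by lra.
have tJ1 : J%:R * t <= 1 / 16.
  have : J%:R * t <= 1 / (16 * t) * t by rewrite ler_pM2r.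
  by rewrite (_ : 1 / (16 * t) * t = 1 / 16)//; field; rewrite gt_eqF.
have tJ2 : 1 / 16 < (J%:R + 1) * t.
  have : 1 / (16 * t) * t < J.+1%:R * t by rewrite ltr_pM2r.
  by rewrite natr1 (_ : 1 / (16 * t) * t = 1 / 16)//; field; rewrite gt_eqF.
have l01 j : 0 < l j < 1 / 2.
  apply/andP; split; first by rewrite divr_gt0// !mulr_gt0// ltr_wpDl.
  rewrite ltr_pdivrMr//.
  have : (j%:R + 1) * t <= J%:R * t by rewrite ler_pM2r// natr1 ler_nat.
  lra.
pose w j := (1 - l j) * a + l j * z.
have mass j : Num.sqrt (pr mu (I a)) * Num.sqrt (c * t) <= pr mu (I (w j)).
  have /andP[l0 l1] := l01 j.
  have ct0 : 0 < c * t by rewrite mulr_gt0.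
  have m0 : 0 < pr mu (I a) by exact: lt_le_trans ma.
  apply: (@le_trans _ _ (pr mu (I a) `^ (1 - l j) * pr mu (I z) `^ l j)); last first.
    apply: (lc_closed lc (cI a) (cI z) (mI (w j))); first by apply/andP; split; lra.
    move=> x y; rewrite /I /= => hx hy; rewrite dotpDl !dotpZl /w.
    rewrite (_ : _ - _ = (1 - l j) * (dotp x u - a) + l j * (dotp y u - z)); last by ring.
    apply: (le_trans (ler_normD _ _)); rewrite (normrM (1 - l j)) (normrM (l j)) (ger0_norm (ltW l0)) (@ger0_norm _ (1 - l j)); last by lra.
    nra.
  apply: (@le_trans _ _ (pr mu (I a) `^ (1 - l j) * (c * t) `^ l j)); last first.
    by rewrite ler_wpM2l ?powR_ge0//; apply: ge0_ler_powR; rewrite ?nnegrE ?pr_ge0 ?(ltW ct0) ?(ltW l0).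
  rewrite -!powR12_sqrt ?(ltW m0) ?(ltW ct0)//.
  have -> : pr mu (I a) `^ (1 - l j) = pr mu (I a) `^ 2^-1 * pr mu (I a) `^ (2^-1 - l j).
    by rewrite -powRD ?(gt_eqF m0) ?implybT//; congr powR; field.
  have -> : (c * t) `^ 2^-1 = (c * t) `^ (2^-1 - l j) * (c * t) `^ (l j).
    by rewrite -powRD ?(gt_eqF ct0) ?implybT// subrK.
  rewrite -mulrA ler_wpM2l ?powR_ge0// ler_wpM2r ?powR_ge0//.
  by apply: ge0_ler_powR; rewrite ?nnegrE ?(ltW ct0) ?(ltW m0)//; lra.
have : \sum_(j < J) pr mu (I (w j)) <= 1.
  apply: pr_sum_le => // x.
  under eq_bigr do rewrite indicE.
  apply: sum_bool_le1 => i j; rewrite !inE /I /= => hi hj.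
  apply: val_inj => /=; apply: contrapT => ij.
  have : 1 <= `|i%:R - j%:R| :> R.
    by apply: natr_dist_ge1.
  have wij : `|w i - w j| = 3 * t * `|i%:R - j%:R|.
    have -> : w i - w j = 3 * t * (i%:R - j%:R) * ((z - a) / `|z - a|).
      by rewrite /w /l; field; rewrite gt_eqF.
    rewrite normrM normf_div normr_id divff ?gt_eqF// mulr1 normrM ger0_norm//; lra.
  have : `|w i - w j| <= t + t.
    rewrite (_ : w i - w j = (dotp x u - w j) - (dotp x u - w i)); last by ring.
    by apply: (le_trans (ler_normB _ _)); lra.
  rewrite wij; nra.
have : \sum_(j < J) (Num.sqrt (pr mu (I a)) * Num.sqrt (c * t)) <= \sum_(j < J) pr mu (I (w j)).
  by apply: ler_sum => j _.
rewrite sumr_const card_ord -[_ *+ J]mulr_natl; set m := pr mu (I a) in ma *.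
move=> h1 h2; have {h1 h2} h := le_trans h1 h2.
have ct0 : 0 < c * t by rewrite mulr_gt0.
have m0 : 0 <= m by lra.
rewrite -sqrtrM// in h.
have s0 := sqrtr_ge0 (m * (c * t)).
have tJ3 : 1 / 32 <= J%:R * t.
  case: (J) tJ2 => [|J'] tJ2; first by exfalso; move: tJ2 t16; rewrite add0r mul1r; lra.
  have : J'.+1%:R + 1 <= 2 * J'.+1%:R :> R by have := ler0n R J'; rewrite -natr1; lra.
  by move=> /(ler_wpM2r (ltW t0)); lra.
have h32 : Num.sqrt (m * (c * t)) <= 32 * t.
  have := ler_wpM2r s0 tJ3; have := ler_wpM2r (ltW t0) h; lra.
have mct : 0 <= m * (c * t) by rewrite mulr_ge0// ltW.
rewrite -[X in X <= _](sqr_sqrtr mct).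
by rewrite ler_sqr ?nnegrE// mulr_ge0// (ltW t0).
Qed.

(** For t > 1/16, or if the mass is below [anti_c * t], the bound is trivial; otherwise
    [lc_anticonc_aux] applies and is divided by [anti_c * t]. *)
Lemma lc_anticonc (u : 'rV[R]_n) (a t : R) : dotp u u = 1 -> 0 < t ->
  pr mu [set x | `|dotp x u - a| <= t] <= Canti * t.
Proof.
move=> u1 t0.
have c0 : 0 < anti_c :> R := anti_c_gt0.
have mI : measurable [set x : 'rV[R]_n | `|dotp x u - a| <= t].
  by apply: measurable_closed_rV; exact: closed_dotp_le.
have [t16|t16] := ltP (1 / 16) t.
  by apply: (le_trans (pr_le1 mu mI)); have := @Canti_ge R; nra.
have [ma|ma] := ltP (pr mu [set x | `|dotp x u - a| <= t]) (anti_c * t).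
  apply: (le_trans (ltW ma)); rewrite ler_pM2r//.
  by apply: (le_trans anti_c_le1); have := @Canti_ge R; lra.
have D2 : 1 / anti_D ^+ 2 <= anti_kappa / 2 :> R.
  have K41 : 1 <= K4 :> R := K4_ge1.
  rewrite mul1r -[_ / 2]invrK lef_pV2 ?posrE ?invr_gt0 ?divr_gt0 ?exprn_gt0//.
  - by rewrite invfM invrK invrK /anti_D exprMn; nra.
  - by have := @anti_D_ge R; lra.
  - exact: anti_kappa_gt0.
have := lc_anticonc_aux u1 t0 anti_kappa_gt0 anti_D_ge c0 erefl D2 (lc_spread iso lc a u1) t16 ma.
rewrite /Canti (_ : (32 * t) ^+ 2 = (32 ^+ 2 / anti_c * t) * (anti_c * t)); last by field; rewrite gt_eqF.
by rewrite ler_pM2r// mulr_gt0.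
Qed.

End anticoncentration.

(** * Gram determinants *)

Section projections.
Context {R : realType} {n : nat}.
Implicit Types (P : 'M[R]_n) (z w : 'rV[R]_n).

Definition is_proj P := P^T = P /\ P *m P = P.

(** The orthogonal projection onto the part of the range of [P] that is orthogonal to [z], as long
    as [z *m P] is nonzero. *)
Definition proj_cut P z : 'M[R]_n :=
  P - (dotp (z *m P) (z *m P))^-1 *: ((z *m P)^T *m (z *m P)).

Lemma mulmx_dotp z w : z *m w^T = (dotp z w)%:M.
Proof.
apply/matrixP => i j; rewrite (ord1 i) (ord1 j) !mxE eqxx mulr1n.
by apply: eq_bigr => k _; rewrite mxE.
Qed.

Lemma is_proj1 : is_proj 1%:M.
Proof. by split; rewrite ?trmx1 ?mulmx1. Qed.

Lemma proj_cutP P z : is_proj P -> z *m P != 0 ->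
  is_proj (proj_cut P z) /\ \tr (proj_cut P z) = \tr P - 1.
Proof.
move=> [PT PP] w0; rewrite /proj_cut; set w := z *m P in w0 *; set s := _^-1.
have wP : w *m P = w by rewrite /w -mulmxA PP.
have Pw : P *m w^T = w^T by rewrite -[LHS]trmxK trmx_mul trmxK PT wP.
have sw : s * dotp w w = 1 by rewrite mulVf// dotp_eq0.
have ww : (w^T *m w) *m (w^T *m w) = dotp w w *: (w^T *m w).
  by rewrite mulmxA -[w^T *m w *m w^T]mulmxA mulmx_dotp mul_mx_scalar -scalemxAl.
split; first split.
- by rewrite linearB /= linearZ /= trmx_mul trmxK PT.
- rewrite mulmxBl !mulmxBr PP -scalemxAr -!scalemxAl -scalemxAr ww.
  have PwT : P *m (w^T *m w) = w^T *m w by rewrite mulmxA Pw.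
  have wTP : w^T *m w *m P = w^T *m w by rewrite -mulmxA wP.
  by rewrite PwT wTP !scalerA -mulrA sw mulr1 subrr subr0.
- rewrite linearB /= linearZ /= mxtrace_mulC mulmx_dotp mxtrace_scalar mulr1n.
  by rewrite [_ * _]sw.
Qed.

Lemma dotp_proj P z : is_proj P -> dotp (z *m P) (z *m P) = dotp (z *m P) z.
Proof.
move=> [PT PP]; have : (dotp (z *m P) (z *m P))%:M = (dotp (z *m P) z)%:M :> 'M[R]_1.
  by rewrite -!mulmx_dotp trmx_mul PT mulmxA -[z *m P *m P]mulmxA PP.
by move/matrixP => /(_ 0 0); rewrite !mxE eqxx !mulr1n.
Qed.

Lemma dotp_mulmx P z w : is_proj P -> dotp (z *m P) w = dotp z (w *m P).
Proof.
move=> [PT PP]; have : (dotp (z *m P) w)%:M = (dotp z (w *m P))%:M :> 'M[R]_1.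
  by rewrite -!mulmx_dotp trmx_mul PT mulmxA.
by move/matrixP => /(_ 0 0); rewrite !mxE eqxx !mulr1n.
Qed.

End projections.

Section gram.
Context {R : realType}.

Lemma det_schur m (a : R) (b : 'rV[R]_m) (c : 'cV[R]_m) (D : 'M[R]_m) : a != 0 ->
  \det (block_mx a%:M b c D) = a * \det (D - a^-1 *: (c *m b)).
Proof.
move=> a0.
have -> : block_mx a%:M b c D = block_mx 1%:M 0 (a^-1 *: c) 1%:M *m
    block_mx a%:M b 0 (D - a^-1 *: (c *m b)) :> 'M[R]_(1 + m).
  rewrite mulmx_block !mul1mx !mul0mx !addr0 -scalemxAl mul_mx_scalar scalerA.
  by rewrite mulVf// scale1r -scalemxAl addrC subrK.
by rewrite det_mulmx det_lblock det_ublock !det1 det_scalar1 !mul1r.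
Qed.

(** For an orthogonal projection [P], the squared volume of the parallelepiped spanned by the
    projected rows of [Z]. *)
Definition gram n m (P : 'M[R]_n) (Z : 'M[R]_(m, n)) : R := \det (Z *m P *m Z^T).

Lemma gram0 n (P : 'M[R]_n) (Z : 'M[R]_(0, n)) : gram P Z = 1.
Proof. by rewrite /gram det_mx00. Qed.

Lemma gram1 n (Z : 'M[R]_n) : gram 1%:M Z = \det Z ^+ 2.
Proof. by rewrite /gram mulmx1 det_mulmx det_tr expr2. Qed.

(** Base times height: the Schur complement of the corner |z P|^2 is the Gram matrix of the
    remaining rows projected orthogonally to [z *m P]. *)
Lemma gram_cons n m (P : 'M[R]_n) (z : 'rV[R]_n) (Z : 'M[R]_(m, n)) :
  is_proj P -> z *m P != 0 ->
  gram P (col_mx z Z) = dotp (z *m P) (z *m P) * gram (proj_cut P z) Z.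
Proof.
move=> hP w0; have [PT PP] := hP; rewrite /gram tr_col_mx mul_col_mx mul_col_row.
have -> : z *m P *m z^T = (dotp (z *m P) (z *m P))%:M by rewrite mulmx_dotp -dotp_proj.
rewrite det_schur ?dotp_eq0//; congr (_ * \det _).
rewrite /proj_cut mulmxBr mulmxBl -!(scalemxAr, scalemxAl); congr (_ - _ *: _).
by rewrite trmx_mul PT !mulmxA.
Qed.

(** Induction on the Schur complement of the corner, which is again positive semidefinite and has
    smaller diagonal entries. If the corner is 0, semidefiniteness forces the rest of the first row
    to vanish. *)
Lemma hadamard_psd n (A : 'M[R]_n) : A^T = A ->
  (forall v : 'rV[R]_n, 0 <= (v *m A *m v^T) 0 0) ->
  0 <= \det A <= \prod_i A i i.
Proof.
elim: n A => [|n IH] A AT Apsd; first by rewrite det_mx00 big_ord0 ler01 lexx.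
pose B : 'M[R]_(1 + n) := A.
pose a := A 0 0; pose b := ursubmx B; pose D := drsubmx B.
have aE : ulsubmx B = a%:M.
  apply/matrixP => i j; rewrite (ord1 i) (ord1 j) !mxE eqxx mulr1n.
  by congr (A _ _); exact: val_inj.
have cE : dlsubmx B = b^T by rewrite /b trmx_ursub [B^T]AT.
have BE : B = block_mx a%:M b b^T D by rewrite -[LHS]submxK aE cE.
have DT : D^T = D by rewrite /D trmx_drsub [B^T]AT.
have Bpsd : forall v : 'rV[R]_(1 + n), 0 <= (v *m B *m v^T) 0 0 := Apsd.
have detB : \det A = \det (block_mx a%:M b b^T D) by rewrite -BE.
have quad (t : R) (v : 'rV[R]_n) :
    0 <= t ^+ 2 * a + 2 * t * dotp v b + (v *m D *m v^T) 0 0.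
  have := Bpsd (row_mx t%:M v).
  rewrite BE mul_row_block tr_row_mx mul_row_col !mulmxDl tr_scalar_mx.
  rewrite !mul_scalar_mx !mul_mx_scalar -scalemxAl !mulmx_dotp.
  rewrite !mxE eqxx !mulr1n (dotpC b v) => h; lra.
have a0 : 0 <= a by have := quad 1 0; rewrite dotp0l !mul0mx mxE; lra.
have diag (i : 'I_n) : D i i = A (lift 0 i) (lift 0 i).
  by rewrite !mxE; congr (A _ _); exact: val_inj.
have Dpsd : forall v : 'rV[R]_n, 0 <= (v *m D *m v^T) 0 0.
  by move=> v; have := quad 0 v; rewrite expr0n mulr0 !mul0r !add0r.
have /andP[D0 D1] := IH D DT Dpsd.
rewrite big_ord_recl -[A ord0 ord0]/a.
have -> : \prod_(i < n) A (lift ord0 i) (lift ord0 i) = \prod_i D i i.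
  by apply: eq_bigr => i _; rewrite diag.
have [a00|an0] := eqVneq a 0.
  have b0 : b = 0.
    apply/eqP; rewrite -dotp_eq0; apply/eqP/le_anti; rewrite dotp_ge0 andbT.
    rewrite leNgt; apply/negP => b0.
    have := quad (- ((b *m D *m b^T) 0 0 + 1) / (2 * dotp b b)) b.
    rewrite a00 mulr0 add0r.
    rewrite (_ : 2 * _ * _ = - ((b *m D *m b^T) 0 0 + 1)); first by lra.
    by field; rewrite gt_eqF.
  rewrite detB a00 b0 trmx0 (det_ublock _ 0) det_scalar1 mul0r mul0r.
  by rewrite lexx.
have {}a0 : 0 < a by rewrite lt_def an0.
rewrite detB det_schur//.
pose D' := D - a^-1 *: (b^T *m b).
have quad' (v : 'rV[R]_n) : (v *m D' *m v^T) 0 0 = (v *m D *m v^T) 0 0 - a^-1 * dotp v b ^+ 2.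
  rewrite /D' mulmxBr mulmxBl -scalemxAr -scalemxAl !mxE; congr (_ - _ * _).
  have -> : \sum_j (v *m (b^T *m b)) 0 j * v^T j 0 = (v *m b^T *m (b *m v^T)) 0 0.
    by rewrite -mulmxA !mulmxA mxE.
  by rewrite !mulmx_dotp -scalar_mxM mxE eqxx mulr1n (dotpC b v) expr2.
have D'T : D'^T = D' by rewrite /D' linearB /= linearZ /= trmx_mul trmxK DT.
have D'psd (v : 'rV[R]_n) : 0 <= (v *m D' *m v^T) 0 0.
  rewrite quad'; have := quad (- a^-1 * dotp v b) v.
  rewrite (_ : _ ^+ 2 * a = a^-1 * dotp v b ^+ 2); last by field.
  rewrite (_ : 2 * _ * _ = - 2 * (a^-1 * dotp v b ^+ 2)); last by field.
  lra.
have /andP[D'0 D'1] := IH D' D'T D'psd.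
rewrite mulr_ge0 ?(ltW a0)//= ler_pM2l//; apply: (le_trans D'1).
apply: ler_prod => i _; apply/andP; split.
  have := D'psd (delta_mx 0 i).
  by rewrite -rowE trmx_delta -colE !mxE.
rewrite /D' !mxE lerBlDr lerDl mulr_ge0 ?invr_ge0 ?(ltW a0)//.
by rewrite big_ord1 !mxE -expr2 sqr_ge0.
Qed.

Lemma det_le_trace n (A : 'M[R]_n) (t : R) : (0 < n)%N -> A^T = A ->
  (forall v : 'rV[R]_n, 0 <= (v *m A *m v^T) 0 0) -> \tr A <= n%:R * t ->
  0 <= \det A <= t ^+ n.
Proof.
move=> n0 AT Apsd At; have /andP[d0 d1] := hadamard_psd AT Apsd; rewrite d0/=.
have Aii i : 0 <= A i i.
  by have := Apsd (delta_mx 0 i); rewrite -rowE trmx_delta -colE !mxE.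
have := @leif_AGM R _ predT (fun i => A i i) (fun i _ => Aii i).
rewrite cardT size_enum_ord => -[agm _].
apply: (le_trans d1); apply: (le_trans agm); apply: lerXn2r; rewrite ?nnegrE.
- by rewrite mulr_ge0 ?invr_ge0// sumr_ge0.
- rewrite -(@pmulr_rge0 _ n%:R) ?ltr0n//; apply: le_trans At.
  by rewrite sumr_ge0.
- by rewrite ler_pdivrMr ?ltr0n// mulrC.
Qed.

Lemma det_row_perm_sqr n (s : 'S_n) (A : 'M[R]_n) : \det (row_perm s A) ^+ 2 = \det A ^+ 2.
Proof. by rewrite row_permE det_mulmx det_perm exprMn sqrr_sign mul1r. Qed.

(** Multilinearity expands the determinant over all maps [f] from rows to indices. Averaging this
    expansion over the permutations of the rows, whence the factorial, turns the product of diagonal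
    entries into a second determinant. *)
Lemma cauchy_binet_sum n (I : finType) (c : I -> R) (z : I -> 'rV[R]_n) :
  n`!%:R * \det (\sum_r c r *: ((z r)^T *m z r)) =
  \sum_(f : {ffun 'I_n -> I}) (\prod_i c (f i)) * \det (\matrix_(i, j) z (f i) 0 j) ^+ 2.
Proof.
set M := \sum_r _.
pose Z (f : {ffun 'I_n -> I}) : 'M[R]_n := \matrix_(i, j) z (f i) 0 j.
have ME i j : M i j = \sum_r c r * z r 0 i * z r 0 j.
  rewrite /M summxE; apply: eq_bigr => r _; rewrite !mxE big_ord1 !mxE mulrA; congr (_ * _ * _).
have detM : \det M = \sum_(f : {ffun 'I_n -> I})
    (\prod_i (c (f i) * z (f i) 0 i)) * \det (Z f).
  rewrite /determinant.
  under eq_bigr => s _.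
    under eq_bigr do rewrite ME.
    rewrite bigA_distr_bigA mulr_sumr; over.
  rewrite exchange_big /=; apply: eq_bigr => f _; rewrite mulr_sumr.
  apply: eq_bigr => s _; rewrite big_split /= mulrCA; congr (_ * (_ * _)).
  by apply: eq_bigr => i _; rewrite mxE.
have -> : n`!%:R * \det M = \sum_(s : 'S_n) \det M by rewrite sumr_const card_Sn mulr_natl.
transitivity (\sum_(s : 'S_n) \sum_(f : {ffun 'I_n -> I})
    (\prod_i c (f i)) * (\prod_i z (f (s i)) 0 i) * ((-1) ^+ s * \det (Z f))).
  apply: eq_bigr => s _; rewrite detM.
  rewrite (reindex_inj (h := fun f : {ffun 'I_n -> I} => [ffun i => f (s i)])); last first.
    move=> f g /ffunP fg; apply/ffunP => i.
    by have := fg (s^-1%g i); rewrite !ffunE permKV.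
  apply: eq_bigr => f _; congr (_ * _).
    rewrite big_split /=; congr (_ * _); last by apply: eq_bigr => i _; rewrite ffunE.
    rewrite [RHS](reindex_inj (@perm_inj _ s)).
    by apply: eq_bigr => i _; rewrite ffunE.
  have -> : Z [ffun i => f (s i)] = row_perm s (Z f).
    by apply/matrixP => i j; rewrite !mxE ffunE.
  by rewrite row_permE det_mulmx det_perm.
rewrite exchange_big /=; apply: eq_bigr => f _.
under eq_bigr do rewrite -mulrA.
rewrite -mulr_sumr; congr (_ * _).
under eq_bigr do rewrite mulrA.
rewrite -mulr_suml expr2; congr (_ * _).
rewrite -det_tr /determinant; apply: eq_bigr => s _.
rewrite mulrC; congr (_ * _).
by apply: eq_bigr => i _; rewrite !mxE.
Qed.

(* The terms of the Cauchy--Binet expansion that use each block exactly once. *)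
Lemma det_sum_blocks_ge n (C : finType) (w : 'I_n -> C -> R) (z : 'I_n -> C -> 'rV[R]_n) :
  (forall k c, 0 <= w k c) ->
  \sum_(f : {ffun 'I_n -> C}) (\prod_k w k (f k)) * \det (\matrix_(i, j) z i (f i) 0 j) ^+ 2 <=
  \det (\sum_k \sum_c w k c *: ((z k c)^T *m z k c)).
Proof.
move=> w0; rewrite pair_big /=.
have nf0 : 0 < n`!%:R :> R by rewrite ltr0n fact_gt0.
rewrite -(ler_pM2l nf0).
rewrite (@cauchy_binet_sum _ _ (fun p => w p.1 p.2) (fun p => z p.1 p.2)).
(* Row i takes its vector from block s(i). The n! permutations s all give the same term, which
   cancels the factorial on the left. *)
pose h (p : 'S_n * {ffun 'I_n -> C}) : {ffun 'I_n -> 'I_n * C} :=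
  [ffun i => (p.1 i, p.2 (p.1 i))].
have hinj : injective h.
  move=> [s f] [s' f'] /ffunP hE.
  have ss' : s = s' by apply/permP => i; have := hE i; rewrite !ffunE => -[].
  rewrite -ss' in hE *; congr (_, _); apply/ffunP => i.
  by have := hE (s^-1%g i); rewrite !ffunE /= permKV => -[].
pose F (g : {ffun 'I_n -> 'I_n * C}) := (\prod_i w (g i).1 (g i).2) *
  \det (\matrix_(i, j) z (g i).1 (g i).2 0 j) ^+ 2.
rewrite -/F.
have F0 g : 0 <= F g by rewrite mulr_ge0 ?sqr_ge0// prodr_ge0.
apply: (@le_trans _ _ (\sum_(g in h @: predT) F g)); last first.
  rewrite [X in _ <= X](bigID (fun g => g \in h @: predT))/= lerDl.
  by apply: sumr_ge0 => g _; exact: F0.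
rewrite big_imset/=; last by move=> x y _ _; exact: hinj.
rewrite (eq_bigl xpredT)//.
rewrite -(pair_big xpredT xpredT (fun s f => F (h (s, f)))) /=.
rewrite -card_Sn mulr_natl -sumr_const le_eqVlt; apply/orP; left; apply/eqP.
apply: eq_big => // s _; apply: eq_bigr => f _; rewrite /F; congr (_ * _).
  rewrite [LHS](reindex_inj (@perm_inj _ s)).
  by apply: eq_bigr => i _; rewrite ffunE.
rewrite -(det_row_perm_sqr s); congr (\det _ ^+ 2).
by apply/matrixP => i j; rewrite !mxE ffunE.
Qed.

End gram.

(** * Projections of log-concave measures *)

Section swap.
Context {d d' : measure_display} {T : measurableType d} {T' : measurableType d'} {R : realType}.
Context (mu : probability T R) (nu : {sigma_finite_measure set T' -> \bar R}).

(** Tonelli and the independence of the tuple. It is applied to random test directions: for a fixed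
    point y, the probability of passing q independent tests is a q-th power. *)
Lemma mtup_pow_swap q (w : T' -> R) (psi : T * T' -> R) :
  measurable_fun setT w -> measurable_fun setT psi ->
  (forall y, 0 <= w y) -> (forall p, 0 <= psi p) ->
  (\int[mtup mu q]_g \int[nu]_y (w y * \prod_(j < q) psi (tnth g j, y))%:E =
   \int[nu]_y ((w y)%:E * \prod_(j < q) \int[mu]_x (psi (x, y))%:E))%E.
Proof.
move=> mw mpsi w0 psi0.
pose F (p : q.-tuple T * T') : \bar R := (w p.2 * \prod_(j < q) psi (tnth p.1 j, p.2))%:E.
have mpj (j : 'I_q) : measurable_fun setT (fun p : q.-tuple T * T' => psi (tnth p.1 j, p.2)).
  apply: (measurableT_comp mpsi); apply: measurable_fun_pair => //.
  by apply: (measurableT_comp (measurable_tnth j)).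
have mF : measurable_fun setT F.
  apply/measurable_EFinP; apply: measurable_funM; first by apply: measurableT_comp.
  by apply: measurable_prod => j _.
have F0 p : (0 <= F p)%E by rewrite lee_fin mulr_ge0// prodr_ge0.
transitivity (\int[nu]_y \int[mtup mu q]_g F (g, y))%E.
  exact: (@fubini_tonelli _ _ _ _ _ (mtup mu q) nu F mF F0).
apply: eq_integral => y _.
have my : measurable_fun setT (fun x => psi (x, y)).
  by apply: (measurableT_comp mpsi); exact: measurable_pair2.
rewrite /F /=; under eq_integral do rewrite EFinM -prodEFin.
rewrite ge0_integralZl ?lee_fin//.
- rewrite (@ge0_integral_mtup_prod _ _ _ mu q (fun _ x => (psi (x, y))%:E))//.
    by move=> _; exact/measurable_EFinP.
  by move=> _ x; rewrite lee_fin.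
- under eq_fun do rewrite prodEFin.
  apply/measurable_EFinP; apply: measurable_prod => j _.
  exact: (measurableT_comp my (measurable_tnth j)).
- by move=> g _; apply: prode_ge0 => j _; rewrite lee_fin.
Qed.

End swap.

Lemma continuous_mulR {R : realType} {n : nat} (f g : 'rV[R]_n -> R) :
  continuous f -> continuous g -> continuous (fun x => f x * g x : R).
Proof. by move=> cf cg x; apply: continuousM; [exact: cf|exact: cg]. Qed.

Section pr_more.
Context {d : measure_display} {T : measurableType d} {R : realType} (P : probability T R).
Local Notation pr := (pr P).

Lemma pr_le_wsum (I : finType) (w : I -> R) (B : set T) (A : I -> set T) : measurable B ->
  (forall i, measurable (A i)) -> (forall i, 0 <= w i) ->
  (forall x, B x -> 1 <= \sum_i w i * \1_(A i) x) -> pr B <= \sum_i w i * pr (A i).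
Proof.
move=> mB mA w0 hB; rewrite -lee_fin -sumEFin.
under eq_bigr do rewrite EFinM -integral_pr_indic// -nng_intZ//.
rewrite -(integral_pr_indic P mB) -nng_int_sum//; first last.
- by move=> i x; rewrite mulr_ge0// indicE.
- by move=> i; apply: measurable_funM => //; exact: measurable_indic.
apply: nng_int_le => //.
- apply: measurable_sum => i; apply: measurable_funM => //; exact: measurable_indic.
- move=> x; rewrite indicE; case: (boolP (x \in B)) => [|_].
    by rewrite inE => /hB.
  by rewrite sumr_ge0// => i _; rewrite mulr_ge0// indicE.
Qed.

End pr_more.

Section projected_norm.
Context {R : realType} {n : nat} (P : 'M[R]_n) (hP : is_proj P).
Implicit Types x y : 'rV[R]_n.

Definition pnorm2 x : R := dotp (x *m P) (x *m P).

Lemma pnorm2_ge0 x : 0 <= pnorm2 x. Proof. exact: dotp_ge0. Qed.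

Lemma mulmx_proj_coord x i : (x *m P) 0 i = dotp x (row i P).
Proof.
rewrite mxE; apply: eq_bigr => j _; rewrite !mxE.
by rewrite -[in LHS]hP.1 mxE.
Qed.

Lemma pnorm2E x : pnorm2 x = \sum_i dotp x (row i P) ^+ 2.
Proof. by apply: eq_bigr => i _; rewrite mulmx_proj_coord expr2. Qed.

Lemma dotp_row_proj i : dotp (row i P) (row i P) = P i i.
Proof.
have := congr1 (fun M : 'M[R]_n => M i i) hP.2; rewrite mxE => <-.
apply: eq_bigr => j _; rewrite !mxE.
by have := congr1 (fun M : 'M[R]_n => M i j) hP.1; rewrite mxE => ->.
Qed.

Lemma proj_diag_ge0 i : 0 <= P i i.
Proof. by rewrite -dotp_row_proj dotp_ge0. Qed.

Lemma row_proj0 i : P i i = 0 -> row i P = 0.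
Proof. by move=> Pii; apply/eqP; rewrite -dotp_eq0 dotp_row_proj Pii. Qed.

Lemma measurable_pnorm2 (b : 'rV[R]_n) : measurable_fun setT (fun x => pnorm2 (x - b)).
Proof.
under eq_fun do rewrite pnorm2E.
apply: measurable_sum => i; apply: measurable_funX.
under eq_fun do rewrite dotpBl.
by apply: measurable_funB => //; exact: measurable_dotp.
Qed.

Lemma measurable_pnorm2_le (b : 'rV[R]_n) (a : R) : measurable [set x | pnorm2 (x - b) <= a].
Proof.
rewrite (_ : [set _ | _] = (fun x => pnorm2 (x - b)) @^-1` `]-oo, a]%classic).
  by rewrite -[X in measurable X]setTI; exact: measurable_pnorm2.
by apply/seteqP; split => x /=; rewrite in_itv.
Qed.

Lemma continuous_pnorm2 : continuous (fun x => pnorm2 x : R).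
Proof.
rewrite (_ : pnorm2 = fun x => \sum_i dotp x (row i P) ^+ 2); last first.
  by apply/funext => x; exact: pnorm2E.
elim: (index_enum _) => [|i s IH].
  rewrite (_ : (fun _ => _) = cst 0); first exact: cst_continuous.
  by apply/funext => y; rewrite big_nil.
rewrite (_ : (fun _ => _) = (fun y : 'rV[R]_n => dotp y (row i P) ^+ 2 + \sum_(j <- s) dotp y (row j P) ^+ 2)).
  apply: continuous_addR => // y.
  exact: (continuous_mulR (@continuous_dotp _ _ _) (@continuous_dotp _ _ _)).
by apply/funext => y; rewrite big_cons.
Qed.

Lemma pnorm2N x : pnorm2 (- x) = pnorm2 x.
Proof. by rewrite /pnorm2 mulNmx dotpNl dotpNr opprK. Qed.

End projected_norm.

Section projected_small_ball.
Context {R : realType} {n : nat} (mu : probability 'rV[R]_n R).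
Hypotheses (iso : isotropic mu) (lc : log_concave mu).
Context (P : 'M[R]_n) (hP : is_proj P) (k : nat) (trP : \tr P = k%:R) (k0 : (0 < k)%N).
Local Notation f := (pnorm2 P).

Let kR0 : 0 < k%:R :> R. Proof. by rewrite ltr0n. Qed.

Lemma sum_proj_diag : \sum_i P i i = k%:R. Proof. exact: trP. Qed.

(** Give coordinate i the weight P_ii, which is its variance; the weights add up to k. If |P (x -
    b)|^2 <= t^2 k, the coordinates exceeding (3/2) t sqrt P_ii have weight at most 4k / 9, so more
    than half of the weight lies on small coordinates. Each coordinate is small with probability at
    most 2 Canti t. *)
Lemma proj_anticonc (b : 'rV[R]_n) (t : R) : 0 < t ->
  pr mu [set x | f (x - b) <= t ^+ 2 * k%:R] <= 4 * Canti * t.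
Proof.
move=> t0; have C0 := @Canti_ge R.
pose s i := Num.sqrt (P i i).
have s2 i : s i ^+ 2 = P i i by rewrite sqr_sqrtr// proj_diag_ge0.
pose A i : set 'rV[R]_n := [set x | `|dotp x (row i P) - dotp b (row i P)| <= 3 / 2 * t * s i].
have mA i : measurable (A i) by apply: measurable_closed_rV; exact: closed_dotp_le.
have hA i : P i i * pr mu (A i) <= P i i * (2 * Canti * t).
  have [->|Pn0] := eqVneq (P i i) 0; first by rewrite !mul0r.
  have P0 : 0 < P i i by rewrite lt_def Pn0 proj_diag_ge0.
  have si0 : 0 < s i by rewrite sqrtr_gt0.
  rewrite ler_pM2l//.
  pose u := (s i)^-1 *: row i P.
  have u1 : dotp u u = 1.
    by rewrite /u dotpZl dotpZr dotp_row_proj// -s2; field; rewrite gt_eqF.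
  have t32 : 0 < 3 / 2 * t by lra.
  have := lc_anticonc iso lc (dotp b u) u1 t32.
  have -> : [set x | `|dotp x u - dotp b u| <= 3 / 2 * t] = A i.
    apply/seteqP; split => x; rewrite /A /u /= !dotpZr -mulrBr normrM gtr0_norm ?invr_gt0//;
      by rewrite ler_pdivrMl// mulrC.
  by move/le_trans; apply; nra.
apply: (@le_trans _ _ (\sum_i (2 / k%:R * P i i) * pr mu (A i))).
  apply: pr_le_wsum => //.
  - exact: measurable_pnorm2_le.
  - by move=> i; rewrite mulr_ge0 ?proj_diag_ge0// divr_ge0.
  move=> x /= hx; under eq_bigr do rewrite -[_ * P _ _ * _]mulrA.
  rewrite -mulr_sumr mulrAC ler_pdivlMr// mul1r.
  have h i : (9 / 4) * t ^+ 2 * (P i i - P i i * \1_(A i) x) <= dotp (x - b) (row i P) ^+ 2.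
    rewrite indicE; have [xA|xA] := boolP (x \in A i); first by rewrite mulr1 subrr mulr0 sqr_ge0.
    rewrite mulr0 subr0 dotpBl; move: xA; rewrite notin_setE /A /= => /negP; rewrite -ltNge => /ltW.
    have st0 : 0 <= 3 / 2 * t * s i by rewrite mulr_ge0 ?sqrtr_ge0//; lra.
    rewrite -ler_sqr ?nnegrE// real_normK ?num_real//.
    by rewrite (_ : (3 / 2 * t * s i) ^+ 2 = 9 / 4 * t ^+ 2 * P i i)// -s2; field.
  have : \sum_i (9 / 4) * t ^+ 2 * (P i i - P i i * \1_(A i) x) <= t ^+ 2 * k%:R.
    by apply: le_trans hx; rewrite pnorm2E//; apply: ler_sum => i _.
  rewrite -mulr_sumr sumrB sum_proj_diag.
  rewrite -mulrA mulrCA ler_pM2l ?exprn_gt0// => h2.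
  have := kR0; lra.
under eq_bigr do rewrite -[_ * P _ _ * _]mulrA.
rewrite -mulr_sumr.
have : \sum_i P i i * pr mu (A i) <= \sum_i P i i * (2 * Canti * t) by exact: ler_sum.
rewrite -mulr_suml sum_proj_diag => h.
rewrite mulrAC ler_pdivrMr//; lra.
Qed.

Lemma proj_null (b : 'rV[R]_n) : pr mu [set x | f (x - b) = 0] = 0.
Proof.
have mE : measurable [set x | f (x - b) = 0].
  rewrite (_ : [set _ | _] = [set x | f (x - b) <= 0]); first exact: measurable_pnorm2_le.
  apply/seteqP; split => x /= h; first by rewrite h.
  by apply/le_anti; rewrite h pnorm2_ge0.
apply/le_anti; rewrite pr_ge0 andbT; apply/ler_addgt0Pr => e e0; rewrite add0r.
have C0 := @Canti_ge R; have d0 : 0 < e / (4 * Canti) by rewrite divr_gt0//; lra.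
have := proj_anticonc b d0; rewrite (_ : 4 * Canti * (e / (4 * Canti)) = e); last first.
  by field; rewrite gt_eqF//; lra.
apply: le_trans; apply: pr_le => //; first exact: measurable_pnorm2_le.
by move=> x /= ->; rewrite mulr_ge0// sqr_ge0.
Qed.

Lemma iso_pnorm2 : (\int[mu]_x (f x)%:E = k%:R%:E)%E.
Proof.
under eq_integral do rewrite pnorm2E//.
rewrite nng_int_sum//; first last.
- by move=> i x; exact: sqr_ge0.
- by move=> i; apply: measurable_funX; exact: measurable_dotp.
under eq_bigr do rewrite iso_sqr// dotp_row_proj//.
by rewrite sumEFin sum_proj_diag.
Qed.

Lemma weighted_jensen_sqr (I : finType) (w y : I -> R) : (forall i, 0 <= w i) ->
  (\sum_i w i * y i) ^+ 2 <= (\sum_i w i) * \sum_i w i * y i ^+ 2.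
Proof.
move=> w0; set S := \sum_i w i; set Y := \sum_i w i * y i; set Z := \sum_i _.
have S0 : 0 <= S by exact: sumr_ge0.
have h : 0 <= \sum_i w i * (S * y i - Y) ^+ 2 by apply: sumr_ge0 => i _; rewrite mulr_ge0// sqr_ge0.
have : \sum_i w i * (S * y i - Y) ^+ 2 = S * (S * Z - Y ^+ 2).
  transitivity (\sum_i (S ^+ 2 * (w i * y i ^+ 2) - (2 * S * Y) * (w i * y i) + Y ^+ 2 * w i)).
    by apply: eq_bigr => i _; ring.
  rewrite big_split sumrB /= -!mulr_sumr -/S -/Y -/Z; ring.
move=> hE; rewrite hE in h; have [Sz|Sn] := eqVneq S 0; last first.
  by move: h; rewrite pmulr_rge0 ?subr_ge0// lt_def Sn.
have -> : Y = 0.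
  by rewrite /Y big1// => i _; rewrite (psumr_eq0P _ Sz) ?mul0r.
by rewrite expr0n Sz mul0r.
Qed.

(** Jensen with the weights P_ii reduces this to fourth moments of single linear forms. Zero
    diagonal entries correspond to zero rows of [P], and the inverse of 0 being 0 makes their terms
    vanish. *)
Lemma iso_pnorm4 : (\int[mu]_x (f x ^+ 2)%:E <= (K4 * k%:R ^+ 2)%:E)%E.
Proof.
pose s i := Num.sqrt (P i i).
have s2 i : s i ^+ 2 = P i i by rewrite sqr_sqrtr// proj_diag_ge0.
pose g x := k%:R * \sum_i (P i i)^-1 * dotp x (row i P) ^+ 4.
have p4 (y : R) : 0 <= y ^+ 4 by rewrite -[4%N]/((2 * 2)%N) exprM sqr_ge0.
have m4 i : measurable_fun setT (fun x : 'rV[R]_n => (P i i)^-1 * dotp x (row i P) ^+ 4).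
  by apply: measurable_funM => //; apply: measurable_funX; exact: measurable_dotp.
have g4 i x : 0 <= (P i i)^-1 * dotp x (row i P) ^+ 4.
  by rewrite mulr_ge0 ?invr_ge0 ?proj_diag_ge0.
have mf : measurable_fun setT (fun x => f x ^+ 2).
  apply: measurable_funX; have := measurable_pnorm2 hP 0.
  by under eq_fun do rewrite subr0.
apply: (@le_trans _ _ (\int[mu]_x (g x)%:E)%E).
  apply: nng_int_le => //.
  - apply: measurable_funM => //; exact: measurable_sum.
  - by move=> x; exact: sqr_ge0.
  - move=> x; rewrite pnorm2E// /g.
    have -> : \sum_i dotp x (row i P) ^+ 2 = \sum_i P i i * ((P i i)^-1 * dotp x (row i P) ^+ 2).
      apply: eq_bigr => i _; have [Pi|Pi] := eqVneq (P i i) 0.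
        by rewrite Pi row_proj0// dotp0r expr0n mul0r.
      by rewrite mulrA mulfV// mul1r.
    apply: (le_trans (weighted_jensen_sqr _ (proj_diag_ge0 hP))).
    rewrite sum_proj_diag ler_pM2l//; apply: ler_sum => i _.
    have [Pi|Pi] := eqVneq (P i i) 0; first by rewrite Pi mul0r invr0 mul0r.
    by rewrite le_eqVlt; apply/orP; left; apply/eqP; field.
rewrite /g nng_intZ//; [|exact: measurable_sum|by move=> x; apply: sumr_ge0].
rewrite nng_int_sum// (_ : (K4 * k%:R ^+ 2)%:E = (k%:R%:E * (K4 * k%:R)%:E)%E); last first.
  by rewrite -EFinM; congr (_%:E); ring.
apply: lee_pmul => //; first by apply: sume_ge0 => i _; exact: nng_int_ge0.
rewrite -sum_proj_diag mulr_sumr -sumEFin; apply: lee_sum => i _.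
rewrite nng_intZ ?invr_ge0 ?proj_diag_ge0//; last first.
  by apply: measurable_funX; exact: measurable_dotp.
have [Pi|Pi] := eqVneq (P i i) 0; first by rewrite Pi invr0 mul0e mulr0.
have P0 : 0 < P i i by rewrite lt_def Pi proj_diag_ge0.
have si0 : 0 < s i by rewrite sqrtr_gt0.
have := @lc_moment4 _ _ _ iso lc (row i P) _ si0.
rewrite s2 dotp_row_proj// lexx => /(_ isT) h.
rewrite (_ : (K4 * P i i)%:E = ((P i i)^-1)%:E * (K4 * s i ^+ 4)%:E)%E; last first.
  rewrite -EFinM -[4%N]/((2 * 2)%N) exprM s2; congr (_%:E); by field.
by apply: lee_pmul => //; [rewrite lee_fin invr_ge0 ltW|exact: nng_int_ge0].
Qed.

Definition shell : set 'rV[R]_n := [set x | k%:R / 2 <= f x <= (8 * K4) ^+ 2 * k%:R].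

Lemma closed_shell : closed shell.
Proof.
have cf := continuous_pnorm2 hP.
rewrite (_ : shell = (f @^-1` [set y | k%:R / 2 <= y]) `&` (f @^-1` [set y | y <= (8 * K4) ^+ 2 * k%:R])).
  by apply: closedI; apply: preimage_closed => [x _|]; [exact: cf|exact: closed_ge|exact: cf|exact: closed_le].
by apply/seteqP; split => x /=; [move=> /andP[]|move=> [? ?]; apply/andP].
Qed.

(** Paley--Zygmund gives mass (4 K4)^-1 to the outside of the inner sphere; the outer radius is such
    that Markov removes at most half of it. *)
Lemma shell_mass : (8 * K4)^-1 <= pr mu shell.
Proof.
have K1 := @K4_ge1 R.
have mf : measurable_fun setT (f : 'rV[R]_n -> R).
  by have := measurable_pnorm2 hP 0; under eq_fun do rewrite subr0.
have f0 x : 0 <= f x by exact: pnorm2_ge0.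
have mge a : measurable [set x | a <= f x].
  rewrite (_ : [set _ | _] = f @^-1` `[a, +oo[%classic).
    by rewrite -[X in measurable X]setTI; exact: mf.
  by apply/seteqP; split => x /=; rewrite in_itv/= andbT.
have h1 : (4 * K4)^-1 <= pr mu [set x | k%:R / 2 <= f x].
  by apply: pr_paley_zygmund => //; [lra|exact: iso_pnorm2|exact: iso_pnorm4].
have K80 : 0 < (8 * K4) ^+ 2 * k%:R :> R by rewrite mulr_gt0// exprn_gt0//; lra.
have h2 : pr mu [set x | (8 * K4) ^+ 2 * k%:R <= f x] <= (8 * K4)^-1.
  apply: (le_trans (@pr_markov _ _ _ mu f _ k%:R mf f0 K80 _)); first by rewrite iso_pnorm2.
  rewrite ler_pdivrMr// (_ : (8 * K4)^-1 * _ = 8 * K4 * k%:R); last first.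
    by field; rewrite gt_eqF//; lra.
  by rewrite ler_peMl// ?ltW//; lra.
apply: (@le_trans _ _ (pr mu ([set x | k%:R / 2 <= f x] `&` ~` [set x | (8 * K4) ^+ 2 * k%:R <= f x]))).
  apply: le_trans (prI mu (mge _) (measurableC (mge _))); rewrite prC//.
  have : (8 * K4)^-1 = (4 * K4)^-1 / 2 :> R by field; rewrite gt_eqF//; lra.
  lra.
apply: pr_le; first by apply: measurableI => //; exact: measurableC.
  exact: measurable_closed_rV closed_shell.
move=> x [/= h3 /negP]; rewrite -ltNge => /ltW h4; apply/andP; split=> //.
Qed.

End projected_small_ball.

Section measurable_sets.
Context {d : measure_display} {T : measurableType d} {R : realType}.

Lemma measurable_forall_ord q (F : 'I_q -> set T) : (forall j, measurable (F j)) ->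
  measurable [set x | forall j, F j x].
Proof.
move=> mF; rewrite (_ : [set _ | _] = \bigcap_(j in [set: 'I_q]) F j).
  by apply: fin_bigcap_measurable => //; exact: finite_finset.
by apply/seteqP; split => x /= h j; [move=> _|]; exact: h.
Qed.

Lemma measurable_le_cst (f : T -> R) (a : R) : measurable_fun setT f ->
  measurable [set x | f x <= a].
Proof.
move=> mf; rewrite (_ : [set _ | _] = f @^-1` `]-oo, a]%classic).
  by rewrite -[X in measurable X]setTI; exact: mf.
by apply/seteqP; split => x /=; rewrite in_itv.
Qed.

Lemma measurable_ge_cst (f : T -> R) (a : R) : measurable_fun setT f ->
  measurable [set x | a <= f x].
Proof.
move=> mf; rewrite (_ : [set _ | _] = f @^-1` `[a, +oo[%classic).
  by rewrite -[X in measurable X]setTI; exact: mf.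
by apply/seteqP; split => x /=; rewrite in_itv/= andbT.
Qed.

Lemma measurable_lt_cst (f : T -> R) (a : R) : measurable_fun setT f ->
  measurable [set x | f x < a].
Proof.
move=> mf; rewrite (_ : [set _ | _] = f @^-1` `]-oo, a[%classic).
  by rewrite -[X in measurable X]setTI; exact: mf.
by apply/seteqP; split => x /=; rewrite in_itv.
Qed.

Lemma measurable_bool_le (f : T -> R) (a : R) : measurable_fun setT f ->
  measurable_fun setT (fun x => (f x <= a)%R%:R : R).
Proof.
move=> mf; have mA := measurable_le_cst a mf.
rewrite (_ : (fun _ => _) = \1_[set x | f x <= a]); first exact: measurable_indic.
apply/funext => x; rewrite indicE; congr (nat_of_bool _)%:R.
by apply/idP/idP; rewrite inE.
Qed.

Lemma integral_bool_le (P : probability T R) (f : T -> R) (a : R) : measurable_fun setT f ->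
  (\int[P]_x ((f x <= a)%R%:R)%:E = (pr P [set x | f x <= a])%:E)%E.
Proof.
move=> mf; rewrite -(integral_pr_indic P (measurable_le_cst a mf)).
apply: eq_integral => x _; rewrite indicE; congr (nat_of_bool _)%:R%:E.
by apply/idP/idP; rewrite inE.
Qed.

Lemma integral_pr_le (P : probability T R) (f : T -> R) (a : R) : measurable_fun setT f ->
  (forall x, 0 <= f x <= a) -> (\int[P]_x (f x)%:E <= a%:E)%E.
Proof.
move=> mf fa; rewrite -(integral_pr_cst P a%:E); apply: nng_int_le => // x;
  by have /andP[] := fa x.
Qed.

End measurable_sets.

Lemma closed_forall_ord {T : topologicalType} q (F : 'I_q -> set T) :
  (forall j, closed (F j)) -> closed [set x | forall j, F j x].
Proof.
move=> cF; rewrite (_ : [set _ | _] = \bigcap_(j in [set: 'I_q]) F j).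
  by apply: closed_bigI => j _; exact: cF.
by apply/seteqP; split => x /= h j; [move=> _|]; exact: h.
Qed.

Lemma prX {d d'} {T : measurableType d} {T' : measurableType d'} {R : realType}
    (P : probability T R) (Q : probability T' R) A B : measurable A -> measurable B ->
  pr (P \x Q)%E (A `*` B) = pr P A * pr Q B.
Proof.
move=> mA mB; apply: EFin_inj; rewrite EFinM !prK//; last exact: measurableX.
exact: product_measure1E.
Qed.

(** * Small-ball estimate for projections, by counting collisions *)

Section hoelder_count.
Context {R : realType} {I : finType}.

Lemma light_heavy (a tau : R) : 0 <= a -> 0 < tau ->
  a <= a ^+ 2 / tau + Num.sqrt tau * Num.sqrt a.
Proof.
move=> a0 t0; have s0 := sqrtr_ge0 a; have st0 := sqrtr_ge0 tau.
have [ta|ta] := leP tau a.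
  apply: ler_wpDr; first by rewrite mulr_ge0.
  by rewrite ler_pdivlMr// expr2 ler_wpM2l.
apply: ler_wpDl; first by rewrite divr_ge0 ?sqr_ge0// ltW.
rewrite -[X in X <= _]sqr_sqrtr// expr2 ler_wpM2r// ler_wsqrtr//; exact: ltW.
Qed.

(* [sum a <= (sum a^2)^(1/3) (sum a^(1/2))^(2/3)] up to constants *)
Lemma sum_sqr_sqrt_interp (a : I -> R) (b al pc K : R) :
  (forall i, 0 <= a i) -> 0 <= b -> 0 <= al -> 0 <= K -> al <= \sum_i a i ->
  \sum_i a i ^+ 2 <= pc -> \sum_i Num.sqrt b * Num.sqrt (a i) <= K ->
  b * al ^+ 3 <= 8 * K ^+ 2 * pc.
Proof.
move=> a0 b0 al0 K0 h1 h2 h3.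
have sa0 : 0 <= \sum_i a i ^+ 2 by apply: sumr_ge0 => i _; exact: sqr_ge0.
have pc0 : 0 <= pc by exact: le_trans h2.
have [alz|aln] := eqVneq al 0.
  by rewrite alz expr0n mulr0 mulr_ge0// mulr_ge0// sqr_ge0.
have {}al0 : 0 < al by rewrite lt_def aln.
have [pcz|pcn] := eqVneq pc 0.
  have : \sum_i a i = 0.
    apply: big1 => i _; apply/eqP; rewrite -sqrf_eq0; apply/eqP.
    have ha : \sum_i a i ^+ 2 = 0 by apply/le_anti; rewrite sa0 andbT; move: h2; rewrite pcz.
    exact: (psumr_eq0P (fun j _ => sqr_ge0 (a j)) ha).
  by move=> hz; move: h1; rewrite hz leNgt al0.
have {}pc0 : 0 < pc by rewrite lt_def pcn.
(* At this threshold the indices with large [a i] contribute at most al / 2 to the sum. *)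
pose tau := 2 * pc / al; have t0 : 0 < tau by rewrite divr_gt0// mulr_gt0.
have st0 := sqrtr_ge0 tau; have sb0 := sqrtr_ge0 b.
have key : Num.sqrt b * al <= 2 * Num.sqrt tau * K.
  have e1 : Num.sqrt b * al <= Num.sqrt b * \sum_i a i by rewrite ler_wpM2l.
  have e2 : \sum_i a i <= (\sum_i a i ^+ 2) / tau + Num.sqrt tau * \sum_i Num.sqrt (a i).
    rewrite mulr_suml mulr_sumr -big_split; apply: ler_sum => i _; exact: light_heavy.
  have e3 : (\sum_i a i ^+ 2) / tau <= al / 2.
    rewrite ler_pdivrMr// (_ : al / 2 * tau = pc)// /tau; by field.
  rewrite -mulr_sumr in h3.
  have e4 : Num.sqrt b * \sum_i a i <= Num.sqrt b * (al / 2) + Num.sqrt tau * K.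
    apply: (@le_trans _ _ (Num.sqrt b * (al / 2 + Num.sqrt tau * \sum_i Num.sqrt (a i)))).
      by rewrite ler_wpM2l//; apply: (le_trans e2); rewrite lerD2r.
    by rewrite mulrDr lerD2l mulrCA ler_wpM2l.
  lra.
have : (Num.sqrt b * al) ^+ 2 <= (2 * Num.sqrt tau * K) ^+ 2.
  by rewrite ler_sqr ?nnegrE ?mulr_ge0 ?(ltW al0).
rewrite !exprMn !sqr_sqrtr ?(ltW t0)// => /(ler_wpM2r (ltW al0)).
rewrite (_ : b * al ^+ 2 * al = b * al ^+ 3); last by ring.
by rewrite (_ : 2 ^+ 2 * tau * K ^+ 2 * al = 8 * K ^+ 2 * pc)// /tau; field.
Qed.

End hoelder_count.

Section collision.
Context {R : realType} {n : nat} (mu : probability 'rV[R]_n R).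
Hypothesis lc : log_concave mu.
Local Notation pr := (pr mu).

Lemma measurable_dotp_sub (v : 'rV[R]_n) :
  measurable_fun setT (fun p : 'rV[R]_n * 'rV[R]_n => dotp (p.1 - p.2) v).
Proof.
under eq_fun do rewrite dotpBl.
apply: measurable_funB.
  exact: (measurableT_comp (measurable_dotp v) measurable_fst).
exact: (measurableT_comp (measurable_dotp v) measurable_snd).
Qed.

Definition collide q (A : set 'rV[R]_n) (v : 'I_q -> 'rV[R]_n) (s : R)
    (p : 'rV[R]_n * 'rV[R]_n) : R :=
  \1_A p.1 * \1_A p.2 * \prod_(j < q) (`|dotp (p.1 - p.2) (v j)| <= 2 * s)%R%:R.

Lemma collide01 q A (v : 'I_q -> 'rV[R]_n) s p : 0 <= collide A v s p <= 1.
Proof.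
have i01 (B : set 'rV[R]_n) x : 0 <= (\1_B x : R) <= 1 by rewrite indicE ler0n lern1 leq_b1.
have /andP[a0 a1] := i01 A p.1; have /andP[b0 b1] := i01 A p.2.
rewrite /collide mulr_ge0 ?mulr_ge0 ?prodr_ge0//=.
have le1M (a b : R) : 0 <= a -> a <= 1 -> 0 <= b -> b <= 1 -> a * b <= 1 by nra.
rewrite le1M ?mulr_ge0 ?prodr_ge0 ?(le1M _ _ a0 a1 b0 b1)//.
by rewrite prodr_ile1// => j _; rewrite ler0n lern1 leq_b1.
Qed.

Lemma measurable_collide q A (v : 'I_q -> 'rV[R]_n) s : measurable A ->
  measurable_fun setT (collide A v s).
Proof.
move=> mA; apply: measurable_funM.
  have mi : measurable_fun setT (\1_A : 'rV[R]_n -> R) by exact: measurable_indic.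
  apply: measurable_funM; first exact: (measurableT_comp mi measurable_fst).
  exact: (measurableT_comp mi measurable_snd).
apply: measurable_prod => j _; apply: measurable_bool_le.
by apply: measurableT_comp => //; exact: measurable_dotp_sub.
Qed.

(** Cut [A] into cells of side 2s in the q directions. Midpoints of the box and of a cell lie in a
    box of half-side s, whose centre moves by s with each step of the cell; log-concavity bounds the
    mass of that box below by the geometric mean of the two masses, and a point lies in at most 3^q
    of these boxes. On the other hand, the sum of the squared cell masses is at most the collision
    probability. [sum_sqr_sqrt_interp] combines the two bounds. *)
Lemma box_collision q (v : 'I_q -> 'rV[R]_n) (beta : 'I_q -> R) (s : R) (A : set 'rV[R]_n)
    (L : nat) : closed A -> 0 < s ->
  (forall x, A x -> forall j, `|dotp x (v j)| < 2 * s * L%:R) ->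
  ((pr [set x | forall j, (`|dotp x (v j) - beta j| <= s)%R] * pr A ^+ 3)%:E <=
   (8 * 9 ^+ q)%:E * \int[mu \x mu]_p (collide A v s p)%:E)%E.
Proof.
move=> cA s0 AL; set B := [set x | _].
have mA := measurable_closed_rV cA.
have cB : closed B by apply: (@closed_forall_ord _ q (fun j => [set x | `|dotp x (v j) - beta j| <= s])) => j; exact: closed_dotp_le.
have mcol := measurable_collide v s mA.
pose pc := fine (\int[(mu \x mu)%E]_p (collide A v s p)%:E)%E.
have pcE : (\int[mu \x mu]_p (collide A v s p)%:E = pc%:E)%E.
  rewrite fineK// ge0_fin_numE.
    apply: (@le_lt_trans _ _ 1%:E); last exact: ltry.
    by apply: integral_pr_le => // p; exact: collide01.
  by apply: nng_int_ge0 => p; have /andP[] := collide01 A v s p.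
rewrite pcE -EFinM lee_fin.
pose idx := {ffun 'I_q -> 'I_(2 * L)}.
pose lo (z : idx) j : R := 2 * s * ((z j)%:R - L%:R).
(* The closed cells [cZ] serve log-concavity; the half-open cells [AZ] are disjoint and serve the
   count of collisions. *)
pose cZ z := A `&` [set x | forall j, `|dotp x (v j) - (lo z j + s)| <= s].
pose AZ z := cZ z `&` [set x | forall j, dotp x (v j) < lo z j + 2 * s].
pose C z := [set x | forall j, `|dotp x (v j) - (beta j / 2 + lo z j / 2 + s / 2)| <= s].
have ccZ z : closed (cZ z).
  apply: closedI => //; apply: (@closed_forall_ord _ q (fun j => [set x | `|dotp x (v j) - (lo z j + s)| <= s])) => j; exact: closed_dotp_le.
have mcZ z := measurable_closed_rV (ccZ z).
have mAZ z : measurable (AZ z).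
  apply: measurableI => //; apply: (@measurable_forall_ord _ _ q (fun j => [set x | dotp x (v j) < lo z j + 2 * s])) => j.
  by apply: measurable_lt_cst; exact: measurable_dotp.
have mC z : measurable (C z).
  apply: measurable_closed_rV; apply: (@closed_forall_ord _ q (fun j => [set x | `|dotp x (v j) - (beta j / 2 + lo z j / 2 + s / 2)| <= s])) => j.
  exact: closed_dotp_le.
have -> : 9 ^+ q = (3 ^+ q) ^+ 2 :> R by rewrite -exprM mulnC exprM; congr (_ ^+ q); ring.
apply: (@sum_sqr_sqrt_interp _ _ (fun z => pr (AZ z))).
- by move=> z; exact: pr_ge0.
- exact: pr_ge0.
- exact: pr_ge0.
- exact: exprn_ge0.
- apply: pr_le_sum => // x Ax.
  have zj (j : 'I_q) : exists i : 'I_(2 * L), 2 * s * (i%:R - L%:R) <= dotp x (v j) < 2 * s * (i%:R - L%:R) + 2 * s.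
    have := AL x Ax j; rewrite ltr_norml => /andP[h1 h2].
    pose y := dotp x (v j) / (2 * s) + L%:R.
    have yE : dotp x (v j) = 2 * s * (y - L%:R) by rewrite /y; field; rewrite gt_eqF.
    have y0 : 0 <= y.
      rewrite /y -lerBlDr sub0r ler_pdivlMr ?mulr_gt0//; lra.
    have /andP[y1 y2] := truncn_itv y0.
    have yL : y < (2 * L)%:R.
      rewrite natrM /y -ltrBrDr ltr_pdivrMr ?mulr_gt0//; lra.
    have iL : (Num.Def.trunc y < 2 * L)%N by rewrite -(ltr_nat R); exact: le_lt_trans y1 yL.
    exists (Ordinal iL) => /=; rewrite yE; rewrite -natr1 in y2.
    have s20 : 0 < 2 * s by rewrite mulr_gt0.
    rewrite ler_pM2l// lerD2r y1/=.
    rewrite (_ : _ + 2 * s = 2 * s * ((Num.Def.trunc y)%:R - L%:R + 1)); last by ring.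
    by rewrite ltr_pM2l//; lra.
  have /choice[g gP] := zj.
  exists [ffun j => g j] => //; split; last first.
    by move=> j; rewrite /lo ffunE; have /andP[] := gP j.
  split=> // j; rewrite /lo ffunE ler_norml; have /andP[h1 h2] := gP j.
  by apply/andP; split; lra.
- rewrite -lee_fin -pcE -sumEFin.
  have -> : (\sum_z (pr (AZ z) ^+ 2)%:E = \sum_z \int[(mu \x mu)]_p (\1_(AZ z `*` AZ z) p)%:E)%E.
    apply: eq_bigr => z _; rewrite integral_pr_indic; last exact: measurableX.
    by rewrite prX// expr2.
  rewrite -nng_int_sum//; last by move=> z; apply: measurable_indic; exact: measurableX.
  apply: nng_int_le => //.
  + by apply: measurable_sum => z; apply: measurable_indic; exact: measurableX.
  + by move=> p; apply: sumr_ge0.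
  move=> p; have [[z [z1 z2]]|noz] := pselect (exists z, AZ z p.1 /\ AZ z p.2); last first.
    rewrite big1; first by have /andP[] := collide01 A v s p.
    move=> z _; rewrite indicE memNset// => -[/= h1 h2]; apply: noz; by exists z.
  apply: (@le_trans _ _ 1).
    under eq_bigr do rewrite indicE.
    apply: sum_bool_le1 => z3 z4; rewrite !inE => -[/= h3 _] [/= h4 _].
    apply/ffunP => j; apply: val_inj => /=; apply: contrapT => zz.
    have := natr_dist_ge1 (R := R) zz.
    have := h3.2 j; have := h4.2 j; have := h3.1.2 j; have := h4.1.2 j.
    rewrite /= !ler_norml => /andP[b1 _] /andP[b2 _] b3 b4.
    have c1 : lo z4 j < lo z3 j + 2 * s by lra.
    have c2 : lo z3 j < lo z4 j + 2 * s by lra.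
    have s20 : 0 < 2 * s by rewrite mulr_gt0.
    have cl (a b : R) : 2 * s * (a - L%:R) < 2 * s * (b - L%:R) + 2 * s -> a < b + 1.
      rewrite (_ : 2 * s * (b - L%:R) + 2 * s = 2 * s * (b - L%:R + 1)); last by ring.
      rewrite ltr_pM2l//; lra.
    have {}c1 := cl _ _ c1; have {}c2 := cl _ _ c2.
    rewrite leNgt => /negP; apply; rewrite ltr_norml; apply/andP; split; lra.
  rewrite /collide !indicE !mem_set ?mul1r; [|exact: z2.1.1|exact: z1.1.1].
  rewrite (eq_bigr (fun=> 1)) ?prodr_const ?expr1n// => j _.
  rewrite (_ : (_ <= _)%R = true)//; apply/idP; rewrite dotpBl.
  have := z1.2 j; have := z1.1.2 j; have := z2.2 j; have := z2.1.2 j.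
  rewrite /= !ler_norml => /andP[b1 _] b2 /andP[b3 _] b4; apply/andP; split; lra.
- apply: (@le_trans _ _ (\sum_z pr (C z))).
    apply: ler_sum => z _.
    apply: (@le_trans _ _ (Num.sqrt (pr B) * Num.sqrt (pr (cZ z)))).
      rewrite ler_wpM2l ?sqrtr_ge0// ler_wsqrtr// pr_le//.
      by move=> x [].
    have h12 : (1 - 2^-1 : R) = 2^-1 by field.
    rewrite -!powR12_sqrt ?pr_ge0// -{1}h12.
    apply: (lc_closed lc cB (ccZ z) (mC z)); first by apply/andP; split; lra.
    move=> x y Bx [_ cy] j; rewrite h12 dotpDl !dotpZl.
    have := Bx j; have := cy j; rewrite /= !ler_norml => /andP[? ?] /andP[? ?].
    apply/andP; split; lra.
  apply: pr_sum_le => // x.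
  pose w j := (dotp x (v j) - beta j / 2 - s / 2 + s * L%:R) / s.
  apply: (@le_trans _ _ (\sum_(z : idx) \prod_j (`|w j - (z j)%:R| <= 1)%R%:R)).
    apply: ler_sum => z _; rewrite indicE; case: (boolP (x \in C z)); last first.
      by move=> _; rewrite prodr_ge0.
    rewrite inE => Cx; rewrite (eq_bigr (fun=> 1)) ?prodr_const ?expr1n// => j _.
    rewrite (_ : (_ <= _)%R = true)//; apply/idP.
    rewrite -(ler_pM2l s0) -{1}(gtr0_norm s0) -normrM mulr1.
    have := Cx j; rewrite /= (_ : s * (w j - (z j)%:R) = dotp x (v j) - (beta j / 2 + lo z j / 2 + s / 2))//.
    by rewrite /w /lo; field; rewrite gt_eqF.
  rewrite -(bigA_distr_bigA (fun j i => (`|w j - (nat_of_ord i)%:R| <= 1)%R%:R)) /=.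
  rewrite -[q in 3 ^+ q]card_ord -prodr_const; apply: ler_prod => j _.
  rewrite sum_near_le3 andbT; exact: sumr_ge0.
Qed.

End collision.

Lemma integral_prod_bool_le {d} {T : measurableType d} {R : realType} (P : probability T R)
    q (F : 'I_q -> T -> R) (a : R) : (forall j, measurable_fun setT (F j)) ->
  (\int[P]_x (\prod_(j < q) (F j x <= a)%R%:R)%:E = (pr P [set x | forall j, F j x <= a])%:E)%E.
Proof.
move=> mF; have mA : measurable [set x | forall j, F j x <= a].
  by apply: (@measurable_forall_ord _ _ q (fun j => [set x | F j x <= a])) => j; exact: measurable_le_cst.
rewrite -(integral_pr_indic P mA); apply: eq_integral => x _; congr (_%:E); rewrite indicE.
case: (boolP (x \in _)) => [|]; rewrite ?inE ?notin_setE /= => h.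
  by rewrite big1// => j _; rewrite h.
have [j /negbTE hj] : exists j, ~~ (F j x <= a).
  by apply: contrapT => /forallNP h'; apply: h => j; apply/negPn/negP; exact: h'.
by rewrite (bigD1 j)//= hj mul0r.
Qed.

Section small_ball_constants.
Context {R : realType}.

(** The radius makes a random direction separate two far points except with probability 1/48 in
    [collision_bound]; six times the rate is the exponent of [chord_tail]; the cube in [sb_const]
    comes from the third power of the shell mass in [box_collision]. *)
Definition sb_radius : R := (12 * (24 * Canti))^-1.
Definition sb_rate : R := (24 * (48 * K4))^-1.
Definition sb_const : R := 48 * (8 * K4) ^+ 3.

Lemma sb_radius_gt0 : 0 < sb_radius.
Proof.
have C0 : 0 < Canti :> R by apply: lt_le_trans Canti_ge.
by rewrite invr_gt0 mulr_gt0 ?ltr0n// mulr_gt0 ?ltr0n.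
Qed.

Lemma sb_rate_gt0 : 0 < sb_rate.
Proof.
have K0 : 0 < K4 :> R by apply: lt_le_trans K4_ge1.
by rewrite invr_gt0 mulr_gt0 ?ltr0n// mulr_gt0 ?ltr0n.
Qed.

Lemma sb_const_ge1 : 1 <= sb_const.
Proof.
have h := @K4_ge1 R; rewrite /sb_const.
have : 1 <= (8 * K4 : R) ^+ 3 by rewrite exprn_ege1//; lra.
lra.
Qed.

End small_ball_constants.

Section small_ball.
Context {R : realType} {n : nat} (mu : probability 'rV[R]_n R).
Hypotheses (iso : isotropic mu) (lc : log_concave mu).
Context (P : 'M[R]_n) (hP : is_proj P) (k : nat) (trP : \tr P = k%:R) (k0 : (0 < k)%N).
Local Notation f := (pnorm2 P).
Local Notation A := (shell P k).
Local Notation rk := (Num.sqrt k%:R : R).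

Let kR0 : 0 < k%:R :> R. Proof. by rewrite ltr0n. Qed.
Let rk0 : 0 < rk. Proof. by rewrite sqrtr_gt0. Qed.
Let rk2 : rk ^+ 2 = k%:R. Proof. by rewrite sqr_sqrtr// ltW. Qed.

Lemma measurable_bilinear_proj :
  measurable_fun setT (fun p : 'rV[R]_n * 'rV[R]_n => dotp p.2 (p.1 *m P)).
Proof.
under eq_fun do rewrite -dotp_mulmx// /dotp.
apply: measurable_sum => i; apply: measurable_funM.
  under eq_fun do rewrite mulmx_proj_coord//.
  exact: (measurableT_comp (measurable_dotp (row i P)) measurable_snd).
exact: (measurableT_comp (measurable_coord0 i) measurable_fst).
Qed.

(** The test directions are sampled from [mu] itself, so that moment and anticoncentration estimates
    apply to them as well. *)
Lemma pr_direction_ge (w : 'rV[R]_n) (s : R) : 0 < s -> dotp w w <= (s / 2) ^+ 2 ->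
  3 / 4 <= pr mu [set g | `|dotp g w| <= s].
Proof.
move=> s0 ws.
have mA : measurable [set g : 'rV[R]_n | `|dotp g w| <= s].
  by apply: measurable_le_cst; apply: measurableT_comp => //; exact: measurable_dotp.
have mB : measurable [set g : 'rV[R]_n | s <= `|dotp g w|].
  by apply: measurable_ge_cst; apply: measurableT_comp => //; exact: measurable_dotp.
have h1 := pr_chebyshev iso s0 ws.
have h2 : pr mu (~` [set g | `|dotp g w| <= s]) <= pr mu [set g | s <= `|dotp g w|].
  apply: pr_le => //; first exact: measurableC.
  by move=> g /= /negP; rewrite -ltNge => /ltW.
rewrite prC// in h2.
have : (s / 2) ^+ 2 / s ^+ 2 = 1 / 4 by field; rewrite gt_eqF.
lra.
Qed.

Lemma pr_direction_le (w : 'rV[R]_n) (t : R) : 0 < t -> k%:R / 2 <= dotp w w ->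
  pr mu [set g | `|dotp g w| <= t * rk] <= 3 / 2 * Canti * t.
Proof.
move=> t0 wk.
have w0 : 0 < dotp w w by apply: lt_le_trans wk; rewrite divr_gt0.
pose l := enorm w; have l0 : 0 < l by rewrite sqrtr_gt0.
have l2 : l ^+ 2 = dotp w w by rewrite sqr_enorm.
pose u := l^-1 *: w.
have u1 : dotp u u = 1 by rewrite dotpZl dotpZr -l2; field; rewrite gt_eqF.
have kl : rk <= 3 / 2 * l.
  rewrite -ler_sqr ?nnegrE ?sqrtr_ge0 ?mulr_ge0 ?(ltW l0)// rk2 exprMn l2.
  have -> : (3 / 2) ^+ 2 = 9 / 4 :> R by field.
  lra.
have tl : 0 < t * rk / l by rewrite divr_gt0// mulr_gt0.
have := lc_anticonc iso lc 0 u1 tl.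
have -> : [set x | `|dotp x u - 0| <= t * rk / l] = [set g | `|dotp g w| <= t * rk].
  apply/seteqP; split => x; rewrite /u /= subr0 dotpZr normrM gtr0_norm ?invr_gt0//;
    by rewrite [_^-1 * _]mulrC ler_pM2r ?invr_gt0.
move/le_trans; apply.
have C0 : 0 <= Canti :> R by have := @Canti_ge R; lra.
rewrite (_ : 3 / 2 * Canti * t = Canti * (3 / 2 * t)); last by ring.
rewrite ler_wpM2l// ler_pdivrMr//.
have := ler_wpM2l (ltW t0) kl; lra.
Qed.

(* Both ends of a short chord of the shell point in nearby directions, so one
   end lies in a half-space at distance of order [sqrt k] from the origin. *)
Lemma chord_tail (y : 'rV[R]_n) : A y ->
  pr mu [set x | k%:R / 4 <= dotp x (y *m P)] <= 2 * expR (- (6 * sb_rate * rk)).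
Proof.
move=> /andP[_ yA]; have K1 := @K4_ge1 R.
have s0 : 0 < 8 * K4 * rk by rewrite !mulr_gt0//; lra.
have ys : dotp (y *m P) (y *m P) <= (8 * K4 * rk) ^+ 2 by rewrite exprMn rk2.
have t0 : 0 <= rk / (96 * K4) by rewrite divr_ge0 ?(ltW rk0)//; lra.
have h := lc_tail iso lc s0 ys t0.
have -> : - (6 * sb_rate * rk) = - (rk / (96 * K4)) / 2.
  by rewrite /sb_rate; field; rewrite gt_eqF//; lra.
apply: le_trans h; apply: pr_le.
- by apply: measurable_ge_cst; exact: measurable_dotp.
- by apply: measurable_ge_cst; apply: measurableT_comp => //; exact: measurable_dotp.
move=> x /= hx; apply: le_trans (ler_norm _); apply: le_trans hx.
rewrite (_ : 3 * _ * _ = rk ^+ 2 / 4); first by rewrite rk2.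
by field; rewrite gt_eqF//; lra.
Qed.

(** For two points of the shell, either their projected inner product is at least k / 4, which
    [chord_tail] makes unlikely, or their projected distance is at least sqrt (k / 2), and then each
    of the q independent directions fails to separate them with probability at most 1/48. *)
Lemma collision_bound q :
  (\int[mu \x mu]_p ((\1_A p.1 * \1_A p.2)%:E *
     \prod_(j < q) \int[mu]_g ((`|dotp (p.1 - p.2) (g *m P)| <= 2 * (2 * sb_radius * rk))%R%:R)%:E) <=
   (48^-1 ^+ q + 2 * expR (- (6 * sb_rate * rk)))%:E)%E.
Proof.
have cA : closed A by apply: closed_shell.
have mA : measurable A := measurable_closed_rV cA.
have r0 := @sb_radius_gt0 R; have C0 := @Canti_ge R.
pose E : set ('rV[R]_n * 'rV[R]_n) := [set p | A p.2 /\ k%:R / 4 <= dotp p.1 (p.2 *m P)].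
have mE : measurable E.
  apply: measurableI.
    by rewrite -[X in measurable X]setTI; exact: (measurable_snd _ _ mA).
  apply: measurable_ge_cst.
  under eq_fun do rewrite -dotp_mulmx// dotpC.
  exact: measurable_bilinear_proj.
pose phi (p : 'rV[R]_n * 'rV[R]_n) := pr mu [set g | `|dotp g ((p.1 - p.2) *m P)| <= 2 * (2 * sb_radius * rk)].
have phiE p : (\int[mu]_g ((`|dotp (p.1 - p.2) (g *m P)| <= 2 * (2 * sb_radius * rk))%R%:R)%:E = (phi p)%:E)%E.
  rewrite /phi -integral_bool_le; last by apply: measurableT_comp => //; exact: measurable_dotp.
  by apply: eq_integral => g _; rewrite -dotp_mulmx// dotpC.
apply: (@le_trans _ _ (\int[mu \x mu]_p (48^-1 ^+ q + \1_E p)%:E)%E).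
  have mphi : measurable_fun setT (fun p => (phi p)%:E).
    pose F (pg : ('rV[R]_n * 'rV[R]_n) * 'rV[R]_n) : \bar R :=
      ((`|dotp (pg.1.1 - pg.1.2) (pg.2 *m P)| <= 2 * (2 * sb_radius * rk))%R%:R)%:E.
    have mF : measurable_fun setT F.
      apply/measurable_EFinP; apply: measurable_bool_le; apply: measurableT_comp => //.
      under eq_fun do rewrite dotpBl.
      apply: measurable_funB.
        have := measurableT_comp measurable_bilinear_proj (measurable_fun_pair (measurable_snd) (measurableT_comp measurable_fst measurable_fst)).
        exact.
      have := measurableT_comp measurable_bilinear_proj (measurable_fun_pair (measurable_snd) (measurableT_comp measurable_snd measurable_fst)).
      exact.
    have := @measurable_fun_fubini_tonelli_F _ _ _ _ R mu F mF (fun _ => _).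
    rewrite /fubini_F /F; under eq_fun do rewrite phiE.
    by apply => x; rewrite lee_fin.
  under eq_integral => p _ do rewrite (eq_bigr (fun=> (phi p)%:E)) ?prodEFin -?EFinM//.
  apply: nng_int_le => //.
  - apply: measurable_funM; last first.
      apply: measurable_prod => j _; exact/measurable_EFinP.
    have mi : measurable_fun setT (\1_A : 'rV[R]_n -> R) by exact: measurable_indic.
    apply: measurable_funM; first exact: (measurableT_comp mi measurable_fst).
    exact: (measurableT_comp mi measurable_snd).
  - by apply: measurable_funD => //; exact: measurable_indic.
  - by move=> p; rewrite !mulr_ge0 ?indicE// prodr_ge0// => j _; exact: pr_ge0.
  move=> p; rewrite prodr_const card_ord.
  have mset : measurable [set g | `|dotp g ((p.1 - p.2) *m P)| <= 2 * (2 * sb_radius * rk)].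
    by apply: measurable_le_cst; apply: measurableT_comp => //; exact: measurable_dotp.
  have phi1 : 0 <= phi p ^+ q <= 1.
    by rewrite exprn_ge0 ?exprn_ile1 ?pr_ge0// pr_le1.
  have q48 : 0 <= (48^-1 : R) ^+ q by rewrite exprn_ge0.
  rewrite !indicE; case: (boolP (p.1 \in A)) => [|_]; last by rewrite /= mulr0n !mul0r addr_ge0.
  rewrite inE => A1; case: (boolP (p.2 \in A)) => [|_]; last by rewrite /= mulr0n mulr0 mul0r addr_ge0.
  rewrite inE => A2; rewrite /= !mulr1n !mul1r; case: (boolP (p \in E)) => [_|pE].
    by move: phi1 => /andP[_]; rewrite /= mulr1n; lra.
  rewrite addr0; apply: lerXn2r; rewrite ?nnegrE ?pr_ge0//.
  have wk : k%:R / 2 <= dotp ((p.1 - p.2) *m P) ((p.1 - p.2) *m P).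
    move: pE; rewrite notin_setE /E /= => /not_andP[//|/negP]; rewrite -ltNge => pk.
    move: A1 A2 => /andP[a1 _] /andP[a2 _].
    rewrite mulmxBl dotpBl !dotpBr (dotpC (p.2 *m P) (p.1 *m P)).
    move: pk; rewrite (_ : dotp p.1 _ = dotp (p.1 *m P) (p.2 *m P)); last first.
      by rewrite -[in LHS]hP.2 mulmxA -dotp_mulmx.
    rewrite /pnorm2 in a1 a2; lra.
  have h4 : 2 * (2 * sb_radius * rk) = (4 * sb_radius) * rk by ring.
  have := pr_direction_le (mulr_gt0 (ltr0n _ 4) r0) wk; rewrite -h4 -/(phi p).
  move/le_trans; apply; rewrite /sb_radius.
  rewrite (_ : _ * _ * _ = 48^-1)//; field; rewrite gt_eqF//; lra.
rewrite nng_intD//.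
rewrite integral_pr_cst EFinD leeD2l//.
have -> : (\int[mu \x mu]_p (\1_E p)%:E = \int[mu]_y (pr mu (ysection E y))%:E)%E.
  rewrite integral_pr_indic// prK// /=.
  rewrite (@product_measure_unique _ _ _ _ _ mu mu (mu \x^ mu)%E)//.
    by apply: eq_integral => y _ /=; rewrite prK//; exact: measurable_ysection.
  by move=> X Y mX mY; exact: product_measure2E.
apply: integral_pr_le.
  have := @measurable_fun_ysection _ _ _ _ R mu E mE.
  rewrite (_ : _ \o _ = fun y => (pr mu (ysection E y))%:E); first by move/measurable_EFinP.
  by apply/funext => y /=; rewrite prK//; exact: measurable_ysection.
move=> y; rewrite pr_ge0/=.
have [Ay|nAy] := pselect (A y); last first.
  rewrite (_ : ysection E y = set0); first by rewrite /pr measure0 mulr_ge0// expR_ge0.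
  by apply/seteqP; split => // x; rewrite /ysection /= inE => -[].
apply: le_trans (chord_tail Ay); apply: pr_le; first exact: measurable_ysection.
  by apply: measurable_ge_cst; exact: measurable_dotp.
by move=> x; rewrite /ysection /= inE => -[].
Qed.

(** A point of the ball passes each test in a random direction with probability at least 3/4, so the
    ball loses at most (3/4)^q when replaced by a box with q sides. [box_collision] costs 9^q and a
    collision of far points gains 48^-q; in total each direction gains the factor 9 (4/3) / 48 =
    1/4. *)
Lemma proj_small_ball (b : 'rV[R]_n) :
  pr mu [set x | f (x - b) <= sb_radius ^+ 2 * k%:R] <= sb_const * expR (- (sb_rate * rk)).
Proof.
have K1 := @K4_ge1 R; have r0 := @sb_radius_gt0 R; have rate0 := @sb_rate_gt0 R.
(* The chord term limits the number of directions: 12^q exp (-6y) with q <= y stays below exp (-y)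
   because 12 <= exp 4. *)
pose q := Num.Def.trunc (sb_rate * rk).
have rr0 : 0 <= sb_rate * rk by rewrite mulr_ge0 ?ltW.
have /andP[q1 q2] := truncn_itv rr0.
pose s := 2 * sb_radius * rk.
have s0 : 0 < s by rewrite !mulr_gt0.
set S := [set x | _].
have mS : measurable S by exact: measurable_pnorm2_le.
have cA : closed A by apply: closed_shell.
have mA : measurable A := measurable_closed_rV cA.
pose psi1 (gx : 'rV[R]_n * 'rV[R]_n) : R := (`|dotp (gx.2 - b) (gx.1 *m P)| <= s)%R%:R.
pose psi2 (gp : 'rV[R]_n * ('rV[R]_n * 'rV[R]_n)) : R :=
  (`|dotp (gp.2.1 - gp.2.2) (gp.1 *m P)| <= 2 * (2 * sb_radius * rk))%R%:R.
have mpsi1 : measurable_fun setT psi1.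
  apply: measurable_bool_le; apply: measurableT_comp => //.
  under eq_fun do rewrite dotpBl.
  apply: measurable_funB; first exact: measurable_bilinear_proj.
  under eq_fun do rewrite -dotp_mulmx// dotpC.
  exact: (measurableT_comp (measurable_dotp (b *m P)) measurable_fst).
have mpsi2 : measurable_fun setT psi2.
  apply: measurable_bool_le; apply: measurableT_comp => //.
  under eq_fun do rewrite dotpBl.
  apply: measurable_funB.
    exact: (measurableT_comp measurable_bilinear_proj (measurable_fun_pair measurable_fst (measurableT_comp measurable_fst measurable_snd))).
  exact: (measurableT_comp measurable_bilinear_proj (measurable_fun_pair measurable_fst (measurableT_comp measurable_snd measurable_snd))).
have lower : (((3 / 4) ^+ q * pr mu S)%:E <=
    \int[mtup mu q]_g \int[mu]_x (1 * \prod_(j < q) psi1 (tnth g j, x))%:E)%E.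
  rewrite (@mtup_pow_swap _ _ _ _ _ mu mu q (cst 1) psi1)//.
  rewrite EFinM -integral_pr_indic// -nng_intZ ?exprn_ge0//.
  have E1 x : (\int[mu]_g (psi1 (g, x))%:E = (pr mu [set g | `|dotp g ((x - b) *m P)| <= s])%:E)%E.
    rewrite -integral_bool_le; last by apply: measurableT_comp => //; exact: measurable_dotp.
    by apply: eq_integral => g _; rewrite /psi1 /= -dotp_mulmx// dotpC.
  have mE1 : measurable_fun setT (fun x : 'rV[R]_n => pr mu [set g | `|dotp g ((x - b) *m P)| <= s]).
    apply/measurable_EFinP.
    rewrite (_ : _ \o _ = fubini_G mu (fun gx => (psi1 gx)%:E)); last first.
      by apply/funext => x; rewrite /fubini_G /= E1.
    apply: measurable_fun_fubini_tonelli_G; first exact/measurable_EFinP.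
    by move=> gx; rewrite lee_fin.
  under [leRHS]eq_integral => x _ do rewrite (eq_bigr (fun=> (pr mu [set g | `|dotp g ((x - b) *m P)| <= s])%:E)) ?prodEFin -?EFinM//.
  apply: nng_int_le => //.
  - by apply: measurable_funM => //; exact: measurable_indic.
  - by apply: measurable_funM => //; exact: measurable_prod.
  move=> x; rewrite mul1r prodr_const card_ord indicE.
  case: (boolP (x \in S)) => [|_]; last by rewrite mulr0 exprn_ge0// pr_ge0.
  rewrite inE => Sx; rewrite mulr1; apply: lerXn2r; rewrite ?nnegrE ?pr_ge0//.
  apply: pr_direction_ge => //; apply: le_trans Sx _.
  by rewrite -rk2 -exprMn (_ : s / 2 = sb_radius * rk)// /s; field.
have upper : (\int[mtup mu q]_g \int[mu \x mu]_p (\1_A p.1 * \1_A p.2 * \prod_(j < q) psi2 (tnth g j, p))%:E <=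
   (48^-1 ^+ q + 2 * expR (- (6 * sb_rate * rk)))%:E)%E.
  have mi : measurable_fun setT (\1_A : 'rV[R]_n -> R) by exact: measurable_indic.
  rewrite (@mtup_pow_swap _ _ _ _ _ mu [the probability _ _ of (mu \x mu)%E] q (fun p => \1_A p.1 * \1_A p.2) psi2)//.
  - exact: collision_bound.
  - apply: measurable_funM; first exact: (measurableT_comp mi measurable_fst).
    exact: (measurableT_comp mi measurable_snd).
have mid : ((pr mu A ^+ 3)%:E * \int[mtup mu q]_g \int[mu]_x (1 * \prod_(j < q) psi1 (tnth g j, x))%:E <=
    (8 * 9 ^+ q)%:E * \int[mtup mu q]_g \int[mu \x mu]_p (\1_A p.1 * \1_A p.2 * \prod_(j < q) psi2 (tnth g j, p))%:E)%E.
  have mi : measurable_fun setT (\1_A : 'rV[R]_n -> R) by exact: measurable_indic.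
  have m1 : measurable_fun setT (fun g : q.-tuple 'rV[R]_n => \int[mu]_x (1 * \prod_(j < q) psi1 (tnth g j, x))%:E)%E.
    apply: (@measurable_fun_fubini_tonelli_F _ _ _ _ R mu (fun gx : q.-tuple 'rV[R]_n * 'rV[R]_n => (1 * \prod_(j < q) psi1 (tnth gx.1 j, gx.2))%:E)).
      apply/measurable_EFinP; apply: measurable_funM => //; apply: measurable_prod => j _.
      apply: (measurableT_comp mpsi1); apply: measurable_fun_pair => //.
      exact: (measurableT_comp (measurable_tnth j)).
    by move=> gx; rewrite lee_fin mul1r prodr_ge0.
  have m2 : measurable_fun setT (fun g : q.-tuple 'rV[R]_n => \int[mu \x mu]_p (\1_A p.1 * \1_A p.2 * \prod_(j < q) psi2 (tnth g j, p))%:E)%E.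
    apply: (@measurable_fun_fubini_tonelli_F _ _ _ _ R [the probability _ _ of (mu \x mu)%E] (fun gx : q.-tuple 'rV[R]_n * ('rV[R]_n * 'rV[R]_n) => (\1_A gx.2.1 * \1_A gx.2.2 * \prod_(j < q) psi2 (tnth gx.1 j, gx.2))%:E)).
      apply/measurable_EFinP; apply: measurable_funM.
        apply: measurable_funM; apply: (measurableT_comp mi).
          exact: (measurableT_comp measurable_fst measurable_snd).
        exact: (measurableT_comp measurable_snd measurable_snd).
      apply: measurable_prod => j _.
      apply: (measurableT_comp mpsi2); apply: measurable_fun_pair => //.
      exact: (measurableT_comp (measurable_tnth j)).
    by move=> gx; rewrite lee_fin !mulr_ge0 ?indicE// prodr_ge0.
  rewrite -ge0_integralZl//; first last.
  - by rewrite lee_fin exprn_ge0// pr_ge0.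
  - by move=> g _; apply: nng_int_ge0 => x; rewrite mul1r prodr_ge0.
  rewrite -ge0_integralZl//; first last.
  - by move=> g _; apply: nng_int_ge0 => p; rewrite !mulr_ge0 ?indicE// prodr_ge0.
  apply: ge0_le_integral => //.
  - move=> g _; apply: mule_ge0; first by rewrite lee_fin exprn_ge0// pr_ge0.
    by apply: nng_int_ge0 => x; rewrite mul1r prodr_ge0.
  - exact: measurable_funeM.
  - exact: measurable_funeM.
  move=> g _; pose v j := tnth g j *m P.
  (* Just large enough for the cells to cover the bounded values of the shell; the bound of
     [box_collision] does not depend on it. *)
  pose L := (Num.Def.trunc (\sum_(j < q) (8 * K4 * rk * enorm (tnth g j)) / (2 * s))).+1.
  have AL x : A x -> forall j, `|dotp x (v j)| < 2 * s * L%:R.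
    move=> /andP[_ xA] j; rewrite mulrC -ltr_pdivrMr ?mulr_gt0//.
    apply: le_lt_trans (truncnS_gt _).
    apply: (@le_trans _ _ (8 * K4 * rk * enorm (tnth g j) / (2 * s))); last first.
      rewrite (bigD1 j)//= lerDl sumr_ge0// => i _.
      by rewrite divr_ge0 ?mulr_ge0 ?enorm_ge0 ?(ltW s0) ?(ltW rk0)//; lra.
    rewrite ler_pM2r ?invr_gt0 ?mulr_gt0// /v -dotp_mulmx//.
    apply: (le_trans (cauchy_schwarz _ _)); rewrite ler_wpM2r ?enorm_ge0//.
    have K8 : 0 <= 8 * K4 * rk by rewrite !mulr_ge0 ?(ltW rk0)//; lra.
    by rewrite -ler_sqr ?nnegrE ?enorm_ge0// sqr_enorm exprMn rk2.
  have e1 : (\int[mu]_x (1 * \prod_(j < q) psi1 (tnth g j, x))%:E =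
      (pr mu [set x | forall j, (`|dotp x (v j) - dotp b (v j)| <= s)%R])%:E)%E.
    rewrite -integral_prod_bool_le; last first.
      by move=> j; apply: measurableT_comp => //; apply: measurable_funB => //; exact: measurable_dotp.
    apply: eq_integral => x _; rewrite mul1r; congr (_%:E); apply: eq_bigr => j _.
    by rewrite /psi1 /= dotpBl.
  rewrite e1 -EFinM mulrC.
  exact: (box_collision lc (v := v) (fun j => dotp b (v j)) cA s0 AL).
have {}mid : pr mu A ^+ 3 * ((3 / 4) ^+ q * pr mu S) <= 8 * 9 ^+ q * (48^-1 ^+ q + 2 * expR (- (6 * sb_rate * rk))).
  rewrite -lee_fin (EFinM (pr mu A ^+ 3)) (EFinM (8 * 9 ^+ q)).
  apply: le_trans (le_trans _ mid) _.
    by apply: lee_wpmul2l => //; rewrite lee_fin exprn_ge0// pr_ge0.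
  by apply: lee_wpmul2l => //; rewrite lee_fin mulr_ge0// exprn_ge0.
have al := shell_mass iso lc hP trP k0.
clear - mid al q1 q2 K1 rate0 rr0.
set a := pr mu A in mid al; set S0 := pr mu S in mid *.
set E6 := expR _ in mid; set y := sb_rate * rk in q1 q2 rr0 *.
have S00 : 0 <= S0 by exact: pr_ge0.
have K80 : 0 < 8 * K4 :> R by lra.
have a8 : (8 * K4) ^- 3 <= a ^+ 3.
  rewrite -exprVn; apply: lerXn2r => //; rewrite nnegrE ?invr_ge0 ?(ltW K80)//.
  by apply: le_trans al; rewrite invr_ge0 ltW.
have e4 : expR (- 1) >= 1 / 4 :> R.
  have h := expR_ge1Dx (- (1 / 2) : R).
  have : expR (- (1 / 2)) * expR (- (1 / 2)) = expR (- 1) :> R by rewrite -expRD; congr expR; lra.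
  nra.
have q4 : (1 / 4) ^+ q <= 4 * expR (- y).
  apply: (@le_trans _ _ (expR (- 1) ^+ q)); first by apply: lerXn2r; rewrite ?nnegrE ?expR_ge0.
  rewrite -expRM_natl; apply: (@le_trans _ _ (expR (1 - y))).
    by rewrite ler_expR; rewrite -natr1 -/q in q2; lra.
  rewrite expRD ler_pM2r ?expR_gt0// -[expR 1]invrK -expRN -[4]invrK lef_pV2 ?posrE ?expR_gt0 ?invr_gt0//; lra.
have q12 : 12 ^+ q * E6 <= expR (- y).
  have h12 : 12 <= expR 4 :> R.
    have h2 : 2 <= expR 1 :> R by have := expR_ge1Dx (1 : R); lra.
    have -> : expR 4 = (expR 1 ^+ 2) ^+ 2 :> R by rewrite -!expRM_natl; congr expR; lra.
    have h3 : 2 * 2 <= expR 1 * expR 1 :> R by apply: ler_pM.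
    have : 2 * 2 * (2 * 2) <= expR 1 * expR 1 * (expR 1 * expR 1) :> R.
      by apply: ler_pM; rewrite // mulr_ge0.
    rewrite !expr2; lra.
  apply: (@le_trans _ _ (expR 4 ^+ q * E6)).
    by rewrite ler_wpM2r ?expR_ge0//; apply: lerXn2r; rewrite ?nnegrE ?expR_ge0.
  rewrite -expRM_natl -expRD ler_expR -/q in q1 *.
  have : 6 * sb_rate * rk = 6 * y by rewrite /y; ring.
  by move=> ->; lra.
have c0 : 0 < (3 / 4 : R) ^+ q by rewrite exprn_gt0//; lra.
have h : (8 * K4) ^- 3 * S0 <= 48 * expR (- y).
  rewrite -(ler_pM2r c0).
  apply: (@le_trans _ _ (a ^+ 3 * ((3 / 4) ^+ q * S0))).
    by rewrite -mulrA [S0 * _]mulrC ler_wpM2r// mulr_ge0// ltW.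
  apply: (le_trans mid).
  have -> : 9 ^+ q = 12 ^+ q * (3 / 4) ^+ q :> R by rewrite -exprMn; congr (_ ^+ q); field.
  have e1 : 12 ^+ q * (48^-1) ^+ q = (1 / 4) ^+ q :> R by rewrite -exprMn; congr (_ ^+ q); field.
  rewrite mulrA -[X in X <= _]mulrA [_ ^+ q * (_ + _)]mulrC mulrA ler_pM2r//.
  rewrite -mulrA mulrDr e1; lra.
rewrite /sb_const -mulrA mulrCA -ler_pdivrMl ?exprn_gt0//.
Qed.

End small_ball.

(** * Determinants of independent random rows *)

Section ffun_cons.
Context {C : finType}.

Definition ffcons m (c : C) (f : {ffun 'I_m -> C}) : {ffun 'I_m.+1 -> C} :=
  [ffun i => if unlift ord0 i is Some j then f j else c].

Lemma ffcons0 m c (f : {ffun 'I_m -> C}) : ffcons c f ord0 = c.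
Proof. by rewrite ffunE unlift_none. Qed.

Lemma ffconsS m c (f : {ffun 'I_m -> C}) j : ffcons c f (lift ord0 j) = f j.
Proof. by rewrite ffunE liftK. Qed.

Lemma sum_ffcons (V : nmodType) m (F : {ffun 'I_m.+1 -> C} -> V) :
  \sum_f F f = \sum_c \sum_(f : {ffun 'I_m -> C}) F (ffcons c f).
Proof.
rewrite pair_big /= (reindex (fun p : C * {ffun 'I_m -> C} => ffcons p.1 p.2))//=.
exists (fun f => (f ord0, [ffun j => f (lift ord0 j)])) => [[c f] _|f _] /=.
  by rewrite ffcons0; congr (_, _); apply/ffunP => j; rewrite ffunE ffconsS.
apply/ffunP => i; have [j ->|->] := unliftP ord0 i; last by rewrite ffcons0.
by rewrite ffconsS ffunE.
Qed.

End ffun_cons.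

Section measurable_matrices.
Context {d : measure_display} {T : measurableType d} {R : realType}.

Lemma measurable_bool_lt (f : T -> R) (a : R) : measurable_fun setT f ->
  measurable_fun setT (fun x => (f x < a)%R%:R : R).
Proof.
move=> mf; have mA := measurable_lt_cst a mf.
rewrite (_ : (fun _ => _) = \1_[set x | f x < a]); first exact: measurable_indic.
apply/funext => x; rewrite indicE; congr (nat_of_bool _)%:R.
by apply/idP/idP; rewrite inE.
Qed.

Lemma measurable_det m (M : T -> 'M[R]_m) :
  (forall i j, measurable_fun setT (fun t => M t i j)) ->
  measurable_fun setT (fun t => \det (M t)).
Proof.
move=> mM; rewrite /determinant; apply: measurable_sum => s.
by apply: measurable_funM => //; apply: measurable_prod => i _.
Qed.

Lemma measurable_mulmx_entry m n p (A : T -> 'M[R]_(m, n)) (B : T -> 'M[R]_(n, p)) :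
  (forall i j, measurable_fun setT (fun t => A t i j)) ->
  (forall i j, measurable_fun setT (fun t => B t i j)) ->
  forall i j, measurable_fun setT (fun t => (A t *m B t) i j).
Proof.
move=> mA mB i j; under eq_fun do rewrite mxE.
by apply: measurable_sum => k; exact: measurable_funM.
Qed.

Lemma measurable_gram m n (P : 'M[R]_n) (Z : T -> 'M[R]_(m, n)) :
  (forall i j, measurable_fun setT (fun t => Z t i j)) ->
  measurable_fun setT (fun t => gram P (Z t)).
Proof.
move=> mZ; apply: measurable_det => i j.
apply: (@measurable_mulmx_entry m n m (fun t => Z t *m P) (fun t => (Z t)^T)).
  exact: (@measurable_mulmx_entry m n n Z (fun=> P)).
by move=> k l; under eq_fun do rewrite mxE; exact: mZ.
Qed.

Lemma measurable_dotp2 n (u v : T -> 'rV[R]_n) :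
  (forall j, measurable_fun setT (fun t => u t 0 j)) ->
  (forall j, measurable_fun setT (fun t => v t 0 j)) ->
  measurable_fun setT (fun t => dotp (u t) (v t)).
Proof. by move=> mu mv; apply: measurable_sum => j; exact: measurable_funM. Qed.

Lemma measurable_pnorm2_comp n (P : 'M[R]_n) (z : T -> 'rV[R]_n) :
  (forall j, measurable_fun setT (fun t => z t 0 j)) ->
  measurable_fun setT (fun t => pnorm2 P (z t)).
Proof.
move=> mz; have mzP j : measurable_fun setT (fun t => (z t *m P) 0 j).
  apply: (@measurable_mulmx_entry 1 n n z (fun=> P)) => // i j'.
  by rewrite (ord1 i); exact: mz.
exact: measurable_dotp2.
Qed.

End measurable_matrices.

Lemma tnth_cons0 {T : Type} m x (t : m.-tuple T) : tnth [tuple of x :: t] ord0 = x.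
Proof. by rewrite tnth0. Qed.

Lemma tnth_consS {T : Type} m x (t : m.-tuple T) j : tnth [tuple of x :: t] (lift ord0 j) = tnth t j.
Proof. by rewrite tnthS. Qed.

Section chain.
Context {d : measure_display} {T : measurableType d} {R : realType} (lam : probability T R).
Context (n : nat) (C : finType) (zf : nat -> T -> C -> 'rV[R]_n) (pi : nat -> T -> C -> R).
Context (Q : nat -> T -> R) (s : R) (E : nat -> R).
Hypotheses (mz : forall k c j, measurable_fun setT (fun t => zf k t c 0 j))
  (mpi : forall k c, measurable_fun setT (fun t => pi k t c))
  (mQ : forall k, measurable_fun setT (Q k))
  (pi0 : forall k t c, 0 <= pi k t c) (pi1 : forall k t, \sum_c pi k t c = 1)
  (Q0 : forall k t, 0 < Q k t) (s0 : 0 < s) (E0 : forall k, 0 <= E k).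
Hypothesis zf_null : forall k P, (0 < k)%N -> is_proj P -> \tr P = k%:R ->
  (\int[lam]_t (\sum_c pi k t c * (pnorm2 P (zf k t c) <= 0)%R%:R)%:E = 0)%E.
Hypothesis zf_moment : forall k P, (0 < k)%N -> is_proj P -> \tr P = k%:R ->
  (\int[lam]_t (\sum_c pi k t c * (Q k t * pnorm2 P (zf k t c)) `^ (- s))%:E <= (E k)%:E)%E.

Definition chain_mx m (t : m.-tuple T) (f : {ffun 'I_m -> C}) : 'M[R]_(m, n) :=
  \matrix_(i, j) zf (m - i) (tnth t i) (f i) 0 j.

Definition chain_wt m (t : m.-tuple T) (f : {ffun 'I_m -> C}) : R :=
  \prod_(i < m) pi (m - i) (tnth t i) (f i).

Definition chain_Q m (t : m.-tuple T) : R := \prod_(i < m) Q (m - i) (tnth t i).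

(* Averaged over the choice of one row [zf k t c] per slot with weights [pi k t c], the indicator
   that the determinant is small. The rows are indexed from the last one: slot [i] of [m] has
   label [m - i], the rank left for it to act on. *)
Definition chain_bad m (P : 'M[R]_n) (v : R) (t : m.-tuple T) : R :=
  \sum_f chain_wt t f * (chain_Q t * gram P (chain_mx t f) < v)%R%:R.

Lemma chain_wt_ge0 m (t : m.-tuple T) f : 0 <= chain_wt t f.
Proof. exact: prodr_ge0. Qed.

Lemma chain_wt_sum m (t : m.-tuple T) : \sum_f chain_wt t f = 1.
Proof.
rewrite -(bigA_distr_bigA (fun (i : 'I_m) c => pi (m - i) (tnth t i) c)).
by rewrite big1// => i _; exact: pi1.
Qed.

Lemma chain_Q_gt0 m (t : m.-tuple T) : 0 < chain_Q t.
Proof. exact: prodr_gt0. Qed.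

Lemma measurable_chain_wt m f : measurable_fun setT (fun t : m.-tuple T => chain_wt t f).
Proof.
apply: measurable_prod => i _.
exact: (measurableT_comp (mpi _ _) (measurable_tnth i)).
Qed.

Lemma measurable_chain_Q m : measurable_fun setT (fun t : m.-tuple T => chain_Q t).
Proof.
apply: measurable_prod => i _.
exact: (measurableT_comp (mQ _) (measurable_tnth i)).
Qed.

Lemma measurable_chain_mx m f i j : measurable_fun setT (fun t : m.-tuple T => chain_mx t f i j).
Proof.
under eq_fun do rewrite mxE.
exact: (measurableT_comp (mz _ _ _) (measurable_tnth i)).
Qed.

Lemma chain_bad01 m P v (t : m.-tuple T) : 0 <= chain_bad P v t <= 1.
Proof.
apply/andP; split; first by apply: sumr_ge0 => f _; rewrite mulr_ge0// chain_wt_ge0.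
rewrite -[leRHS](chain_wt_sum t); apply: ler_sum => f _.
by rewrite ler_piMr ?chain_wt_ge0// lern1 leq_b1.
Qed.

Lemma measurable_chain_bad m P v : measurable_fun setT (fun t : m.-tuple T => chain_bad P v t).
Proof.
apply: measurable_sum => f; apply: measurable_funM; first exact: measurable_chain_wt.
apply: measurable_bool_lt; apply: measurable_funM; first exact: measurable_chain_Q.
by apply: measurable_gram => i j; exact: measurable_chain_mx.
Qed.

(** Taking out the first row cuts the projection and divides the threshold by Q |Pz|^2. A row with
    Pz = 0 is counted as bad outright. *)
Lemma chain_bad_cons m (P : 'M[R]_n) v x (t : m.-tuple T) :
  is_proj P -> 0 < v ->
  chain_bad P v [tuple of x :: t] <=
  \sum_c pi m.+1 x c *
    (if pnorm2 P (zf m.+1 x c) <= 0 then 1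
     else chain_bad (proj_cut P (zf m.+1 x c)) (v / (Q m.+1 x * pnorm2 P (zf m.+1 x c))) t).
Proof.
move=> hP v0; rewrite {1}/chain_bad sum_ffcons; apply: ler_sum => c _.
have wtE f : chain_wt [tuple of x :: t] (ffcons c f) = pi m.+1 x c * chain_wt t f.
  rewrite /chain_wt big_ord_recl subn0 tnth_cons0 ffcons0; congr (_ * _).
  by apply: eq_bigr => i _; rewrite tnth_consS ffconsS.
under eq_bigr do rewrite wtE -mulrA.
rewrite -mulr_sumr ler_wpM2l//.
case: ifPn => [_|].
  rewrite -[leRHS](chain_wt_sum t); apply: ler_sum => f _.
  by rewrite ler_piMr ?chain_wt_ge0// lern1 leq_b1.
rewrite -ltNge => z0.
have zP0 : zf m.+1 x c *m P != 0 by rewrite -dotp_gt0.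
have y0 : 0 < Q m.+1 x * pnorm2 P (zf m.+1 x c) by rewrite mulr_gt0.
apply: ler_sum => f _; rewrite ler_wpM2l ?chain_wt_ge0//.
have -> : chain_mx [tuple of x :: t] (ffcons c f) = col_mx (zf m.+1 x c) (chain_mx t f) :> 'M[R]_(1 + m, n).
  apply/matrixP => i j; rewrite mxE; have [i' ->|->] := unliftP ord0 i.
    rewrite tnth_consS ffconsS [in RHS](_ : lift ord0 i' = rshift 1 i'); last exact: val_inj.
    by rewrite col_mxEd mxE.
  rewrite tnth_cons0 ffcons0 [in RHS](_ : ord0 = lshift m (0 : 'I_1)); last exact: val_inj.
  by rewrite col_mxEu subn0.
rewrite (gram_cons _ hP zP0) -/(pnorm2 P _).
have -> : chain_Q [tuple of x :: t] = Q m.+1 x * chain_Q t.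
  rewrite /chain_Q big_ord_recl subn0 tnth_cons0; congr (_ * _).
  by apply: eq_bigr => i _; rewrite tnth_consS.
rewrite ltr_pdivlMr// (_ : _ * (_ * _) = chain_Q t * gram (proj_cut P (zf m.+1 x c)) (chain_mx t f) *
  (Q m.+1 x * pnorm2 P (zf m.+1 x c)))//; ring.
Qed.

(** Conditionally on the first slot, the induction hypothesis at the threshold v / (Q |Pz|^2)
    produces the factor (Q |Pz|^2)^(-s), whose mean is [zf_moment]. Rows with Pz = 0 need [zf_null],
    as [powR] takes the value 0 there. With no rows left the determinant is 1, below v only if v >
    1. *)
Theorem chain_bound m (P : 'M[R]_n) (v : R) : is_proj P -> \tr P = m%:R -> 0 < v ->
  (\int[mtup lam m]_t (chain_bad P v t)%:E <= (v `^ s * \prod_(k < m) E k.+1)%:E)%E.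
Proof.
elim: m P v => [|m IH] P v hP trP v0.
  rewrite big_ord0 mulr1; apply: integral_pr_le; first exact: measurable_chain_bad.
  move=> t; have /andP[b0 b1] := chain_bad01 P v t; rewrite b0/=.
  have [v1|v1] := leP v 1; last first.
    apply: (le_trans b1); rewrite -[X in X <= _](@powRr0 _ v).
    by rewrite ler_powR ?ltW.
  rewrite /chain_bad big1 ?powR_ge0// => f _.
  by rewrite /chain_Q big_ord0 gram0 mul1r ltNge v1 mulr0.
have mF : measurable_fun setT (fun xt : T * m.-tuple T => (chain_bad P v (cons_tup xt))%:E).
  apply/measurable_EFinP.
  exact: (measurableT_comp (measurable_chain_bad _ _) (@measurable_cons_tup _ _ m)).
rewrite ge0_integral_mtupS; last first.
- by move=> t; rewrite lee_fin; have /andP[] := chain_bad01 P v t.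
- by apply/measurable_EFinP; exact: measurable_chain_bad.
pose D := \prod_(k < m) E k.+1.
have D0 : 0 <= D by exact: prodr_ge0.
pose g1 x := \sum_c pi m.+1 x c * (pnorm2 P (zf m.+1 x c) <= 0)%R%:R.
pose g2 x := \sum_c pi m.+1 x c * (Q m.+1 x * pnorm2 P (zf m.+1 x c)) `^ (- s).
have mpn c : measurable_fun setT (fun x => pnorm2 P (zf m.+1 x c)).
  by apply: measurable_pnorm2_comp.
have mg1 : measurable_fun setT g1.
  by apply: measurable_sum => c; apply: measurable_funM => //; exact: measurable_bool_le.
have mg2 : measurable_fun setT g2.
  apply: measurable_sum => c; apply: measurable_funM => //.
  by apply: (measurableT_comp (measurable_powR _)); exact: measurable_funM.
have g10 x : 0 <= g1 x by apply: sumr_ge0 => c _; rewrite mulr_ge0.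
have g20 x : 0 <= g2 x by apply: sumr_ge0 => c _; rewrite mulr_ge0// powR_ge0.
apply: (@le_trans _ _ (\int[lam]_x (g1 x + v `^ s * D * g2 x)%:E)%E).
  apply: ge0_le_integral => //.
  - by move=> x _; apply: nng_int_ge0 => t; have /andP[] := chain_bad01 P v (cons_tup (x, t)).
  - apply: (@measurable_fun_fubini_tonelli_F _ _ _ _ R (mtup lam m) _ mF).
    by move=> xt; rewrite lee_fin; have /andP[] := chain_bad01 P v (cons_tup xt).
  - apply/measurable_EFinP; apply: measurable_funD => //; exact: measurable_funM.
  move=> x _.
  pose bb c (t : m.-tuple T) := if pnorm2 P (zf m.+1 x c) <= 0 then 1
     else chain_bad (proj_cut P (zf m.+1 x c)) (v / (Q m.+1 x * pnorm2 P (zf m.+1 x c))) t.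
  have mbb c : measurable_fun setT (bb c).
    by rewrite /bb; have [_|_] := leP (pnorm2 P (zf m.+1 x c)) 0; [exact: measurable_cst|exact: measurable_chain_bad].
  have bb0 c t : 0 <= bb c t.
    by rewrite /bb; case: ifP => // _; have /andP[] := chain_bad01 (proj_cut P (zf m.+1 x c)) (v / (Q m.+1 x * pnorm2 P (zf m.+1 x c))) t.
  apply: (@le_trans _ _ (\int[mtup lam m]_t (\sum_c pi m.+1 x c * bb c t)%:E)%E).
    apply: nng_int_le => //.
    - apply/measurable_EFinP; apply: measurableT_comp mF _; exact: measurable_pair1.
    - by apply: measurable_sum => c; exact: measurable_funM.
    - by move=> t; have /andP[] := chain_bad01 P v (cons_tup (x, t)).
    - by move=> t; exact: chain_bad_cons.
  rewrite nng_int_sum//; first last.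
  - by move=> c t; rewrite mulr_ge0.
  - by move=> c; exact: measurable_funM.
  rewrite /g1 /g2 mulr_sumr -big_split /= -sumEFin; apply: lee_sum => c _.
  rewrite nng_intZ// mulrCA -mulrDr EFinM; apply: lee_wpmul2l; first by rewrite lee_fin.
  rewrite /bb; have [z0|z0] := leP (pnorm2 P (zf m.+1 x c)) 0.
    by rewrite integral_pr_cst lee_fin mulr1n lerDl mulr_ge0 ?powR_ge0// mulr_ge0// powR_ge0.
  rewrite mulr0n add0r.
  have zP0 : zf m.+1 x c *m P != 0 by rewrite -dotp_gt0.
  have y0 : 0 < Q m.+1 x * pnorm2 P (zf m.+1 x c) by rewrite mulr_gt0.
  have [hP' trP'] := proj_cutP hP zP0.
  have trm : \tr (proj_cut P (zf m.+1 x c)) = m%:R by rewrite trP' trP -natr1 addrK.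
  apply: le_trans (IH _ _ hP' trm _) _; first by rewrite divr_gt0.
  rewrite lee_fin -/D powRM ?invr_ge0 ?(ltW v0) ?(ltW y0)//.
  by rewrite -powR_inv1 ?(ltW y0)// -powRrM mulN1r mulrAC.
rewrite nng_intD//; first last.
- by move=> x; rewrite mulr_ge0// mulr_ge0// powR_ge0.
- exact: measurable_funM.
rewrite zf_null// add0e nng_intZ ?mulr_ge0 ?powR_ge0// big_ord_recr /= -/D mulrA (EFinM _ (E m.+1)).
by apply: lee_wpmul2l; [rewrite lee_fin mulr_ge0// powR_ge0|exact: zf_moment].
Qed.

Definition chain_sum (t : n.-tuple T) : R :=
  \sum_(f : {ffun 'I_n -> C})
    (\prod_(i < n) (Q (n - i) (tnth t i) * pi (n - i) (tnth t i) (f i))) * \det (chain_mx t f) ^+ 2.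

Lemma measurable_chain_sum : measurable_fun setT chain_sum.
Proof.
apply: measurable_sum => f; apply: measurable_funM; last first.
  by apply: measurable_funX; apply: measurable_det => i j; exact: measurable_chain_mx.
apply: measurable_prod => i _; apply: measurable_funM.
  exact: (measurableT_comp (mQ _) (measurable_tnth i)).
exact: (measurableT_comp (mpi _ _) (measurable_tnth i)).
Qed.

(** If the sum is below v / 2, choices of total weight at least 1/2 have a determinant below v;
    Markov then costs the factor 2. *)
Corollary chain_sum_small (v : R) : 0 < v ->
  pr (mtup lam n) [set t | chain_sum t < v / 2] <= 2 * (v `^ s * \prod_(k < n) E k.+1).
Proof.
move=> v0.
have mX := measurable_chain_sum.
have mA := measurable_lt_cst (v / 2) mX.
rewrite -lee_fin -(integral_pr_indic (mtup lam n) mA).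
apply: (@le_trans _ _ (\int[mtup lam n]_t (2 * chain_bad 1%:M v t)%:E)%E).
  apply: nng_int_le => //.
  - by apply: measurable_funM => //; exact: measurable_chain_bad.
  move=> t; have /andP[b0 b1] := chain_bad01 1%:M v t.
  rewrite indicE; case: (boolP (t \in _)) => [|_]; last by rewrite mulr_ge0.
  rewrite inE /= => hX; rewrite mulr1n leNgt; apply/negP => hb.
  move: hX; rewrite ltNge => /negP; apply.
  have : \sum_f chain_wt t f * (1 - (chain_Q t * gram 1%:M (chain_mx t f) < v)%R%:R) * v <= chain_sum t.
    apply: ler_sum => f _; rewrite big_split /= -/(chain_Q t) -/(chain_wt t f).
    have W0 := chain_wt_ge0 t f; have q0 := ltW (chain_Q_gt0 t).
    rewrite gram1; have [h|h] := ltP (chain_Q t * _) v.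
      rewrite mulr1n subrr mulr0 mul0r; apply: mulr_ge0; first exact: mulr_ge0.
      exact: sqr_ge0.
    by rewrite mulr0n subr0 mulr1 [chain_Q t * chain_wt t f]mulrC -mulrA; exact: ler_wpM2l.
  move=> hh; apply: le_trans hh; rewrite -mulr_suml.
  have -> : \sum_f chain_wt t f * (1 - (chain_Q t * gram 1%:M (chain_mx t f) < v)%R%:R) =
      1 - chain_bad 1%:M v t.
    rewrite -[X in X - _](chain_wt_sum t) -sumrB; apply: eq_bigr => f _.
    by rewrite mulrBr mulr1.
  by rewrite (mulrC v) ler_pM2r//; lra.
rewrite nng_intZ//; [|exact: measurable_chain_bad|by move=> t; have /andP[] := chain_bad01 1%:M v t].
rewrite EFinM; apply: lee_wpmul2l => //; apply: chain_bound => //; first exact: is_proj1.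
by rewrite mxtrace1.
Qed.

End chain.

(** * Packing by approximate images of cubes *)

Section softmax.
Context {R : realType} {E : finType} (beta : E -> R).
Hypotheses (beta0 : forall e, 0 <= beta e) (betaS : 0 < \sum_e beta e).
Implicit Types (a g sg : E -> R).

Definition softmax_mass a : R := \sum_e beta e * expR (a e).
Definition softmax a e : R := beta e * expR (a e) / softmax_mass a.
Definition softavg a sg : R := \sum_e softmax a e * sg e.

Lemma softmax_mass_gt0 a : 0 < softmax_mass a.
Proof.
have h e : 0 <= beta e * expR (a e) by rewrite mulr_ge0// expR_ge0.
rewrite lt_def sumr_ge0// andbT; apply/eqP => /psumr_eq0P h0.
move: betaS; rewrite big1 ?ltxx// => e _.
by have /eqP := h0 (fun e _ => h e) e isT; rewrite mulf_eq0 (gt_eqF (expR_gt0 _)) orbF => /eqP.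
Qed.

Lemma softmax_ge0 a e : 0 <= softmax a e.
Proof. by rewrite divr_ge0 ?(ltW (softmax_mass_gt0 a))// mulr_ge0// expR_ge0. Qed.

Lemma softmax_sum a : \sum_e softmax a e = 1.
Proof. by rewrite -mulr_suml divff// gt_eqF// softmax_mass_gt0. Qed.

Lemma softavg_cst a c : softavg a (fun=> c) = c.
Proof. by rewrite /softavg -mulr_suml softmax_sum mul1r. Qed.

Lemma softavgD a sg sg' : softavg a (fun e => sg e + sg' e) = softavg a sg + softavg a sg'.
Proof. by rewrite /softavg -big_split; apply: eq_bigr => e _; rewrite mulrDr. Qed.

Lemma softavgZ a c sg : softavg a (fun e => c * sg e) = c * softavg a sg.
Proof. by rewrite /softavg mulr_sumr; apply: eq_bigr => e _; rewrite mulrCA. Qed.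

Lemma softavg_ext a sg sg' : sg =1 sg' -> softavg a sg = softavg a sg'.
Proof. by move=> h; apply: eq_bigr => e _; rewrite h. Qed.

Lemma softavg_norm_le a sg c : (forall e, `|sg e| <= c) -> `|softavg a sg| <= c.
Proof.
move=> h; apply: (le_trans (ler_norm_sum _ _ _)).
rewrite -(softavg_cst a c); apply: ler_sum => e _.
by rewrite normrM (ger0_norm (softmax_ge0 _ _)) ler_wpM2l// softmax_ge0.
Qed.

(** Adding [g] to the exponent is the change of density by exp g. *)
Lemma softavg_shift a g sg :
  softavg (fun e => a e + g e) sg = softavg a (fun e => sg e * expR (g e)) / softavg a (fun e => expR (g e)).
Proof.
have W0 := gt_eqF (softmax_mass_gt0 a).
have e1 : softmax_mass (fun e => a e + g e) = softmax_mass a * softavg a (fun e => expR (g e)).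
  rewrite /softavg mulr_sumr; apply: eq_bigr => e _; rewrite expRD /softmax.
  by field; rewrite W0.
have W1 := softmax_mass_gt0 (fun e => a e + g e).
have A1 : softavg a (fun e => expR (g e)) != 0.
  by apply: contraTneq W1; rewrite e1 => ->; rewrite mulr0 ltxx.
rewrite [LHS]/softavg mulr_suml; apply: eq_bigr => e _.
by rewrite /softmax e1 expRD; field; rewrite W0 A1.
Qed.

Lemma softavg_expR_gt0 a g : 0 < softavg a (fun e => expR (g e)).
Proof.
have W1 := softmax_mass_gt0 (fun e => a e + g e).
rewrite lt_def sumr_ge0 ?andbT; last by move=> e _; rewrite mulr_ge0 ?softmax_ge0// expR_ge0.
apply: contraTneq W1 => h; rewrite -leNgt (_ : softmax_mass _ = softmax_mass a * softavg a (fun e => expR (g e))).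
  by rewrite h mulr0.
rewrite /softavg mulr_sumr; apply: eq_bigr => e _; rewrite expRD /softmax.
by field; rewrite gt_eqF// softmax_mass_gt0.
Qed.

Definition softcov a sg sg' := softavg a (fun e => sg e * sg' e) - softavg a sg * softavg a sg'.

Lemma covariance_pairs (p sg sg' : E -> R) : \sum_e p e = 1 ->
  \sum_e p e * (sg e * sg' e) - (\sum_e p e * sg e) * (\sum_e p e * sg' e) =
  \sum_e \sum_f p e * p f / 2 * ((sg e - sg f) * (sg' e - sg' f)).
Proof.
move=> p1; set S := \sum_e p e * sg e; set S' := \sum_e p e * sg' e.
set SS := \sum_e p e * (sg e * sg' e).
have -> : \sum_e \sum_f p e * p f / 2 * ((sg e - sg f) * (sg' e - sg' f)) =
    \sum_e (p e * (sg e * sg' e) / 2 + p e * (SS / 2) - p e * sg e * (S' / 2) - p e * sg' e * (S / 2)).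
  apply: eq_bigr => e _.
  transitivity (\sum_f (p e * (sg e * sg' e) / 2 * p f + p e / 2 * (p f * (sg f * sg' f))
      - p e * sg e / 2 * (p f * sg' f) - p e * sg' e / 2 * (p f * sg f))).
    by apply: eq_bigr => f _; ring.
  by rewrite !sumrB !big_split /= -!mulr_sumr p1 -/S -/S' -/SS; field.
by rewrite !sumrB big_split /= -!mulr_suml p1 -/S -/S' -/SS; field.
Qed.

Lemma softcovE a sg sg' :
  softcov a sg sg' = \sum_e \sum_f softmax a e * softmax a f / 2 * ((sg e - sg f) * (sg' e - sg' f)).
Proof. by rewrite -covariance_pairs// softmax_sum. Qed.

(** After the change of density the difference is a covariance of g and exp g, nonnegative by
    Chebyshev's association inequality: both are increasing functions of the same quantity. *)
Lemma softavg_monotone a g : softavg a g <= softavg (fun e => a e + g e) g.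
Proof.
rewrite softavg_shift ler_pdivlMr ?softavg_expR_gt0// -subr_ge0.
rewrite -/(softcov a g (fun e => expR (g e))) softcovE.
apply: sumr_ge0 => e _; apply: sumr_ge0 => f _.
apply: mulr_ge0; first by rewrite divr_ge0// mulr_ge0// softmax_ge0.
have [h|h] := leP (g f) (g e).
  by rewrite mulr_ge0// subr_ge0// ler_expR.
by rewrite -mulrNN !opprB mulr_ge0// subr_ge0 ?ler_expR ltW.
Qed.

Lemma expR_taylor2 (x : R) : `|x| <= 1 / 4 -> 0 <= expR x - 1 - x <= 2 * x ^+ 2.
Proof.
rewrite ler_norml => /andP[x1 x2]; have h1 := expR_ge1Dx x.
have h2 := expR_ge1Dx (- x); rewrite expRN in h2.
have e0 := expR_gt0 x.
have h3 : expR x * (1 - x) <= 1.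
  have : expR x * (1 - x) <= expR x * (expR x)^-1 by rewrite ler_pM2l.
  by rewrite divff ?gt_eqF.
apply/andP; split; first lra.
have : expR x <= 1 + x + 2 * x ^+ 2.
  have h4 : expR x * (1 - x) <= (1 + x + 2 * x ^+ 2) * (1 - x) by nra.
  by move: h4; rewrite ler_pM2r//; lra.
lra.
Qed.

(** [softavg_shift] writes the tilted average as a quotient; numerator and denominator are expanded
    to first order, the denominator staying above 1/2 since c <= 1/4. *)
Lemma softavg_taylor a g sg (c S : R) : c <= 1 / 4 ->
  (forall e, `|g e| <= c) -> (forall e, `|sg e| <= S) -> 0 <= S ->
  `|softavg (fun e => a e + g e) sg - softavg a sg - softcov a sg g| <= 16 * S * c ^+ 2.
Proof.
move=> c4 gc sgS S0.
have [|e0] := pselect (exists e : E, True); last first.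
  by exfalso; move: betaS; rewrite big1 ?ltxx// => e _; exfalso; apply: e0; exists e.
move=> [e0 _]; have c0 : 0 <= c by apply: le_trans (gc e0).
pose r e := expR (g e) - 1 - g e.
have rc e : `|r e| <= 2 * c ^+ 2.
  have /expR_taylor2/andP[r1 r2] := le_trans (gc e) c4.
  rewrite ger0_norm//; apply: (le_trans r2); rewrite ler_pM2l//.
  rewrite -(real_normK (num_real (g e))) ler_sqr ?nnegrE//; exact: gc.
have Eg : softavg a (fun e => expR (g e)) = 1 + softavg a g + softavg a r.
  rewrite -(softavg_cst a 1) -!softavgD; apply: softavg_ext => e; rewrite /r; ring.
have Esg : softavg a (fun e => sg e * expR (g e)) =
    softavg a sg + softavg a (fun e => sg e * g e) + softavg a (fun e => sg e * r e).
  rewrite -!softavgD; apply: softavg_ext => e; rewrite /r; ring.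
rewrite softavg_shift Eg Esg /softcov.
have b1 := softavg_norm_le a gc; have b2 := softavg_norm_le a rc; have b3 := softavg_norm_le a sgS.
have b4 : `|softavg a (fun e => sg e * g e)| <= S * c.
  by apply: softavg_norm_le => e; rewrite normrM ler_pM.
have b5 : `|softavg a (fun e => sg e * r e)| <= S * (2 * c ^+ 2).
  by apply: softavg_norm_le => e; rewrite normrM ler_pM.
set m := softavg a g in b1 *; set q := softavg a r in b2 *; set t := softavg a sg in b3 *.
set u := softavg a _ in b4 *; set w := softavg a _ in b5 *.
have d2 : 1 / 2 <= 1 + m + q.
  have cc : c ^+ 2 <= 1 / 16 by nra.
  by move: b1 b2; rewrite !ler_norml => /andP[? _] /andP[? _]; lra.
have dn0 : 1 + m + q != 0 by rewrite gt_eqF//; lra.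
have -> : (t + u + w) / (1 + m + q) - t - (u - t * m) =
   (w - t * q - (m + q) * (u - t * m)) / (1 + m + q) by field.
rewrite normrM normfV ler_pdivrMr ?normr_gt0// (ger0_norm (le_trans _ d2)); last by lra.
apply: (@le_trans _ _ (8 * S * c ^+ 2)); last first.
  have z0 : 0 <= S * c ^+ 2 by rewrite mulr_ge0// sqr_ge0.
  have := ler_wpM2l z0 d2; lra.
have b6 : `|t * q| <= S * (2 * c ^+ 2) by rewrite normrM ler_pM.
have b7 : `|t * m| <= S * c by rewrite normrM ler_pM.
have b8 : `|m + q| <= 2 * c by apply: (le_trans (ler_normD _ _)); nra.
have b9 : `|u - t * m| <= 2 * (S * c) by apply: (le_trans (ler_normB _ _)); lra.
have b10 : `|(m + q) * (u - t * m)| <= 2 * c * (2 * (S * c)) by rewrite normrM ler_pM.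
apply: (le_trans (ler_normB _ _)); apply: (@le_trans _ _ (2 * (S * (2 * c ^+ 2)) + 2 * c * (2 * (S * c)))).
  apply: lerD => //; apply: (le_trans (ler_normB _ _)); lra.
by rewrite le_eqVlt; apply/orP; left; apply/eqP; ring.
Qed.

End softmax.

Section neighbourhoods.
Context {R : realType} {n : nat}.
Implicit Types K : set 'rV[R]_n.

Definition box_rV (r : R) : set 'rV[R]_n := [set x | forall i, `|x 0 i| <= r].

Lemma closed_box r : closed (box_rV r).
Proof.
apply: (@closed_forall_ord _ n (fun i => [set x : 'rV[R]_n | `|x 0 i| <= r])) => i.
apply: (@preimage_closed _ _ (fun x : 'rV[R]_n => `|x 0 i|) [set y | y <= r]); last exact: closed_le.
move=> x _; apply: (@continuous_comp _ _ _ (fun x : 'rV[R]_n => x 0 i) (fun y => `|y|)).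
  exact: coord_continuous.
exact: norm_continuous.
Qed.

Lemma compact_box r : compact (box_rV r).
Proof.
have -> : box_rV r = box_rV r `&` cube_rV (Num.Def.trunc `|r|).+1.
  apply/seteqP; split => [x xr|x []//]; split=> // i.
  apply: (le_trans (xr i)); apply: (le_trans (ler_norm _)); rewrite ltW//; exact: truncnS_gt.
by apply: compact_closed_cube; exact: closed_box.
Qed.

Lemma lebesgue_box (r : R) : 0 <= r -> lebesgue_rV n (box_rV r) = ((2 * r) ^+ n)%:E.
Proof.
move=> r0.
transitivity (lebesgue_rV n [set x : 'rV[R]_n | forall i, [set` `[- r, r]] (x 0 i)]).
  congr (lebesgue_rV _ _); apply/seteqP; split => x /= h i; have := h i;
    by rewrite /= in_itv /= ler_norml.
rewrite (lebesgue_rV_prod (A := fun _ : 'I_n => [set` `[- r, r]] : set R)); last first.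
  by move=> i; exact: measurable_itv.
under eq_bigr do rewrite lebesgue_measure_itv /=.
rewrite (eq_bigr (fun=> (2 * r)%:E)); last first.
  move=> i _; rewrite lte_fin; have [h|h] := ltP; first by rewrite -EFinD; congr (_%:E); ring.
  by congr (_%:E); lra.
by rewrite prodEFin prodr_const card_ord.
Qed.

(** The coefficients 1 give it the form of [compact_minkowski]. *)
Definition thicken K (r : R) : set 'rV[R]_n := [set 1 *: x + 1 *: y | x in K & y in box_rV r].

Lemma compact_thicken K r : compact K -> compact (thicken K r).
Proof. by move=> cK; apply: compact_minkowski => //; exact: compact_box. Qed.

Lemma thickenP K r x y : K x -> (forall i, `|(y - x) 0 i| <= r) -> thicken K r y.
Proof. by move=> Kx h; exists x => //; exists (y - x) => //; rewrite !scale1r addrC subrK. Qed.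

Lemma compact_sub_box K : compact K -> exists2 r, 0 < r & K `<=` box_rV r.
Proof.
move=> cK; have := compact_bounded cK => -[M [_ hM]].
exists (`|M| + 1) => [|x Kx i]; first by rewrite ltr_wpDl.
have h : `|x| <= `|M| + 1.
  by apply: (hM (`|M| + 1)) => //; rewrite (le_lt_trans (ler_norm M))// ltrDl.
apply: le_trans h; rewrite [leRHS]mx_normrE.
by apply: (le_bigmax _ (fun ij : 'I_1 * 'I_n => `|x ij.1 ij.2|) (0, i)).
Qed.

Lemma lebesgue_compact_lty K : compact K -> (lebesgue_rV n K < +oo)%E.
Proof.
move=> cK; have [r r0 Kr] := compact_sub_box cK.
apply: (@le_lt_trans _ _ (lebesgue_rV n (box_rV r))).
  apply: le_measure => //; rewrite inE; first exact: measurable_compact_rV.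
  by apply: measurable_compact_rV; exact: compact_box.
by rewrite lebesgue_box ?(ltW r0)// ltry.
Qed.

(** Continuity from above along the decreasing thickenings, whose volumes are finite. Tiles only
    approximate images that lie in [K], so volume bounds are first obtained for its thickenings. *)
Lemma lebesgue_thicken_inf K (V : \bar R) : compact K ->
  (forall j : nat, V <= lebesgue_rV n (thicken K j.+1%:R^-1))%E -> (V <= lebesgue_rV n K)%E.
Proof.
move=> cK hV; have cl : closed K by apply: compact_closed.
pose F j := thicken K j.+1%:R^-1.
have mF j : measurable (F j) by apply: measurable_compact_rV; exact: compact_thicken.
have FE : \bigcap_j F j = K.
  apply/seteqP; split => [y Fy|x Kx j _]; last first.
    by apply: (thickenP Kx) => i; rewrite subrr mxE normr0 invr_ge0.
  apply: cl => U /nbhs_ballP[e /= e0 eU].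
  have [j _ /(_ _ (leqnn j)) je] : \forall j \near \oo, (j.+1%:R^-1 : R) < e.
    exact: (near_infty_natSinv_lt (PosNum e0)).
  have [x Kx [b bj yE]] := Fy j I; exists x; split => //; apply: eU => /=; split => // i i'.
  rewrite (ord1 i) /ball /= -yE !mxE !mul1r addrAC subrr add0r.
  exact: le_lt_trans (bj i') je.
have := @nonincreasing_cvg_mu _ _ _ (lebesgue_rV n) F.
rewrite FE => /(_ _ mF _ _) h.
have {}h : (lebesgue_rV n \o F) j @[j --> \oo] --> lebesgue_rV n K.
  apply: h => //.
  - by apply: lebesgue_compact_lty; exact: compact_thicken.
  - exact: measurable_compact_rV.
  - move=> i j ij; apply/subsetPset => y [x Kx [b bj yE]]; exists x => //; exists b => // k.
    by apply: (le_trans (bj k)); rewrite lef_pV2 ?posrE// ler_nat ltnS.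
rewrite -(cvg_lim _ h)//; apply: lime_ge.
  by apply/cvg_ex; eexists; exact: h.
by apply: nearW.
Qed.

End neighbourhoods.

Lemma continuous_affine {R : realType} {m n : nat} (b : 'rV[R]_n) (A : 'M[R]_(m, n)) :
  continuous (fun x : 'rV[R]_m => b + x *m A).
Proof.
suff h (s : seq 'I_m) : continuous (fun x : 'rV[R]_m => b + \sum_(i <- s) x 0 i *: row i A).
  by move=> x; under eq_fun do rewrite mulmx_sum_row; exact: h.
elim: s => [|i s IH] x.
  rewrite (_ : (fun _ => _) = cst (b + 0)); first exact: cst_continuous.
  by apply/funext => y; rewrite big_nil.
rewrite (_ : (fun _ => _) = (fun y : 'rV[R]_m => y 0 i *: row i A + (b + \sum_(j <- s) y 0 j *: row j A))).
  have h1 : {for x, continuous (fun y : 'rV[R]_m => y 0 i *: row i A)}.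
    by apply: continuousZr_tmp; exact: coord_continuous.
  exact: (continuousD h1 (IH x)).
by apply/funext => y; rewrite big_cons addrCA.
Qed.

Section packing.
Context {R : realType} {n : nat} (n0 : (0 < n)%N).
Context (K : set 'rV[R]_n) (T : 'rV[R]_n -> 'rV[R]_n) (D : 'rV[R]_n -> 'M[R]_n) (M h rho : R).
Context (A : finType) (pt : A -> 'rV[R]_n).
Hypotheses (cK : compact K) (KT : forall x, K (T x)) (M0 : 0 <= M) (h0 : 0 < h) (rho0 : 0 <= rho).
Hypothesis T_mono : forall x w : 'rV[R]_n, 0 <= dotp (T (x + w) - T x) w.
Hypothesis T_taylor : forall x w : 'rV[R]_n, (forall i, `|w 0 i| <= h) ->
  forall i, `|(T (x + w) - T x - w *m D x) 0 i| <= M * h ^+ 2.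
Hypothesis pt_sep : forall a b, a != b -> exists i, h <= `|(pt a - pt b) 0 i|.
Hypothesis pt_bound : forall a i, `|pt a 0 i| <= rho.

(** Large enough that eps h / 2 exceeds 2 n M h^2, the Taylor error entering [tile_disjoint], and
    still of order h, so that the perturbation disappears with the mesh. *)
Let eps : R := (4 * n%:R * M + 1) * h.
Let eps0 : 0 < eps.
Proof. by rewrite mulr_gt0// ltr_wpDl// !mulr_ge0. Qed.

(* The parallelepipeds [T_eps(a) + (cube of side h/2) D_eps(a)] with
   [T_eps = T + eps id] approximate the [T_eps]-images of disjoint cubes; strong
   monotonicity of [T_eps] keeps them apart. *)
Definition tile a : set 'rV[R]_n :=
  [set (T (pt a) + eps *: pt a) + x *m (D (pt a) + eps%:M) | x in box_rV (h / 4)].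

Lemma tile_sub a : tile a `<=` thicken K (M * h ^+ 2 + eps * (rho + h)).
Proof.
move=> _ [u ub <-].
have uh i : `|u 0 i| <= h by apply: (le_trans (ub i)); have := h0; lra.
apply: (thickenP (KT (pt a + u))) => i.
have -> : T (pt a) + eps *: pt a + u *m (D (pt a) + eps%:M) - T (pt a + u) =
    - (T (pt a + u) - T (pt a) - u *m D (pt a)) + eps *: (pt a + u).
  by rewrite mulmxDr mul_mx_scalar scalerDr !opprB; apply/rowP => j; rewrite !mxE; ring.
rewrite mxE; apply: (le_trans (ler_normD _ _)); apply: lerD.
  by rewrite mxE normrN; exact: T_taylor.
rewrite !mxE normrM (gtr0_norm eps0) ler_pM2l//.
by apply: (le_trans (ler_normD _ _)); apply: lerD.
Qed.

(** If two tiles met, the perturbed map would take values within 2 M h^2 of each other,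
    coordinatewise, at two points differing by at least h / 2 in some coordinate; monotonicity with
    constant [eps] forbids this. *)
Lemma tile_disjoint a b y : tile a y -> tile b y -> a = b.
Proof.
move=> [u ub ya] [v vb yb]; apply: contrapT => /eqP /pt_sep[i hi].
have uh k : `|u 0 k| <= h by apply: (le_trans (ub k)); have := h0; lra.
have vh k : `|v 0 k| <= h by apply: (le_trans (vb k)); have := h0; lra.
pose x := pt a + u; pose x' := pt b + v; pose w := x - x'.
pose dl := T x + eps *: x - (T x' + eps *: x').
have dlb k : `|dl 0 k| <= 2 * (M * h ^+ 2).
  have -> : dl = (T x - T (pt a) - u *m D (pt a)) - (T x' - T (pt b) - v *m D (pt b)).
    have := etrans ya (esym yb); rewrite !mulmxDr !mul_mx_scalar /dl /x /x' !scalerDr => e.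
    apply/rowP => j; have := congr1 (fun z : 'rV[R]_n => z 0 j) e; rewrite !mxE; lra.
  rewrite mxE; apply: (le_trans (ler_normD _ _)); rewrite [X in _ + `|X|]mxE normrN.
  by rewrite mulr2n mulrDl mul1r; apply: lerD; exact: T_taylor.
have ww : (h / 2) ^+ 2 <= dotp w w.
  apply: (@le_trans _ _ (w 0 i * w 0 i)); last first.
    by rewrite /dotp (bigD1 i)//= lerDl sumr_ge0// => j _; rewrite -expr2 sqr_ge0.
  rewrite -expr2 -(real_normK (num_real (w 0 i))) ler_sqr ?nnegrE//; last by have := h0; lra.
  have : `|(pt a - pt b) 0 i| <= `|w 0 i| + (`|u 0 i| + `|v 0 i|).
    have -> : (pt a - pt b) 0 i = w 0 i - (u 0 i - v 0 i) by rewrite !mxE; ring.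
    apply: (le_trans (ler_normB _ _)); rewrite lerD2l; exact: ler_normB.
  by have := ub i; have := vb i; lra.
have mono : eps * dotp w w <= dotp dl w.
  have := T_mono x' w; rewrite (_ : x' + w = x); last by rewrite /w addrC subrK.
  move=> hm; rewrite /dl.
  have -> : T x + eps *: x - (T x' + eps *: x') = (T x - T x') + eps *: w.
    by rewrite /w scalerBr; apply/rowP => j; rewrite !mxE; ring.
  by rewrite dotpDl dotpZl lerDr.
have ww0 : 0 < dotp w w by apply: lt_le_trans ww; rewrite exprn_gt0//; have := h0; lra.
have dd : dotp dl dl <= n%:R * (2 * (M * h ^+ 2)) ^+ 2.
  rewrite /dotp -[n in n%:R]card_ord mulr_natl -sumr_const; apply: ler_sum => k _.
  have c0 : 0 <= 2 * (M * h ^+ 2) by rewrite mulr_ge0// mulr_ge0// sqr_ge0.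
  by rewrite -expr2 -(real_normK (num_real (dl 0 k))) ler_sqr ?nnegrE.
have cs := cauchy_schwarz_sqr dl w.
have k1 : eps ^+ 2 * dotp w w <= dotp dl dl.
  rewrite -(ler_pM2r ww0); apply: le_trans cs.
  have -> : eps ^+ 2 * dotp w w * dotp w w = (eps * dotp w w) ^+ 2 by ring.
  by rewrite ler_sqr ?nnegrE ?(le_trans _ mono)// mulr_ge0 ?ltW.
have k2 : (eps * (h / 2)) ^+ 2 <= n%:R * (2 * (M * h ^+ 2)) ^+ 2.
  apply: (le_trans _ dd); apply: (le_trans _ k1); rewrite exprMn.
  by rewrite ler_wpM2l// sqr_ge0.
have n1 : 1 <= n%:R :> R by rewrite ler1n.
have k3 : (eps * (h / 2)) ^+ 2 <= (n%:R * (2 * (M * h ^+ 2))) ^+ 2.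
  apply: (le_trans k2); rewrite [X in _ <= X]exprMn ler_wpM2r ?sqr_ge0//.
  by rewrite expr2 ler_peMr// (le_trans _ n1).
move: k3; rewrite ler_sqr ?nnegrE; last 2 first.
- by rewrite mulr_ge0 ?(ltW eps0)//; have := h0; lra.
- by rewrite mulr_ge0 ?(le_trans _ n1)// mulr_ge0// mulr_ge0// sqr_ge0.
apply/negP; rewrite -ltNge /eps.
have -> : n%:R * (2 * (M * h ^+ 2)) = (4 * n%:R * M * h) * (h / 2) by field.
rewrite ltr_pM2r; last by have := h0; lra.
by have := h0; lra.
Qed.

Lemma packing_volume :
  (((h / 2) ^+ n * \sum_a `|\det (D (pt a) + eps%:M)|)%:E <=
   lebesgue_rV n (thicken K (M * h ^+ 2 + eps * (rho + h))))%E.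
Proof.
have mth : measurable (thicken K (M * h ^+ 2 + eps * (rho + h))).
  by apply: measurable_compact_rV; exact: compact_thicken.
have mbox : measurable (box_rV (n := n) (h / 4)).
  by apply: measurable_closed_rV; exact: closed_box.
have mtile a : measurable (tile a).
  apply: measurable_compact_rV; apply: continuous_compact; last exact: compact_box.
  apply: continuous_subspaceT => x.
  exact: continuous_affine.
have voltile a : ((`|\det (D (pt a) + eps%:M)| * (h / 2) ^+ n)%:E <= lebesgue_rV n (tile a))%E.
  (* A singular matrix contributes 0 to the sum, so its tile may be degenerate. *)
  have [uA|] := boolP ((D (pt a) + eps%:M) \in unitmx); last first.
    by rewrite unitmxE unitfE negbK => /eqP ->; rewrite normr0 mul0r.
  rewrite /tile lebesgue_rV_image// lebesgue_box; last by have := h0; lra.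
  by rewrite -EFinM (_ : 2 * (h / 4) = h / 2)//; field.
rewrite mulrC mulr_suml -sumEFin.
apply: (@le_trans _ _ (\sum_a \int[lebesgue_rV n]_x (\1_(tile a) x)%:E)%E).
  by apply: lee_sum => a _; rewrite integral_indic// setIT.
rewrite -nng_int_sum//; last first.
  by move=> a; exact: measurable_indic.
rewrite -[X in lebesgue_rV n X]setIT -integral_indic//.
apply: nng_int_le => //.
- by apply: measurable_sum => a; exact: measurable_indic.
- by move=> y; apply: sumr_ge0.
move=> y; have [ya|ya] := pselect (exists a, tile a y).
  have [a ta] := ya; rewrite [leRHS]indicE mem_set; last exact: tile_sub ta.
  under eq_bigr do rewrite indicE.
  by apply: sum_bool_le1 => b c; rewrite !inE; exact: tile_disjoint.
rewrite big1// => a _; rewrite indicE memNset// => ta; apply: ya; by exists a.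
Qed.

End packing.

(** * Negative moments in a slot *)

Lemma expRN_le2 {R : realType} (y : R) : 0 <= y -> expR (- y) + y <= 1 + y ^+ 2.
Proof.
move=> y0; have h : expR (- y) <= (1 + y)^-1.
  by rewrite expRN lef_pV2 ?posrE ?expR_gt0 ?expR_ge1Dx//; lra.
apply: (@le_trans _ _ ((1 + y)^-1 + y)); first by rewrite lerD2r.
rewrite -lerBrDr -(ler_pM2r (_ : 0 < 1 + y)); last lra.
rewrite mulVf; last by rewrite gt_eqF//; lra.
nra.
Qed.

Lemma int_affine_le {d : measure_display} {T : measurableType d} {R : realType}
    (P : probability T R) (f : T -> R) (a b K : R) :
  measurable_fun setT f -> (forall x, 0 <= f x) -> 0 <= a -> 0 <= b ->
  (\int[P]_x (f x)%:E <= K%:E)%E -> (\int[P]_x (a + b * f x)%:E <= (a + b * K)%:E)%E.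
Proof.
move=> mf f0 a0 b0 fK; rewrite nng_intD//; first last.
- by move=> x; exact: mulr_ge0.
- exact: measurable_funM.
rewrite integral_pr_cst EFinD leeD2l// nng_intZ// EFinM.
by apply: lee_wpmul2l => //; rewrite lee_fin.
Qed.

Lemma lee_prod_EFin {R : realType} (I : Type) (s : seq I) (f : I -> \bar R) (g : I -> R) :
  (forall i, 0 <= f i)%E -> (forall i, f i <= (g i)%:E)%E ->
  (\prod_(i <- s) f i <= (\prod_(i <- s) g i)%:E)%E.
Proof.
move=> f0 fg; rewrite -prodEFin.
suff /andP[] : ((0 <= \prod_(i <- s) f i) && (\prod_(i <- s) f i <= \prod_(i <- s) (g i)%:E))%E by [].
elim/big_ind2 : _ => [|x1 x2 y1 y2 /andP[h1 h2] /andP[h3 h4]|i _].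
- by rewrite lexx lee01.
- by rewrite mule_ge0//= lee_pmul.
- by rewrite f0 fg.
Qed.

Section inverse_mass.
Context {d : measure_display} {T : measurableType d} {R : realType} (nu : probability T R).
Context (w : T -> R) (m Z : R) (H h : nat).
Hypotheses (mw : measurable_fun setT w) (w2 : forall x, 2 <= w x) (hH : (h <= H)%N) (h0 : (0 < h)%N).
Hypotheses (wm : (\int[nu]_x (w x)%:E = m%:E)%E) (wZ : (\int[nu]_x (w x ^+ 2)%:E <= Z%:E)%E).

Definition prefix_mass (t : H.-tuple T) : R := \sum_(i < H | (i < h)%N) w (tnth t i).

Lemma mean_weight_ge2 : 2 <= m.
Proof.
rewrite -lee_fin -wm -(integral_pr_cst nu 2%:E); apply: nng_int_le => //.
Qed.

Lemma sqr_mean_le : m ^+ 2 <= Z.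
Proof.
have m2 := mean_weight_ge2.
have : ((2 * m) * m <= Z + m ^+ 2)%R.
  rewrite -lee_fin EFinM -wm -nng_intZ//; [|by move=> x; apply: le_trans (w2 x)|by rewrite mulr_ge0//; lra].
  rewrite EFinD; apply: le_trans (leeD wZ (lexx (m ^+ 2)%:E)).
  rewrite -(integral_pr_cst nu (m ^+ 2)%:E) -nng_intD//; last 3 first.
  - exact: measurable_funX.
  - by move=> x; exact: sqr_ge0.
  - by move=> x; exact: sqr_ge0.
  apply: nng_int_le => //.
  - exact: measurable_funM.
  - by apply: measurable_funD => //; exact: measurable_funX.
  - by move=> x; rewrite mulr_ge0 ?mulr_ge0//; [lra|apply: le_trans (w2 x)].
  - by move=> x; have := sqr_ge0 (w x - m); nra.
by rewrite expr2; lra.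
Qed.

Lemma card_prefix : \sum_(i < H | (i < h)%N) 1 = h%:R :> R.
Proof.
rewrite -(big_ord_widen_cond H xpredT (fun=> 1 : R) hH) /=.
by rewrite sumr_const card_ord.
Qed.

Lemma measurable_prefix_mass : measurable_fun setT prefix_mass.
Proof.
rewrite /prefix_mass; under eq_fun do rewrite -big_filter.
by apply: measurable_sum => i; exact: (measurableT_comp mw (measurable_tnth i)).
Qed.

Lemma prefix_mass_ge t : 2 * h%:R <= prefix_mass t.
Proof. by rewrite -card_prefix mulr_sumr mulr1; apply: ler_sum. Qed.

Lemma prefix_mass_mean : (\int[mtup nu H]_t (prefix_mass t)%:E = (h%:R * m)%:E)%E.
Proof.
rewrite /prefix_mass; under eq_integral do rewrite -big_filter.
rewrite nng_int_sum//; first last.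
- by move=> i t; apply: le_trans (w2 _).
- by move=> i; exact: (measurableT_comp mw (measurable_tnth i)).
rewrite big_filter -card_prefix mulr_suml -sumEFin; apply: eq_bigr => i _.
rewrite mul1r -wm (ge0_integral_mtup1 nu i (f := fun x => (w x)%:E))//; first exact/measurable_EFinP.
by move=> x; rewrite lee_fin; apply: le_trans (w2 _).
Qed.

Lemma prefix_mass_laplace (l : R) : 0 <= l ->
  (\int[mtup nu H]_t (expR (- (l * prefix_mass t)))%:E <=
   (expR (h%:R * (l ^+ 2 * Z - l * m)))%:E)%E.
Proof.
move=> l0.
pose f (i : 'I_H) x : \bar R := (if (i < h)%N then expR (- (l * w x)) else 1)%:E.
have mf i : measurable_fun setT (f i).
  apply/measurable_EFinP; case: (i < h)%N => //.
  by apply: measurableT_comp => //; apply: measurableT_comp => //; exact: measurable_funM.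
have f0 i x : (0 <= f i x)%E by rewrite lee_fin; case: (i < h)%N => //; exact: expR_ge0.
have -> : (\int[mtup nu H]_t (expR (- (l * prefix_mass t)))%:E =
    \int[mtup nu H]_t \prod_(i < H) f i (tnth t i))%E.
  apply: eq_integral => t _; rewrite /f prodEFin; congr (_%:E).
  rewrite /prefix_mass mulr_sumr -sumrN expR_sum big_mkcond; apply: eq_bigr => i _.
  by case: ifP.
rewrite ge0_integral_mtup_prod//.
pose M : R := expR (l ^+ 2 * Z - l * m).
have e1 : (\int[nu]_x (expR (- (l * w x)))%:E <= M%:E)%E.
  have mle : (\int[nu]_x (expR (- (l * w x)) + l * w x)%:E <= (1 + l ^+ 2 * Z)%:E)%E.
    apply: (@le_trans _ _ (\int[nu]_x (1 + l ^+ 2 * w x ^+ 2)%:E)%E).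
      apply: nng_int_le => //.
      - apply: measurable_funD; last exact: measurable_funM.
        by apply: measurableT_comp => //; apply: measurableT_comp => //; exact: measurable_funM.
      - by apply: measurable_funD => //; apply: measurable_funM => //; exact: measurable_funX.
      - by move=> x; rewrite addr_ge0 ?expR_ge0// mulr_ge0//; apply: le_trans (w2 x).
      move=> x; set y := l * w x.
      have y0 : 0 <= y by rewrite mulr_ge0//; apply: le_trans (w2 x).
      have -> : l ^+ 2 * w x ^+ 2 = y ^+ 2 by rewrite /y exprMn.
      exact: expRN_le2.
    apply: int_affine_le => //; first exact: measurable_funX.
    - by move=> x; exact: sqr_ge0.
    - exact: sqr_ge0.
  move: mle; rewrite nng_intD//; first last.
  - by move=> x; rewrite mulr_ge0//; apply: le_trans (w2 x).
  - exact: measurable_funM.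
  - by apply: measurableT_comp => //; apply: measurableT_comp => //; exact: measurable_funM.
  rewrite nng_intZ//; last by move=> x; apply: le_trans (w2 x).
  rewrite wm -EFinM -leeBrDr// -EFinB => /le_trans; apply.
  rewrite lee_fin /M; apply: le_trans (expR_ge1Dx _); lra.
apply: (@le_trans _ _ (\prod_(i < H) (if (i < h)%N then M else 1))%:E).
  apply: lee_prod_EFin => i; first exact: integral_ge0.
  by rewrite /f; case: (i < h)%N => //; rewrite integral_pr_cst.
rewrite lee_fin -big_mkcond /= prodr_const.
have -> : #|[pred i : 'I_H | (i < h)%N]| = h.
  apply/eqP; rewrite -(eqr_nat R) -card_prefix -sumr_const; apply/eqP.
  by apply: eq_bigl => i; rewrite inE.
by rewrite /M -expRM_natl.
Qed.

(** Where the mass is at least half its mean, the inverse is at most 2 / (h m). Elsewhere the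
    deterministic bound 2h is used, together with the Laplace transform at l = m / (4Z): this makes
    the exponent -y with y = h m^2 / (16 Z), and exp (-y) <= 1 / y. *)
Lemma prefix_mass_inv :
  (\int[mtup nu H]_t ((prefix_mass t)^-1)%:E <=
   (2 / (h%:R * m) + 8 * Z / (h%:R * m) ^+ 2)%:E)%E.
Proof.
have m2 := mean_weight_ge2; have Zm := sqr_mean_le.
have hR : 1 <= h%:R :> R by rewrite ler1n.
have Z0 : 0 < Z by apply: lt_le_trans Zm; rewrite exprn_gt0//; lra.
pose l := m / (4 * Z); have l0 : 0 <= l by rewrite divr_ge0//; lra.
pose y := h%:R * m ^+ 2 / (16 * Z).
have y0 : 0 < y by rewrite divr_gt0 ?mulr_gt0 ?exprn_gt0//; lra.
have W0 t : 0 < prefix_mass t by apply: lt_le_trans (prefix_mass_ge t); lra.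
have mm := measurable_prefix_mass.
have mexp : measurable_fun setT (fun t => expR (- (l * prefix_mass t))).
  by apply: measurableT_comp => //; apply: measurableT_comp => //; exact: measurable_funM.
have minv : measurable_fun setT (fun t => (prefix_mass t)^-1).
  have : (fun t => (prefix_mass t)^-1) = (fun t => prefix_mass t `^ (-1)).
    by apply/funext => t; rewrite powR_inv1// ltW.
  by move=> ->; apply: (measurableT_comp (measurable_powR _)).
apply: (@le_trans _ _ (\int[mtup nu H]_t (2 / (h%:R * m) +
    (expR (l * (h%:R * m / 2)) / (2 * h%:R)) * expR (- (l * prefix_mass t)))%:E)%E).
  apply: nng_int_le => //.
  - by apply: measurable_funD => //; exact: measurable_funM.
  - by move=> t; rewrite invr_ge0 ltW.
  move=> t; have [hW|hW] := leP (h%:R * m / 2) (prefix_mass t).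
    apply: ler_wpDr; first by rewrite mulr_ge0 ?expR_ge0// divr_ge0 ?expR_ge0// mulr_ge0//; lra.
    rewrite (_ : 2 / (h%:R * m) = (h%:R * m / 2)^-1); last by field; rewrite !gt_eqF//; lra.
    by rewrite lef_pV2 ?posrE ?divr_gt0 ?mulr_gt0//; lra.
  apply: ler_wpDl; first by rewrite divr_ge0// mulr_ge0//; lra.
  apply: (@le_trans _ _ (2 * h%:R)^-1).
    by rewrite lef_pV2 ?posrE ?mulr_gt0 ?prefix_mass_ge//; lra.
  rewrite mulrAC -expRD; apply: ler_peMl; first by rewrite invr_ge0 mulr_ge0//; lra.
  rewrite -[leLHS]expR0 ler_expR -mulrBr mulr_ge0// subr_ge0; exact: ltW.
apply: (@le_trans _ _ (2 / (h%:R * m) + expR (l * (h%:R * m / 2)) / (2 * h%:R) *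
    expR (h%:R * (l ^+ 2 * Z - l * m)))%:E).
  apply: int_affine_le => //.
  - by rewrite divr_ge0// mulr_ge0//; lra.
  - exact: prefix_mass_laplace.
rewrite lee_fin lerD2l mulrAC -expRD.
have -> : l * (h%:R * m / 2) + h%:R * (l ^+ 2 * Z - l * m) = - y.
  by rewrite /l /y; field; rewrite gt_eqF.
have ey : expR (- y) <= y^-1.
  rewrite expRN lef_pV2 ?posrE ?expR_gt0//; have := expR_ge1Dx y; lra.
apply: (@le_trans _ _ (y^-1 / (2 * h%:R))).
  by rewrite ler_pM2r// invr_gt0 mulr_gt0//; lra.
by rewrite le_eqVlt; apply/orP; left; apply/eqP; rewrite /y; field; rewrite !gt_eqF//; lra.
Qed.

End inverse_mass.

Section negative_moments.
Context {d : measure_display} {T : measurableType d} {R : realType} (P : probability T R).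
Context (r : T -> R) (A : R).
Hypotheses (mr : measurable_fun setT r) (r0 : forall x, 0 <= r x) (A0 : 0 <= A).
Hypothesis rA : forall t, 0 < t -> pr P [set x | r x <= t ^+ 2] <= A * t.

(** If J is least with 4^(-2J) < y, then y^(-1/4) <= 2^J, and the term of index J - 1 alone equals
    2^J. *)
Lemma powRN_le_series (y : R) : 0 <= y ->
  ((y `^ (- (4^-1)))%:E <= 1 + \sum_(0 <= j <oo) (2 ^+ j.+1 * (y <= (4 ^- j) ^+ 2)%R%:R)%:E)%E.
Proof.
move=> y0; have [y1|y1] := leP 1 y.
  apply: (@le_trans _ _ 1%E); last first.
    by rewrite leeDl// nneseries_ge0// => j _ _; rewrite lee_fin mulr_ge0.
  by rewrite lee_fin -[X in _ <= X](powRr0 y) ler_powR//.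
(* [powR] sends the base 0 to 0 at a nonzero exponent, so nothing is claimed there. *)
have [->|yN0] := eqVneq y 0.
  rewrite powR0; last by rewrite oppr_eq0 invr_eq0 pnatr_eq0.
  by rewrite adde_ge0// nneseries_ge0// => j _ _; rewrite lee_fin mulr_ge0.
have y0' : 0 < y by rewrite lt_def yN0.
have exJ : exists J, (4 ^- J) ^+ 2 < y.
  have [J hJ] : exists J, y^-1 < J%:R.
    by exists (Num.truncn y^-1).+1; exact: truncnS_gt.
  exists J; rewrite -exprVn -exprM mulnC exprM !exprVn invf_plt ?posrE ?exprn_gt0//.
  apply: (lt_le_trans hJ); have := @ltn_expl (4 ^ 2) J isT.
  by rewrite -(ltr_nat R) !natrX => /ltW.
have hP := ex_minnP exJ; case: hP => J hJ Jmin.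
have J0 : (0 < J)%N.
  by rewrite lt0n; apply: contraTneq hJ => ->; rewrite expr0 invr1 expr1n -leNgt ltW.
have hJ1 : y <= (4 ^- J.-1) ^+ 2.
  by rewrite leNgt; apply/negP => /Jmin; rewrite leqNgt prednK// leqnn.
apply: (@le_trans _ _ (2 ^+ J)%:E).
  rewrite lee_fin powRN invf_ple ?posrE ?powR_gt0 ?exprn_gt0//.
  have -> : (2 ^- J : R) = (((4 ^- J) ^+ 2)) `^ (4^-1).
    rewrite -exprVn -exprVn -exprM.
    have -> : (4^-1 : R) ^+ (J * 2) = (2^-1 ^+ J) ^+ 4.
      have -> : (4^-1 : R) = (2^-1) ^+ 2 by field.
      by rewrite -!exprM; congr (_ ^+ _); rewrite mulnC -mulnA.
    have q0 : 0 <= 2^-1 ^+ J :> R by rewrite exprn_ge0.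
    rewrite -[in RHS](powR_mulrn _ q0) -powRrM divff ?powRr1//.
  by rewrite ge0_ler_powR ?nnegrE ?exprn_ge0 ?invr_ge0 ?exprn_ge0// ltW.
apply: (@le_trans _ _ (\sum_(0 <= j < J) (2 ^+ j.+1 * (y <= (4 ^- j) ^+ 2)%R%:R)%:E)%E).
  case: J J0 hJ1 {hJ Jmin} => // J _ hJ; rewrite big_nat_recr//= hJ mulr1 leeDr//.
  by apply: sume_ge0 => j _; rewrite lee_fin mulr_ge0.
apply: le_trans (nneseries_lim_ge J _) _; last by rewrite leeDr.
by move=> j _ _; rewrite lee_fin mulr_ge0.
Qed.

(** Integrated term by term, the series of [powRN_le_series] is dominated by a geometric one:
    2^(j+1) A 4^-j = 2 A 2^-j. *)
Lemma neg_moment : (\int[P]_x (r x `^ (- (4^-1)))%:E <= (1 + 4 * A)%:E)%E.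
Proof.
pose f j x : \bar R := (2 ^+ j.+1 * (r x <= (4 ^- j) ^+ 2)%R%:R)%:E.
have mb j : measurable_fun setT (fun x => (r x <= (4 ^- j) ^+ 2)%R%:R : R) by exact: measurable_bool_le.
have mf j : measurable_fun setT (f j) by apply/measurable_EFinP; exact: measurable_funM.
have f0 j x : (0 <= f j x)%E by rewrite lee_fin mulr_ge0.
have mS : measurable_fun setT (fun x => \sum_(0 <= j <oo) f j x)%E.
  by apply: (@ge0_emeasurable_sum _ _ _ setT f xpredT) => // j x _ _; exact: f0.
apply: (@le_trans _ _ (\int[P]_x (1 + \sum_(0 <= j <oo) f j x))%E).
  apply: ge0_le_integral => //.
  - by move=> x _; rewrite lee_fin powR_ge0.
  - by apply/measurable_EFinP; apply: (measurableT_comp (measurable_powR _)).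
  - exact: emeasurable_funD.
  - by move=> x _; exact: powRN_le_series.
rewrite ge0_integralD//; last by move=> x _; apply: nneseries_ge0.
rewrite integral_pr_cst EFinD leeD2l// integral_nneseries//.
apply: le_trans (@epsilon_trick0 _ (4 * A) xpredT _); last by rewrite mulr_ge0.
apply: lee_nneseries => [j _ _|j _]; first by apply: integral_ge0.
rewrite nng_intZ// integral_bool_le// -EFinM lee_fin.
have h4 : 0 < 4 ^- j :> R by rewrite invr_gt0 exprn_gt0.
apply: (@le_trans _ _ (2 ^+ j.+1 * (A * 4 ^- j))); first by rewrite ler_wpM2l// rA.
rewrite le_eqVlt natrX; apply/orP; left; apply/eqP.
have -> : (4 : R) ^+ j = 2 ^+ j * 2 ^+ j by rewrite -exprMn; congr (_ ^+ _); ring.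
by rewrite exprS; field; rewrite expf_neq0.
Qed.

(** With u = r^(-1/8), AM-GM in the form u <= a u^2 + 1 / a on the event: the first term is a times
    the moment of order -1/4, the second at most B a. Halving the exponent thus extracts the square
    root of the probability of the event, which pays for the later union bound over pairs. *)
Lemma neg_moment_small (t a B : R) : 0 < a -> 0 <= B ->
  pr P [set x | r x <= t] <= B * a ^+ 2 ->
  (\int[P]_x ((r x <= t)%R%:R * r x `^ (- (8^-1)))%:E <= (a * (1 + 4 * A + B))%:E)%E.
Proof.
move=> a0 B0 hB.
have mb : measurable_fun setT (fun x => (r x <= t)%R%:R : R) by exact: measurable_bool_le.
have mp c : measurable_fun setT (fun x => r x `^ c) by apply: (measurableT_comp (measurable_powR _)).
apply: (@le_trans _ _ (\int[P]_x (a * (r x `^ (- (4^-1))) + a^-1 * (r x <= t)%R%:R)%:E)%E).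
  apply: nng_int_le => //.
  - exact: measurable_funM.
  - by apply: measurable_funD; exact: measurable_funM.
  - by move=> x; rewrite mulr_ge0// powR_ge0.
  move=> x; have [h|h] := leP (r x) t; last first.
    by rewrite mul0r mulr0 addr0 mulr_ge0 ?powR_ge0// ltW.
  rewrite mul1r mulr1; set u := r x `^ (- 8^-1).
  have u0 : 0 <= u by exact: powR_ge0.
  have -> : r x `^ (- 4^-1) = u ^+ 2.
    by rewrite /u -powR_mulrn ?powR_ge0// -powRrM; congr (_ `^ _); field.
  have ai : 0 < a^-1 by rewrite invr_gt0.
  have := mulr_ge0 (ltW a0) (sqr_ge0 (u - a^-1)).
  have -> : a * (u - a^-1) ^+ 2 = a * u ^+ 2 + a^-1 - 2 * u by field; rewrite gt_eqF.
  lra.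
rewrite nng_intD//; first last.
- by move=> x; rewrite mulr_ge0// invr_ge0 ltW.
- by move=> x; rewrite mulr_ge0 ?powR_ge0// ltW.
- exact: measurable_funM.
- exact: measurable_funM.
rewrite nng_intZ//; first last.
- exact: ltW.
- by move=> x; exact: powR_ge0.
rewrite nng_intZ ?invr_ge0 ?(ltW a0)// integral_bool_le// mulrDr EFinD leeD//.
  by rewrite EFinM lee_wpmul2l ?neg_moment// lee_fin ltW.
rewrite -EFinM lee_fin.
apply: (@le_trans _ _ (a^-1 * (B * a ^+ 2))); first by rewrite ler_wpM2l// invr_ge0 ltW.
by rewrite le_eqVlt; apply/orP; left; apply/eqP; field; rewrite gt_eqF.
Qed.

End negative_moments.

Lemma int_affine2_le {d : measure_display} {T : measurableType d} {R : realType}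
    (P : probability T R) (f g : T -> R) (a b c K L : R) :
  measurable_fun setT f -> measurable_fun setT g -> (forall x, 0 <= f x) -> (forall x, 0 <= g x) ->
  0 <= a -> 0 <= b -> 0 <= c ->
  (\int[P]_x (f x)%:E <= K%:E)%E -> (\int[P]_x (g x)%:E <= L%:E)%E ->
  (\int[P]_x (a + b * f x + c * g x)%:E <= (a + b * K + c * L)%:E)%E.
Proof.
move=> mf mg f0 g0 a0 b0 c0 fK gL; rewrite nng_intD//; first last.
- by move=> x; exact: mulr_ge0.
- by move=> x; rewrite addr_ge0// mulr_ge0.
- exact: measurable_funM.
- by apply: measurable_funD => //; exact: measurable_funM.
rewrite EFinD leeD//; first exact: int_affine_le.
by rewrite nng_intZ// EFinM lee_wpmul2l.
Qed.

Lemma integral_mtup_cat_le {d : measure_display} {T : measurableType d} {R : realType}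
    (P : probability T R) a b (f : (a + b).-tuple T -> R) (g : a.-tuple T -> R) :
  measurable_fun setT f -> measurable_fun setT g -> (forall t, 0 <= f t) ->
  (forall s : a.-tuple T, (\int[mtup P b]_t (f [tuple of s ++ t])%:E <= (g s)%:E)%E) ->
  (\int[mtup P (a + b)]_t (f t)%:E <= \int[mtup P a]_s (g s)%:E)%E.
Proof.
move=> mf mg f0 fg; rewrite ge0_integral_mtup_cat//; last exact/measurable_EFinP.
have mF : measurable_fun setT (fun st : a.-tuple T * b.-tuple T => (f [tuple of st.1 ++ st.2])%:E).
  by apply/measurable_EFinP; apply: (measurableT_comp mf); exact: measurable_cat_tup.
apply: ge0_le_integral => //.
- by move=> s _; apply: nng_int_ge0.
- by apply: (@measurable_fun_fubini_tonelli_F _ _ _ _ R (mtup P b) _ mF) => st; rewrite lee_fin.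
- exact/measurable_EFinP.
Qed.

Section slot.
Context {R : realType} {n : nat} (nu : probability 'rV[R]_n R) (u : 'rV[R]_n -> R).
Context (H h : nat) (Z : R).
Hypotheses (mu_ : measurable_fun setT u) (hH : (h <= H)%N) (h0 : (0 < h)%N).
Notation V := 'rV[R]_n.
Notation T := ((H + H).-tuple V).
Notation E := (bool * 'I_(H + H))%type.

(* A slot is a tuple of [H + H] points; the index [(b, i)] stands for the signed point
   [(-1)^b x_i], of weight [exp ((-1)^b u x_i)]. Only the first [h] points of either half count.
   One end of a difference [slot_z] is taken from each half, so that the two are independent. *)
Definition slot_sg (b : bool) : R := (-1) ^+ b.
Definition slot_w (x : V) : R := expR (u x) + expR (- u x).
Hypothesis wZ : (\int[nu]_x (slot_w x ^+ 2)%:E <= Z%:E)%E.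

Definition slot_e (t : T) (a : E) : R := expR (slot_sg a.1 * u (tnth t a.2)).
Definition slot_in1 (a : E) : bool := (a.2 < h)%N.
Definition slot_in2 (a : E) : bool := (H <= a.2 < H + h)%N.
Definition slot_left (t : T) : H.-tuple V := [tuple tnth t (lshift H i) | i < H].
Definition slot_right (t : T) : H.-tuple V := [tuple tnth t (rshift H i) | i < H].
Definition slot_W1 (t : T) : R := \sum_(a | slot_in1 a) slot_e t a.
Definition slot_W2 (t : T) : R := \sum_(a | slot_in2 a) slot_e t a.
(** A product e_1 e_2 / (W_1 + W_2)^2 of softmax probabilities splits into [slot_Q], which does not
    depend on the pair, and [slot_pi], a probability on pairs with one end in either half. *)
Definition slot_Q (t : T) : R := slot_W1 t * slot_W2 t / (slot_W1 t + slot_W2 t) ^+ 2.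
Definition slot_pi (t : T) (c : E * E) : R :=
  (slot_in1 c.1)%:R * (slot_in2 c.2)%:R * (slot_e t c.1 * slot_e t c.2) / (slot_W1 t * slot_W2 t).
Definition slot_z (t : T) (c : E * E) : V :=
  slot_sg c.1.1 *: tnth t c.1.2 - slot_sg c.2.1 *: tnth t c.2.2.

Lemma slot_w_ge2 x : 2 <= slot_w x.
Proof.
rewrite /slot_w expRN; have e0 := expR_gt0 (u x); set e := expR (u x) in e0 *.
have ei : e * e^-1 = 1 by rewrite divff// gt_eqF.
have i0 : 0 < e^-1 by rewrite invr_gt0.
have := sqr_ge0 (e - e^-1); nra.
Qed.

Lemma measurable_slot_w : measurable_fun setT slot_w.
Proof.
by apply: measurable_funD; apply: measurableT_comp => //; exact: measurableT_comp.
Qed.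

Lemma slot_left_cat (s t : H.-tuple V) : slot_left [tuple of s ++ t] = s.
Proof.
apply: eq_from_tnth => i; rewrite tnth_mktuple.
by rewrite (tnth_nth 0) /= nth_cat size_tuple ltn_ord -tnth_nth.
Qed.

Lemma slot_right_cat (s t : H.-tuple V) : slot_right [tuple of s ++ t] = t.
Proof.
apply: eq_from_tnth => i; rewrite tnth_mktuple.
by rewrite (tnth_nth 0) /= nth_cat size_tuple ltnNge leq_addr/= addKn -tnth_nth.
Qed.

Lemma slot_sum_sign t (i : 'I_(H + H)) :
  \sum_(b : bool) slot_e t (b, i) = slot_w (tnth t i).
Proof. by rewrite big_bool /slot_e /slot_sg /= expr1 expr0 mulN1r mul1r addrC. Qed.

Lemma slot_W1E t : slot_W1 t = prefix_mass slot_w h (slot_left t).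
Proof.
rewrite /slot_W1 /prefix_mass big_mkcond /= -(pair_bigA _ (fun b i => if slot_in1 (b, i) then slot_e t (b, i) else 0)) /=.
rewrite exchange_big /= big_split_ord /= [X in _ + X]big1 ?addr0 => [|i _].
  rewrite [RHS]big_mkcond; apply: eq_bigr => i _; rewrite /slot_in1 /=.
  by case: ifP => _; [rewrite slot_sum_sign tnth_mktuple|rewrite big1].
by rewrite big1// => b _; rewrite /slot_in1 /= ltnNge (leq_trans hH) ?leq_addr.
Qed.

Lemma slot_W2E t : slot_W2 t = prefix_mass slot_w h (slot_right t).
Proof.
rewrite /slot_W2 /prefix_mass big_mkcond /= -(pair_bigA _ (fun b i => if slot_in2 (b, i) then slot_e t (b, i) else 0)) /=.
rewrite exchange_big /= big_split_ord /= [X in X + _]big1 ?add0r => [|i _].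
  rewrite [RHS]big_mkcond; apply: eq_bigr => i _; rewrite /slot_in2 /= leq_addr ltn_add2l /=.
  by case: ifP => _; [rewrite slot_sum_sign tnth_mktuple|rewrite big1].
by rewrite big1// => b _; rewrite /slot_in2 /= leqNgt ltn_ord.
Qed.

Lemma slot_W1_gt0 t : 0 < slot_W1 t.
Proof.
rewrite slot_W1E; apply: lt_le_trans (prefix_mass_ge slot_w_ge2 hH _).
by rewrite mulr_gt0// ltr0n.
Qed.

Lemma slot_W2_gt0 t : 0 < slot_W2 t.
Proof.
rewrite slot_W2E; apply: lt_le_trans (prefix_mass_ge slot_w_ge2 hH _).
by rewrite mulr_gt0// ltr0n.
Qed.

Lemma slot_Q_gt0 t : 0 < slot_Q t.
Proof.
by rewrite divr_gt0 ?mulr_gt0 ?exprn_gt0 ?addr_gt0 ?slot_W1_gt0 ?slot_W2_gt0.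
Qed.

Lemma slot_Q_le1 t : slot_Q t <= 1.
Proof.
have h1 := slot_W1_gt0 t; have h2 := slot_W2_gt0 t.
rewrite ler_pdivrMr ?exprn_gt0 ?addr_gt0// mul1r; nra.
Qed.

Lemma slot_pi_ge0 t c : 0 <= slot_pi t c.
Proof.
have h1 := slot_W1_gt0 t; have h2 := slot_W2_gt0 t.
by rewrite divr_ge0// mulr_ge0// ?mulr_ge0// ?expR_ge0// ltW.
Qed.

Lemma slot_pi_sum t : \sum_c slot_pi t c = 1.
Proof.
have h1 := slot_W1_gt0 t; have h2 := slot_W2_gt0 t.
rewrite /slot_pi -mulr_suml.
suff -> : \sum_(c : E * E) (slot_in1 c.1)%:R * (slot_in2 c.2)%:R * (slot_e t c.1 * slot_e t c.2) =
    slot_W1 t * slot_W2 t by rewrite divff// gt_eqF// mulr_gt0.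
rewrite -(pair_bigA _ (fun a b => (slot_in1 a)%:R * (slot_in2 b)%:R * (slot_e t a * slot_e t b))) /=.
rewrite /slot_W1 /slot_W2 [in RHS]big_mkcond [X in _ = _ * X]big_mkcond /= mulr_suml.
apply: eq_bigr => a _; rewrite mulr_sumr; apply: eq_bigr => b _.
by case: (slot_in1 a); case: (slot_in2 b); rewrite /= ?(mulr1n, mulr0n, mul0r, mulr0, mul1r).
Qed.

Lemma slot_pi_le1 t c : slot_pi t c <= (slot_in1 c.1)%:R * (slot_in2 c.2)%:R.
Proof.
have l1 : slot_pi t c <= 1.
  rewrite -(slot_pi_sum t) (bigD1 c)//= lerDl sumr_ge0// => c' _.
  exact: slot_pi_ge0.
move: l1; rewrite /slot_pi; case: (slot_in1 c.1); case: (slot_in2 c.2);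
  by rewrite /= ?(mulr1n, mulr0n, mul0r, mulr0, mul1r).
Qed.

Lemma measurable_slot_e a : measurable_fun setT (slot_e^~ a).
Proof.
apply: measurableT_comp => //; apply: measurable_funM => //.
by apply: measurableT_comp => //; exact: measurable_tnth.
Qed.

Lemma measurable_slot_W1 : measurable_fun setT slot_W1.
Proof.
rewrite /slot_W1; under eq_fun do rewrite -big_filter.
by apply: measurable_sum => a; exact: measurable_slot_e.
Qed.

Lemma measurable_slot_W2 : measurable_fun setT slot_W2.
Proof.
rewrite /slot_W2; under eq_fun do rewrite -big_filter.
by apply: measurable_sum => a; exact: measurable_slot_e.
Qed.

Lemma measurable_inv_pos d' (T' : measurableType d') (f : T' -> R) :
  measurable_fun setT f -> (forall t, 0 < f t) -> measurable_fun setT (fun t => (f t)^-1).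
Proof.
move=> mf f0; have -> : (fun t => (f t)^-1) = (fun t => f t `^ (-1)).
  by apply/funext => t; rewrite powR_inv1// ltW.
by apply: (measurableT_comp (measurable_powR _)).
Qed.

Lemma measurable_slot_Q : measurable_fun setT slot_Q.
Proof.
have m1 := measurable_slot_W1; have m2 := measurable_slot_W2.
apply: measurable_funM; first exact: measurable_funM.
apply: measurable_inv_pos; first by apply: measurable_funX; exact: measurable_funD.
by move=> t; rewrite exprn_gt0// addr_gt0 ?slot_W1_gt0 ?slot_W2_gt0.
Qed.

Lemma measurable_slot_pi c : measurable_fun setT (slot_pi^~ c).
Proof.
have m1 := measurable_slot_W1; have m2 := measurable_slot_W2.
apply: measurable_funM.
  by apply: measurable_funM => //; apply: measurable_funM; exact: measurable_slot_e.
apply: measurable_inv_pos; first exact: measurable_funM.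
by move=> t; rewrite mulr_gt0 ?slot_W1_gt0 ?slot_W2_gt0.
Qed.

Lemma measurable_slot_z c (j : 'I_n) : measurable_fun setT (fun t => slot_z t c 0 j).
Proof.
rewrite (_ : (fun _ => _) = (fun t : T => slot_sg c.1.1 * tnth t c.1.2 0 j - slot_sg c.2.1 * tnth t c.2.2 0 j)).
  by apply: measurable_funB; apply: measurable_funM => //;
    apply: (measurableT_comp (measurable_coord j)); exact: measurable_tnth.
by apply/funext => t; rewrite !mxE.
Qed.

(** 1 / Q = 2 + W_1 / W_2 + W_2 / W_1, and the two masses are independent, so the mean of a quotient
    is a product of a mean and an inverse moment. *)
Lemma slot_Q_inv : (\int[mtup nu (H + H)]_t ((slot_Q t)^-1)%:E <= (6 + 8 * Z / h%:R)%:E)%E.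
Proof.
have w2 := slot_w_ge2; have mw := measurable_slot_w.
have hR : 1 <= h%:R :> R by rewrite ler1n.
have [m wm] : exists m : R, (\int[nu]_x (slot_w x)%:E = m%:E)%E.
  exists (fine (\int[nu]_x (slot_w x)%:E)); rewrite fineK// ge0_fin_numE.
    apply: le_lt_trans (ltry Z); apply: le_trans wZ; apply: nng_int_le => //.
    - exact: measurable_funX.
    - by move=> x; apply: le_trans (w2 x).
    - by move=> x; have := w2 x; nra.
  by apply: nng_int_ge0 => x; apply: le_trans (w2 x).
have m2 := mean_weight_ge2 mw w2 wm.
have Zm := sqr_mean_le mw w2 wm wZ.
pose a := 2 / (h%:R * m) + 8 * Z / (h%:R * m) ^+ 2.
pose F := prefix_mass (H := H) slot_w h.
have F0 s : 0 < F s by apply: lt_le_trans (prefix_mass_ge w2 hH s); lra.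
have mF : measurable_fun setT F by exact: measurable_prefix_mass.
have mFi : measurable_fun setT (fun s => (F s)^-1) by exact: measurable_inv_pos.
have Fi : (\int[mtup nu H]_t ((F t)^-1)%:E <= a%:E)%E := prefix_mass_inv mw w2 hH h0 wm wZ.
have Fm : (\int[mtup nu H]_t (F t)%:E <= (h%:R * m)%:E)%E by rewrite (prefix_mass_mean mw w2 hH wm).
have a0 : 0 <= a by rewrite addr_ge0// divr_ge0// ?mulr_ge0 ?sqr_ge0//; nra.
have hm0 : 0 <= h%:R * m by nra.
apply: (@le_trans _ _ (\int[mtup nu H]_s (2 + a * F s + (h%:R * m) * (F s)^-1)%:E)%E).
  apply: integral_mtup_cat_le.
  - exact: measurable_inv_pos measurable_slot_Q slot_Q_gt0.
  - by apply: measurable_funD; [apply: measurable_funD => //|]; exact: measurable_funM.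
  - by move=> t; rewrite invr_ge0 ltW// slot_Q_gt0.
  move=> s; have Fs := F0 s.
  have -> : 2 + a * F s + h%:R * m * (F s)^-1 = 2 + F s * a + (F s)^-1 * (h%:R * m) by ring.
  rewrite (_ : (fun _ => _) = (fun t => (2 + F s * (F t)^-1 + (F s)^-1 * F t)%:E)).
    by apply: int_affine2_le => //; try (move=> x; rewrite ?invr_ge0; exact: ltW); rewrite ?invr_ge0 ltW.
  apply/funext => t; rewrite /slot_Q slot_W1E slot_W2E slot_left_cat slot_right_cat -/(F s) -/(F t).
  congr (_%:E); field; rewrite !gt_eqF ?addr_gt0//.
apply: (@le_trans _ _ (2 + a * (h%:R * m) + (h%:R * m) * a)%:E).
  by apply: int_affine2_le => // x; rewrite ?invr_ge0; exact: ltW.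
rewrite lee_fin.
have -> : 2 + a * (h%:R * m) + h%:R * m * a = 6 + (2 / m) * (8 * Z / h%:R).
  by rewrite /a; field; rewrite !gt_eqF//; lra.
rewrite lerD2l ler_piMl//; first by rewrite divr_ge0//; nra.
by rewrite ler_pdivrMr; lra.
Qed.

(** Fixing the half that contains the first end leaves a single random point shifted by a constant;
    evenness of [G] absorbs the signs. *)
Lemma slot_pair_le (G : V -> R) (S : R) c : measurable_fun setT G -> (forall x, 0 <= G x) ->
  (forall x, G (- x) = G x) -> 0 <= S ->
  (forall b : V, (\int[nu]_x (G (x - b))%:E <= S%:E)%E) ->
  slot_in1 c.1 -> slot_in2 c.2 ->
  (\int[mtup nu (H + H)]_t (G (slot_z t c))%:E <= S%:E)%E.
Proof.
move=> mG G0 Ge S0 GS h1 /andP[h2 h3].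
rewrite -(integral_pr_cst (mtup nu H) S%:E).
have i1 : (c.1.2 < H)%N by apply: leq_trans hH.
have i2 : (c.2.2 - H < H)%N by rewrite ltn_subLR//; exact: ltn_ord.
have mz : measurable_fun setT (fun t : T => slot_z t c).
  by apply: measurable_fun_rV => j; rewrite (ord1 (0 : 'I_1)); exact: measurable_slot_z.
apply: integral_mtup_cat_le => //; first exact: (measurableT_comp mG mz).
move=> s; pose b := slot_sg c.2.1 *: (slot_sg c.1.1 *: tnth s (Ordinal i1)).
have sq1 (e : bool) (x : V) : slot_sg e *: (slot_sg e *: x) = x.
  by rewrite scalerA /slot_sg -expr2 sqrr_sign scale1r.
have zE (t : H.-tuple V) : G (slot_z [tuple of s ++ t] c) = G (tnth t (Ordinal i2) - b).
  have -> : slot_z [tuple of s ++ t] c = - (slot_sg c.2.1 *: (tnth t (Ordinal i2) - b)).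
    rewrite scalerBr /b sq1 opprB /slot_z; congr (_ *: _ - _ *: _).
      by rewrite !(tnth_nth 0) /= nth_cat size_tuple i1.
    by rewrite !(tnth_nth 0) /= nth_cat size_tuple ltnNge h2.
  by rewrite Ge /slot_sg; case: c.2.1; rewrite ?expr1 ?expr0 ?scaleN1r ?scale1r// Ge.
under eq_integral do rewrite zE.
rewrite (ge0_integral_mtup1 nu (Ordinal i2) (f := fun x => (G (x - b))%:E)); first exact: GS; last first.
  by move=> x; rewrite lee_fin.
apply/measurable_EFinP; apply: (measurableT_comp mG).
apply: measurable_fun_rV => j; under eq_fun do rewrite !mxE.
by apply: measurable_funB => //; exact: measurable_coord.
Qed.

Lemma slot_count1 : \sum_(a : E) (slot_in1 a)%:R = 2 * h%:R :> R.
Proof.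
rewrite -(pair_bigA _ (fun b i => (slot_in1 (b, i))%:R : R)) /= exchange_big /= big_split_ord /=.
rewrite [X in _ + X]big1 ?addr0 => [|i _]; last first.
  by rewrite big1// => b _; rewrite /slot_in1 /= ltnNge (leq_trans hH) ?leq_addr.
rewrite -(@card_prefix R H h hH) [in RHS]big_mkcond mulr_sumr; apply: eq_bigr => i _.
by rewrite /slot_in1 big_bool /=; case: (i < h)%N; rewrite ?mulr1n ?mulr0n; ring.
Qed.

Lemma slot_count2 : \sum_(a : E) (slot_in2 a)%:R = 2 * h%:R :> R.
Proof.
rewrite -(pair_bigA _ (fun b i => (slot_in2 (b, i))%:R : R)) /= exchange_big /= big_split_ord /=.
rewrite [X in X + _]big1 ?add0r => [|i _]; last first.
  by rewrite big1// => b _; rewrite /slot_in2 /= leqNgt ltn_ord.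
rewrite -(@card_prefix R H h hH) [in RHS]big_mkcond mulr_sumr; apply: eq_bigr => i _.
by rewrite /slot_in2 big_bool /= leq_addr ltn_add2l; case: (i < h)%N; rewrite ?mulr1n ?mulr0n; ring.
Qed.

(** The weights depend on the points they multiply, so they are bounded by the indicator of
    admissible pairs. This union bound over (2h)^2 pairs is affordable for a function [G] of tiny
    mean only. *)
Lemma slot_sum_le (G : V -> R) (S : R) : measurable_fun setT G -> (forall x, 0 <= G x) ->
  (forall x, G (- x) = G x) -> 0 <= S ->
  (forall b : V, (\int[nu]_x (G (x - b))%:E <= S%:E)%E) ->
  (\int[mtup nu (H + H)]_t (\sum_c slot_pi t c * G (slot_z t c))%:E <=
   ((2 * h%:R) ^+ 2 * S)%:E)%E.
Proof.
move=> mG G0 Ge S0 GS.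
have mz c : measurable_fun setT (fun t : T => slot_z t c).
  by apply: measurable_fun_rV => j; exact: measurable_slot_z.
have mGz c : measurable_fun setT (fun t : T => G (slot_z t c)) by exact: (measurableT_comp mG (mz c)).
apply: (@le_trans _ _ (\int[mtup nu (H + H)]_t
    (\sum_c (slot_in1 c.1)%:R * (slot_in2 c.2)%:R * G (slot_z t c))%:E)%E).
  apply: nng_int_le => //.
  - by apply: measurable_sum => c; apply: measurable_funM => //; exact: measurable_slot_pi.
  - by apply: measurable_sum => c; exact: measurable_funM.
  - by move=> t; apply: sumr_ge0 => c _; rewrite mulr_ge0 ?slot_pi_ge0.
  - by move=> t; apply: ler_sum => c _; rewrite ler_wpM2r// slot_pi_le1.
rewrite nng_int_sum//; first last.
- by move=> c t; rewrite mulr_ge0// mulr_ge0.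
- by move=> c; exact: measurable_funM.
have -> : ((2 * h%:R) ^+ 2 * S)%:E = (\sum_(c : E * E) ((slot_in1 c.1)%:R * (slot_in2 c.2)%:R * S)%:E)%E.
  rewrite sumEFin -mulr_suml; congr (_ * _)%:E.
  rewrite -(pair_bigA _ (fun a b => (slot_in1 a)%:R * (slot_in2 b)%:R : R)) /=.
  under eq_bigr do rewrite -mulr_sumr slot_count2.
  by rewrite -mulr_suml slot_count1 expr2.
apply: lee_sum => c _.
rewrite nng_intZ// ?mulr_ge0// (EFinM _ S); case h1 : (slot_in1 c.1); case h2 : (slot_in2 c.2);
  rewrite ?mulr1 ?mulr0 ?mul0r ?mul0e// !mul1e.
exact: slot_pair_le.
Qed.

Section moment.
Context (P : 'M[R]_n) (k : nat) (d2 S : R).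
Hypotheses (k0 : (0 < k)%N) (d20 : 0 < d2) (S0 : 0 <= S).
Let G (x : V) : R := (pnorm2 P x / k%:R <= d2)%R%:R * (pnorm2 P x / k%:R) `^ (- (8^-1)).
Hypothesis GS : forall b : V, (\int[nu]_x (G (x - b))%:E <= S%:E)%E.

Lemma measurable_pnorm2_id : measurable_fun setT (fun x : V => pnorm2 P x).
Proof. by apply: measurable_pnorm2_comp => j; exact: measurable_coord. Qed.

Lemma measurable_slot_G : measurable_fun setT G.
Proof.
have m1 : measurable_fun setT (fun x : V => pnorm2 P x / k%:R).
  by apply: measurable_funM => //; exact: measurable_pnorm2_id.
apply: measurable_funM; first exact: measurable_bool_le.
by apply: (measurableT_comp (measurable_powR _)).
Qed.

(** The product xy of the two powers is at most (x^2 + y^2) / 2. Then Q^(-1/8) <= 1 / Q as Q <= 1,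
    and r^(-1/8) is at most d2^(-1/8) except on r <= d2, where it is [G]. *)
Lemma slot_pointwise t c :
  (slot_Q t * pnorm2 P (slot_z t c)) `^ (- (16^-1)) <=
  k%:R `^ (- (16^-1)) / 2 * ((slot_Q t)^-1 + d2 `^ (- (8^-1)) + G (slot_z t c)).
Proof.
have q0 := slot_Q_gt0 t; have q1 := slot_Q_le1 t.
have kR : 0 < k%:R :> R by rewrite ltr0n.
set r := pnorm2 P (slot_z t c) / k%:R.
have r0 : 0 <= r by rewrite divr_ge0 ?pnorm2_ge0.
have -> : slot_Q t * pnorm2 P (slot_z t c) = k%:R * (slot_Q t * r).
  by rewrite /r; field; rewrite gt_eqF.
have -> : (k%:R * (slot_Q t * r)) `^ (- 16^-1) = k%:R `^ (- 16^-1) * (slot_Q t `^ (- 16^-1) * r `^ (- 16^-1)).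
  have qr0 : 0 <= slot_Q t * r by rewrite mulr_ge0// ltW.
  rewrite (powRM _ (ltW kR) qr0); congr (_ * _).
  exact: (powRM _ (ltW q0) r0).
set X := _ + G _; have -> : k%:R `^ (- 16^-1) / 2 * X = k%:R `^ (- 16^-1) * (X / 2) by ring.
apply: ler_wpM2l; first exact: powR_ge0.
rewrite {}/X.
set x := slot_Q t `^ _; set y := r `^ _.
have x2 : x ^+ 2 <= (slot_Q t)^-1.
  rewrite /x -powR_mulrn ?powR_ge0// -powRrM.
  have -> : - 16^-1 * 2%:R = - 8^-1 :> R by field.
  rewrite powRN -[leRHS]powRr1 ?invr_ge0 ?(ltW q0)//.
  have -> : (slot_Q t `^ 8^-1)^-1 = (slot_Q t)^-1 `^ 8^-1.
    by rewrite -(powR_inv1 (ltW q0)) -powRrM mulN1r powRN.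
  by apply: ler_powR; [rewrite invf_ge1|rewrite invf_le1//; lra].
have y2 : y ^+ 2 <= d2 `^ (- 8^-1) + G (slot_z t c).
  have -> : y ^+ 2 = r `^ (- 8^-1).
    by rewrite /y -powR_mulrn ?powR_ge0// -powRrM; congr (_ `^ _); field.
  rewrite /G -/r; have [h1|h1] := leP r d2; first by rewrite mul1r lerDr powR_ge0.
  rewrite mul0r addr0 !powRN lef_pV2 ?posrE ?powR_gt0//; last exact: lt_trans h1.
  by rewrite ge0_ler_powR// ?nnegrE ltW.
have := sqr_ge0 (x - y); lra.
Qed.

(** Only the part with r <= d2 undergoes the union bound; for larger r the weights sum to 1. *)
Lemma slot_moment :
  (\int[mtup nu (H + H)]_t (\sum_c slot_pi t c * (slot_Q t * pnorm2 P (slot_z t c)) `^ (- (16^-1)))%:E <=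
  (k%:R `^ (- (16^-1)) / 2 * (6 + 8 * Z / h%:R + d2 `^ (- (8^-1)) + (2 * h%:R) ^+ 2 * S))%:E)%E.
Proof.
have mG := measurable_slot_G.
have G0 x : 0 <= G x by rewrite mulr_ge0// powR_ge0.
have Ge x : G (- x) = G x by rewrite /G pnorm2N.
have mz c : measurable_fun setT (fun t : T => slot_z t c).
  by apply: measurable_fun_rV => j; exact: measurable_slot_z.
have mGz c : measurable_fun setT (fun t : T => G (slot_z t c)) by exact: (measurableT_comp mG (mz c)).
have mp c : measurable_fun setT (fun t : T => pnorm2 P (slot_z t c)).
  exact: (measurableT_comp measurable_pnorm2_id (mz c)).
pose SG t := \sum_c slot_pi t c * G (slot_z t c).
have mSG : measurable_fun setT SG.
  by apply: measurable_sum => c; apply: measurable_funM => //; exact: measurable_slot_pi.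
have SG0 t : 0 <= SG t by apply: sumr_ge0 => c _; rewrite mulr_ge0 ?slot_pi_ge0.
have D0 : 0 <= d2 `^ (- 8^-1) by exact: powR_ge0.
have K0 : 0 <= k%:R `^ (- 16^-1) / 2 :> R by rewrite divr_ge0// powR_ge0.
have mQi : measurable_fun setT (fun t => (slot_Q t)^-1).
  exact: measurable_inv_pos measurable_slot_Q slot_Q_gt0.
set K := k%:R `^ (- 16^-1) / 2.
apply: (@le_trans _ _ (\int[mtup nu (H + H)]_t (K * d2 `^ (- 8^-1) + K * (slot_Q t)^-1 + K * SG t)%:E)%E).
  apply: nng_int_le => //.
  - apply: measurable_sum => c; apply: measurable_funM; first exact: measurable_slot_pi.
    apply: (measurableT_comp (measurable_powR _)); apply: measurable_funM => //.
    exact: measurable_slot_Q.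
  - by apply: measurable_funD; [apply: measurable_funD => //|]; exact: measurable_funM.
  - by move=> t; apply: sumr_ge0 => c _; rewrite mulr_ge0 ?slot_pi_ge0// powR_ge0.
  move=> t; apply: (@le_trans _ _ (\sum_c slot_pi t c *
      (K * ((slot_Q t)^-1 + d2 `^ (- (8^-1)) + G (slot_z t c))))).
    by apply: ler_sum => c _; rewrite ler_wpM2l ?slot_pi_ge0// slot_pointwise.
  rewrite le_eqVlt; apply/orP; left; apply/eqP.
  rewrite -mulrDr addrC -[X in K * X + _]mul1r -(slot_pi_sum t) mulr_suml -mulrDr /SG -big_split mulr_sumr.
  by apply: eq_bigr => c _ /=; ring.
apply: le_trans (int_affine2_le (P := mtup nu (H + H)) _ _ _ _ _ _ _ slot_Q_inv (slot_sum_le mG G0 Ge S0 GS)) _ => //.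
- by move=> t; rewrite invr_ge0 ltW ?slot_Q_gt0.
- by rewrite mulr_ge0.
by rewrite lee_fin le_eqVlt; apply/orP; left; apply/eqP; ring.
Qed.

End moment.

Lemma slot_null (P : 'M[R]_n) :
  (forall b : V, (\int[nu]_x ((pnorm2 P (x - b) <= 0)%R%:R)%:E <= 0)%E) ->
  (\int[mtup nu (H + H)]_t (\sum_c slot_pi t c * (pnorm2 P (slot_z t c) <= 0)%R%:R)%:E = 0)%E.
Proof.
move=> hP; apply/eqP; rewrite eq_le; apply/andP; split; last first.
  by apply: nng_int_ge0 => t; apply: sumr_ge0 => c _; rewrite mulr_ge0 ?slot_pi_ge0.
rewrite -[leRHS](_ : ((2 * h%:R) ^+ 2 * 0)%:E = 0%E); last by rewrite mulr0.
apply: (slot_sum_le (G := fun x : V => (pnorm2 P x <= 0)%R%:R)) => //.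
- by apply: measurable_bool_le; exact: measurable_pnorm2_id.
- by move=> x; rewrite pnorm2N.
Qed.

End slot.

(** [neg_moment_small] with A = 8 Canti and B = 2 sb_const, the factor 2 relating the conditioned
    law to [mu]. [slot_const] collects the numerical terms of [slot_moment] once the union bound is
    absorbed by [h_rate]. *)
Definition pair_const {R : realType} : R := 1 + 32 * Canti + 2 * sb_const.
Definition slot_const {R : realType} : R := 3 + (sb_radius ^+ 2) `^ (- (8^-1)) / 2 + 2 * pair_const.
(** The square root of the small-ball exponential, i.e. the [a] of [neg_moment_small]. *)
Definition slot_rate {R : realType} (k : nat) : R := expR (- (sb_rate * Num.sqrt k%:R / 2)).

Lemma pair_const_ge0 {R : realType} : 0 <= pair_const :> R.
Proof. by have := @Canti_ge R; have := @sb_const_ge1 R; rewrite /pair_const; lra. Qed.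

Lemma slot_const_ge3 {R : realType} : 3 <= slot_const :> R.
Proof.
have := @pair_const_ge0 R; rewrite /slot_const.
have : 0 <= (sb_radius ^+ 2) `^ (- (8^-1)) / 2 :> R by rewrite divr_ge0// powR_ge0.
lra.
Qed.

Lemma powR_fact {R : realType} n (a : R) : \prod_(k < n) k.+1%:R `^ a = n`!%:R `^ a.
Proof.
elim: n => [|n IH]; first by rewrite big_ord0 powR1.
by rewrite big_ord_recr /= IH factS natrM powRM// mulrC.
Qed.

Section slots.
Context {R : realType} {n : nat} (mu nu : probability 'rV[R]_n R).
Hypotheses (iso : isotropic mu) (lc : log_concave mu).
Hypothesis nu_mu : forall A, measurable A -> pr nu A <= 2 * pr mu A.
Notation V := 'rV[R]_n.

Section one.
Context (P : 'M[R]_n) (hP : is_proj P) (k : nat) (trP : \tr P = k%:R) (k0 : (0 < k)%N).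

Let kR : 0 < k%:R :> R. Proof. by rewrite ltr0n. Qed.

Lemma nu_pair_le (b : V) :
  (\int[nu]_x ((pnorm2 P (x - b) / k%:R <= sb_radius ^+ 2)%R%:R *
      (pnorm2 P (x - b) / k%:R) `^ (- (8^-1)))%:E <= (slot_rate k * pair_const)%:E)%E.
Proof.
have mr : measurable_fun setT (fun x : V => pnorm2 P (x - b) / k%:R).
  by apply: measurable_funM => //; exact: measurable_pnorm2.
have r0 (x : V) : 0 <= pnorm2 P (x - b) / k%:R by rewrite divr_ge0// pnorm2_ge0.
have C0 := @Canti_ge R; have B1 := @sb_const_ge1 R.
have -> : pair_const = 1 + 4 * (8 * Canti) + 2 * sb_const :> R by rewrite /pair_const; ring.
have sE (t : R) : [set x : V | pnorm2 P (x - b) / k%:R <= t] = [set x : V | pnorm2 P (x - b) <= t * k%:R].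
  by apply/seteqP; split => x /=; rewrite ler_pdivrMr.
apply: neg_moment_small => //.
- lra.
- move=> t t0; rewrite sE; apply: le_trans (nu_mu _) _; first exact: measurable_pnorm2_le.
  by have := proj_anticonc iso lc hP trP k0 b t0; lra.
- exact: expR_gt0.
- lra.
rewrite sE; apply: le_trans (nu_mu _) _; first exact: measurable_pnorm2_le.
rewrite -mulrA ler_wpM2l//.
apply: le_trans (proj_small_ball iso lc hP trP k0 b) _.
rewrite /slot_rate -expRM_natl ler_wpM2l//; first lra.
by rewrite le_eqVlt; apply/orP; left; apply/eqP; congr expR; field.
Qed.

Lemma nu_null_le (b : V) : (\int[nu]_x ((pnorm2 P (x - b) <= 0)%R%:R)%:E <= 0)%E.
Proof.
rewrite integral_bool_le; last exact: measurable_pnorm2.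
rewrite lee_fin; apply: le_trans (nu_mu _) _; first exact: measurable_pnorm2_le.
have -> : [set x : V | pnorm2 P (x - b) <= 0] = [set x | pnorm2 P (x - b) = 0].
  apply/seteqP; split => x /= h; last by rewrite h.
  by apply/eqP; rewrite eq_le h pnorm2_ge0.
by rewrite (proj_null iso lc hP trP k0) mulr0.
Qed.

End one.

Context (u : nat -> V -> R) (H : nat) (h : nat -> nat) (Z : nat -> R).
Hypotheses (mu_ : forall k, measurable_fun setT (u k)) (hH : forall k, (h k <= H)%N) (h0 : forall k, (0 < h k)%N).
Hypothesis uZ : forall k, (\int[nu]_x (slot_w (u k) x ^+ 2)%:E <= (Z k)%:E)%E.
Hypothesis h_rate : forall k, (h k)%:R ^+ 2 * slot_rate k <= 1 :> R.
Notation T := ((H + H).-tuple V).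

Definition slots_sum (t : n.-tuple T) : R :=
  chain_sum (fun _ => @slot_z R n H) (fun k => slot_pi (u k) (h k)) (fun k => slot_Q (u k) (h k)) t.

Lemma measurable_slots_sum : measurable_fun setT slots_sum.
Proof.
apply: measurable_chain_sum => k.
- by move=> c j; exact: measurable_slot_z.
- by move=> c; exact: measurable_slot_pi.
- exact: measurable_slot_Q.
Qed.

Lemma slots_small (v : R) : 0 < v ->
  pr (mtup (mtup nu (H + H)) n) [set t | slots_sum t < v / 2] <=
  2 * (v `^ (16^-1) * \prod_(k < n) (k.+1%:R `^ (- (16^-1)) * (slot_const + 4 * Z k.+1 / (h k.+1)%:R))).
Proof.
have Z0 k : 0 <= Z k by rewrite -lee_fin; apply: le_trans (uZ k); apply: nng_int_ge0 => x; exact: sqr_ge0.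
have C3 := @slot_const_ge3 R; have pc := @pair_const_ge0 R.
pose E k := k%:R `^ (- (16^-1)) * (slot_const + 4 * Z k / (h k)%:R) : R.
apply: (@chain_sum_small _ _ _ _ _ _ _ _ _ _ E) => // k.
- by move=> c j; exact: measurable_slot_z.
- by move=> c; exact: measurable_slot_pi.
- exact: measurable_slot_Q.
- by move=> t c; exact: slot_pi_ge0.
- by move=> t; exact: slot_pi_sum.
- by move=> t; exact: slot_Q_gt0.
- by rewrite mulr_ge0 ?powR_ge0// addr_ge0 ?divr_ge0 ?mulr_ge0//; lra.
- move=> P k0 hP trP; apply: slot_null => //.
  by move=> b; exact: (nu_null_le hP trP k0).
move=> P k0 hP trP.
have r2 : 0 < sb_radius ^+ 2 :> R by rewrite exprn_gt0// sb_radius_gt0.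
have S0 : 0 <= slot_rate k * pair_const :> R by rewrite mulr_ge0// expR_ge0.
apply: le_trans (slot_moment (mu_ k) (hH k) (h0 k) (uZ k) k0 r2 S0 (nu_pair_le hP trP k0)) _.
rewrite lee_fin -mulrA; apply: ler_wpM2l; first exact: powR_ge0.
rewrite /slot_const.
have -> : (2 * (h k)%:R) ^+ 2 * (slot_rate k * pair_const) = 4 * pair_const * ((h k)%:R ^+ 2 * slot_rate k) :> R by ring.
have := ler_wpM2l (mulr_ge0 (ler0n R 4) pc) (h_rate k); rewrite mulr1.
have -> : 4 * Z k / (h k)%:R = 8 * Z k / (h k)%:R / 2 by field; rewrite pnatr_eq0 -lt0n.
lra.
Qed.

(** The 16th power undoes the exponent 1/16 of the moments; the factor 16 inside produces the
    probability 16^-n. *)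
Definition slots_kappa (B : R) : R := (16 * (slot_const + B))^-1 ^+ 16.

(** The powers of the ranks multiply to a power of n!, cancelled by the one in the threshold. AM-GM
    bounds the remaining product by its average factor, so only the sum of the ratios Z / h matters,
    not each of them. *)
Lemma slots_small_exp (B : R) : (0 < n)%N -> 0 <= B ->
  \sum_(k < n) 4 * Z k.+1 / (h k.+1)%:R <= n%:R * B ->
  pr (mtup (mtup nu (H + H)) n) [set t | slots_sum t < n`!%:R * slots_kappa B ^+ n / 2] <= 2 * 16^-1 ^+ n.
Proof.
move=> n0 B0 hB.
have Z0 k : 0 <= Z k by rewrite -lee_fin; apply: le_trans (uZ k); apply: nng_int_ge0 => x; exact: sqr_ge0.
have C3 := @slot_const_ge3 R.
have nR : 0 < n%:R :> R by rewrite ltr0n.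
have c0 : 0 < 16 * (slot_const + B) by lra.
have ka0 : 0 < slots_kappa B by rewrite exprn_gt0// invr_gt0.
have f0 : 0 < n`!%:R :> R by rewrite ltr0n fact_gt0.
apply: le_trans (slots_small _) _; first by rewrite mulr_gt0// exprn_gt0.
rewrite ler_wpM2l// big_split /=.
have -> : \prod_(k < n) k.+1%:R `^ (- 16^-1) = (n`!%:R `^ 16^-1)^-1 :> R.
  by rewrite -powRN powR_fact.
have -> : (n`!%:R * slots_kappa B ^+ n) `^ 16^-1 = n`!%:R `^ 16^-1 * (16 * (slot_const + B))^-1 ^+ n.
  have kn0 : 0 <= slots_kappa B ^+ n by rewrite exprn_ge0// ltW.
  rewrite (powRM _ (ltW f0) kn0); congr (_ * _).
  rewrite /slots_kappa -exprM mulnC exprM -powR_mulrn ?exprn_ge0 ?invr_ge0 ?(ltW c0)//.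
  by rewrite -powRrM divff// powRr1// exprn_ge0// invr_ge0 ltW.
have : \prod_(k < n) (slot_const + 4 * Z k.+1 / (h k.+1)%:R) <= (slot_const + B) ^+ n.
  have nn (k : 'I_n) : k \in predT -> 0 <= slot_const + 4 * Z k.+1 / (h k.+1)%:R.
    by move=> _; rewrite addr_ge0 ?divr_ge0 ?mulr_ge0//; lra.
  have := leif_AGM nn; rewrite /= card_ord => -[h1 _]; apply: (le_trans h1).
  rewrite lerXn2r ?nnegrE//.
  - by rewrite divr_ge0 ?(ltW nR)// sumr_ge0// => k kT; exact: nn.
  - lra.
  rewrite ler_pdivrMr// big_split /= sumr_const card_ord (mulrC _ n%:R) mulrDr.
  by apply: lerD; [rewrite mulr_natl|exact: hB].
set p := \prod_(k < n) _ => hp.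
have -> : n`!%:R `^ 16^-1 * (16 * (slot_const + B))^-1 ^+ n * ((n`!%:R `^ 16^-1)^-1 * p) =
    (16 * (slot_const + B))^-1 ^+ n * p.
  by field; rewrite !gt_eqF ?powR_gt0//; lra.
apply: (@le_trans _ _ ((16 * (slot_const + B))^-1 ^+ n * (slot_const + B) ^+ n)).
  by rewrite ler_wpM2l// exprn_ge0// invr_ge0 ltW.
rewrite -exprMn le_eqVlt; apply/orP; left; apply/eqP; congr (_ ^+ _).
by field; rewrite gt_eqF//; lra.
Qed.

End slots.

(** * The averaged softmax map *)

(** The scalar matrix is the sum of eps e_j^T e_j over the standard basis, so Cauchy--Binet expands
    both determinants over the same index set, with coefficients increasing in eps. *)
Lemma det_add_scalar_ge {R : realType} n (I : finType) (c : I -> R) (z : I -> 'rV[R]_n) (eps : R) :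
  (forall r, 0 <= c r) -> 0 <= eps ->
  \det (\sum_r c r *: ((z r)^T *m z r)) <= \det (\sum_r c r *: ((z r)^T *m z r) + eps%:M).
Proof.
move=> c0 e0.
pose z' (r : I + 'I_n) : 'rV[R]_n := match r with inl i => z i | inr j => delta_mx 0 j end.
pose cc (e : R) (r : I + 'I_n) : R := match r with inl i => c i | inr _ => e end.
have E e : \sum_r cc e r *: ((z' r)^T *m z' r) = \sum_r c r *: ((z r)^T *m z r) + e%:M.
  rewrite big_sumType /=; congr (_ + _).
  rewrite -scaler_sumr -scalemx1; congr (_ *: _).
  apply/matrixP => i j; rewrite summxE !mxE (bigD1 i)//= big1 ?addr0.
    by rewrite mxE big_ord1 !mxE !eqxx mul1r /= eq_sym.
  by move=> k ki; rewrite mxE big_ord1 !mxE eqxx /= eq_sym (negPf ki) mul0r.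
have := E 0; rewrite (_ : (0 : R)%:M = 0) ?addr0 => [E0|]; last exact: raddf0.
rewrite -{1}E0 -E -(ler_pM2l (_ : 0 < n`!%:R)) ?ltr0n ?fact_gt0// !cauchy_binet_sum.
apply: ler_sum => f _; apply: ler_wpM2r; first exact: sqr_ge0.
by apply: ler_prod => i _; case: (f i) => r /=; rewrite ?c0 ?lexx.
Qed.

Section softmax_map.
Context {R : realType} {n : nat} (n0 : (0 < n)%N) (H : nat) (h : nat -> nat) (l : nat -> R).
Hypotheses (hH : forall k, (h k <= H)%N) (h0 : forall k, (0 < h k)%N) (l1 : forall k, 1 <= l k).
Notation V := 'rV[R]_n.
Notation E := (bool * 'I_(H + H))%type.
Context (t : n.-tuple ((H + H).-tuple V)).
Implicit Types (xi w : V) (i : 'I_n) (a : E).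

Definition sm_beta i a : R := (slot_in1 (h (n - i)) a || slot_in2 (h (n - i)) a)%:R.
Definition sm_vec i a : V := slot_sg a.1 *: tnth (tnth t i) a.2.
Definition sm_ex xi i a : R := dotp xi (sm_vec i a) / l (n - i)%N.
Definition sm_pr xi i : E -> R := softmax (sm_beta i) (sm_ex xi i).
Definition sm_wt xi i (c : E * E) : R := sm_pr xi i c.1 * sm_pr xi i c.2 / (2 * n%:R * l (n - i)%N).
(* [sder] is the derivative of [smap], each covariance being written as a sum over pairs; only the
   pairs with one point in either half of a slot are kept in [det_sder_ge]. *)
Definition smap xi : V := n%:R^-1 *: \sum_i \sum_a sm_pr xi i a *: sm_vec i a.
Definition sder xi : 'M[R]_n :=
  \sum_i \sum_c sm_wt xi i c *: ((slot_z (tnth t i) c)^T *m slot_z (tnth t i) c).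
Definition sm_u xi k (x : V) : R := dotp xi x / l k.

Let nR : 0 < n%:R :> R. Proof. by rewrite ltr0n. Qed.
Let l0 k : 0 < l k. Proof. exact: lt_le_trans (l1 k). Qed.

Lemma sm_beta0 i a : 0 <= sm_beta i a. Proof. exact: ler0n. Qed.

Lemma sm_betaS i : 0 < \sum_a sm_beta i a.
Proof.
apply: (@lt_le_trans _ _ (\sum_a (slot_in1 (h (n - i)) a)%:R)).
  by rewrite slot_count1// mulr_gt0// ltr0n.
by apply: ler_sum => a _; rewrite ler_nat /sm_beta; case: (slot_in1 _ a).
Qed.
Local Hint Resolve sm_beta0 sm_betaS : core.

Lemma sm_pr_ge0 xi i a : 0 <= sm_pr xi i a.
Proof. exact: softmax_ge0. Qed.

Lemma sm_pr_sum xi i : \sum_a sm_pr xi i a = 1.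
Proof. exact: softmax_sum. Qed.

Lemma sm_wt_ge0 xi i c : 0 <= sm_wt xi i c.
Proof.
by rewrite /sm_wt divr_ge0// mulr_ge0 ?sm_pr_ge0// ?mulr_ge0// ?(ltW nR)// ltW.
Qed.

Lemma smapE xi j : smap xi 0 j = n%:R^-1 * \sum_i softavg (sm_beta i) (sm_ex xi i) (fun a => sm_vec i a 0 j).
Proof.
rewrite mxE summxE; congr (_ * _); apply: eq_bigr => i _; rewrite summxE.
by apply: eq_bigr => a _; rewrite mxE.
Qed.

Lemma sm_exD xi w i : sm_ex (xi + w) i = fun a => sm_ex xi i a + sm_ex w i a.
Proof. by apply/funext => a; rewrite /sm_ex dotpDl mulrDl. Qed.

Lemma dotp_smap xi w : dotp (smap xi) w =
  n%:R^-1 * \sum_(i < n) l (n - i)%N * softavg (sm_beta i) (sm_ex xi i) (sm_ex w i).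
Proof.
rewrite dotpZl dotp_suml; congr (_ * _); apply: eq_bigr => i _.
rewrite dotp_suml -softavgZ; apply: eq_bigr => a _.
by rewrite dotpZl /sm_ex (dotpC w); congr (_ * _); field; rewrite gt_eqF.
Qed.

(** [smap] is the gradient of the convex function n^-1 sum_i l_i log sum_a exp (<xi, v_a> / l_i),
    with a running over the points in use; what is proved is monotonicity, slot by slot. *)
Lemma smap_mono xi w : 0 <= dotp (smap (xi + w) - smap xi) w.
Proof.
rewrite dotpBl !dotp_smap -mulrBr -sumrB mulr_ge0 ?invr_ge0 ?(ltW nR)//.
apply: sumr_ge0 => i _; rewrite -mulrBr mulr_ge0 ?(ltW (l0 _))// subr_ge0 sm_exD.
exact: softavg_monotone.
Qed.

Lemma sder_mul xi w j : (w *m sder xi) 0 j =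
  n%:R^-1 * \sum_i softcov (sm_beta i) (sm_ex xi i) (fun a => sm_vec i a 0 j) (sm_ex w i).
Proof.
rewrite /sder mulmx_sumr summxE mulr_sumr; apply: eq_bigr => i _.
rewrite mulmx_sumr summxE softcovE// pair_big mulr_sumr /=; apply: eq_bigr => -[a b] _ /=.
rewrite -scalemxAr mulmxA mxE.
have -> : w *m (slot_z (tnth t i) (a, b))^T = (l (n - i)%N * (sm_ex w i a - sm_ex w i b))%:M.
  apply/matrixP => x y; rewrite !ord1 mxE [in RHS]mxE eqxx mulr1n.
  transitivity (dotp w (sm_vec i a - sm_vec i b)); last first.
    by rewrite dotpBr /sm_ex; field; rewrite gt_eqF.
  by apply: eq_bigr => k _; rewrite [in LHS]mxE.
rewrite mul_scalar_mx /sm_wt /= !mxE -/(sm_vec i a) -/(sm_vec i b) /sm_pr.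
by rewrite /=; field; rewrite !gt_eqF.
Qed.

Lemma smap_taylor (r hh : R) xi w : 0 <= r -> n%:R * hh * r <= 1 / 4 ->
  (forall i (a : 'I_(H + H)) j, `|tnth (tnth t i) a 0 j| <= r) -> (forall j, `|w 0 j| <= hh) ->
  forall j, `|(smap (xi + w) - smap xi - w *m sder xi) 0 j| <= 16 * r * (n%:R * r) ^+ 2 * hh ^+ 2.
Proof.
move=> r0 hr tr wh j; have hh0 : 0 <= hh by apply: le_trans (wh j).
have vr i a k : `|sm_vec i a 0 k| <= r.
  by rewrite mxE normrM /slot_sg normrX normrN1 expr1n mul1r.
have gr i a : `|sm_ex w i a| <= n%:R * hh * r.
  rewrite normrM normfV (gtr0_norm (l0 _)) ler_pdivrMr//.
  apply: (@le_trans _ _ (n%:R * hh * r)); last by rewrite ler_peMr ?mulr_ge0.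
  apply: (le_trans (ler_norm_sum _ _ _)).
  apply: (@le_trans _ _ (\sum_(k < n) hh * r)).
    by apply: ler_sum => k _; rewrite normrM ler_pM.
  by rewrite sumr_const card_ord -[leRHS]mulrA mulr_natl.
rewrite mxE [X in `|X + _|]mxE [X in `|_ + X + _|]mxE [X in `|_ + X|]mxE !smapE sder_mul -!mulrBr -!sumrB normrM.
rewrite ger0_norm ?invr_ge0 ?(ltW nR)// mulrC ler_pdivrMr//.
apply: (le_trans (ler_norm_sum _ _ _)).
apply: (@le_trans _ _ (\sum_(i < n) 16 * r * (n%:R * hh * r) ^+ 2)).
  by apply: ler_sum => i _; rewrite sm_exD; exact: softavg_taylor.
rewrite sumr_const card_ord -mulr_natr le_eqVlt; apply/orP; left; apply/eqP; ring.
Qed.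

Lemma sm_massE xi i : softmax_mass (sm_beta i) (sm_ex xi i) =
  slot_W1 (sm_u xi (n - i)) (h (n - i)) (tnth t i) + slot_W2 (sm_u xi (n - i)) (h (n - i)) (tnth t i).
Proof.
rewrite /softmax_mass /slot_W1 /slot_W2 [X in _ = X + _]big_mkcond [X in _ = _ + X]big_mkcond -big_split.
apply: eq_bigr => a _; rewrite /sm_beta.
have -> : expR (sm_ex xi i a) = slot_e (sm_u xi (n - i)) (tnth t i) a.
  by rewrite /sm_ex /slot_e /sm_u /sm_vec dotpZr mulrA.
case h1 : (slot_in1 _ a) => /=; last by case: (slot_in2 _ a); rewrite ?mul1r ?mul0r ?add0r ?addr0.
have -> : slot_in2 (h (n - i)) a = false.
  by apply/negbTE; rewrite negb_and -ltnNge (leq_trans h1).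
by rewrite mul1r addr0.
Qed.

(** On pairs with one end in either half the two sides agree up to the factor split between [slot_Q]
    and [slot_pi]; on all other pairs the left side is 0. *)
Lemma sm_wt_ge xi i c :
  (2 * n%:R * l (n - i)%N)^-1 * (slot_Q (sm_u xi (n - i)) (h (n - i)) (tnth t i) *
    slot_pi (sm_u xi (n - i)) (h (n - i)) (tnth t i) c) <= sm_wt xi i c.
Proof.
have W1 := slot_W1_gt0 (sm_u xi (n - i)) (hH (n - i)) (h0 (n - i)) (tnth t i).
have W2 := slot_W2_gt0 (sm_u xi (n - i)) (hH (n - i)) (h0 (n - i)) (tnth t i).
rewrite /sm_wt mulrC ler_pM2r ?invr_gt0 ?mulr_gt0// /sm_pr /softmax sm_massE.
rewrite /slot_Q /slot_pi; set w1 := slot_W1 _ _ _ in W1 *; set w2 := slot_W2 _ _ _ in W2 *.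
have eE a : expR (sm_ex xi i a) = slot_e (sm_u xi (n - i)) (tnth t i) a.
  by rewrite /sm_ex /slot_e /sm_u /sm_vec dotpZr mulrA.
rewrite !eE; set e1 := slot_e _ _ c.1; set e2 := slot_e _ _ c.2.
have e10 : 0 <= e1 by exact: expR_ge0.
have e20 : 0 <= e2 by exact: expR_ge0.
set b1 := (slot_in1 _ _)%:R; set b2 := (slot_in2 _ _)%:R.
have -> : w1 * w2 / (w1 + w2) ^+ 2 * (b1 * b2 * (e1 * e2) / (w1 * w2)) = (b1 * e1 / (w1 + w2)) * (b2 * e2 / (w1 + w2)).
  by field; rewrite !gt_eqF ?addr_gt0.
have w0 : 0 <= (w1 + w2)^-1 by rewrite invr_ge0 addr_ge0// ltW.
have hb1 : b1 <= sm_beta i c.1 by rewrite ler_nat; case: (slot_in1 _ c.1).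
have hb2 : b2 <= sm_beta i c.2 by rewrite ler_nat; case: (slot_in2 _ c.2); rewrite ?orbT.
by rewrite ler_pM ?mulr_ge0 ?ler0n// ler_wpM2r// ler_wpM2r.
Qed.

(** Slots are labelled by the rank n - i that remains, so the product of the temperatures is
    reindexed by reversal. *)
Lemma det_sder_ge xi :
  \prod_(i < n) (2 * n%:R * l i.+1)^-1 * slots_sum (sm_u xi) h t <= \det (sder xi).
Proof.
apply: le_trans (det_sum_blocks_ge _ (sm_wt_ge0 xi)).
rewrite /slots_sum /chain_sum mulr_sumr; apply: ler_sum => f _.
rewrite mulrA; apply: ler_wpM2r; first exact: sqr_ge0.
have -> : \prod_(i < n) (2 * n%:R * l i.+1)^-1 = \prod_(i < n) (2 * n%:R * l (n - i)%N)^-1.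
  rewrite [RHS](reindex_inj rev_ord_inj) /=; apply: eq_bigr => i _.
  by rewrite subKn// ltn_ord.
rewrite -big_split; apply: ler_prod => i _ /=; rewrite sm_wt_ge andbT.
rewrite mulr_ge0 ?invr_ge0//; first by rewrite !mulr_ge0 ?(ltW nR) ?(ltW (l0 _)).
by apply: mulr_ge0; [exact/ltW/slot_Q_gt0|exact: slot_pi_ge0].
Qed.

Lemma det_sder_eps xi (eps : R) : 0 <= eps -> \det (sder xi) <= \det (sder xi + eps%:M).
Proof.
move=> e0; rewrite /sder pair_big /=.
apply: (@det_add_scalar_ge _ _ _ (fun p => sm_wt xi p.1 p.2) (fun p => slot_z (tnth t p.1) p.2)) => //.
by move=> p; exact: sm_wt_ge0.
Qed.

End softmax_map.

(** The exceptional set is the limit inferior of the [A j]. It is needed because the mesh has to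
    tend to 0 for one and the same sample, while for each mesh a different set of samples fails;
    outside it, infinitely many meshes succeed. *)
Lemma pr_frequently {d : measure_display} {T : measurableType d} {R : realType}
    (P : probability T R) (A : nat -> set T) (dl : R) :
  (forall j, measurable (A j)) -> (forall j, pr P (A j) <= dl) ->
  exists B, [/\ measurable B, pr P B <= dl & forall t, ~ B t -> forall J, exists2 j, (J <= j)%N & ~ A j t].
Proof.
move=> mA hA; pose F J := \bigcap_(j in [set j | (J <= j)%N]) A j.
have mF J : measurable (F J) by apply: bigcap_measurable => [|j _]; [exists J => /=|exact: mA].
have mB : measurable (\bigcup_J F J) by exact: bigcup_measurable.
exists (\bigcup_J F J); split => //.
- have ndF : {homo F : a b / (a <= b)%N >-> (a <= b)%O}.
    by move=> a b ab; apply/subsetPset => t ta j jb; apply: ta; exact: leq_trans jb.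
  have cv := @nondecreasing_cvg_mu _ _ _ P F mF mB ndF.
  rewrite -lee_fin prK// -(cvg_lim _ cv)//; apply: lime_le; first by apply/cvg_ex; exists (P (\bigcup_J F J)).
  near=> J; rewrite /= -(prK P (mF J)) lee_fin; apply: le_trans (hA J).
  by apply: pr_le => // t; apply; exact: leqnn.
- move=> t Bt J; apply: contrapT => hn; apply: Bt; exists J => // j Jj.
  by apply: contrapT => hA'; apply: hn; exists j.
Unshelve. all: by end_near. Qed.

Lemma int_le_on {d : measure_display} {T : measurableType d} {R : realType}
    (P : probability T R) (f : T -> R) (G : set T) (c : R) :
  measurable_fun setT f -> (forall x, 0 <= f x) -> measurable G -> P (~` G) = 0%E -> 0 <= c ->
  (forall x, G x -> f x <= c) -> (\int[P]_x (f x)%:E <= c%:E)%E.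
Proof.
move=> mf f0 mG nG c0 fc.
have mfE : measurable_fun setT (fun x => (f x)%:E) by exact/measurable_EFinP.
rewrite (@ge0_negligible_integral _ _ _ P setT (~` G))//; try exact: measurableC; try (by move=> x _; rewrite lee_fin).
have -> : setT `\` ~` G = G by rewrite setTD setCK.
apply: (@le_trans _ _ (\int[P]_(x in G) (c%:E))%E).
  apply: ge0_le_integral => //; try (by move=> x Gx; rewrite lee_fin// fc).
  exact: measurable_funS mfE.
rewrite integral_cst// -[leRHS]mule1; apply: lee_wpmul2l; first by rewrite lee_fin.
exact: probability_le1.
Qed.

(** * Exponential weights averaged over a grid *)

Section grid.
Context {R : realType} {n : nat} (rho : R) (m : nat).
Hypotheses (rho0 : 0 < rho) (m0 : (0 < m)%N).
Implicit Types f : {ffun 'I_n -> 'I_m}.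

(** The midpoints of the m equal subintervals of [-1, 1]; the family is symmetric, so exponentials
    average to hyperbolic cosines. *)
Definition grid_u (j : 'I_m) : R := (2 * j%:R + 1 - m%:R) / m%:R.
Definition grid_pt f : 'rV[R]_n := \row_j (rho * grid_u (f j)).

Let mR : 0 < m%:R :> R. Proof. by rewrite ltr0n. Qed.

Lemma grid_u_le1 j : `|grid_u j| <= 1.
Proof.
rewrite normrM normfV (gtr0_norm mR) ler_pdivrMr// mul1r ler_norml.
have h1 : j%:R + 1 <= m%:R :> R by rewrite natr1 ler_nat ltn_ord.
have h2 : 0 <= j%:R :> R by exact: ler0n.
lra.
Qed.

Lemma grid_u_rev j : grid_u (rev_ord j) = - grid_u j.
Proof.
rewrite /grid_u /= natrB; last exact: ltn_ord.
by rewrite -[j.+1%:R]natr1; field; rewrite gt_eqF.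
Qed.

Lemma grid_sep f g : f != g -> exists j, 2 * rho / m%:R <= `|(grid_pt f - grid_pt g) 0 j|.
Proof.
move=> fg; have [j fgj] : exists j, f j != g j.
  apply: contrapT => hn; move/eqP: fg; apply; apply/ffunP => j.
  by apply/eqP; apply: contrapT => h; apply: hn; exists j; apply/negP.
exists j; rewrite !mxE -mulrBr.
have -> : rho * (grid_u (f j) - grid_u (g j)) = 2 * rho / m%:R * ((f j)%:R - (g j)%:R).
  by rewrite /grid_u; field; rewrite gt_eqF.
have c0 : 0 < 2 * rho / m%:R by rewrite divr_gt0 ?mulr_gt0.
rewrite normrM (gtr0_norm c0) ler_peMr ?(ltW c0)//.
by apply: natr_dist_ge1 => h; move/eqP: fgj; apply; apply: val_inj.
Qed.

Lemma grid_bound f j : `|grid_pt f 0 j| <= rho.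
Proof. by rewrite mxE normrM (gtr0_norm rho0) ler_piMr ?grid_u_le1// ltW. Qed.

Lemma cosh_le (x : R) : (expR x + expR (- x)) / 2 <= expR (2 * x ^+ 2).
Proof.
wlog x0 : x / 0 <= x.
  move=> hw; have [|xn] := leP 0 x; first exact: hw.
  by have := hw (- x); rewrite opprK sqrrN addrC; apply; rewrite oppr_ge0 ltW.
have [x1|x1] := leP (1 / 2) x.
  have h1 : expR (- x) <= expR x by rewrite ler_expR; lra.
  have : expR x <= expR (2 * x ^+ 2) by rewrite ler_expR; nra.
  lra.
have y0 : 0 <= x ^+ 2 by exact: sqr_ge0.
have y1 : x ^+ 2 <= 1 / 4 by nra.
have h1 : expR x <= (1 - x)^-1.
  rewrite -[x in expR x]opprK expRN lef_pV2 ?posrE ?expR_gt0//; last lra.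
  by have := expR_ge1Dx (- x); lra.
have h2 : expR (- x) <= (1 + x)^-1.
  rewrite expRN lef_pV2 ?posrE ?expR_gt0//; last lra.
  by have := expR_ge1Dx x; lra.
apply: (@le_trans _ _ (1 + 2 * x ^+ 2)); last by exact: expR_ge1Dx.
apply: (@le_trans _ _ ((1 - x ^+ 2)^-1)).
  have -> : (1 - x ^+ 2)^-1 = ((1 - x)^-1 + (1 + x)^-1) / 2.
    by field; apply/and3P; split; rewrite gt_eqF//; nra.
  lra.
rewrite -[leLHS]mul1r ler_pdivrMr; last lra.
nra.
Qed.

Lemma grid_expR_avg (y : R) : \sum_j expR (y * grid_u j) <= m%:R * expR (2 * y ^+ 2).
Proof.
have e1 : \sum_j expR (y * grid_u j) = \sum_j (expR (y * grid_u j) + expR (- (y * grid_u j))) / 2.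
  rewrite -mulr_suml big_split /=.
  have -> : \sum_j expR (- (y * grid_u j)) = \sum_j expR (y * grid_u j).
    rewrite (reindex_inj rev_ord_inj) /=; apply: eq_bigr => j _.
    by rewrite grid_u_rev mulrN opprK.
  by field.
rewrite e1; apply: (@le_trans _ _ (\sum_(j < m) expR (2 * y ^+ 2))); last first.
  by rewrite sumr_const card_ord [leRHS]mulr_natl.
apply: ler_sum => j _; apply: le_trans (cosh_le _) _.
rewrite ler_expR ler_wpM2l// exprMn ler_piMr ?sqr_ge0//.
by have := grid_u_le1 j; rewrite -(ler_sqr (x := `|_|)) ?nnegrE// expr1n real_normK ?num_real.
Qed.

Lemma grid_dotp_avg (x : 'rV[R]_n) (c : R) :
  \sum_f expR (c * dotp (grid_pt f) x) <= m%:R ^+ n * expR (2 * (c * rho) ^+ 2 * dotp x x).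
Proof.
apply: (@le_trans _ _ (\sum_(f : {ffun 'I_n -> 'I_m}) \prod_(j < n) expR ((c * rho * x 0 j) * grid_u (f j)))).
  rewrite le_eqVlt; apply/orP; left; apply/eqP; apply: eq_bigr => f _.
  rewrite -expR_sum /dotp mulr_sumr; congr expR; apply: eq_bigr => j _.
  by rewrite mxE; ring.
rewrite -(bigA_distr_bigA (fun (i : 'I_n) j => expR ((c * rho * x 0 i) * grid_u j))).
apply: (@le_trans _ _ (\prod_(i < n) (m%:R * expR (2 * (c * rho * x 0 i) ^+ 2)))).
  apply: ler_prod => i _; rewrite grid_expR_avg andbT.
  by apply: sumr_ge0 => j _; exact: expR_ge0.
rewrite big_split /= prodr_const card_ord ler_wpM2l ?exprn_ge0//.
rewrite -expR_sum /dotp mulr_sumr le_eqVlt; apply/orP; left; apply/eqP; congr expR.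
by apply: eq_bigr => i _; ring.
Qed.

(** Averaging over the grid makes the exponent sub-Gaussian, of order rho^2 |x|^2 / l^2, whereas a
    single grid point aligned with x may give one of order rho sqrt n |x| / l. *)
Lemma grid_weight_avg (x : 'rV[R]_n) (l : R) : 0 < l ->
  \sum_f slot_w (fun y => dotp (grid_pt f) y / l) x ^+ 2 <=
  m%:R ^+ n * (4 * expR (8 * rho ^+ 2 / l ^+ 2 * dotp x x)).
Proof.
move=> l0; pose e := expR (8 * rho ^+ 2 / l ^+ 2 * dotp x x); rewrite -/e.
have e1 : 1 <= e.
  by rewrite /e -[leLHS]expR0 ler_expR mulr_ge0 ?dotp_ge0// divr_ge0 ?sqr_ge0// mulr_ge0// sqr_ge0.
have wE f : slot_w (fun y => dotp (grid_pt f) y / l) x ^+ 2 =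
    2 + (expR ((2 / l) * dotp (grid_pt f) x) + expR (- (2 / l) * dotp (grid_pt f) x)).
  rewrite /slot_w sqrrD -expRD subrr expR0 -mulr_natl mulr1 -!expRM_natl.
  by rewrite addrAC addrC; congr (_ + (expR _ + expR _)); field; rewrite gt_eqF.
under eq_bigr do rewrite wE.
rewrite big_split /= [X in _ + X]big_split /= sumr_const card_ffun !card_ord.
have -> : (2 : R) *+ (m ^ n) = 2 * m%:R ^+ n by rewrite -[LHS]mulr_natr natrX.
have h1 := grid_dotp_avg x (2 / l); have h2 := grid_dotp_avg x (- (2 / l)).
have e2 : expR (2 * (2 / l * rho) ^+ 2 * dotp x x) = e.
  by rewrite /e; congr expR; field; rewrite gt_eqF.
have e3 : expR (2 * (- (2 / l) * rho) ^+ 2 * dotp x x) = e.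
  by rewrite /e; congr expR; field; rewrite gt_eqF.
rewrite e2 in h1; rewrite e3 in h2.
have M0 : 0 <= m%:R ^+ n :> R by rewrite exprn_ge0.
have : m%:R ^+ n * 1 <= m%:R ^+ n * e by rewrite ler_wpM2l.
lra.
Qed.

End grid.

(** * Volume of the hull from finer and finer meshes *)

Section mesh.
Context {R : realType} {n : nat} (n0 : (0 < n)%N) (mu nu : probability 'rV[R]_n R).
Hypotheses (iso : isotropic mu) (lc : log_concave mu).
Hypothesis nu_mu : forall A, measurable A -> pr nu A <= 2 * pr mu A.
Context (H : nat) (h : nat -> nat) (l : nat -> R).
Hypotheses (hH : forall k, (h k <= H)%N) (h0 : forall k, (0 < h k)%N) (l1 : forall k, 1 <= l k).
Hypothesis h_rate : forall k, (h k)%:R ^+ 2 * slot_rate k <= 1 :> R.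
Context (G : set 'rV[R]_n) (D cw rho : R).
Hypotheses (mG : measurable G) (nG : nu (~` G) = 0%E) (GD : forall x, G x -> dotp x x <= D).
Hypotheses (rho0 : 0 < rho) (cw0 : 0 < cw) (D0 : 0 <= D).
Hypothesis h_cw : forall k, (0 < k)%N -> 4 * expR (8 * rho ^+ 2 / l k ^+ 2 * D) <= cw * (h k)%:R.
Notation V := 'rV[R]_n.
Notation T := ((H + H).-tuple V).

Let l0 k : 0 < l k. Proof. exact: lt_le_trans (l1 k). Qed.
Let nR : 0 < n%:R :> R. Proof. by rewrite ltr0n. Qed.

Lemma measurable_sm_u (xi : V) k : measurable_fun setT (sm_u l xi k).
Proof.
rewrite /sm_u; apply: measurable_funM => //.
rewrite (_ : dotp xi = (fun x => dotp x xi)); first exact: measurable_dotp.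
by apply/funext => x; rewrite dotpC.
Qed.

Definition mesh_const : R := slots_kappa (8 * cw).

Lemma mesh_const_gt0 : 0 < mesh_const.
Proof.
have C3 := @slot_const_ge3 R.
by rewrite exprn_gt0// invr_gt0 mulr_gt0// addr_gt0 ?mulr_gt0//; lra.
Qed.

Lemma slots_sum_ge0 xi (t : n.-tuple T) : 0 <= slots_sum (sm_u l xi) h t.
Proof.
apply: sumr_ge0 => f _; rewrite mulr_ge0 ?sqr_ge0//; apply: prodr_ge0 => i _.
by apply: mulr_ge0; [exact/ltW/slot_Q_gt0|exact: slot_pi_ge0].
Qed.

Section one_mesh.
Context (m : nat) (m0 : (0 < m)%N).
Notation A := {ffun 'I_n -> 'I_m}.
Notation pt := (grid_pt rho).
Let mR : 0 < m%:R ^+ n :> R. Proof. by rewrite exprn_gt0// ltr0n. Qed.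

Let w (f : A) k x : R := slot_w (sm_u l (pt f) k) x ^+ 2.

Let mw f k : measurable_fun setT (w f k).
Proof. by apply: measurable_funX; apply: measurable_slot_w; exact: measurable_sm_u. Qed.

Let w0 f k x : 0 <= w f k x. Proof. exact: sqr_ge0. Qed.

Lemma mesh_weight_sum k : (\sum_(f : A) \int[nu]_x (w f k x)%:E <=
  (m%:R ^+ n * (4 * expR (8 * rho ^+ 2 / l k ^+ 2 * D)))%:E)%E.
Proof.
rewrite -nng_int_sum//.
apply: (int_le_on _ _ mG nG).
- by apply: measurable_sum => f; exact: mw.
- by move=> x; apply: sumr_ge0 => f _; exact: w0.
- by rewrite mulr_ge0 ?(ltW mR)// mulr_ge0// expR_ge0.
move=> x Gx; apply: le_trans (@grid_weight_avg R n rho m m0 x (l k) (l0 k)) _.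
rewrite ler_pM2l// ler_pM2l// ler_expR ler_wpM2l ?GD//.
by rewrite divr_ge0 ?sqr_ge0// mulr_ge0// sqr_ge0.
Qed.

Lemma mesh_weight_fin f k : exists z : R, (\int[nu]_x (w f k x)%:E = z%:E)%E.
Proof.
exists (fine (\int[nu]_x (w f k x)%:E)); rewrite fineK// ge0_fin_numE.
  apply: le_lt_trans (ltry (m%:R ^+ n * (4 * expR (8 * rho ^+ 2 / l k ^+ 2 * D)))).
  apply: le_trans (mesh_weight_sum k); rewrite (bigD1 f)//= leeDl//.
  by apply: sume_ge0 => g _; exact: nng_int_ge0.
exact: nng_int_ge0.
Qed.

Let v : R := n`!%:R * mesh_const ^+ n.

(** At least half of the grid points have moderate weights, and for each of these the slot sum is
    small with probability at most 2 / 16^n. By Markov, except with probability 8 / 16^n, fewer than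
    a quarter of the grid points are lost among them, so a quarter remain with slot sum at least v /
    2. *)
Lemma mesh_event : exists B, [/\ measurable B,
  pr (mtup (mtup nu (H + H)) n) B <= 8 * 16^-1 ^+ n &
  forall t, ~ B t -> m%:R ^+ n * (v / 8) <= \sum_(f : A) slots_sum (sm_u l (pt f)) h t].
Proof.
have C3 := @slot_const_ge3 R.
have v0 : 0 < v by rewrite mulr_gt0 ?ltr0n ?fact_gt0// exprn_gt0// mesh_const_gt0.
have /choice[Z ZE] : forall f, exists z : nat -> R, forall k, (\int[nu]_x (w f k x)%:E = (z k)%:E)%E.
  by move=> f; have /choice[z hz] := mesh_weight_fin f; exists z.
have Z0 f k : 0 <= Z f k by rewrite -lee_fin -ZE; exact: nng_int_ge0.
have Zsum k : (0 < k)%N -> \sum_(f : A) 4 * Z f k / (h k)%:R <= m%:R ^+ n * (4 * cw).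
  move=> k0; rewrite -mulr_suml ler_pdivrMr ?ltr0n// -mulr_sumr.
  have : \sum_f Z f k <= m%:R ^+ n * (4 * expR (8 * rho ^+ 2 / l k ^+ 2 * D)).
    by rewrite -lee_fin -sumEFin; under eq_bigr do rewrite -ZE; exact: mesh_weight_sum.
  have := ler_wpM2l (ltW mR) (h_cw k0); lra.
(* The threshold is twice the bound on the grid average, so at least half of the grid points
   qualify. *)
pose S (f : A) : bool := (\sum_(k < n) 4 * Z f k.+1 / (h k.+1)%:R <= n%:R * (8 * cw)).
have cntS : m%:R ^+ n / 2 <= \sum_f (S f)%:R :> R.
  have : \sum_(f : A) (1 - (S f)%:R) * (n%:R * (8 * cw)) <= m%:R ^+ n * (4 * cw) * n%:R.
    apply: (@le_trans _ _ (\sum_(f : A) \sum_(k < n) 4 * Z f k.+1 / (h k.+1)%:R)).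
      apply: ler_sum => f _; rewrite /S; have [h1|h1] := leP _ (n%:R * (8 * cw)).
        rewrite subrr mul0r; apply: sumr_ge0 => k _.
        by rewrite divr_ge0// mulr_ge0.
      by rewrite subr0 mul1r ltW.
    rewrite exchange_big /= mulr_natr; apply: (@le_trans _ _ (\sum_(k < n) m%:R ^+ n * (4 * cw))).
      by apply: ler_sum => k _; exact: Zsum.
    by rewrite sumr_const card_ord.
  rewrite -mulr_suml sumrB sumr_const card_ffun !card_ord natrX.
  set s := \sum_f _; have -> : m%:R ^+ n * (4 * cw) * n%:R = m%:R ^+ n / 2 * (n%:R * (8 * cw)) :> R by field.
  rewrite ler_pM2r; last by rewrite mulr_gt0// mulr_gt0.
  lra.
pose Af (f : A) := [set t : n.-tuple T | slots_sum (sm_u l (pt f)) h t < v / 2].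
have mAf f : measurable (Af f).
  by apply: measurable_lt_cst; apply: measurable_slots_sum => // k; exact: measurable_sm_u.
(* With these weights the exceptional event says that at least m^n / 4 of the points counted by [S]
   are bad. *)
pose wt (f : A) : R := (S f)%:R * (4 / m%:R ^+ n).
have wt0 f : 0 <= wt f by rewrite mulr_ge0// divr_ge0// ltW.
have mfun : measurable_fun setT (fun t : n.-tuple T => \sum_f wt f * \1_(Af f) t).
  by apply: measurable_sum => f; apply: measurable_funM => //; exact: measurable_indic.
exists [set t | 1 <= \sum_f wt f * \1_(Af f) t]; split.
- exact: measurable_ge_cst.
- apply: le_trans (pr_le_wsum _ _ mAf wt0 _) _ => //; first exact: measurable_ge_cst.
  apply: (@le_trans _ _ (\sum_(f : A) (4 / m%:R ^+ n) * (2 * 16^-1 ^+ n))).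
    apply: ler_sum => f _; rewrite /wt; case hS : (S f); last first.
      by rewrite mul0r mul0r mulr_ge0 ?divr_ge0 ?(ltW mR)// mulr_ge0// exprn_ge0// invr_ge0.
    rewrite mul1r ler_wpM2l//.
    apply: (slots_small_exp iso lc nu_mu (Z := Z f)) => //.
    - by move=> k; exact: measurable_sm_u.
    - by move=> k; rewrite -ZE.
    - by rewrite mulr_ge0// ltW.
  rewrite sumr_const card_ffun !card_ord -[X in X <= _]mulr_natr natrX le_eqVlt; apply/orP; left; apply/eqP.
  by field; rewrite gt_eqF.
move=> t /negP; rewrite -ltNge => ht.
have hb : (\sum_(f : A) (S f)%:R * \1_(Af f) t : R) < m%:R ^+ n / 4.
  move: ht; have -> : \sum_f wt f * \1_(Af f) t = (\sum_f (S f)%:R * \1_(Af f) t) * (4 / m%:R ^+ n).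
    by rewrite mulr_suml; apply: eq_bigr => f _; rewrite /wt mulrAC.
  set s := \sum_f _; rewrite mulrA ltr_pdivrMr// mul1r => hs; lra.
apply: (@le_trans _ _ (\sum_(f : A) ((S f)%:R - (S f)%:R * \1_(Af f) t) * (v / 2))).
  rewrite -mulr_suml sumrB.
  have -> : m%:R ^+ n * (v / 8) = m%:R ^+ n / 4 * (v / 2) by field.
  by rewrite ler_pM2r ?divr_gt0//; lra.
apply: ler_sum => f _; have s0 := slots_sum_ge0 (pt f) t.
rewrite indicE; have [h1|h1] := ltP (slots_sum (sm_u l (pt f)) h t) (v / 2).
  by rewrite mem_set// mulr1 subrr mul0r.
rewrite memNset; last by rewrite /Af /= ltNge h1.
rewrite mulr0 subr0; case: (S f); rewrite ?mul1r ?mul0r//.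
Qed.

End one_mesh.

(** Cells of volume (rho / m)^n, times m^n grid points, times the average lower bound for the
    determinant: the mesh m cancels. *)
Definition mesh_volume : R :=
  rho ^+ n * \prod_(i < n) (2 * n%:R * l i.+1)^-1 * (n`!%:R * mesh_const ^+ n / 8).

Definition mesh_thick (r : R) (m : nat) : R :=
  16 * r * (n%:R * r) ^+ 2 * (2 * rho / m%:R) ^+ 2 +
  (4 * n%:R * (16 * r * (n%:R * r) ^+ 2) + 1) * (2 * rho / m%:R) * (rho + 2 * rho / m%:R).

Lemma packing_mesh (K : set V) (r : R) (t : n.-tuple T) m : (0 < m)%N -> compact K ->
  (forall (I : finType) (q : I -> R) (y : I -> V), (forall i, 0 <= q i) -> \sum_i q i = 1 ->
    (forall i, K (y i)) -> K (\sum_i q i *: y i)) ->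
  (forall i a, K (sm_vec t i a)) -> 0 <= r ->
  (forall i (a : 'I_(H + H)) j, `|tnth (tnth t i) a 0 j| <= r) ->
  m%:R ^+ n * (n`!%:R * mesh_const ^+ n / 8) <=
    \sum_(f : {ffun 'I_n -> 'I_m}) slots_sum (sm_u l (grid_pt rho f)) h t ->
  n%:R * (2 * rho / m%:R) * r <= 1 / 4 ->
  (mesh_volume%:E <= lebesgue_rV n (thicken K (mesh_thick r m)))%E.
Proof.
move=> m0 cK convK Kt r0 tr hsum hr; pose M := 16 * r * (n%:R * r) ^+ 2; pose hh := 2 * rho / m%:R.
have mR : 0 < m%:R :> R by rewrite ltr0n.
have hh0 : 0 < hh by rewrite divr_gt0// mulr_gt0.
have M0 : 0 <= M by rewrite mulr_ge0 ?sqr_ge0// mulr_ge0.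
have KT xi : K (smap h l t xi).
  have -> : smap h l t xi = \sum_(p : 'I_n * (bool * 'I_(H + H))) (n%:R^-1 * sm_pr h l t xi p.1 p.2) *: sm_vec t p.1 p.2.
    rewrite /smap pair_big /= scaler_sumr; apply: eq_bigr => p _.
    by rewrite scalerA.
  apply: convK => [p||p]; last exact: Kt.
    by rewrite mulr_ge0 ?invr_ge0 ?(ltW nR)// sm_pr_ge0.
  rewrite -mulr_sumr -(pair_bigA _ (fun i a => sm_pr h l t xi i a)) /=.
  under eq_bigr do rewrite sm_pr_sum//.
  by rewrite sumr_const card_ord mulVf// gt_eqF.
have e0 : 0 <= (4 * n%:R * M + 1) * hh by rewrite mulr_ge0 ?(ltW hh0)// addr_ge0// !mulr_ge0.
have taylor (x w : V) : (forall i, `|w 0 i| <= hh) ->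
    forall i, `|(smap h l t (x + w) - smap h l t x - w *m sder h l t x) 0 i| <= M * hh ^+ 2.
  by move=> hw; exact: (smap_taylor n0 hH h0 l1).
have key := packing_volume n0 cK KT M0 hh0 (smap_mono n0 hH h0 l1 t) taylor
  (@grid_sep R n rho m rho0 m0) (@grid_bound R n rho m rho0 m0).
apply: le_trans key.
  rewrite lee_fin /mesh_volume.
  have -> : hh / 2 = rho / m%:R by rewrite /hh; field; rewrite gt_eqF.
  pose L := \prod_(i < n) (2 * n%:R * l i.+1)^-1.
  have L0 : 0 <= L by apply: prodr_ge0 => i _; rewrite invr_ge0 !mulr_ge0 ?(ltW nR)// ltW.
  apply: (@le_trans _ _ ((rho / m%:R) ^+ n * (L * \sum_(f : {ffun 'I_n -> 'I_m}) slots_sum (sm_u l (grid_pt rho f)) h t))).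
    have rm0 : 0 <= (rho / m%:R) ^+ n by rewrite exprn_ge0// divr_ge0 ?ltW.
    apply: le_trans (ler_wpM2l rm0 (ler_wpM2l L0 hsum)).
    rewrite le_eqVlt; apply/orP; left; apply/eqP.
    by rewrite expr_div_n -/L; field; rewrite expf_neq0// gt_eqF.
  apply: ler_wpM2l; first by rewrite exprn_ge0// divr_ge0// ltW.
  rewrite mulr_sumr; apply: ler_sum => f _.
  apply: le_trans (det_sder_ge n0 hH h0 l1 t _) _.
  apply: le_trans (ler_norm _); exact: det_sder_eps.
Qed.

Lemma mesh_thick_small (r e : R) : 0 <= r -> 0 < e ->
  exists2 m0 : nat, (0 < m0)%N & forall m, (m0 <= m)%N ->
    mesh_thick r m <= e /\ n%:R * (2 * rho / m%:R) * r <= 1 / 4.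
Proof.
move=> r0 e0; pose M := 16 * r * (n%:R * r) ^+ 2.
have M0 : 0 <= M by rewrite mulr_ge0 ?sqr_ge0// mulr_ge0.
pose c := M * (2 * rho) + (4 * n%:R * M + 1) * (3 * rho).
have c0 : 0 <= c by rewrite addr_ge0 ?mulr_ge0 ?addr_ge0 ?mulr_ge0 ?(ltW rho0) ?(ltW nR).
have cr0 : 0 <= c * (2 * rho) / e by rewrite divr_ge0 ?mulr_ge0 ?(ltW rho0) ?(ltW e0).
have nr0 : 0 <= n%:R * (2 * rho) * r * 4 by rewrite !mulr_ge0 ?(ltW rho0) ?(ltW nR).
exists (Num.truncn (c * (2 * rho) / e + n%:R * (2 * rho) * r * 4)).+1 => // m hm.
have hmR : c * (2 * rho) / e + n%:R * (2 * rho) * r * 4 <= m%:R.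
  by apply: le_trans (ltW (truncnS_gt _)) _; rewrite ler_nat.
have m0 : (0 < m)%N by exact: leq_trans hm.
have mR : 0 < m%:R :> R by rewrite ltr0n.
have m1 : 1 <= m%:R :> R by rewrite ler1n.
split.
  pose hh := 2 * rho / m%:R.
  have hh0 : 0 <= hh by rewrite divr_ge0 ?mulr_ge0 ?(ltW rho0) ?(ltW mR).
  have hh2 : hh <= 2 * rho by rewrite ler_pdivrMr// ler_peMr// mulr_ge0// ltW.
  have -> : mesh_thick r m = hh * (M * hh + (4 * n%:R * M + 1) * (rho + hh)).
    by rewrite /mesh_thick -/hh -/M; ring.
  apply: (@le_trans _ _ (hh * c)).
    rewrite ler_wpM2l// lerD ?ler_wpM2l// ?addr_ge0 ?mulr_ge0 ?(ltW nR)//; lra.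
  have -> : hh * c = c * (2 * rho) / m%:R by rewrite /hh; ring.
  rewrite ler_pdivrMr// -[leRHS]mulrC -ler_pdivrMr//.
  by apply: le_trans hmR; rewrite lerDl.
have -> : n%:R * (2 * rho / m%:R) * r = n%:R * (2 * rho) * r / m%:R by ring.
rewrite ler_pdivrMr//; lra.
Qed.

(** The mesh that makes a thickening thin depends on [r] and on its thickness, hence cannot be fixed
    before the sample; [pr_frequently] supplies arbitrarily fine successful meshes outside one
    event, and the thickness then tends to 0. *)
Theorem slots_volume : exists B : set (n.-tuple T), [/\ measurable B,
  pr (mtup (mtup nu (H + H)) n) B <= 8 * 16^-1 ^+ n &
  forall t, ~ B t -> forall (K : set V) (r : R), compact K ->
  (forall (I : finType) (q : I -> R) (y : I -> V), (forall i, 0 <= q i) -> \sum_i q i = 1 ->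
    (forall i, K (y i)) -> K (\sum_i q i *: y i)) ->
  (forall i a, K (sm_vec t i a)) ->
  (forall i (a : 'I_(H + H)) j, `|tnth (tnth t i) a 0 j| <= r) ->
  (mesh_volume%:E <= lebesgue_rV n K)%E].
Proof.
have /choice[B hB] := fun j : nat => @mesh_event j.+1 isT.
have mB j : measurable (B j) by case: (hB j).
have pB j : pr (mtup (mtup nu (H + H)) n) (B j) <= 8 * 16^-1 ^+ n by case: (hB j).
have [B' [mB' pB' hB']] := pr_frequently mB pB.
exists B'; split => // t Bt K r cK convK Kt tr.
apply: lebesgue_thicken_inf => // j.
have j0 : 0 < j.+1%:R^-1 :> R by rewrite invr_gt0.
pose r1 := `|r|; have r10 : 0 <= r1 by exact: normr_ge0.
have tr1 i (a : 'I_(H + H)) c : `|tnth (tnth t i) a 0 c| <= r1.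
  exact: le_trans (tr i a c) (ler_norm _).
have [m0 m00 hm0] := mesh_thick_small r10 j0.
have [m mm hm] := hB' t Bt m0.
have [h1 h2] := hm0 m.+1 (leq_trans mm (leqnSn m)).
have [_ _ h3] := hB m.
apply: le_trans (packing_mesh (m := m.+1) isT cK convK Kt r10 tr1 (h3 t hm) h2) _.
apply: le_measure; rewrite ?inE; try (apply: measurable_compact_rV; exact: compact_thicken).
move=> _ [x Kx [y yb <-]]; exists x => //; exists y => // i.
exact: le_trans (yb i) h1.
Qed.

End mesh.

(** * Conditioning on points of small norm *)

Section conditioning.
Context {d : measure_display} {T : measurableType d} {R : realType} (mu : probability T R).
Context (G : set T) (mG : measurable G) (G0 : 0 < pr mu G).

Definition cond_pr : probability T R :=
  [the probability T R of mnormalize [the measure T R of mrestr mu mG] mu].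

Lemma cond_prE A : measurable A -> cond_pr A = (mu (A `&` G) * ((pr mu G)^-1)%:E)%E.
Proof.
move=> mA; rewrite /cond_pr /= /mnormalize /= {1 2 3}/mrestr setTI.
have -> : mu G = (pr mu G)%:E by rewrite prK.
by rewrite eqe gt_eqF//= /mrestr setTI.
Qed.

Lemma cond_pr_out : cond_pr (~` G) = 0%E.
Proof.
rewrite cond_prE; last exact: measurableC.
by rewrite setICl measure0 mul0e.
Qed.

Lemma cond_pr_le A : 1 / 2 <= pr mu G -> measurable A -> pr cond_pr A <= 2 * pr mu A.
Proof.
move=> G2 mA; have mAG := measurableI _ _ mA mG.
have -> : pr cond_pr A = pr mu (A `&` G) * (pr mu G)^-1.
  apply: EFin_inj; rewrite prK// cond_prE// EFinM prK//.
rewrite mulrC; apply: (@le_trans _ _ (2 * pr mu (A `&` G))).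
  rewrite ler_wpM2r ?pr_ge0// -[leRHS]invrK lef_pV2 ?posrE ?invr_gt0//; lra.
by rewrite ler_pM2l// pr_le.
Qed.

Lemma integral_cond (f : T -> R) : measurable_fun setT f -> (forall x, 0 <= f x) ->
  (\int[mu]_x (\1_G x * f x)%:E <= (pr mu G)%:E * \int[cond_pr]_x (f x)%:E)%E.
Proof.
move=> mf f0; have mfE : measurable_fun setT (fun x => (f x)%:E) by exact/measurable_EFinP.
have -> : (\int[mu]_x (\1_G x * f x)%:E = \int[mu]_(x in G) (f x)%:E)%E.
  rewrite [RHS]integral_mkcond; apply: eq_integral => x _; rewrite patchE indicE.
  by case: (x \in G); rewrite ?mul1r ?mul0r.
pose k : {nonneg R} := NngNum (ltW G0).
rewrite (eq_measure_integral [the measure T R of mscale k cond_pr]); last first.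
  move=> A mA AG; rewrite /= /mscale /= cond_prE// (setIidl AG).
  by rewrite -(prK mu mA) -!EFinM mulrCA divff ?mulr1// gt_eqF.
rewrite ge0_integral_mscale//; first last.
- by move=> x _; rewrite lee_fin.
- exact: measurable_funS mfE.
apply: lee_wpmul2l; first by rewrite lee_fin ltW.
apply: ge0_subset_integral => //; by move=> x _; rewrite lee_fin.
Qed.

End conditioning.

Section tuple_split.
Context {d : measure_display} {T : measurableType d} {R : realType}.

Lemma integral_mtup0 (P : probability T R) (f : 0.-tuple T -> \bar R) :
  (\int[mtup P 0]_t f t = f [tuple])%E.
Proof.
transitivity (\int[mtup P 0]_t f [tuple])%E; last exact: integral_pr_cst.
by apply: eq_integral => t _; rewrite tuple0.
Qed.

Definition tup_l a b (t : (a + b).-tuple T) : a.-tuple T := [tuple tnth t (lshift b i) | i < a].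
Definition tup_r a b (t : (a + b).-tuple T) : b.-tuple T := [tuple tnth t (rshift a i) | i < b].

Lemma measurable_tup_l a b : measurable_fun setT (@tup_l a b).
Proof. exact: (@measurable_tnth_map _ _ (a + b) a (lshift b)). Qed.

Lemma measurable_tup_r a b : measurable_fun setT (@tup_r a b).
Proof. exact: (@measurable_tnth_map _ _ (a + b) b (@rshift a b)). Qed.

Lemma tup_l_cat a b (s : a.-tuple T) (t : b.-tuple T) : tup_l [tuple of s ++ t] = s.
Proof.
apply: eq_from_tnth => i; rewrite tnth_mktuple (tnth_nth (tnth s i)) /=.
by rewrite nth_cat size_tuple ltn_ord -tnth_nth.
Qed.

Lemma tup_r_cat a b (s : a.-tuple T) (t : b.-tuple T) : tup_r [tuple of s ++ t] = t.
Proof.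
apply: eq_from_tnth => i; rewrite tnth_mktuple (tnth_nth (tnth t i)) /=.
by rewrite nth_cat size_tuple ltnNge leq_addr/= addKn -tnth_nth.
Qed.

End tuple_split.

(** * Selecting enough points of the conditioned law *)

Section selection.
Context {d : measure_display} {T : measurableType d} {R : realType} (mu : probability T R).
Context (G : set T) (mG : measurable G) (G0 : 0 < pr mu G).
Local Notation nu := (cond_pr mu mG).

Definition behead_tup N (t : N.+1.-tuple T) : N.-tuple T := [tuple tnth t (lift ord0 i) | i < N].

(** The value of [f] at the first M points of the sample that fall in [G], and 1 if there are fewer
    than M of them; for an indicator of failure, a shortage thus counts as a failure. *)
Fixpoint sel N : forall M, (M.-tuple T -> R) -> N.-tuple T -> R :=
  match N return forall M, (M.-tuple T -> R) -> N.-tuple T -> R with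
  | 0 => fun M => match M return (M.-tuple T -> R) -> 0.-tuple T -> R with
         | 0 => fun f _ => f [tuple]
         | _.+1 => fun _ _ => 1
         end
  | N'.+1 => fun M => match M return (M.-tuple T -> R) -> N'.+1.-tuple T -> R with
         | 0 => fun f _ => f [tuple]
         | M'.+1 => fun f t =>
             \1_G (tnth t ord0) * sel (fun y => f (cons_tup (tnth t ord0, y))) (behead_tup t) +
             \1_(~` G) (tnth t ord0) * sel f (behead_tup t)
         end
  end.

Lemma behead_cons N x (t : N.-tuple T) : behead_tup (cons_tup (x, t)) = t.
Proof. by apply: eq_from_tnth => i; rewrite tnth_mktuple /= tnthS. Qed.

Lemma head_cons N x (t : N.-tuple T) : tnth (cons_tup (x, t)) ord0 = x.
Proof. by rewrite /cons_tup /= tnth0. Qed.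

Lemma measurable_sel N M d' (T' : measurableType d') (f : T' * M.-tuple T -> R) :
  measurable_fun setT f ->
  measurable_fun setT (fun p : T' * N.-tuple T => sel (fun y => f (p.1, y)) p.2).
Proof.
elim: N M d' T' f => [|N IH] [|M] d' T' f mf //=.
- by apply: (measurableT_comp mf); apply: measurable_fun_pair => //; exact: measurable_fst.
- by apply: (measurableT_comp mf); apply: measurable_fun_pair => //; exact: measurable_fst.
have mh : measurable_fun setT (fun p : T' * N.+1.-tuple T => tnth p.2 ord0).
  by apply: (measurableT_comp (measurable_tnth ord0)); exact: measurable_snd.
have mb : measurable_fun setT (fun p : T' * N.+1.-tuple T => behead_tup p.2).
  apply: (measurableT_comp (f := @behead_tup N)); last exact: measurable_snd.
  exact: (@measurable_tnth_map _ _ N.+1 N (lift ord0)).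
have mi (A : set T) : measurable A -> measurable_fun setT (fun p : T' * N.+1.-tuple T => \1_A (tnth p.2 ord0) : R).
  by move=> mA; apply: (measurableT_comp (f := \1_A : T -> R)) => //; exact: measurable_indic.
apply: measurable_funD; apply: measurable_funM.
- exact: mi.
- pose f' (q : (T' * T) * M.-tuple T) := f (q.1.1, cons_tup (q.1.2, q.2)).
  have mf' : measurable_fun setT f'.
    apply: (measurableT_comp mf); apply: measurable_fun_pair.
      by apply: (measurableT_comp (@measurable_fst _ _ T' T)); exact: measurable_fst.
    apply: (measurableT_comp (@measurable_cons_tup _ T M)); apply: measurable_fun_pair; last exact: measurable_snd.
    by apply: (measurableT_comp (@measurable_snd _ _ T' T)); exact: measurable_fst.
  apply: (measurableT_comp (IH M _ _ f' mf') (g := fun p : T' * N.+1.-tuple T => ((p.1, tnth p.2 ord0), behead_tup p.2))).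
  by apply: measurable_fun_pair => //; apply: measurable_fun_pair => //; exact: measurable_fst.
- by apply: mi; exact: measurableC.
- apply: (measurableT_comp (IH M.+1 _ _ f mf) (g := fun p : T' * N.+1.-tuple T => (p.1, behead_tup p.2))).
  by apply: measurable_fun_pair => //; exact: measurable_fst.
Qed.

Lemma measurable_sel1 N M (f : M.-tuple T -> R) : measurable_fun setT f ->
  measurable_fun setT (fun t : N.-tuple T => sel f t).
Proof.
move=> mf; pose f' (p : unit * M.-tuple T) := f p.2.
have mf' : measurable_fun setT f' by apply: (measurableT_comp mf); exact: measurable_snd.
apply: (measurableT_comp (measurable_sel (N := N) mf') (g := fun t : N.-tuple T => (tt, t))).
by apply: measurable_fun_pair.
Qed.

Lemma sel_ge0 N M (f : M.-tuple T -> R) t : (forall y, 0 <= f y) -> 0 <= sel (N := N) f t.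
Proof.
elim: N M f t => [|N IH] [|M] f t f0 //=.
by rewrite addr_ge0// mulr_ge0 ?indicE// IH.
Qed.

Lemma sel_spec N M (f : M.-tuple T -> R) t : sel (N := N) f t < 1 ->
  exists2 y : M.-tuple T, f y < 1 & forall i, G (tnth y i) /\ exists j, tnth y i = tnth t j.
Proof.
elim: N M f t => [|N IH] [|M] f t /=.
- by move=> h; exists [tuple] => // -[].
- by rewrite ltxx.
- by move=> h; exists [tuple] => // -[].
rewrite !indicE in_setC; case: (boolP (tnth t ord0 \in G)) => hG /=.
  rewrite mulr1n mul1r mulr0n mul0r addr0 => /IH[y fy hy].
  exists (cons_tup (tnth t ord0, y)) => // i; have [j ->|->] := unliftP ord0 i.
    have -> : tnth (cons_tup (tnth t ord0, y)) (lift ord0 j) = tnth y j by rewrite /cons_tup /= tnthS.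
    have [h1 [k hk]] := hy j; split => //; exists (lift ord0 k).
    by rewrite hk tnth_mktuple.
  by rewrite head_cons; split; [exact: set_mem|exists ord0].
rewrite mulr1n mul1r mulr0n mul0r add0r => /IH[y fy hy].
exists y => // i; have [h1 [k hk]] := hy i; split => //; exists (lift ord0 k).
by rewrite hk tnth_mktuple.
Qed.

Section bound.
Context (u : R) (u1 : 1 <= u).
Let g := pr mu G.
Let q : R := g / u + (1 - g).

Let u0 : 0 < u. Proof. exact: lt_le_trans u1. Qed.
Let g1 : g <= 1. Proof. exact: pr_le1. Qed.
Let q0 : 0 <= q.
Proof. by rewrite addr_ge0 ?subr_ge0// divr_ge0 ?(ltW G0) ?(ltW u0). Qed.

(** The selected points are independent with the conditioned law. The second term is the Chernoff
    bound for fewer than M successes in N trials, [q] being the mean of u^(-1) on success and 1 on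
    failure; both are proved together by induction on the sample. *)
Lemma integral_sel N M (f : M.-tuple T -> R) : measurable_fun setT f -> (forall y, 0 <= f y <= 1) ->
  (\int[mtup mu N]_t (sel f t)%:E <= \int[mtup nu M]_y (f y)%:E + (u ^+ M * q ^+ N)%:E)%E.
Proof.
elim: N M f => [|N IH] [|M] f mf f01.
- rewrite !integral_mtup0 /=.
  by rewrite leeDl// lee_fin mulr_ge0.
- rewrite integral_mtup0 expr0 mulr1.
  apply: (@le_trans _ _ (u ^+ M.+1)%:E); first by rewrite lee_fin exprn_ege1.
  by rewrite leeDr// nng_int_ge0// => y; have /andP[] := f01 y.
- have -> : (\int[mtup mu N.+1]_t (sel f t)%:E = (f [tuple])%:E)%E by rewrite /= integral_pr_cst.
  rewrite integral_mtup0 leeDl// lee_fin expr0 mul1r exprn_ge0//; exact: q0.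
have f0 y : 0 <= f y by have /andP[] := f01 y.
pose F x := (\int[mtup nu M]_y (f (cons_tup (x, y)))%:E)%E.
have mfc : measurable_fun setT (fun p : T * M.-tuple T => f (cons_tup p)).
  by apply: (measurableT_comp mf); exact: measurable_cons_tup.
have mF : measurable_fun setT F.
  have mE : measurable_fun setT (fun p : T * M.-tuple T => (f (cons_tup p))%:E) by exact/measurable_EFinP.
  by apply: (@measurable_fun_fubini_tonelli_F _ _ _ _ R (mtup nu M) _ mE) => p; rewrite lee_fin.
have mfx x : measurable_fun setT (fun y : M.-tuple T => f (cons_tup (x, y))).
  by apply: (measurableT_comp mfc (g := pair x)); exact: measurable_pair1.
have Fx x : (0 <= F x <= 1)%E.
  rewrite nng_int_ge0//= -(integral_pr_cst (mtup nu M) 1%E); apply: nng_int_le => // y.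
  by have /andP[] := f01 (cons_tup (x, y)).
pose Fr x : R := fine (F x).
have FE x : F x = (Fr x)%:E.
  have /andP[h1 h2] := Fx x; rewrite /Fr fineK// ge0_fin_numE//; exact: le_lt_trans h2 (ltry _).
have Fr0 x : 0 <= Fr x by rewrite fine_ge0//; have /andP[] := Fx x.
have mFr : measurable_fun setT Fr.
  by apply/measurable_EFinP; rewrite (_ : EFin \o Fr = F)//; apply/funext => x /=; rewrite FE.
have IE : (\int[mtup nu M.+1]_y (f y)%:E = \int[nu]_x (Fr x)%:E)%E.
  rewrite ge0_integral_mtupS//; last exact/measurable_EFinP.
  by apply: eq_integral => x _; rewrite -FE.
have [J JE J0] : exists2 J : R, (\int[mtup nu M.+1]_y (f y)%:E = J%:E)%E & 0 <= J.
  have h0 : (0 <= \int[mtup nu M.+1]_y (f y)%:E)%E by exact: nng_int_ge0.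
  have h1 : (\int[mtup nu M.+1]_y (f y)%:E <= 1%:E)%E.
    by rewrite -(integral_pr_cst (mtup nu M.+1) 1%:E); apply: nng_int_le => // y; have /andP[] := f01 y.
  exists (fine (\int[mtup nu M.+1]_y (f y)%:E)); last exact: fine_ge0.
  by rewrite fineK// ge0_fin_numE//; exact: le_lt_trans h1 (ltry _).
pose c1 := u ^+ M * q ^+ N; pose c2 := u ^+ M.+1 * q ^+ N.
have c10 : 0 <= c1 by rewrite mulr_ge0 ?exprn_ge0// ltW.
have c20 : 0 <= c2 by rewrite mulr_ge0 ?exprn_ge0// ltW.
have mGc := measurableC mG.
have m1 (A : set T) : measurable A -> measurable_fun setT (\1_A : T -> R) by move=> mA; exact: measurable_indic.
have msel := measurable_sel1 (N := N.+1) mf.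
have mselE : measurable_fun setT (fun p : T * N.-tuple T => (sel f (cons_tup p))%:E).
  by apply/measurable_EFinP; apply: (measurableT_comp msel); exact: measurable_cons_tup.
rewrite JE ge0_integral_mtupS//; first last.
- by move=> t; rewrite lee_fin sel_ge0.
- exact/measurable_EFinP.
apply: (@le_trans _ _ (\int[mu]_x (\1_G x * (Fr x + c1) + \1_(~` G) x * (J + c2))%:E)%E).
  apply: ge0_le_integral => //.
  - by move=> x _; apply: nng_int_ge0 => t; exact: sel_ge0.
  - apply: (@measurable_fun_fubini_tonelli_F _ _ _ _ R (mtup mu N) _ mselE) => p.
    by rewrite lee_fin sel_ge0.
  - apply/measurable_EFinP; apply: measurable_funD; apply: measurable_funM => //.
    exact: measurable_funD.
  move=> x _.
  have selE t : sel f (cons_tup (x, t)) = \1_G x * sel (N := N) (fun y => f (cons_tup (x, y))) t + \1_(~` G) x * sel f t.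
    by rewrite [LHS]/= head_cons behead_cons.
  under eq_integral do rewrite selE.
  rewrite !indicE in_setC; case: (boolP (x \in G)) => hG /=.
    under eq_integral do rewrite mulr1n mul1r mulr0n mul0r addr0.
    rewrite mulr1n mul1r mulr0n mul0r addr0 EFinD -FE.
    by apply: IH => // y; exact: f01.
  under eq_integral do rewrite mulr1n mul1r mulr0n mul0r add0r.
  rewrite mulr1n mul1r mulr0n mul0r add0r EFinD -JE.
  exact: IH.
have i0 (A : set T) x : 0 <= \1_A x :> R by rewrite indicE.
rewrite nng_intD//; first last.
- by move=> x; rewrite mulr_ge0// addr_ge0.
- by move=> x; rewrite mulr_ge0// addr_ge0.
- by apply: measurable_funM => //; exact: m1.
- by apply: measurable_funM => //; exact: measurable_funD.
have -> : (\int[mu]_x (\1_(~` G) x * (J + c2))%:E = ((1 - g) * (J + c2))%:E)%E.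
  under eq_integral do rewrite mulrC.
  rewrite nng_intZ ?addr_ge0//.
  by rewrite integral_pr_indic// prC// -EFinM mulrC.
have h1 : (\int[mu]_x (\1_G x * (Fr x + c1))%:E <= (g * (J + c1))%:E)%E.
  apply: le_trans (integral_cond mG G0 _ _) _.
  - exact: measurable_funD.
  - by move=> x; rewrite addr_ge0.
  rewrite EFinM; apply: lee_wpmul2l; first by rewrite lee_fin pr_ge0.
  by rewrite nng_intD// -IE JE integral_pr_cst EFinD.
apply: (@le_trans _ _ ((g * (J + c1))%:E + ((1 - g) * (J + c2))%:E)%E); first exact: leeD2r.
rewrite -!EFinD lee_fin le_eqVlt; apply/orP; left; apply/eqP.
by rewrite /c1 /c2 [q ^+ N.+1]exprS /q !exprS; field; rewrite gt_eqF.
Qed.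

End bound.

Fixpoint resh n K : (n * K).-tuple T -> n.-tuple (K.-tuple T) :=
  match n return (n * K).-tuple T -> n.-tuple (K.-tuple T) with
  | 0 => fun _ => [tuple]
  | n'.+1 => fun t => cons_tup (@tup_l _ _ K (n' * K) t, resh (@tup_r _ _ K (n' * K) t))
  end.

Lemma measurable_resh n K : measurable_fun setT (@resh n K).
Proof.
elim: n => [|n IH] /=; first exact: measurable_cst.
apply: (measurableT_comp (@measurable_cons_tup _ _ n)); apply: measurable_fun_pair.
  exact: (@measurable_tup_l _ T K (n * K)).
apply: (measurableT_comp IH).
exact: (@measurable_tup_r _ T K (n * K)).
Qed.

Lemma resh_entry n K (t : (n * K).-tuple T) i a : exists j, tnth (tnth (resh t) i) a = tnth t j.
Proof.
elim: n t i => [|n IH] t i; first by case: i.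
have [j ->|->] := unliftP ord0 i.
  have -> : tnth (resh t) (lift ord0 j) = tnth (resh (@tup_r _ _ K (n * K) t)) j.
    by rewrite [resh t]/= tnthS.
  have [k ->] := IH (@tup_r _ _ K (n * K) t) j.
  by exists (rshift K k); rewrite tnth_mktuple.
exists (lshift (n * K) a).
have -> : tnth (resh t) ord0 = @tup_l _ _ K (n * K) t by rewrite [resh t]/= tnth0.
by rewrite tnth_mktuple.
Qed.

Lemma integral_resh (P : probability T R) n K (g : n.-tuple (K.-tuple T) -> \bar R) :
  measurable_fun setT g -> (forall s, 0 <= g s)%E ->
  (\int[mtup P (n * K)]_t g (resh t) = \int[mtup (mtup P K) n]_s g s)%E.
Proof.
elim: n g => [|n IH] g mg g0.
  rewrite integral_mtup0 -[RHS](integral_pr_cst (mtup P 0)).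
  by apply: eq_integral => t _.
have mgr : measurable_fun setT (fun t : (n.+1 * K).-tuple T => g (resh t)).
  by apply: (measurableT_comp mg); exact: measurable_resh.
rewrite (ge0_integral_mtup_cat P (a := K) (b := n * K) mgr)//.
rewrite ge0_integral_mtupS//; apply: eq_integral => s _.
rewrite -IH//; last first.
  by apply: (measurableT_comp mg); apply: (measurableT_comp (@measurable_cons_tup _ _ n)).
apply: eq_integral => t _.
have -> : resh ([tuple of s ++ t] : (n.+1 * K).-tuple T) =
    cons_tup (tup_l [tuple of s ++ t], resh (tup_r [tuple of s ++ t])) by [].
by rewrite tup_l_cat tup_r_cat.
Qed.

Lemma select_slots n K N (B : set (n.-tuple (K.-tuple T))) (u : R) : measurable B -> 1 <= u ->
  exists B' : set (N.-tuple T), [/\ measurable B',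
   pr (mtup mu N) B' <= pr (mtup (mtup nu K) n) B + u ^+ (n * K) * (pr mu G / u + (1 - pr mu G)) ^+ N &
   forall t, ~ B' t -> exists2 s : n.-tuple (K.-tuple T), ~ B s &
     forall i a, G (tnth (tnth s i) a) /\ exists j, tnth (tnth s i) a = tnth t j].
Proof.
move=> mB u1; pose f (y : (n * K).-tuple T) : R := \1_B (resh y).
have mf : measurable_fun setT f.
  apply: (measurableT_comp (f := \1_B : _ -> R)); first exact: measurable_indic.
  exact: measurable_resh.
have f01 y : 0 <= f y <= 1 by rewrite /f indicE lern1 leq_b1 andbT.
have ms := measurable_sel1 (N := N) mf.
exists [set t | 1 <= sel f t]; split.
- exact: measurable_ge_cst.
- have h := integral_sel u1 N mf f01.
  have hI : (\int[mtup nu (n * K)]_y (f y)%:E = (pr (mtup (mtup nu K) n) B)%:E)%E.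
    rewrite -(integral_pr_indic _ mB) -integral_resh//.
    by apply/measurable_EFinP; exact: measurable_indic.
  rewrite hI -EFinD in h.
  rewrite -[leRHS]divr1; apply: pr_markov => // t; apply: sel_ge0 => y.
  by have /andP[] := f01 y.
- move=> t /negP; rewrite -ltNge => /sel_spec[y fy hy].
  exists (resh y).
    by move=> By; move: fy; rewrite /f indicE mem_set// ltxx.
  by move=> i a; have [j ->] := resh_entry y i a.
Qed.

End selection.

(** * Lower bounds for the volume of the hull *)

Section elementary.
Context {R : realType}.

(** Induction with (1 + 1/n)^n <= e. *)
Lemma expn_le_fact (n : nat) : n%:R ^+ n <= n`!%:R * expR 1 ^+ n :> R.
Proof.
elim: n => [|n IH]; first by rewrite !expr0 mul1r.
have e0 : 0 <= expR 1 :> R by exact: expR_ge0.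
have [->|n0] := eqVneq n 0%N.
  by rewrite !expr1 factS fact0 muln1 mul1r -[X in X <= _]expR0 ler_expR.
have nR : 0 < n%:R :> R by rewrite ltr0n lt0n.
have h : n.+1%:R ^+ n <= n%:R ^+ n * expR 1 :> R.
  have -> : n.+1%:R = n%:R * (1 + n%:R^-1) :> R by rewrite -natr1; field; rewrite gt_eqF.
  rewrite exprMn ler_wpM2l ?exprn_ge0 ?(ltW nR)//.
  apply: (@le_trans _ _ (expR n%:R^-1 ^+ n)).
    by rewrite lerXn2r ?nnegrE ?expR_ge0 ?expR_ge1Dx// addr_ge0// invr_ge0 ltW.
  by rewrite -expRM_natl divff// gt_eqF.
rewrite exprS factS natrM exprS -mulrA ler_wpM2l//.
apply: le_trans h _; rewrite mulrCA mulrC; rewrite ler_wpM2l//.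
Qed.

Lemma sum_inv_sqrt (n : nat) : \sum_(i < n) (Num.sqrt i.+1%:R)^-1 <= 2 * Num.sqrt n%:R :> R.
Proof.
elim: n => [|n IH]; first by rewrite big_ord0 sqrtr0 mulr0.
rewrite big_ord_recr /=; apply: (le_trans (lerD IH (lexx _))).
set a := Num.sqrt n%:R; set b := Num.sqrt n.+1%:R.
have a0 : 0 <= a by exact: sqrtr_ge0.
have b0 : 0 < b by rewrite sqrtr_gt0 ltr0n.
have ab : b ^+ 2 = a ^+ 2 + 1 by rewrite !sqr_sqrtr// natr1.
rewrite -lerBrDl -(ler_pM2r b0) mulVf ?gt_eqF//; nra.
Qed.

Lemma truncn_half (x : R) : 1 <= x -> x <= 2 * (Num.truncn x)%:R.
Proof.
move=> x1; have := truncnS_gt x; rewrite -natr1.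
have : 1 <= (Num.truncn x)%:R :> R by rewrite ler1n truncn_gt0.
lra.
Qed.

Lemma prod_inv_ge n (l : 'I_n -> R) (b : R) : (0 < n)%N -> (forall i, 0 < l i) ->
  \sum_i l i <= n%:R * b -> b ^- n <= \prod_i (l i)^-1.
Proof.
move=> n0 l0 hl; have nR : 0 < n%:R :> R by rewrite ltr0n.
have nn (i : 'I_n) : i \in predT -> 0 <= l i by move=> _; exact: ltW.
have := leif_AGM nn; rewrite /= card_ord => -[h1 _].
have P0 : 0 < \prod_i l i by apply: prodr_gt0.
have h2 : \prod_i l i <= b ^+ n.
  apply: (le_trans h1); rewrite lerXn2r ?nnegrE//.
  - by rewrite divr_ge0 ?(ltW nR)// sumr_ge0.
  - rewrite -(pmulr_rge0 _ nR); apply: le_trans hl; exact: sumr_ge0.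
  - by rewrite ler_pdivrMr// mulrC.
by rewrite prodfV lef_pV2 ?posrE// (lt_le_trans P0).
Qed.

End elementary.

Lemma large_arith (N H n : nat) : (16 <= H)%N -> (N < H.+1 * (4 * n))%N -> (2 * N <= H ^ 2 * n)%N.
Proof.
move=> H16 hN; apply: (@leq_trans (2 * (H.+1 * (4 * n)))); first by rewrite leq_mul2l ltnW.
rewrite (_ : 2 * (H.+1 * (4 * n)) = (8 * H.+1) * n)%N; last by lia.
rewrite leq_mul2r; apply/orP; right; nia.
Qed.

(** * Volume when N is large compared with n *)

Section large.
Context {R : realType}.

Definition rho_const : R := Num.min 1 sb_rate.
(** 48 = 6 * 8 combines the bound 6n for the averaged temperatures with the absorbed factor 1/8; exp
    1 comes from the factorial, the square root from [rho], and the final 1/2 from L <= 4p. *)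
Definition vol_const : R := slots_kappa (8 * 8) / (48 * expR 1) * Num.sqrt (rho_const / (8 * 64)) / 2.

Lemma rho_const_gt0 : 0 < rho_const.
Proof. by rewrite lt_min ltr01 sb_rate_gt0. Qed.

Lemma vol_const_gt0 : 0 < vol_const.
Proof.
have C3 := @slot_const_ge3 R; have r0 := rho_const_gt0.
rewrite /vol_const divr_gt0// mulr_gt0//; last by rewrite sqrtr_gt0 divr_gt0.
apply: divr_gt0; last by rewrite mulr_gt0// expR_gt0.
by rewrite /slots_kappa exprn_gt0// invr_gt0 mulr_gt0//; lra.
Qed.

Context {n N : nat} (mu : probability 'rV[R]_n R).
Hypotheses (n0 : (0 < n)%N) (iso : isotropic mu) (lc : log_concave mu).
Hypotheses (nN : (8 * 16 * n <= N)%N) (Ne : N%:R <= expR (Num.sqrt n%:R) :> R).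
Notation V := 'rV[R]_n.

Let nR : 0 < n%:R :> R. Proof. by rewrite ltr0n. Qed.
(** The n slots hold 2H points each, at most half of the sample, so enough good points remain after
    the selection. *)
Let H := (N %/ (4 * n))%N.
Let p : R := ln H%:R.
Let G : set V := [set x | dotp x x <= 64 * n%:R].
Let c1 : R := sb_rate / 4.
(** The cap makes h^2 at most the inverse of [slot_rate], so that it pays for the union bound over
    pairs. *)
Let h k := minn H (Num.truncn (expR (c1 * Num.sqrt k%:R))).
(** Since (1 + p/s)^2 >= 4p/s for s = sqrt k, the exponent p / l^2 is at most s / 4, and also at
    most p: up to constants, the weights then have second moment at most h k in either case of the
    minimum. *)
Let l k : R := 1 + p / Num.sqrt k%:R.
(** For points with |x|^2 <= 64 n the exponent 8 rho^2 |x|^2 of the averaged weights is at most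
    rho_const p. *)
Let rho : R := Num.sqrt (rho_const * p / (8 * (64 * n%:R))).

Let H16 : (16 <= H)%N.
Proof. by rewrite /H leq_divRL ?muln_gt0//; apply: leq_trans nN; lia. Qed.

Let HR : 16 <= H%:R :> R. Proof. by have := H16; rewrite -(ler_nat R). Qed.

Let pE : expR p = H%:R. Proof. by rewrite lnK// posrE; have := HR; lra. Qed.

Let p0 : 0 < p. Proof. by rewrite ln_gt0//; have := HR; lra. Qed.

Let p_sqrt : p <= Num.sqrt n%:R.
Proof.
rewrite -ler_expR pE; apply: le_trans Ne; rewrite ler_nat; exact: leq_div.
Qed.

Let c10 : 0 < c1. Proof. by rewrite divr_gt0// sb_rate_gt0. Qed.

Let e1 k : 1 <= expR (c1 * Num.sqrt k%:R) :> R.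
Proof. by rewrite -[leLHS]expR0 ler_expR mulr_ge0 ?sqrtr_ge0// ltW. Qed.

Let hH k : (h k <= H)%N. Proof. exact: geq_minl. Qed.

Let h0 k : (0 < h k)%N.
Proof. by rewrite leq_min truncn_gt0 e1 andbT; apply: leq_trans H16. Qed.

Let l1 k : 1 <= l k. Proof. by rewrite lerDl divr_ge0 ?sqrtr_ge0// ltW. Qed.

Let h_rate k : (h k)%:R ^+ 2 * slot_rate k <= 1 :> R.
Proof.
have hk : (h k)%:R <= expR (c1 * Num.sqrt k%:R) :> R.
  apply: (@le_trans _ _ (Num.truncn (expR (c1 * Num.sqrt k%:R)))%:R); first by rewrite ler_nat geq_minr.
  by rewrite truncn_le ltW ?expR_gt0.
apply: (@le_trans _ _ (expR (c1 * Num.sqrt k%:R) ^+ 2 * slot_rate k)).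
  by rewrite ler_wpM2r ?expR_ge0// lerXn2r ?nnegrE ?expR_ge0.
rewrite -expRM_natl /slot_rate -expRD le_eqVlt -[X in _ == X]expR0; apply/orP; left; apply/eqP.
by congr expR; rewrite /c1; field.
Qed.

Let rho0 : 0 < rho.
Proof. by rewrite sqrtr_gt0 divr_gt0 ?mulr_gt0 ?rho_const_gt0. Qed.

Let h_cw k : (0 < k)%N -> 4 * expR (8 * rho ^+ 2 / l k ^+ 2 * (64 * n%:R)) <= 8 * (h k)%:R :> R.
Proof.
move=> k0; have r0 := rho_const_gt0.
have sk : 0 < Num.sqrt k%:R :> R by rewrite sqrtr_gt0 ltr0n.
have lk : 0 < l k by apply: lt_le_trans (l1 k).
have -> : 8 * rho ^+ 2 / l k ^+ 2 * (64 * n%:R) = rho_const * (p / l k ^+ 2).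
  rewrite /rho sqr_sqrtr; last by rewrite divr_ge0 ?mulr_ge0 ?(ltW r0) ?(ltW p0) ?(ltW nR).
  by field; rewrite !gt_eqF.
have b1 : p / l k ^+ 2 <= p.
  by rewrite ler_pdivrMr ?exprn_gt0// ler_peMr ?(ltW p0)// exprn_ege1.
have b2 : p / l k ^+ 2 <= Num.sqrt k%:R / 4.
  rewrite ler_pdivrMr ?exprn_gt0// /l; set s := Num.sqrt _ in sk *.
  have -> : s / 4 * (1 + p / s) ^+ 2 = p + (s - p) ^+ 2 / (4 * s) by field; rewrite gt_eqF.
  by rewrite lerDl divr_ge0 ?sqr_ge0// mulr_ge0// ltW.
have q0 : 0 <= p / l k ^+ 2 by rewrite divr_ge0 ?sqr_ge0// ltW.
have m1 : rho_const * (p / l k ^+ 2) <= p.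
  apply: le_trans b1; rewrite ler_piMl//; by rewrite /rho_const ge_min lexx.
have m2 : rho_const * (p / l k ^+ 2) <= c1 * Num.sqrt k%:R.
  apply: (@le_trans _ _ (sb_rate * (Num.sqrt k%:R / 4))).
    by rewrite ler_pM// ?(ltW r0)//; by rewrite /rho_const ge_min lexx orbT.
  by rewrite /c1 le_eqVlt; apply/orP; left; apply/eqP; field.
have -> : 8 * (h k)%:R = 4 * (2 * (h k)%:R) :> R by ring.
rewrite ler_pM2l//.
have := truncn_half (e1 k); rewrite -ler_expR in m2 => ht.
have m1' : expR (rho_const * (p / l k ^+ 2)) <= H%:R by rewrite -pE ler_expR.
rewrite /h /minn; case: (_ < _)%N; first by have := HR; lra.
exact: le_trans m2 ht.
Qed.

Let mG : measurable G.
Proof.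
rewrite /G; apply: measurable_le_cst; apply: measurable_dotp2 => j; exact: measurable_coord.
Qed.

Let G64 : 1 - 64^-1 <= pr mu G.
Proof.
have mGc := measurableC mG.
have mdot : measurable_fun setT (fun x : V => dotp x x).
  by apply: measurable_dotp2 => j; exact: measurable_coord.
have h1 : pr mu (~` G) <= 64^-1.
  have hI : (\int[mu]_x (dotp x x)%:E <= n%:R%:E)%E.
    have := iso_pnorm2 iso is_proj1 (mxtrace1 R n).
    by under eq_integral do rewrite /pnorm2 mulmx1; move=> ->.
  have c64 : 0 < 64 * n%:R :> R by rewrite mulr_gt0.
  have h2 := pr_markov mdot (fun x => dotp_ge0 x) c64 hI.
  have h3 : pr mu (~` G) <= pr mu [set x | 64 * n%:R <= dotp x x].
    apply: pr_le => //; first exact: measurable_ge_cst.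
    by move=> x /negP; rewrite -ltNge => /ltW.
  have -> : 64^-1 = n%:R / (64 * n%:R) :> R by field; rewrite gt_eqF.
  exact: le_trans h3 h2.
by move: h1; rewrite prC//; lra.
Qed.

Theorem volume_large : exists B : set (N.-tuple V), [/\ measurable B,
  pr (mtup mu N) B <= 9 * 16^-1 ^+ n &
  forall t, ~ B t -> forall K : set V, compact K ->
  (forall (I : finType) (q : I -> R) (y : I -> V), (forall i, 0 <= q i) -> \sum_i q i = 1 ->
    (forall i, K (y i)) -> K (\sum_i q i *: y i)) ->
  (forall j, K (tnth t j) /\ K (- tnth t j)) ->
  (((vol_const * Num.sqrt (ln ((2 * N)%:R / n%:R) / n%:R)) ^+ n)%:E <= lebesgue_rV n K)%E].
Proof.
have G0 : 0 < pr mu G by have := G64; lra.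
have G2 : 1 / 2 <= pr mu G by have := G64; lra.
have D0 : 0 <= 64 * n%:R :> R by rewrite mulr_ge0.
have cw0 : 0 < 8 :> R by [].
have GD (x : V) : G x -> dotp x x <= 64 * n%:R by [].
have nu_mu (A : set V) : measurable A -> pr (cond_pr mu mG) A <= 2 * pr mu A.
  exact: cond_pr_le.
have [B [mB pB hB]] := slots_volume n0 iso lc nu_mu hH h0 l1 h_rate mG (cond_pr_out mG G0) GD rho0 cw0 h_cw.
(* With pr G >= 1 - 1/64 the Chernoff base is at most 2/64; selecting M points from N >= 2M then
   fails with probability at most 64^M (2/64)^(2M) = 16^-M. *)
have u1 : 1 <= 64 :> R by rewrite ler1n.
have [B' [mB' pB' hB']] := select_slots mG G0 N mB u1.
exists B'; split => //.
  apply: le_trans pB' _.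
  have -> : 9 * 16^-1 ^+ n = 8 * 16^-1 ^+ n + 16^-1 ^+ n :> R by ring.
  apply: lerD => //.
  have q1 : pr mu G / 64 + (1 - pr mu G) <= 2 / 64.
    by have := G64; have := pr_le1 mu mG; lra.
  have q0 : 0 <= pr mu G / 64 + (1 - pr mu G).
    by have := pr_le1 mu mG; lra.
  have KN : (n * (H + H) * 2 <= N)%N.
    apply: leq_trans (leq_divM N (4 * n)); rewrite -/H.
    by rewrite addnn -muln2 -!mulnA mulnCA [(_ * (2 * 2))%N]mulnC.
  apply: (@le_trans _ _ (64 ^+ (n * (H + H)) * (2 / 64) ^+ N)).
    by rewrite ler_wpM2l ?exprn_ge0// lerXn2r ?nnegrE//; lra.
  apply: (@le_trans _ _ (64 ^+ (n * (H + H)) * (2 / 64) ^+ (n * (H + H) * 2))).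
    by rewrite ler_wpM2l ?exprn_ge0// ler_wiXn2l//; lra.
  have -> : 64 ^+ (n * (H + H)) * (2 / 64) ^+ (n * (H + H) * 2) = 16^-1 ^+ (n * (H + H)) :> R.
    by set a := (n * (H + H))%N; rewrite (mulnC a 2) exprM -exprMn; congr (_ ^+ _); field.
  apply: ler_wiXn2l; rewrite ?invr_ge0 ?invf_le1 ?ler1n//.
  by rewrite leq_pmulr// addn_gt0 (leq_trans _ H16).
move=> t Bt K cK convK Kt; have [s Bs hs] := hB' t Bt.
apply: le_trans (hB s Bs K (64 * n%:R) cK convK _ _); first last.
- move=> i a j; have [hG _] := hs i a.
  set x := tnth _ a; have hx : x 0 j ^+ 2 <= dotp x x.
    rewrite /dotp (bigD1 j)//= -expr2 lerDl; apply: sumr_ge0 => k _.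
    by rewrite -expr2 sqr_ge0.
  have n1 : 1 <= 64 * n%:R :> R.
    have n1 : 1 <= n%:R :> R by rewrite ler1n.
    by lra.
  rewrite -ler_sqr ?nnegrE// real_normK ?num_real//.
  by apply: (le_trans hx); apply: (le_trans hG); rewrite expr2 ler_peMl.
- move=> i a; rewrite /sm_vec; have [_ [j ->]] := hs i a.2.
  have [k1 k2] := Kt j; rewrite /slot_sg; case: a.1; by rewrite ?expr1 ?expr0 ?scaleN1r ?scale1r.
rewrite lee_fin /mesh_volume /mesh_const.
set ka := slots_kappa (8 * 8); have k0 : 0 < ka.
  have C3 := @slot_const_ge3 R.
  by rewrite exprn_gt0// invr_gt0 mulr_gt0//; lra.
have r0 := rho_const_gt0; have e0 : 0 < expR 1 :> R := expR_gt0 1.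
have Lp : ln ((2 * N)%:R / n%:R) <= 4 * p.
  have q0 : 0 < (2 * N)%:R / n%:R :> R.
    by rewrite divr_gt0// ltr0n muln_gt0 (leq_trans _ nN)// muln_gt0 n0.
  rewrite -ler_expR lnK ?posrE// expRM_natl pE ler_pdivrMr//.
  rewrite -natrX -natrM ler_nat.
  have := ltn_ceil N (_ : 0 < 4 * n)%N; rewrite -/H muln_gt0 n0 => /(_ isT) hN.
  apply: (@leq_trans (H ^ 2 * n)); first exact: large_arith H16 hN.
  by rewrite leq_mul// leq_pexp2l// (leq_trans _ H16).
have step : vol_const * Num.sqrt (ln ((2 * N)%:R / n%:R) / n%:R) <= ka * rho / (48 * expR 1).
  have -> : rho = Num.sqrt (rho_const / (8 * 64)) * Num.sqrt (p / n%:R).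
    rewrite /rho -sqrtrM; last by rewrite divr_ge0// ltW.
    by congr Num.sqrt; field; rewrite gt_eqF.
  have -> : ka * (Num.sqrt (rho_const / (8 * 64)) * Num.sqrt (p / n%:R)) / (48 * expR 1) =
      vol_const * (2 * Num.sqrt (p / n%:R)).
    by rewrite /vol_const -/ka; field; rewrite gt_eqF.
  rewrite ler_wpM2l ?(ltW vol_const_gt0)//.
  have -> : 2 * Num.sqrt (p / n%:R) = Num.sqrt (4 * p / n%:R).
    rewrite (_ : 4 * p / n%:R = 2 ^+ 2 * (p / n%:R)); last by ring.
    by rewrite (sqrtrM (p / n%:R) (sqr_ge0 2)) sqrtr_sqr ger0_norm.
  by apply: ler_wsqrtr; rewrite ler_pM2r ?invr_gt0.
have nn : 0 <= vol_const * Num.sqrt (ln ((2 * N)%:R / n%:R) / n%:R).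
  by rewrite mulr_ge0 ?sqrtr_ge0 ?(ltW vol_const_gt0).
apply: (@le_trans _ _ ((ka * rho / (48 * expR 1)) ^+ n)).
  by apply: lerXn2r; rewrite ?nnegrE//; exact: le_trans nn step.
(* The temperatures sum to at most n + 2 p sqrt n <= 3n, by p <= sqrt n; AM-GM bounds their
   product. *)
have hl : (6 * n%:R) ^- n <= \prod_(i < n) (2 * n%:R * l i.+1)^-1.
  apply: prod_inv_ge => // [i|].
    by rewrite !mulr_gt0// (lt_le_trans ltr01 (l1 _)).
  rewrite -mulr_sumr.
  have : \sum_(i < n) l i.+1 <= 3 * n%:R.
    rewrite big_split /= sumr_const card_ord -mulr_sumr.
    have h1 := ler_wpM2l (ltW p0) (@sum_inv_sqrt R n).
    have h2 : p * (2 * Num.sqrt n%:R) <= Num.sqrt n%:R * (2 * Num.sqrt n%:R).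
      by rewrite ler_wpM2r// mulr_ge0// sqrtr_ge0.
    have h3 : Num.sqrt n%:R * (2 * Num.sqrt n%:R) = 2 * n%:R :> R.
      by rewrite mulrCA -expr2 sqr_sqrtr.
    lra.
  have : 0 < 2 * n%:R :> R by rewrite mulr_gt0.
  by move=> c hc; have := ler_wpM2l (ltW c) hc; lra.
have hf := expn_le_fact (R := R) n.
(* The single factor 1/8 is weakened to an n-th power, so that the whole bound becomes one. *)
have h8 : 8^-1 ^+ n <= 8^-1 :> R by rewrite -[leRHS]expr1 ler_wiXn2l// ?invr_ge0// invf_le1// ler1n.
set L := \prod_(i < n) _ in hl *.
have e1n : 0 < expR 1 ^+ n :> R by rewrite exprn_gt0.
have A0 : 0 <= rho ^+ n * (6 * n%:R) ^- n by rewrite mulr_ge0 ?invr_ge0 ?exprn_ge0 ?mulr_ge0 ?(ltW nR) ?(ltW rho0).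
have -> : (ka * rho / (48 * expR 1)) ^+ n =
    rho ^+ n * (6 * n%:R) ^- n * (n%:R ^+ n / expR 1 ^+ n * ka ^+ n * 8^-1 ^+ n).
  have -> : ka * rho / (48 * expR 1) = rho * (6 * n%:R)^-1 * (n%:R / expR 1 * ka * 8^-1).
    by field; rewrite !gt_eqF.
  by rewrite -!exprVn -!exprMn.
have hA : n%:R ^+ n / expR 1 ^+ n * ka ^+ n * 8^-1 ^+ n <= n`!%:R * ka ^+ n / 8.
  have k0n : 0 <= ka ^+ n by rewrite exprn_ge0// ltW.
  have x0 : 0 <= n%:R ^+ n / expR 1 ^+ n * ka ^+ n.
    by rewrite mulr_ge0// divr_ge0// ?exprn_ge0// ltW.
  have y0 : 0 <= 8^-1 ^+ n :> R by rewrite exprn_ge0// invr_ge0.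
  apply: (ler_pM x0 y0 _ h8); apply: ler_wpM2r => //.
  by rewrite ler_pdivrMr.
apply: le_trans (ler_wpM2l A0 hA) _.
rewrite ler_wpM2r//; first by rewrite divr_ge0// mulr_ge0// exprn_ge0// ltW.
by rewrite ler_wpM2l// exprn_ge0// ltW.
Qed.

End large.

(** * Volume when N is comparable to n *)

Section small.
Context {R : realType}.

(** The fourth power undoes the moment exponent 1/4, 1 + 16 Canti is [neg_moment] at A = 4 Canti,
    and the factor 16 yields the probability 16^-n. *)
Definition det_kappa : R := (16 * (1 + 16 * Canti))^-1 ^+ 4.
Definition small_const : R := Num.sqrt (det_kappa / (4 * expR 1)).

Lemma det_kappa_gt0 : 0 < det_kappa.
Proof.
have C0 := @Canti_ge R.
by rewrite exprn_gt0// invr_gt0 mulr_gt0//; lra.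
Qed.

Lemma small_const_gt0 : 0 < small_const.
Proof. by rewrite sqrtr_gt0 divr_gt0 ?det_kappa_gt0// mulr_gt0// expR_gt0. Qed.

Lemma sqr_exprM (a b : R) n : ((a * b) ^+ n) ^+ 2 = (a ^+ 2 * b ^+ 2) ^+ n.
Proof. by rewrite -exprMn -!exprM mulnC. Qed.

Context {n : nat} (mu : probability 'rV[R]_n R).
Hypotheses (n0 : (0 < n)%N) (iso : isotropic mu) (lc : log_concave mu).
Notation V := 'rV[R]_n.

Let nR : 0 < n%:R :> R. Proof. by rewrite ltr0n. Qed.

Definition sample_mx (t : n.-tuple V) : 'M[R]_n := \matrix_(i, j) tnth t i 0 j.

Lemma measurable_det_sample : measurable_fun setT (fun t : n.-tuple V => \det (sample_mx t) ^+ 2).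
Proof.
apply: measurable_funX; apply: measurable_det => i j; under eq_fun do rewrite mxE.
by apply: (measurableT_comp (measurable_coord j)); exact: measurable_tnth.
Qed.

Lemma proj_neg_moment k (P : 'M[R]_n) : (0 < k)%N -> is_proj P -> \tr P = k%:R ->
  (\int[mu]_x ((1 * pnorm2 P x) `^ (- (4^-1)))%:E <= (k%:R `^ (- (4^-1)) * (1 + 16 * Canti))%:E)%E.
Proof.
move=> k0 hP trP; have kR : 0 < k%:R :> R by rewrite ltr0n.
have C0 := @Canti_ge R.
have mp : measurable_fun setT (fun x : V => pnorm2 P x).
  by apply: measurable_pnorm2_comp => j; exact: measurable_coord.
have mr : measurable_fun setT (fun x : V => pnorm2 P x / k%:R) by exact: measurable_funM.
have r0 (x : V) : 0 <= pnorm2 P x / k%:R by rewrite divr_ge0// pnorm2_ge0.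
have A0 : 0 <= 4 * Canti :> R by lra.
have rA (t : R) : 0 < t -> pr mu [set x | pnorm2 P x / k%:R <= t ^+ 2] <= 4 * Canti * t.
  move=> t0; have := proj_anticonc iso lc hP trP k0 0 t0.
  by congr (pr mu _ <= _); apply/seteqP; split => x /=; rewrite subr0 ler_pdivrMr.
have h := neg_moment mr r0 A0 rA.
have -> : (\int[mu]_x ((1 * pnorm2 P x) `^ (- 4^-1))%:E =
    \int[mu]_x (k%:R `^ (- 4^-1) * (pnorm2 P x / k%:R) `^ (- 4^-1))%:E)%E.
  apply: eq_integral => x _; congr (_%:E).
  rewrite -(powRM _ (ltW kR) (r0 x)) mul1r; congr (_ `^ _).
  by field; rewrite gt_eqF.
rewrite nng_intZ ?powR_ge0//; first last.
- by move=> x; exact: powR_ge0.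
- by apply: (measurableT_comp (measurable_powR _)).
rewrite EFinM; apply: lee_wpmul2l; first by rewrite lee_fin powR_ge0.
by apply: le_trans h _; rewrite lee_fin; lra.
Qed.

(** The chain estimate with one choice per slot and Q = 1. Without a union bound over pairs,
    anticoncentration alone suffices, and the moment of order -1/4 can be used. *)
Lemma det_sample_small :
  pr (mtup mu n) [set t | \det (sample_mx t) ^+ 2 < n`!%:R * det_kappa ^+ n / 2] <= 2 * 16^-1 ^+ n.
Proof.
have C0 := @Canti_ge R; have ka0 := det_kappa_gt0.
have f0 : 0 < n`!%:R :> R by rewrite ltr0n fact_gt0.
pose zf (_ : nat) (x : V) (_ : unit) := x.
pose pi (_ : nat) (_ : V) (_ : unit) : R := 1.
pose Q (_ : nat) (_ : V) : R := 1.
pose E k := k%:R `^ (- (4^-1)) * (1 + 16 * Canti) : R.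
have sumu (F : unit -> R) : \sum_c F c = F tt.
  by rewrite (bigD1 tt)//= big1 ?addr0// => -[].
have v0 : 0 < n`!%:R * det_kappa ^+ n by rewrite mulr_gt0// exprn_gt0.
have -> : [set t | \det (sample_mx t) ^+ 2 < n`!%:R * det_kappa ^+ n / 2] =
    [set t : n.-tuple V | chain_sum zf pi Q t < n`!%:R * det_kappa ^+ n / 2].
  suff h t : chain_sum zf pi Q t = \det (sample_mx t) ^+ 2.
    by apply/seteqP; split => t /=; rewrite h.
  rewrite /chain_sum (bigD1 [ffun=> tt])//= [X in _ + X]big1 ?addr0; last first.
    by move=> f; apply: contraNeq => _; apply/eqP/ffunP => i; rewrite ffunE; case: (f i).
  rewrite big1 ?mul1r; last by move=> i _; rewrite mulr1.
  by congr (\det _ ^+ 2); apply/matrixP => i j; rewrite !mxE.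
have s0 : 0 < (4^-1 : R) by rewrite invr_gt0.
have := @chain_sum_small _ _ _ mu n _ zf pi Q (4^-1) E.
move=> /(_ _ _ _ _ _ _ s0 _ _ _ _ v0) key.
apply: le_trans (key _ _ _ _ _ _ _ _ _) _.
- by move=> k c j; exact: measurable_coord.
- by move=> k c; exact: measurable_cst.
- by move=> k; exact: measurable_cst.
- by move=> k t c; exact: ler01.
- by move=> k t; rewrite sumu.
- by move=> k t; exact: ltr01.
- by move=> k; rewrite /E mulr_ge0 ?powR_ge0//; lra.
- move=> k P k0 hP trP; under eq_integral do rewrite sumu mul1r.
  rewrite integral_bool_le; last by apply: measurable_pnorm2_comp => j; exact: measurable_coord.
  congr (_%:E); rewrite -[RHS](proj_null iso lc hP trP k0 0); congr (pr mu _).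
  apply/seteqP; split => x /=; rewrite subr0 => h; last by rewrite h.
  by apply/eqP; rewrite eq_le h pnorm2_ge0.
- move=> k P k0 hP trP; under eq_integral do rewrite sumu mul1r.
  exact: proj_neg_moment.
rewrite ler_wpM2l// big_split /= prodr_const card_ord.
have -> : \prod_(k < n) k.+1%:R `^ (- 4^-1) = (n`!%:R `^ 4^-1)^-1 :> R by rewrite -powRN powR_fact.
have -> : (n`!%:R * det_kappa ^+ n) `^ 4^-1 = n`!%:R `^ 4^-1 * (16 * (1 + 16 * Canti))^-1 ^+ n.
  have kn0 : 0 <= det_kappa ^+ n by rewrite exprn_ge0// ltW.
  rewrite (powRM _ (ltW f0) kn0); congr (_ * _).
  have c0 : 0 <= (16 * (1 + 16 * Canti))^-1 :> R by rewrite invr_ge0; lra.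
  rewrite /det_kappa -exprM mulnC exprM -powR_mulrn ?exprn_ge0//.
  by rewrite -powRrM divff// powRr1// exprn_ge0.
set c := 16 * (1 + 16 * Canti).
have c0 : 0 < c by rewrite /c; lra.
rewrite le_eqVlt; apply/orP; left; apply/eqP.
have -> : 1 + 16 * Canti = c * 16^-1 :> R by rewrite /c; field.
by rewrite exprMn exprVn; field; rewrite !gt_eqF ?powR_gt0 ?exprn_gt0.
Qed.

Context {N : nat}.
Hypotheses (nN : (n <= N)%N) (Nn : (N <= 8 * 16 * n)%N).

Lemma det_sample_large : exists B : set (N.-tuple V), [/\ measurable B,
  pr (mtup mu N) B <= 2 * 16^-1 ^+ n &
  forall t, ~ B t ->
    n`!%:R * det_kappa ^+ n / 2 <= \det (sample_mx [tuple tnth t (widen_ord nN i) | i < n]) ^+ 2].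
Proof.
pose A := [set t : n.-tuple V | \det (sample_mx t) ^+ 2 < n`!%:R * det_kappa ^+ n / 2].
have mA : measurable A by apply: measurable_lt_cst; exact: measurable_det_sample.
pose io : 'I_n -> 'I_N := widen_ord nN.
pose g (t : N.-tuple V) : n.-tuple V := [tuple tnth t (io i) | i < n].
have mg : measurable_fun setT g by exact: measurable_tnth_map.
have mB : measurable (g @^-1` A) by rewrite -[X in measurable X]setTI; exact: mg.
exists (g @^-1` A); split => //.
  apply: le_trans det_sample_small; rewrite le_eqVlt; apply/orP; left; apply/eqP.
  apply: EFin_inj; rewrite -(integral_pr_indic _ mB) -(integral_pr_indic _ mA).
  rewrite -(@ge0_integral_mtup_inj _ _ _ mu N n io (fun t => (\1_A t)%:E)).
  - by apply: eq_integral => t _; rewrite !indicE.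
  - by move=> i j /(congr1 val) /= h; exact: val_inj.
  - by apply/measurable_EFinP; exact: measurable_indic.
  - by move=> t; rewrite lee_fin indicE.
by move=> t /negP; rewrite -leNgt.
Qed.

(** The hull contains the parallelepiped of combinations of n sample points with coefficients at
    most 1/n in modulus. Here ln (2N / n) is at most 8, so it disappears in the constant. *)
Theorem volume_small : exists B : set (N.-tuple V), [/\ measurable B,
  pr (mtup mu N) B <= 2 * 16^-1 ^+ n &
  forall t, ~ B t -> forall K : set V, compact K ->
  (forall (I : finType) (q : I -> R) (y : I -> V), (forall i, 0 <= q i) -> \sum_i q i = 1 ->
    (forall i, K (y i)) -> K (\sum_i q i *: y i)) ->
  (forall j, K (tnth t j) /\ K (- tnth t j)) ->
  (((small_const * Num.sqrt (ln ((2 * N)%:R / n%:R) / n%:R)) ^+ n)%:E <= lebesgue_rV n K)%E].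
Proof.
have ka0 := det_kappa_gt0; have e0 : 0 < expR 1 :> R := expR_gt0 1.
pose io : 'I_n -> 'I_N := widen_ord nN.
pose g (t : N.-tuple V) : n.-tuple V := [tuple tnth t (io i) | i < n].
have [B [mB pB hB]] := det_sample_large; exists B; split => //.
move=> t /hB hdet K cK convK Kt.
set D := \det (sample_mx (g t)) in hdet *.
have f0 : 0 < n`!%:R :> R by rewrite ltr0n fact_gt0.
have v0 : 0 < n`!%:R * det_kappa ^+ n / 2 by rewrite divr_gt0// mulr_gt0// exprn_gt0.
have D0 : D != 0.
  by apply: contraTneq hdet => ->; rewrite expr0n /= -ltNge.
have bK : [set 0 + x *m sample_mx (g t) | x in box_rV n%:R^-1] `<=` K.
  move=> _ [x hx <-]; rewrite add0r.
  (* The points +-x_i get the weights (1/n +- c_i) / 2, which are nonnegative and add up to 1. *)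
  have -> : x *m sample_mx (g t) = \sum_(p : bool * 'I_n)
      ((n%:R^-1 + (-1) ^+ p.1 * x 0 p.2) / 2) *: ((-1) ^+ p.1 *: tnth t (io p.2)).
    rewrite -(pair_bigA _ (fun (b : bool) i => ((n%:R^-1 + (-1) ^+ b * x 0 i) / 2) *: ((-1) ^+ b *: tnth t (io i)))) /=.
    rewrite exchange_big mulmx_sum_row; apply: eq_bigr => i _.
    rewrite big_bool /= expr1 expr0 !scalerA -scalerDl.
    have -> : row i (sample_mx (g t)) = tnth t (io i).
      by apply/rowP => j; rewrite !mxE tnth_mktuple.
    by congr (_ *: _); field; rewrite gt_eqF.
  apply: convK => [[b i]||[b i]] /=.
  - have := hx i; rewrite ler_norml => /andP[h1 h2].
    by apply: divr_ge0 => //; case: b; rewrite ?expr1 ?expr0 ?mulN1r ?mul1r; lra.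
  - rewrite -(pair_bigA _ (fun (b : bool) i => (n%:R^-1 + (-1) ^+ b * x 0 i) / 2)) /=.
    rewrite exchange_big; under eq_bigr do rewrite big_bool /= expr1 expr0.
    rewrite (eq_bigr (fun=> n%:R^-1)) => [|i _]; last by field; rewrite gt_eqF.
    by rewrite sumr_const card_ord -[LHS]mulr_natr mulVf// gt_eqF.
  - by have [k1 k2] := Kt (io i); case: b; rewrite ?expr1 ?expr0 ?scaleN1r ?scale1r.
have uD : sample_mx (g t) \in unitmx by rewrite unitmxE unitfE.
have mbox : measurable (box_rV (n := n) (n%:R^-1 : R)).
  by apply: measurable_compact_rV; exact: compact_box.
have n1 : 0 <= n%:R^-1 :> R by rewrite invr_ge0 ltW.
have himg := lebesgue_rV_image 0 uD mbox.
have mimg : measurable [set 0 + x *m sample_mx (g t) | x in box_rV n%:R^-1].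
  apply: measurable_compact_rV; apply: continuous_compact; last exact: compact_box.
  by apply: continuous_subspaceT; exact: continuous_affine.
apply: (@le_trans _ _ (lebesgue_rV n [set 0 + x *m sample_mx (g t) | x in box_rV n%:R^-1])); last first.
  by apply: le_measure; rewrite ?inE//; exact: measurable_compact_rV.
rewrite himg lebesgue_box// -EFinM lee_fin -/D.
have q0 : 0 < (2 * N)%:R / n%:R :> R.
  have N0 : (0 < N)%N := leq_trans n0 nN.
  by rewrite divr_gt0// ltr0n muln_gt0 N0.
have L0 : 0 <= ln ((2 * N)%:R / n%:R) :> R.
  by apply: ln_ge0; rewrite ler_pdivlMr// mul1r ler_nat; apply: leq_trans nN _; rewrite leq_pmull.
have L8 : ln ((2 * N)%:R / n%:R) <= 8 :> R.
  rewrite -ler_expR lnK ?posrE// ler_pdivrMr//.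
  have h2 : (2 : R) ^+ 8 <= expR 8.
    have -> : expR 8 = expR 1 ^+ 8 :> R by rewrite -expRM_natl mulr1.
    apply: lerXn2r; rewrite ?nnegrE ?expR_ge0//; have := expR_ge1Dx (1 : R); lra.
  apply: le_trans (ler_wpM2r (ltW nR) h2); rewrite -natrX -natrM ler_nat.
  apply: (@leq_trans (2 * (8 * 16 * n))); first by rewrite leq_mul2l Nn orbT.
  by rewrite mulnA leq_mul.
have lhs0 : 0 <= (small_const * Num.sqrt (ln ((2 * N)%:R / n%:R) / n%:R)) ^+ n.
  by apply: exprn_ge0; apply: mulr_ge0; [exact/ltW/small_const_gt0|exact: sqrtr_ge0].
have rhs0 : 0 <= `|D| * (2 / n%:R) ^+ n.
  by apply: mulr_ge0; [exact: normr_ge0|rewrite exprn_ge0// mulr_ge0].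
rewrite -(ler_sqr (x := _ ^+ n)) ?nnegrE//.
have -> : ((small_const * Num.sqrt (ln ((2 * N)%:R / n%:R) / n%:R)) ^+ n) ^+ 2 =
    (det_kappa / (4 * expR 1) * (ln ((2 * N)%:R / n%:R) / n%:R)) ^+ n.
  rewrite sqr_exprM; congr ((_ * _) ^+ n); apply: sqr_sqrtr.
    by rewrite divr_ge0 ?(ltW ka0)// mulr_ge0// ltW.
  by rewrite divr_ge0// ltW.
have -> : (`|D| * (2 / n%:R) ^+ n) ^+ 2 = D ^+ 2 * ((2 / n%:R) ^+ 2) ^+ n.
  by rewrite exprMn real_normK ?num_real// -!exprM [(n * 2)%N]mulnC.
apply: (@le_trans _ _ ((n`!%:R * det_kappa ^+ n / 2) * ((2 * n%:R^-1) ^+ 2) ^+ n)); last first.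
  by rewrite ler_wpM2r// exprn_ge0// sqr_ge0.
have hf := expn_le_fact (R := R) n.
apply: (@le_trans _ _ ((n%:R ^+ n / expR 1 ^+ n) * det_kappa ^+ n * 2^-1 ^+ n * ((2 * n%:R^-1) ^+ 2) ^+ n)).
  have -> : n%:R ^+ n / expR 1 ^+ n * det_kappa ^+ n * 2^-1 ^+ n * ((2 * n%:R^-1) ^+ 2) ^+ n =
      (2 * det_kappa / (expR 1 * n%:R)) ^+ n.
    rewrite -exprVn -!exprMn; congr (_ ^+ _); field.
    by rewrite !gt_eqF.
  have c0 : 0 <= det_kappa / (4 * expR 1).
    by apply: divr_ge0; [exact: ltW|rewrite mulr_ge0// ltW].
  have X0 : 0 <= det_kappa / (4 * expR 1) * (ln ((2 * N)%:R / n%:R) / n%:R).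
    by apply: mulr_ge0 => //; apply: divr_ge0 => //; exact: ltW.
  have le1 : det_kappa / (4 * expR 1) * (ln ((2 * N)%:R / n%:R) / n%:R) <= 2 * det_kappa / (expR 1 * n%:R).
    have -> : 2 * det_kappa / (expR 1 * n%:R) = det_kappa / (4 * expR 1) * (8 / n%:R).
      by field; rewrite !gt_eqF.
    by apply: ler_wpM2l => //; apply: ler_wpM2r.
  by apply: lerXn2r; rewrite ?nnegrE//; exact: le_trans X0 le1.
rewrite ler_wpM2r ?exprn_ge0 ?sqr_ge0//.
have k0n : 0 <= det_kappa ^+ n by rewrite exprn_ge0// ltW.
have x0 : 0 <= n%:R ^+ n / expR 1 ^+ n * det_kappa ^+ n.
  by rewrite mulr_ge0// divr_ge0// ?exprn_ge0// ltW.
have y0 : 0 <= 2^-1 ^+ n :> R by rewrite exprn_ge0// invr_ge0.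
have h2 : 2^-1 ^+ n <= 2^-1 :> R by rewrite -[leRHS]expr1 ler_wiXn2l// ?invr_ge0// invf_le1// ler1n.
apply: (ler_pM x0 y0 _ h2); apply: ler_wpM2r => //.
by rewrite ler_pdivrMr ?exprn_gt0.
Qed.

End small.

(** * Signed sums of sample points *)

(** Twice 12 (1 + 34): the factor 2 is that of [net_approx], and 12 L n + 12 * 17 n is at most 12 *
    35 L n as L >= 1/2. *)
Definition net_const {R : realType} : R := 24 * 35.

Section net.
Context {R : realType} {n : nat} (n0 : (0 < n)%N).
Notation V := 'rV[R]_n.
Notation net_idx := {ffun 'I_n -> bool * 'I_(2 * n).+1}.
Implicit Types k : net_idx.

Let nR : 0 < n%:R :> R. Proof. by rewrite ltr0n. Qed.
Let sn : R := Num.sqrt n%:R.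
Let sn0 : 0 < sn. Proof. by rewrite sqrtr_gt0. Qed.

(* Truncating the coordinates of a unit vector yields some [net_pt k] at distance at most 1/2. *)
Definition net_pt k : V := \row_i ((-1) ^+ (k i).1 * (k i).2%:R / (2 * sn)).
Definition in_net k : bool := (\sum_i (k i).2 ^ 2 <= 4 * n)%N.

Lemma net_pt_le1 k : in_net k -> dotp (net_pt k) (net_pt k) <= 1.
Proof.
move=> hk; have -> : dotp (net_pt k) (net_pt k) = (\sum_i (k i).2 ^ 2)%:R / (4 * n%:R).
  rewrite natr_sum mulr_suml; apply: eq_bigr => i _; rewrite !mxE natrX -expr2.
  rewrite expr_div_n exprMn sqrr_sign mul1r exprMn sqr_sqrtr ?(ltW nR)//.
  by congr (_ / (_ * _)); ring.
by rewrite ler_pdivrMr ?mulr_gt0// mul1r -natrM ler_nat.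
Qed.

(** Since j <= j^2, each member of the net satisfies 1 <= 2^(4n) prod_i 2^(-k_i). Without the
    constraint the sum of the products factorises and is at most 4^n. *)
Lemma net_card : \sum_(k | in_net k) 1 <= 64 ^+ n :> R.
Proof.
pose g (c : bool * 'I_(2 * n).+1) : R := 2^-1 ^+ c.2.
have hg : \sum_c g c <= 4.
  rewrite -(pair_bigA _ (fun (b : bool) (j : 'I_(2 * n).+1) => 2^-1 ^+ j : R)) /= big_bool /=.
  have := @sum_geometric_le R 2^-1 (2 * n).+1.
  have -> : (1 - 2^-1)^-1 = 2 :> R by field.
  by move=> /(_ _) h; have : \sum_(k < (2 * n).+1) 2^-1 ^+ k <= 2 :> R; [apply: h; apply/andP; split; lra|lra].
have g0 c : 0 <= g c by rewrite exprn_ge0// invr_ge0.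
apply: (@le_trans _ _ (\sum_(k : net_idx) 2 ^+ (4 * n) * \prod_i g (k i))).
  rewrite big_mkcond; apply: ler_sum => k _; case: ifP => hk; last first.
    by rewrite mulr_ge0 ?exprn_ge0// prodr_ge0.
  rewrite prodrXr exprVn ler_pdivlMr ?exprn_gt0// mul1r ler_eXn2l ?ltr1n//.
  apply: leq_trans hk; apply: leq_sum => i _.
  by case: (val (k i).2) => // a; rewrite -[X in (X <= _)%N]expn1 leq_pexp2l.
rewrite -mulr_sumr -(bigA_distr_bigA (fun _ => g)) prodr_const card_ord.
have -> : 64 ^+ n = 2 ^+ (4 * n) * 4 ^+ n :> R.
  by rewrite exprM -exprMn; congr (_ ^+ _); ring.
rewrite ler_wpM2l ?exprn_ge0// lerXn2r ?nnegrE//; exact: sumr_ge0.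
Qed.

(** Multiply the unit vector along [w] by 2 sqrt n and round each coordinate towards 0. The error is
    at most 1 / (2 sqrt n) per coordinate, hence at most 1/2 in norm, and the inner product with the
    unit vector stays above 1/2. *)
Lemma net_approx (w : V) : exists2 k, in_net k & enorm w <= 2 * dotp w (net_pt k).
Proof.
have [->|w0] := eqVneq w 0.
  exists [ffun=> (false, ord0)]; last by rewrite dotp0l mulr0 /enorm dotp0l sqrtr0.
  by rewrite /in_net big1// => i _; rewrite ffunE.
have e0 : 0 < enorm w by rewrite enorm_gt0.
have ew := sqr_enorm w.
pose th i := w 0 i / enorm w.
have thS : \sum_i th i ^+ 2 = 1.
  have -> : \sum_i th i ^+ 2 = dotp w w / enorm w ^+ 2.
    by rewrite mulr_suml; apply: eq_bigr => i _; rewrite /th expr_div_n -expr2.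
  by rewrite ew divff// gt_eqF// dotp_gt0.
pose x i := 2 * sn * `|th i|.
have x0 i : 0 <= x i by rewrite mulr_ge0 ?mulr_ge0 ?(ltW sn0).
pose tr i := Num.truncn (x i).
have tr_le i : (tr i)%:R <= x i by rewrite truncn_le.
have tr_gt i : x i < (tr i)%:R + 1 by rewrite natr1 truncnS_gt.
have sq_sn : sn ^+ 2 = n%:R by rewrite sqr_sqrtr// ltW.
have trS : \sum_i (tr i)%:R ^+ 2 <= 4 * n%:R :> R.
  apply: (@le_trans _ _ (\sum_i x i ^+ 2)).
    by apply: ler_sum => i _; rewrite lerXn2r ?nnegrE.
  have -> : \sum_i x i ^+ 2 = 4 * n%:R * \sum_i th i ^+ 2.
    rewrite mulr_sumr; apply: eq_bigr => i _.
    by rewrite /x exprMn real_normK ?num_real// exprMn sq_sn; ring.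
  by rewrite thS mulr1.
have trb i : (tr i < (2 * n).+1)%N.
  rewrite ltnS -(ler_nat R) natrM -ler_sqr ?nnegrE ?mulr_ge0 ?(ltW nR)//.
  apply: le_trans (le_trans trS _).
    by rewrite (bigD1 i)//= lerDl sumr_ge0// => j _; exact: sqr_ge0.
  have n1 : 1 <= n%:R :> R by rewrite ler1n.
  nra.
pose k : net_idx := [ffun i => (w 0 i < 0, Ordinal (trb i))].
exists k.
  rewrite /in_net -(ler_nat R) natr_sum natrM; apply: le_trans trS.
  by rewrite le_eqVlt; apply/orP; left; apply/eqP; apply: eq_bigr => i _; rewrite ffunE natrX.
pose dd := \row_i th i - net_pt k.
have ddb i : `|dd 0 i| <= (2 * sn)^-1.
  rewrite !mxE ffunE /=; set s := (w 0 i < 0).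
  have thE : th i = (-1) ^+ s * `|th i|.
    rewrite /th normrM normfV (gtr0_norm e0) mulrA; congr (_ / _).
    by rewrite /s; case: ltP => h; rewrite ?expr1 ?expr0 ?mulN1r ?mul1r ?(ltr0_norm h) ?(ger0_norm h)// opprK.
  have -> : th i - (-1) ^+ s * (tr i)%:R / (2 * sn) = (-1) ^+ s * ((x i - (tr i)%:R) / (2 * sn)).
    by rewrite {1}thE /x; field; rewrite gt_eqF.
  rewrite normrM normrX normrN1 expr1n mul1r normrM [`|(2 * sn)^-1|]gtr0_norm ?invr_gt0 ?mulr_gt0//.
  rewrite ler_piMl ?invr_ge0 ?mulr_ge0 ?(ltW sn0)// ger0_norm ?subr_ge0//.
  by have := tr_gt i; lra.
have ddS : dotp dd dd <= 1 / 4.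
  apply: (@le_trans _ _ (\sum_(i < n) (2 * sn)^-1 ^+ 2)).
    apply: ler_sum => i _; rewrite -expr2 -real_normK ?num_real//.
    by rewrite lerXn2r ?nnegrE ?invr_ge0 ?mulr_ge0 ?(ltW sn0).
  rewrite sumr_const card_ord -[X in X <= _]mulr_natr exprVn exprMn sq_sn le_eqVlt.
  by apply/orP; left; apply/eqP; field; rewrite gt_eqF.
pose tv := \row_i th i.
have tvS : dotp tv tv = 1 by rewrite -thS; apply: eq_bigr => i _; rewrite !mxE -expr2.
have wE : w = enorm w *: tv.
  by apply/rowP => i; rewrite !mxE /th mulrC divfK// gt_eqF.
have netE : net_pt k = tv - dd by rewrite /dd subKr.
rewrite {2}wE netE dotpZl dotpBr tvS.
have cs := cauchy_schwarz_sqr tv dd; rewrite tvS mul1r in cs.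
have : dotp tv dd <= 1 / 2 by nra.
nra.
Qed.

End net.

Section net_prob.
Context {R : realType} {n N : nat} (mu : probability 'rV[R]_n R).
Hypotheses (n0 : (0 < n)%N) (iso : isotropic mu) (lc : log_concave mu) (nN : (n <= N)%N).
Notation V := 'rV[R]_n.

Let nR : 0 < n%:R :> R. Proof. by rewrite ltr0n. Qed.
Let NR : 0 < N%:R :> R. Proof. by rewrite ltr0n (leq_trans n0). Qed.
Let L : R := ln ((2 * N)%:R / n%:R).

Lemma log_ratio_ge : 1 / 2 <= L.
Proof.
have q2 : 2 <= (2 * N)%:R / n%:R :> R by rewrite ler_pdivlMr// -natrM ler_nat leq_mul.
rewrite -ler_expR lnK ?posrE; last lra.
apply: le_trans q2; have h := expR_ge1Dx (- (1 / 2) : R).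
have e0 := expR_gt0 (1 / 2 : R).
have := ler_wpM2l (ltW e0) h; rewrite expRN divff ?gt_eqF//; lra.
Qed.

(** A sum over any n distinct points is at most 12 L n plus the excess of the whole sample. This
    replaces a union bound over the choices of n points among N. *)
Definition excess (u x : V) : R := Num.max 0 (`|dotp x u| - 12 * L).

Lemma measurable_excess u : measurable_fun setT (excess u).
Proof.
apply: measurable_maxr => //; apply: measurable_funB => //.
by apply: measurableT_comp => //; exact: measurable_dotp.
Qed.

Lemma excess_ge0 u x : 0 <= excess u x. Proof. by rewrite le_max lexx. Qed.

Lemma excess_ge u x : `|dotp x u| <= 12 * L + excess u x.
Proof. by have : `|dotp x u| - 12 * L <= excess u x; [rewrite le_max lexx orbT|lra]. Qed.

(** Since exp (-L) = n / (2N), the exponential moment of one excess is at most 1 + 7n / N, and that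
    of the sum at most exp (7n). Markov at the level 17n leaves exp (-10n). *)
Lemma excess_sum_prob (u : V) : dotp u u <= 1 ->
  pr (mtup mu N) [set t | (12 * 17) * n%:R <= \sum_i excess u (tnth t i)] <= expR (- (10 * n%:R)).
Proof.
move=> u1.
have me i : measurable_fun setT (fun t : N.-tuple V => excess u (tnth t i)).
  by apply: (measurableT_comp (measurable_excess u)); exact: measurable_tnth.
have mS : measurable_fun setT (fun t : N.-tuple V => \sum_i excess u (tnth t i)) by exact: measurable_sum.
have mexp1 : measurable_fun setT (fun x : V => expR (`|dotp x u| / 12)).
  apply: measurableT_comp => //; apply: measurable_funM => //.
  by apply: measurableT_comp => //; exact: measurable_dotp.
have mexp2 : measurable_fun setT (fun x : V => expR (excess u x / 12)).
  by apply: measurableT_comp => //; apply: measurable_funM => //; exact: measurable_excess.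
have eL : expR (- L) = n%:R / (2 * N%:R).
  by rewrite expRN lnK ?posrE ?divr_gt0 ?ltr0n ?muln_gt0 ?(leq_trans n0 nN)// natrM invf_div.
have h1 : (\int[mu]_x (expR (excess u x / 12))%:E <= (expR (7 * n%:R / N%:R))%:E)%E.
  apply: (@le_trans _ _ (\int[mu]_x (1 + expR (- L) * expR (`|dotp x u| / 12))%:E)%E).
    apply: nng_int_le => //.
      by apply: measurable_funD => //; exact: measurable_funM.
    move=> x; rewrite /excess; have [h|h] := leP (`|dotp x u| - 12 * L) 0.
      by rewrite mul0r expR0 lerDl mulr_ge0// expR_ge0.
    rewrite -expRD ler_wpDl// ler_expR; lra.
  have hm : (\int[mu]_x (expR (`|dotp x u| / 12))%:E <= 14%:E)%E.
    have := lc_expmoment iso lc (ltr01 : 0 < (1 : R)) (u := u).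
    by rewrite expr1n mulr1; apply.
  apply: le_trans (int_affine_le mexp1 _ _ _ hm) _ => //; try exact: expR_ge0.
  rewrite lee_fin eL; apply: le_trans (expR_ge1Dx _).
  by rewrite lerD2l le_eqVlt; apply/orP; left; apply/eqP; field; rewrite gt_eqF.
have h2 : (\int[mtup mu N]_t (expR ((\sum_i excess u (tnth t i)) / 12))%:E <= (expR (7 * n%:R))%:E)%E.
  have -> : (\int[mtup mu N]_t (expR ((\sum_i excess u (tnth t i)) / 12))%:E =
      \int[mtup mu N]_t \prod_(i < N) (expR (excess u (tnth t i) / 12))%:E)%E.
    by apply: eq_integral => t _; rewrite prodEFin mulr_suml expR_sum.
  rewrite (@ge0_integral_mtup_prod _ _ _ mu N (fun _ x => (expR (excess u x / 12))%:E)).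
  - apply: (@le_trans _ _ (\prod_(i < N) expR (7 * n%:R / N%:R))%:E).
      apply: lee_prod_EFin => i; first by apply: integral_ge0 => x _; rewrite lee_fin expR_ge0.
      exact: h1.
    rewrite lee_fin prodr_const card_ord -expRM_natl le_eqVlt; apply/orP; left; apply/eqP; congr expR.
    by field; rewrite gt_eqF.
  - by move=> _; exact/measurable_EFinP.
  - by move=> _ x; rewrite lee_fin expR_ge0.
have mf : measurable_fun setT (fun t : N.-tuple V => expR ((\sum_i excess u (tnth t i)) / 12)).
  by apply: measurableT_comp => //; exact: measurable_funM.
have := pr_markov mf (fun t => expR_ge0 _) (expR_gt0 (17 * n%:R)) h2.
rewrite -expRN -expRD => h3; apply: le_trans (le_trans _ h3) _.
  have -> : [set t : N.-tuple V | 12 * 17 * n%:R <= \sum_i excess u (tnth t i)] =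
      [set t | expR (17 * n%:R) <= expR ((\sum_i excess u (tnth t i)) / 12)] => //.
  have c12 : 17 * n%:R * 12 = 12 * 17 * n%:R :> R by ring.
  by apply/seteqP; split => t /=; rewrite ler_expR ler_pdivlMr// c12.
rewrite ler_expR; lra.
Qed.

Theorem sign_sum_bound : exists B : set (N.-tuple V), [/\ measurable B,
  pr (mtup mu N) B <= 16^-1 ^+ n &
  forall t, ~ B t -> forall (e : 'I_n -> 'I_N) (b : 'I_n -> bool), injective e ->
    enorm (\sum_i (-1) ^+ b i *: tnth t (e i)) <= net_const * n%:R * L].
Proof.
pose A k := [set t : N.-tuple V | (12 * 17) * n%:R <= \sum_i excess (net_pt k) (tnth t i)].
have mA k : measurable (A k).
  apply: measurable_ge_cst; apply: measurable_sum => i.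
  by apply: (measurableT_comp (measurable_excess _)); exact: measurable_tnth.
pose B := \big[setU/set0]_(k | in_net k) A k.
have mB : measurable B by apply: bigsetU_measurable => k _; exact: mA.
exists B; split => //.
  apply: (@le_trans _ _ (\sum_(k | @in_net n k) pr (mtup mu N) (A k))).
    apply: pr_le_sum => //.
    by move=> t; rewrite /B -bigcup_seq_cond => -[k /= /andP[_ hk] hA]; exists k.
  apply: (@le_trans _ _ (\sum_(k | @in_net n k) expR (- (10 * n%:R)) * 1)).
    by apply: ler_sum => k hk; rewrite mulr1; apply: excess_sum_prob; exact: net_pt_le1.
  rewrite -mulr_sumr; apply: (@le_trans _ _ (expR (- (10 * n%:R)) * 64 ^+ n)).
    by rewrite ler_wpM2l ?expR_ge0// net_card.
  have -> : expR (- (10 * n%:R)) = expR (- 10) ^+ n :> R.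
    by rewrite -expRM_natl; congr expR; ring.
  (* The union over 64^n points of the net is paid for by exp 10 >= 2^10 = 64 * 16. *)
  rewrite -exprMn lerXn2r ?nnegrE ?mulr_ge0 ?expR_ge0 ?invr_ge0//.
  rewrite expRN ler_pdivrMl ?expR_gt0//.
  have -> : expR 10 = expR 1 ^+ 10 :> R by rewrite -expRM_natl mulr1.
  have h2 : 2 ^+ 10 <= expR 1 ^+ 10 :> R.
    by rewrite lerXn2r ?nnegrE ?expR_ge0//; have := expR_ge1Dx (1 : R); lra.
  rewrite ler_pdivlMr//; apply: le_trans h2.
  by rewrite le_eqVlt; apply/orP; left; apply/eqP; ring.
move=> t Bt e b einj.
set w := \sum_i _; have [k hk hw] := net_approx n0 w.
apply: (le_trans hw).
have Xk : \sum_i excess (net_pt k) (tnth t i) <= (12 * 17) * n%:R.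
  rewrite leNgt; apply/negP => h; apply: Bt; rewrite /B -bigcup_seq_cond.
  by exists k => //=; [rewrite mem_index_enum|exact: ltW].
have h1 : dotp w (net_pt k) <= \sum_i (12 * L + excess (net_pt k) (tnth t (e i))).
  rewrite /w dotp_suml; apply: ler_sum => i _; apply: le_trans (excess_ge _ _).
  rewrite dotpZl; apply: le_trans (ler_norm _) _.
  by rewrite normrM normrX normrN1 expr1n mul1r.
have h2 : \sum_i excess (net_pt k) (tnth t (e i)) <= \sum_i excess (net_pt k) (tnth t i).
  rewrite -(big_imset (fun j => excess (net_pt k) (tnth t j)) (A := predT)) /=; last by move=> i j _ _; exact: einj.
  rewrite [leRHS](bigID (mem (e @: predT))) /= lerDl.
  by apply: sumr_ge0 => i _; exact: excess_ge0.
rewrite big_split /= sumr_const card_ord -mulr_natr in h1.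
have := log_ratio_ge; have := nR; rewrite /net_const => nR' L2.
have : 17 * n%:R <= 34 * (n%:R * L) by nra.
have -> : 24 * 35 * n%:R * L = 24 * 35 * (n%:R * L) by ring.
have : 12 * L * n%:R = 12 * (n%:R * L) by ring.
lra.
Qed.

End net_prob.

(** * Second moments of the simplex *)

Section change_of_variables.
Context {R : realType} {n : nat}.
Notation V := 'rV[R]_n.
Notation leb := (@lebesgue_rV R n).

Lemma ge0_integral_rV_linear (A : 'M[R]_n) (g : V -> \bar R) : A \in unitmx ->
  measurable_fun setT g -> (forall x, 0 <= g x)%E ->
  (\int[leb]_x g x = `|\det A|%:E * \int[leb]_x g (x *m A))%E.
Proof.
move=> uA mg g0; have mA := @measurable_mulmx_rV R n n A.
pose phi : {mfun V >-> V} := mfun_Sub (mem_set mA).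
have k0 : 0 <= `|\det A| by [].
rewrite -(@ge0_integral_pushforward _ _ V V R (fun x => x *m A) mA leb setT g)//.
rewrite -(@ge0_integral_mscale _ V R (pushforward leb phi) setT measurableT (NngNum k0))//.
apply: eq_measure_integral => S mS _ /=.
by rewrite -(lebesgue_rV_linear uA mS) muleC.
Qed.

End change_of_variables.

Section simplex.
Context {R : realType} {n : nat}.
Notation V := 'rV[R]_n.
Notation leb := (@lebesgue_rV R n).

Definition std_simplex : set V := [set x | (forall i, 0 <= x 0 i) /\ \sum_i x 0 i <= 1].

Lemma closed_std_simplex : closed std_simplex.
Proof.
have -> : std_simplex = (\bigcap_(i in [set: 'I_n]) [set x : V | 0 <= x 0 i]) `&`
    [set x : V | \sum_i x 0 i <= 1].
  by apply/seteqP; split => x [x0 x1]; split => // i; [move=> _|]; apply: x0.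
apply: closedI.
  apply: closed_bigI => i _.
  exact: (@preimage_closed _ _ (fun x : V => x 0 i : R) [set y : R | 0 <= y] (fun x _ => @coord_continuous _ _ _ _ _ x) (@closed_ge R 0)).
apply: (@preimage_closed _ _ (fun x : V => \sum_i x 0 i : R) [set y : R | y <= 1] _ (@closed_le R 1)).
move=> x _; have -> : (fun x : V => \sum_i x 0 i) = (fun x : V => dotp x (const_mx 1)).
  by apply/funext => y; apply: eq_bigr => i _; rewrite mxE mulr1.
exact: continuous_dotp.
Qed.

Lemma std_simplex_le1 x i : std_simplex x -> 0 <= x 0 i <= 1.
Proof.
move=> [x0 x1]; rewrite x0/=; apply: le_trans x1.
by rewrite (bigD1 i)//= lerDl sumr_ge0.
Qed.

Lemma compact_std_simplex : compact std_simplex.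
Proof.
apply: (@subclosed_compact _ _ (box_rV 1)).
- exact: closed_std_simplex.
- exact: compact_box.
- by move=> x /std_simplex_le1 h i; have /andP[h0 h1] := h i; rewrite ger0_norm.
Qed.

Lemma measurable_std_simplex : measurable std_simplex.
Proof. by apply: measurable_compact_rV; exact: compact_std_simplex. Qed.

Let mD := measurable_std_simplex.

Let ind : V -> R := \1_std_simplex.

Let mind : measurable_fun setT ind. Proof. exact: measurable_indic. Qed.

Let ind01 x : ind x = (x \in std_simplex)%:R. Proof. by rewrite /ind indicE. Qed.

Lemma std_simplex_fin : (leb std_simplex < +oo)%E.
Proof. exact/lebesgue_compact_lty/compact_std_simplex. Qed.

Definition simplex_moment (i j : 'I_n) : R :=
  fine (\int[leb]_x (\1_std_simplex x * (x 0 i * x 0 j))%:E).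

Let fmom i j x : R := ind x * (x 0 i * x 0 j).

Let mfmom i j : measurable_fun setT (fmom i j).
Proof. by apply: measurable_funM => //; apply: measurable_funM; exact: measurable_coord. Qed.

Let fmom01 i j x : 0 <= fmom i j x <= ind x.
Proof.
rewrite /fmom ind01; case: (boolP (x \in _)) => [/set_mem xD|_]; last by rewrite !mul0r lexx.
rewrite !mul1r.
have /andP[a0 a1] := std_simplex_le1 i xD; have /andP[b0 b1] := std_simplex_le1 j xD.
by rewrite mulr_ge0//= mulr_ile1.
Qed.

Let int_ind : (\int[leb]_x (ind x)%:E = leb std_simplex)%E.
Proof. by rewrite integral_indic// setIT. Qed.

Lemma simplex_momentE i j :
  (\int[leb]_x (\1_std_simplex x * (x 0 i * x 0 j))%:E = (simplex_moment i j)%:E)%E.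
Proof.
rewrite /simplex_moment fineK// ge0_fin_numE.
  apply: le_lt_trans std_simplex_fin; rewrite -int_ind; apply: nng_int_le => //.
  - exact: mfmom.
  - by move=> x; have /andP[] := fmom01 i j x.
  - by move=> x; have /andP[] := fmom01 i j x.
by apply: nng_int_ge0 => x; have /andP[] := fmom01 i j x.
Qed.

Lemma simplex_moment_ge0 i j : 0 <= simplex_moment i j.
Proof. by apply/fine_ge0/nng_int_ge0 => x; have /andP[] := fmom01 i j x. Qed.

Lemma int_simplex_quad (G : 'I_n -> 'I_n -> R) :
  (forall x : V, 0 <= \sum_i \sum_j G i j * (x 0 i * x 0 j)) ->
  (\int[leb]_x (\1_std_simplex x * \sum_i \sum_j G i j * (x 0 i * x 0 j))%:E =
   (\sum_i \sum_j G i j * simplex_moment i j)%:E)%E.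
Proof.
move=> G0.
have ifm i j : leb.-integrable setT (EFin \o fmom i j).
  apply/integrableP; split; first exact/measurable_EFinP.
  under eq_integral do rewrite /= ger0_norm ?(andP (fmom01 _ _ _)).1//.
  by have -> := simplex_momentE i j; rewrite ltry.
transitivity (\int[leb]_x \sum_i \sum_j ((G i j)%:E * (EFin \o fmom i j) x))%E.
  apply: eq_integral => x _; rewrite mulr_sumr -sumEFin; apply: eq_bigr => i _.
  rewrite mulr_sumr -sumEFin; apply: eq_bigr => j _ /=.
  by rewrite -EFinM; congr EFin; rewrite /fmom /ind; ring.
have iZ i j : leb.-integrable setT (fun x => (G i j)%:E * (EFin \o fmom i j) x)%E.
  exact: integrableZl.
rewrite integral_sum//; last first.
  by move=> i; apply: (integrable_sum (mu := leb)) => // j; exact: iZ.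
rewrite -sumEFin; apply: eq_bigr => i _.
rewrite integral_sum// -sumEFin; apply: eq_bigr => j _.
by rewrite integralZl// EFinM -(simplex_momentE i j).
Qed.

Let perm_coord (s : 'S_n) (x : V) k : (x *m perm_mx s) 0 k = x 0 ((s^-1)%g k).
Proof. by rewrite -{1}[s]invgK -col_permE mxE. Qed.

Let ind_perm (s : 'S_n) (x : V) : ind (x *m perm_mx s) = ind x.
Proof.
rewrite !ind01; congr (_%:R); congr nat_of_bool.
apply/idP/idP => /set_mem [x0 x1]; apply: mem_set; split.
- by move=> k; have := x0 (s k); rewrite perm_coord permK.
- move: x1; under eq_bigr do rewrite perm_coord.
  by rewrite [X in _ -> X <= _](reindex_inj (@perm_inj _ s^-1%g)).
- by move=> k; rewrite perm_coord.
- under eq_bigr do rewrite perm_coord.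
  by move: x1; rewrite (reindex_inj (@perm_inj _ s^-1%g)).
Qed.

Lemma simplex_moment_perm (s : 'S_n) i j :
  simplex_moment (s i) (s j) = simplex_moment i j.
Proof.
apply: EFin_inj; rewrite -!simplex_momentE.
rewrite [RHS](@ge0_integral_rV_linear _ _ (perm_mx s^-1)) ?unitmx_perm//; last 2 first.
- by apply/measurable_EFinP; exact: (mfmom i j).
- by move=> x; rewrite lee_fin; have /andP[] := fmom01 i j x.
rewrite det_perm normrX normrN1 expr1n mul1e; apply: eq_integral => x _.
by rewrite -/ind ind_perm !perm_coord invgK.
Qed.

Lemma simplex_moment_diag i j : simplex_moment i i = simplex_moment j j.
Proof. by rewrite -(simplex_moment_perm (tperm i j) i i) tpermL. Qed.

Lemma simplex_moment_offdiag i j i' j' : i != j -> i' != j' ->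
  simplex_moment i j = simplex_moment i' j'.
Proof.
move=> ij ij'; pose s := (tperm i i' * tperm (tperm i i' j) j')%g.
have -> : i' = s i.
  rewrite /s permM tpermL tpermD// 1?eq_sym//.
  by rewrite -{1}(tpermL i i') (inj_eq perm_inj).
have -> : j' = s j by rewrite /s permM tpermL.
by rewrite simplex_moment_perm.
Qed.

(* The shear e_j |-> (e_i + e_j) / 2 maps the simplex onto its half x_i >= x_j. *)
Lemma simplex_moment_le2 (i j : 'I_n) : (i < j)%N ->
  simplex_moment i i <= 2 * simplex_moment i j.
Proof.
move=> ij.
pose A : 'M[R]_n := \matrix_(r, c) (if r == j then (if (c == i) || (c == j) then 1 / 2 else 0) else (r == c)%:R).
have nij : i != j by rewrite neq_ltn ij.
have detA : \det A = 1 / 2.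
  rewrite det_trig; last first.
    apply/is_trig_mxP => r c rc; rewrite mxE; case: eqP => [rj|_].
      have -> : c == i = false by apply/negP => /eqP ci; move: rc; rewrite rj ci ltnNge (ltnW ij).
      by have -> : c == j = false by apply/negP => /eqP ci; move: rc; rewrite rj ci ltnn.
    by rewrite (_ : r == c = false)//; apply/negP => /eqP e; move: rc; rewrite e ltnn.
  rewrite (bigD1 j)//= big1 ?mulr1; first by rewrite mxE eqxx orbT.
  by move=> r rj; rewrite mxE (negbTE rj) eqxx.
have uA : A \in unitmx by rewrite unitmxE unitfE detA; lra.
have xA (x : V) c : (x *m A) 0 c = (if c == j then 0 else x 0 c) + (if (c == i) || (c == j) then x 0 j / 2 else 0).
  rewrite mxE (bigD1 j)//= mxE eqxx addrC; congr (_ + _); last by case: ifP => _; lra.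
  case: eqP => [->|/eqP cj].
    by apply: big1 => r rj; rewrite mxE (negbTE rj) mulr0.
  rewrite (bigD1 c)//= mxE (negbTE cj) eqxx mulr1 big1 ?addr0// => r /andP[rj rc].
  by rewrite mxE (negbTE rj) (negbTE rc) mulr0.
have xAi (x : V) : (x *m A) 0 i = x 0 i + x 0 j / 2 by rewrite xA (negbTE nij) eqxx.
have xAj (x : V) : (x *m A) 0 j = x 0 j / 2 by rewrite xA eqxx orbT add0r.
pose half : set V := [set x | x 0 j <= x 0 i].
have mhalf : measurable half.
  have -> : half = [set x : V | 0 <= x 0 i - x 0 j] by apply/seteqP; split => x /=; rewrite subr_ge0.
  rewrite -[X in measurable X]setTI; apply: (measurable_fun_le (f := fun=> 0)) => //.
  by apply: measurable_funB; exact: measurable_coord.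
pose g k x : R := \1_half x * fmom k k x.
have mg k : measurable_fun setT (g k) by apply: measurable_funM; [exact: measurable_indic|exact: mfmom].
have g0 k x : 0 <= g k x by apply: mulr_ge0 => //; have /andP[] := fmom01 k k x.
have f0 k l x : 0 <= fmom k l x by have /andP[] := fmom01 k l x.
(* The transposition of i and j carries the other half into [half] and exchanges the two
   coordinates. *)
have swap : (\int[leb]_x ((1 - \1_half x) * fmom i i x)%:E <= \int[leb]_x (g j x)%:E)%E.
  have uT : @perm_mx R n (tperm i j) \in unitmx by exact: unitmx_perm.
  rewrite (@ge0_integral_rV_linear _ _ _ (fun x => ((1 - \1_half x) * fmom i i x)%:E) uT); last 2 first.
  - by apply/measurable_EFinP; apply: measurable_funM; [apply: measurable_funB => //; exact: measurable_indic|exact: mfmom].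
  - by move=> x; rewrite lee_fin mulr_ge0// subr_ge0 indicE lern1 leq_b1.
  rewrite det_perm normrX normrN1 expr1n mul1e.
  have e (x : V) k : (x *m perm_mx (tperm i j)) 0 k = x 0 (tperm i j k).
    by rewrite perm_coord tpermV.
  apply: ge0_le_integral => //.
  - by move=> x _; rewrite lee_fin mulr_ge0// subr_ge0 indicE lern1 leq_b1.
  - apply/measurable_EFinP; apply: (measurableT_comp (f := fun x => (1 - \1_half x) * fmom i i x)); last exact: measurable_mulmx_rV.
    by apply: measurable_funM; [apply: measurable_funB => //; exact: measurable_indic|exact: mfmom].
  - exact/measurable_EFinP.
  move=> x _; rewrite lee_fin.
  rewrite /g /fmom ind_perm !e tpermL; apply: ler_wpM2r; first by rewrite mulr_ge0// -?expr2 ?sqr_ge0// ind01.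
  rewrite lerBlDr !indicE; case: (boolP (x \in half)); first by rewrite lerDl.
  by rewrite add0r => xh; rewrite mem_set// /half /= !e tpermR tpermL ltW// ltNge; apply: contra xh => xh; rewrite mem_set.
have half_int k (a b : R) : (forall x : V, ((x *m A) 0 k) ^+ 2 = a * (x 0 i * x 0 i) + b * (x 0 i * x 0 j) + 1 / 4 * (x 0 j * x 0 j)) -> 0 <= a -> 0 <= b ->
    (\int[leb]_x (g k x)%:E <= (1 / 2 * (a * simplex_moment i i + b * simplex_moment i j + 1 / 4 * simplex_moment j j))%:E)%E.
  move=> hk a0 b0.
  rewrite (ge0_integral_rV_linear uA); last 2 first.
  - exact/measurable_EFinP.
  - by move=> x; rewrite lee_fin.
  rewrite detA ger0_norm ?EFinM; last by lra.
  apply: lee_wpmul2l; first by rewrite lee_fin; lra.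
  have -> : (a * simplex_moment i i + b * simplex_moment i j + 1 / 4 * simplex_moment j j)%:E =
     (\int[leb]_x (a * fmom i i x + b * fmom i j x + 1 / 4 * fmom j j x)%:E)%E.
    have m1 : measurable_fun setT (fun x => a * fmom i i x) by exact: measurable_funM.
    have m2 : measurable_fun setT (fun x => b * fmom i j x) by exact: measurable_funM.
    have m3 : measurable_fun setT (fun x => 1 / 4 * fmom j j x) by exact: measurable_funM.
    have p1 x : 0 <= a * fmom i i x by exact: mulr_ge0.
    have p2 x : 0 <= b * fmom i j x by exact: mulr_ge0.
    have p4 : (0 : R) <= 1 / 4 by lra.
    have p3 x : 0 <= 1 / 4 * fmom j j x by exact: mulr_ge0.
    rewrite (@nng_intD _ V R leb setT measurableT (fun x => a * fmom i i x + b * fmom i j x) (fun x => 1 / 4 * fmom j j x))//; last 2 first.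
    - exact: measurable_funD.
    - by move=> x; exact: addr_ge0.
    rewrite nng_intD// !nng_intZ// !EFinD !EFinM.
    by rewrite -(simplex_momentE i i) -(simplex_momentE i j) -(simplex_momentE j j).
  apply: ge0_le_integral => //.
  - by move=> x _; rewrite lee_fin.
  - by apply/measurable_EFinP; apply: (measurableT_comp (f := g k)) => //; exact: measurable_mulmx_rV.
  - by apply/measurable_EFinP; do ! apply: measurable_funD; apply: measurable_funM.
  move=> x _; rewrite lee_fin /g {1}/fmom -expr2 hk.
  have -> : a * fmom i i x + b * fmom i j x + 1 / 4 * fmom j j x =
    ind x * (a * (x 0 i * x 0 i) + b * (x 0 i * x 0 j) + 1 / 4 * (x 0 j * x 0 j)) by rewrite /fmom; ring.
  rewrite [leLHS]mulrA; apply: ler_wpM2r; first by rewrite -hk sqr_ge0.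
  rewrite /ind !indicE; case: (boolP (x *m A \in half)); last by rewrite mul0r.
  move=> /set_mem; rewrite /half /= xAi xAj mul1r => hx.
  case: (boolP (x *m A \in std_simplex)) => //; move=> /set_mem [x0 x1].
  rewrite mem_set//; split.
    move=> k'; have := x0 k'; rewrite xA; case: eqP => [->|_]; first by rewrite orbT; lra.
    by case: eqP => [->|_] /=; rewrite ?addr0// => _; lra.
  have s1 : \sum_(r < n) (if (r == i) || (r == j) then x 0 j / 2 else 0) = x 0 j.
    rewrite (bigD1 i)//= eqxx (bigD1 j) 1?eq_sym//= eqxx orbT big1 ?addr0; first by lra.
    by move=> r /andP[/negbTE -> /negbTE ->].
  have s2 : \sum_(r < n) (if r == j then 0 else x 0 r) = \sum_(r < n | r != j) x 0 r.
    rewrite (bigD1 j)//= eqxx add0r.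
    by apply: eq_bigr => r /negbTE ->.
  apply: le_trans x1; under [leRHS]eq_bigr do rewrite xA.
  by rewrite big_split /= s1 s2 (bigD1 j)//= addrC.
have split_int : (simplex_moment i i)%:E = (\int[leb]_x (g i x)%:E + \int[leb]_x ((1 - \1_half x) * fmom i i x)%:E)%E.
  rewrite -simplex_momentE -nng_intD//.
  - by apply: eq_integral => x _; congr EFin; rewrite /g /fmom /ind; ring.
  - by apply: measurable_funM; [apply: measurable_funB => //; exact: measurable_indic|exact: mfmom].
  - by move=> x; rewrite mulr_ge0// subr_ge0 indicE lern1 leq_b1.
have hi : (\int[leb]_x (g i x)%:E <= (1 / 2 * (1 * simplex_moment i i + 1 * simplex_moment i j + 1 / 4 * simplex_moment j j))%:E)%E.
  by apply: half_int => // x; rewrite xAi; field.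
have hj : (\int[leb]_x (g j x)%:E <= (1 / 2 * (0 * simplex_moment i i + 0 * simplex_moment i j + 1 / 4 * simplex_moment j j))%:E)%E.
  by apply: half_int => // x; rewrite xAj; field.
(* With a and b the diagonal and the mixed moment, the two halves give a <= (a + b + a/4) / 2 + a/8,
   that is, a <= 2b. *)
have := leeD hi (le_trans swap hj); rewrite -split_int -EFinD lee_fin (simplex_moment_diag j i).
lra.
Qed.

(** All n^2 moments are at least half the diagonal one, and their sum, the integral of (sum_i
    x_i)^2, is at most the volume. *)
Lemma simplex_moment_le (i : 'I_n) :
  simplex_moment i i <= 2 / n%:R ^+ 2 * fine (leb std_simplex).
Proof.
have n0 : (0 < n)%N := leq_ltn_trans (leq0n i) (ltn_ord i).
set v := fine _; have v0 : 0 <= v by apply: fine_ge0.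
have vE : leb std_simplex = v%:E by rewrite fineK// ge0_fin_numE// std_simplex_fin.
have sum_le : \sum_(i < n) \sum_(j < n) simplex_moment i j <= v.
  rewrite -lee_fin.
  have := @int_simplex_quad (fun _ _ => 1).
  under [X in (_ -> _ = X%:E)%E]eq_bigr do under eq_bigr do rewrite mul1r.
  have e (x : V) : \sum_i \sum_j 1 * (x 0 i * x 0 j) = (\sum_i x 0 i) ^+ 2.
    rewrite expr2 mulr_suml; apply: eq_bigr => k _; rewrite mulr_sumr.
    by under eq_bigr do rewrite mul1r.
  move=> <-; last by move=> x; rewrite e sqr_ge0.
  rewrite -vE -int_ind; apply: ge0_le_integral => //.
  - by move=> x _; rewrite lee_fin e mulr_ge0// sqr_ge0.
  - apply/measurable_EFinP; apply: measurable_funM => //.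
    apply: measurable_sum => k; apply: measurable_sum => l; apply: measurable_funM => //.
    by apply: measurable_funM; exact: measurable_coord.
  - exact/measurable_EFinP.
  move=> x _; rewrite lee_fin e ind01 /= indicE; case: (boolP (x \in _)); last by rewrite mul0r.
  by move=> /set_mem [x0 x1]; rewrite mul1r expr_le1// sumr_ge0.
have a0 := simplex_moment_ge0 i i.
set a := simplex_moment i i in a0 *.
have low (k l : 'I_n) : a / 2 <= simplex_moment k l.
  case: (eqVneq k l) => [<-|kl].
    by rewrite (simplex_moment_diag k i) -/a; lra.
  rewrite ler_pdivrMr// mulrC.
  have [h|h] : (k < l)%N \/ (l < k)%N by move: kl; rewrite -val_eqE neq_ltn => /orP.
    by rewrite /a (simplex_moment_diag i k); exact: simplex_moment_le2.
  have -> : simplex_moment k l = simplex_moment l k by apply: simplex_moment_offdiag => //; rewrite eq_sym.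
  have -> : a = simplex_moment l l by exact: simplex_moment_diag.
  exact: simplex_moment_le2.
have : n%:R * (n%:R * (a / 2)) <= v.
  apply: le_trans sum_le.
  have -> : n%:R * (n%:R * (a / 2)) = \sum_(i < n) \sum_(j < n) (a / 2).
    by rewrite !sumr_const !card_ord -[RHS]mulr_natl -[X in _ = _ * X]mulr_natl.
  by apply: ler_sum => k _; apply: ler_sum => l _; exact: low.
have np : (0 : R) < n%:R by rewrite ltr0n.
move=> h; rewrite mulrAC ler_pdivlMr ?exprn_gt0//.
by rewrite (_ : a * _ = 2 * (n%:R * (n%:R * (a / 2)))) ?ler_pM2l//; field.
Qed.

End simplex.

Section signed_sums.
Context {R : realType} {n : nat}.
Notation V := 'rV[R]_n.
Notation leb := (@lebesgue_rV R n).

(** Adding the vectors one at a time, the sign of the new one is chosen to make the cross term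
    nonnegative. *)
Lemma sum_sqr_le_signed m (y : 'I_m -> V) : exists b : 'I_m -> bool,
  \sum_i dotp (y i) (y i) <= dotp (\sum_i (-1) ^+ b i *: y i) (\sum_i (-1) ^+ b i *: y i).
Proof.
elim: m y => [|m IH] y; first by exists (fun=> false); rewrite !big_ord0 dotp0l.
have [b hb] := IH (fun i => y (lift ord0 i)).
set s := (X in dotp X X) in hb.
exists (fun i => if unlift ord0 i is Some j then b j else dotp (y ord0) s < 0).
rewrite !big_ord_recl/= unlift_none.
rewrite (eq_bigr (fun i => (-1) ^+ b i *: y (lift ord0 i))) -/s; last by move=> i _; rewrite liftK.
rewrite dotpDl !dotpDr !dotpZl !dotpZr (dotpC s (y ord0)).
set c := dotp _ s.
have h1 : 0 <= (-1) ^+ (c < 0)%R * c.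
  by case: ltP => h; rewrite ?expr1 ?expr0 ?mulN1r ?mul1r// oppr_ge0 ltW.
have h2 : (-1) ^+ (c < 0)%R * ((-1) ^+ (c < 0)%R * dotp (y ord0) (y ord0)) = dotp (y ord0) (y ord0).
  by rewrite mulrA -expr2 sqrr_sign mul1r.
rewrite h2 -addrA lerD2l addrA.
by apply: (le_trans hb); rewrite lerDr addr_ge0.
Qed.

(** By symmetry the integral is (a - b) times the trace of the Gram matrix plus b times the sum of
    its entries, where 0 <= b <= a are the mixed and the diagonal moment. Both quantities are at
    most M: the trace by [sum_sqr_le_signed], the sum as the square of the sum with all signs
    positive. *)
Lemma simplex_second_moment (Y : 'M[R]_n) (M : R) :
  (forall b : 'I_n -> bool, dotp (\sum_i (-1) ^+ b i *: row i Y) (\sum_i (-1) ^+ b i *: row i Y) <= M) ->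
  (\int[leb]_x (\1_std_simplex x * dotp (x *m Y) (x *m Y))%:E <=
   (2 * M / n%:R ^+ 2)%:E * leb std_simplex)%E.
Proof.
move=> hM.
have v0 : 0 <= fine (leb std_simplex) by apply: fine_ge0.
have -> : leb std_simplex = (fine (leb std_simplex))%:E by rewrite fineK// ge0_fin_numE// std_simplex_fin.
pose G i j := dotp (row i Y) (row j Y).
have quad x : dotp (x *m Y) (x *m Y) = \sum_i \sum_j G i j * (x 0 i * x 0 j).
  rewrite mulmx_sum_row dotp_suml; apply: eq_bigr => i _; rewrite dotp_sumr.
  by apply: eq_bigr => j _; rewrite dotpZl dotpZr /G; ring.
under eq_integral do rewrite quad.
rewrite int_simplex_quad; last by move=> x; rewrite -quad dotp_ge0.
rewrite -EFinM lee_fin.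
have M0 : 0 <= M := le_trans (dotp_ge0 _) (hM (fun=> false)).
have [n0|n0] := posnP n.
  rewrite [leLHS]big1 ?mulr_ge0// ?invr_ge0 ?exprn_ge0 ?ler0n//.
  by move=> i; exfalso; have := ltn_ord i; rewrite [X in (_ < X)%N]n0.
have [i0 _] : exists i : 'I_n, true by exists (Ordinal n0).
pose a : R := @simplex_moment R n i0 i0.
have aE i : @simplex_moment R n i i = a by exact: simplex_moment_diag.
have diag_le : \sum_i G i i <= M.
  by have [b hb] := sum_sqr_le_signed (fun i => row i Y); apply: le_trans hb _; exact: hM.
have all_le : \sum_i \sum_j G i j <= M.
  apply: le_trans (hM (fun=> false)); rewrite dotp_suml; apply: ler_sum => i _.
  by rewrite dotp_sumr; apply: ler_sum => j _; rewrite expr0 !scale1r.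
have [b [b0 ba bE]] : exists b : R, [/\ 0 <= b, b <= a & forall i j, i != j -> @simplex_moment R n i j = b].
  have [[j ij]|none] := pselect (exists j, i0 != j); last first.
    (* In dimension 1 there is no mixed moment, and b = 0 serves. *)
    exists 0; rewrite simplex_moment_ge0; split => // i j ij; exfalso; apply: none.
    case: (eqVneq i0 i) => [e|h]; last by exists i.
    by exists j; rewrite e.
  exists (@simplex_moment R n i0 j); split; first exact: simplex_moment_ge0.
    rewrite -lee_fin -(@lee_pmul2l _ 2%:E)// -!EFinM.
    (* The integral of (x_i0 - x_j)^2 is 2a - 2b, hence b <= a. *)
    have := @int_simplex_quad R n (fun k l => ((k == i0)%:R - (k == j)%:R) * ((l == i0)%:R - (l == j)%:R)).
    have sq (x : V) : \sum_k \sum_l ((k == i0)%:R - (k == j)%:R) * ((l == i0)%:R - (l == j)%:R) * (x 0 k * x 0 l) = (\sum_k ((k == i0)%:R - (k == j)%:R) * x 0 k) ^+ 2.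
      by rewrite expr2 mulr_suml; apply: eq_bigr => k _; rewrite mulr_sumr; apply: eq_bigr => l _; ring.
    move=> /(_ (fun x => _)) h; have := h; rewrite {h}.
    set I := integral _ _ _; move=> h.
    have I0 : (0 <= I)%E by apply: nng_int_ge0 => x; rewrite sq mulr_ge0// sqr_ge0.
    move: I0; rewrite h; last by move=> x; rewrite sq sqr_ge0.
    rewrite !lee_fin.
    have pick (F : 'I_n -> R) : \sum_k ((k == i0)%:R - (k == j)%:R) * F k = F i0 - F j.
      under eq_bigr do rewrite mulrBl; rewrite sumrB; congr (_ - _).
        by rewrite (bigD1 i0)//= eqxx mul1r big1 ?addr0// => k /negbTE ->; rewrite mul0r.
      by rewrite (bigD1 j)//= eqxx mul1r big1 ?addr0// => k /negbTE ->; rewrite mul0r.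
    have -> : \sum_k \sum_l ((k == i0)%:R - (k == j)%:R) * ((l == i0)%:R - (l == j)%:R) * @simplex_moment R n k l =
        \sum_k ((k == i0)%:R - (k == j)%:R) * (@simplex_moment R n k i0 - @simplex_moment R n k j).
      apply: eq_bigr => k _; rewrite -pick mulr_sumr.
      by apply: eq_bigr => l _; rewrite mulrA.
    have ji : j != i0 by rewrite eq_sym.
    rewrite pick !aE (simplex_moment_offdiag ji ij).
    by move=> hh; lra.
  by move=> i k ik; exact: simplex_moment_offdiag.
have -> : \sum_i \sum_j G i j * simplex_moment i j = (a - b) * \sum_i G i i + b * \sum_i \sum_j G i j.
  rewrite !mulr_sumr -big_split; apply: eq_bigr => i _ /=.
  rewrite (bigD1 i)//= [in RHS](bigD1 i)//= aE.
  rewrite (eq_bigr (fun j => b * G i j)); last by move=> j ij; rewrite bE 1?eq_sym// mulrC.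
  by rewrite -mulr_sumr; ring.
have aM : (a - b) * \sum_i G i i + b * \sum_i \sum_j G i j <= a * M.
  apply: (@le_trans _ _ ((a - b) * M + b * M)); last by rewrite -mulrDl subrK.
  by apply: lerD; apply: ler_wpM2l => //; rewrite subr_ge0.
apply: (le_trans aM).
rewrite (_ : 2 * M / _ * _ = 2 / n%:R ^+ 2 * fine (leb std_simplex) * M); last by ring.
by apply: ler_wpM2r => //; exact: simplex_moment_le.
Qed.

End signed_sums.

(** * Symmetric hulls *)

Section hulls.
Context {R : realType} {n : nat}.
Notation V := 'rV[R]_n.

Lemma convex_setE (K : set V) : convex_set K <->
  (forall (x y : V) (t : R), 0 <= t <= 1 -> K x -> K y -> K (t *: x + (1 - t) *: y)).
Proof.
split => [cK x y t /andP[t0 t1] Kx Ky|cK x y l /set_mem Kx /set_mem Ky].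
  exact: set_mem (cK x y (Itv01 t0 t1) (mem_set Kx) (mem_set Ky)).
apply: mem_set; apply: (cK x y l%:num) => //.
by rewrite ge0 le1.
Qed.

Lemma convex_sum (K : set V) (I : finType) (w : I -> R) (y : I -> V) : convex_set K ->
  (forall i, 0 <= w i) -> \sum_i w i = 1 -> (forall i, K (y i)) -> K (\sum_i w i *: y i).
Proof.
move=> /convex_setE cK w0 w1 Ky.
suff H (s : seq I) : 0 < \sum_(i <- s) w i ->
    K ((\sum_(i <- s) w i)^-1 *: \sum_(i <- s) w i *: y i).
  by have := H (index_enum I); rewrite w1 invr1 scale1r; apply.
elim: s => [|i s IH]; first by rewrite big_nil ltxx.
rewrite !big_cons => S0; have s0 : 0 <= \sum_(j <- s) w j by apply: sumr_ge0.
have [sz|sz] := eqVneq (\sum_(j <- s) w j) 0.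
  have -> : \sum_(j <- s) w j *: y j = 0.
    apply: big1_seq => j /andP[_ js].
    move/eqP: sz; rewrite psumr_eq0//= => /allP/(_ _ js)/eqP ->.
    by rewrite scale0r.
  move: S0; rewrite sz !addr0 => wi; rewrite scalerA mulVf ?scale1r ?gt_eqF//.
have sp : 0 < \sum_(j <- s) w j by rewrite lt_neqAle eq_sym sz s0.
set S := w i + _ in S0 *.
have -> : S^-1 *: (w i *: y i + \sum_(j <- s) w j *: y j) =
    (w i / S) *: y i + (1 - w i / S) *: ((\sum_(j <- s) w j)^-1 *: \sum_(j <- s) w j *: y j).
  rewrite scalerDr !scalerA [S^-1 * _]mulrC; congr (_ + _ *: _).
  by rewrite /S; field; rewrite sz gt_eqF.
apply: cK; [|exact: Ky|exact: IH].
by rewrite divr_ge0 ?(ltW S0)//= ler_pdivrMr// mul1r lerDl.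
Qed.

(** The weight missing from 1 is put on the origin, for which the extra index of type [unit]
    stands. *)
Lemma abs_convex_sum (K : set V) (I : finType) (q : I -> R) (y : I -> V) :
  convex_set K -> K 0 -> (forall i, K (y i)) -> (forall i, K (- y i)) ->
  \sum_i `|q i| <= 1 -> K (\sum_i q i *: y i).
Proof.
move=> cK K0 Ky Kny q1.
have -> : \sum_i q i *: y i = \sum_(i : (I + unit)%type)
    (match i with inl j => `|q j| | inr _ => 1 - \sum_j `|q j| end) *:
    (match i with inl j => if 0 <= q j then y j else - y j | inr _ => 0 end).
  rewrite big_sumType /= [X in _ + X]big1 ?addr0; last by move=> i _; rewrite scaler0.
  apply: eq_bigr => i _; case: lerP => h; first by rewrite ger0_norm.
  by rewrite scalerN -scaleNr ltr0_norm// opprK.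
apply: convex_sum => //.
- by case=> [i|_] //; rewrite subr_ge0.
- by rewrite big_sumType /= big_const card_unit /= addr0 addrC subrK.
- by case=> [i|_] //; case: ifP.
Qed.

Context {N : nat}.
Implicit Types x : 'I_N -> V.

Definition l1ball : set 'rV[R]_N := [set q | \sum_i `|q 0 i| <= 1].

(** A linear image of the l1 ball: compactness is immediate, and membership becomes a condition on
    coefficients. *)
Definition abs_hull x : set V := [set q *m (\matrix_i x i) | q in l1ball].

Lemma mulmx_rows (q : 'rV[R]_N) x : q *m (\matrix_i x i) = \sum_i q 0 i *: x i.
Proof. by rewrite mulmx_sum_row; apply: eq_bigr => i _; rewrite rowK. Qed.

Lemma compact_l1ball : compact l1ball.
Proof.
apply: (@subclosed_compact _ _ (box_rV 1)).
- apply: (@preimage_closed _ _ (fun q : 'rV[R]_N => \sum_i `|q 0 i| : R) [set y : R | y <= 1] _ (@closed_le R 1)).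
  move=> q _; elim: (index_enum _) q => [|i s IH].
    by rewrite (_ : (fun _ => _) = cst (0 : R)); [exact: cst_continuous|apply/funext => q; rewrite big_nil].
  rewrite (_ : (fun _ => _) = (fun q : 'rV[R]_N => `|q 0 i| + \sum_(j <- s) `|q 0 j| : R)).
    apply: continuous_addR => // q.
    exact: (@cvg_norm R R^o _ (nbhs q) _ (fun q : 'rV[R]_N => q 0 i) (q 0 i) (@coord_continuous _ _ _ 0 i q)).
  by apply/funext => q; rewrite big_cons.
- exact: compact_box.
- move=> q /= q1 i; apply: le_trans q1.
  by rewrite (bigD1 i)//= lerDl sumr_ge0.
Qed.

Lemma compact_abs_hull x : compact (abs_hull x).
Proof.
apply: continuous_compact; last exact: compact_l1ball.
apply: continuous_subspaceT.
rewrite (_ : (fun _ => _) = (fun q : 'rV[R]_N => 0 + q *m \matrix_i x i)); first exact: continuous_affine.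
by apply/funext => q; rewrite add0r.
Qed.

Lemma abs_hull0 x : abs_hull x 0.
Proof.
exists 0; last by rewrite mul0mx.
by rewrite /l1ball /= big1// => i _; rewrite mxE normr0.
Qed.

Lemma abs_hullN x z : abs_hull x z -> abs_hull x (- z).
Proof.
move=> [q q1 <-]; exists (- q); last by rewrite mulNmx.
by rewrite /l1ball /=; under eq_bigr do rewrite mxE normrN.
Qed.

Lemma abs_hull_pt x i : abs_hull x (x i).
Proof.
exists (delta_mx 0 i); last by rewrite -rowE rowK.
rewrite /l1ball /= (bigD1 i)//= big1 => [|j ji]; first by rewrite !mxE !eqxx normr1 addr0.
by rewrite !mxE eqxx (negbTE ji) normr0.
Qed.

Lemma convex_abs_hull x : convex_set (abs_hull x).
Proof.
apply/convex_setE => _ _ t /andP[t0 t1] [p p1 <-] [q q1 <-].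
exists (t *: p + (1 - t) *: q); last by rewrite mulmxDl !scalemxAl.
have t1' : 0 <= 1 - t by rewrite subr_ge0.
apply: (@le_trans _ _ (t * (\sum_i `|p 0 i|) + (1 - t) * (\sum_i `|q 0 i|))).
  rewrite !mulr_sumr -big_split /=; apply: ler_sum => i _; rewrite !mxE.
  by apply: (le_trans (ler_normD _ _)); rewrite !normrM (ger0_norm t0) (ger0_norm t1').
have h1 : t * (\sum_i `|p 0 i|) <= t by rewrite ler_piMr.
have h2 : (1 - t) * (\sum_i `|q 0 i|) <= 1 - t by rewrite ler_piMr.
by apply: (le_trans (lerD h1 h2)); rewrite addrC subrK.
Qed.

Lemma symmetric_hullE x : (0 < N)%N -> symmetric_hull x = abs_hull x.
Proof.
move=> N0; apply/seteqP; split => z.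
  apply; split; first exact: convex_abs_hull.
  by move=> _ [[i _ <-]|[i _ <-]]; [|apply: abs_hullN]; exact: abs_hull_pt.
move=> [q q1 <-] C [cC CX]; rewrite mulmx_rows.
have Cx i : C (x i) by apply: CX; left; exists i.
have Cnx i : C (- x i) by apply: CX; right; exists i.
apply: abs_convex_sum => //.
(* A sample point and its opposite have the midpoint 0; an empty sample has the empty hull, but 0
   would be in [abs_hull]. *)
have i := Ordinal N0.
move/convex_setE: cC => /(_ (x i) (- x i) (1 / 2)).
have -> : (1 / 2) *: x i + (1 - 1 / 2) *: - x i = 0.
  by rewrite scalerN -scalerBl (_ : _ - _ = 0) ?scale0r//; lra.
by apply => //; lra.
Qed.

(** If the points do not span, a vector orthogonal to all of them moves an interior point out of the
    hull. If n of them form a basis, the hull contains the linear image of a small cube. *)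
Lemma abs_hull_interior x :
  (abs_hull x)° !=set0 <-> exists e : 'I_n -> 'I_N, \det (\matrix_i x (e i)) != 0.
Proof.
split.
  move=> [z zK].
  have [full|nfull] := boolP (row_full (\matrix_i x i)).
    exists (fullrankfun full).
    have := fullrowsub_unit full; rewrite unitmxE unitfE.
    by congr (\det _ != 0); apply/row_matrixP => i; rewrite row_rowsub !rowK.
  have cn0 : cokermx (\matrix_i x i) != 0.
    rewrite -mxrank_eq0 mxrank_coker subn_eq0 -ltnNge ltn_neqAle rank_leq_col andbT.
    by move: nfull; rewrite /row_full.
  have [j jn0] : exists j, (col j (cokermx (\matrix_i x i)))^T != 0.
    apply/existsP; apply: contraNT cn0; rewrite negb_exists => /forallP h.
    apply/eqP/matrixP => r c; have := h c; rewrite negbK => /eqP/matrixP/(_ 0 r).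
    by rewrite !mxE.
  set v := _^T in jn0.
  have Kv y : abs_hull x y -> dotp y v = 0.
    move=> [q _ <-].
    have : (q *m \matrix_i x i) *m cokermx (\matrix_i x i) = 0 by rewrite -mulmxA mulmx_coker mulmx0.
    move=> /matrixP/(_ 0 j); rewrite mxE [RHS]mxE => <-.
    by apply: eq_bigr => k _; rewrite /v !mxE.
  have [e /= e0 eK] : exists2 e : R, 0 < e & ball z e `<=` abs_hull x by move/nbhs_ballP: zK.
  pose c := e / (2 * (1 + \sum_i `|v 0 i|)).
  have s0 : 0 < 1 + \sum_i `|v 0 i| by rewrite ltr_pwDl// sumr_ge0.
  have c0 : 0 < c by rewrite divr_gt0// mulr_gt0.
  have hz : abs_hull x (z + c *: v).
    apply: eK; split => // r i; rewrite (ord1 r) /ball_ /= /ball /= !mxE opprD addrA subrr add0r normrN normrM (gtr0_norm c0).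
    rewrite /c mulrAC ltr_pdivrMr ?mulr_gt0// ltr_pM2l//.
    apply: (@le_lt_trans _ _ (\sum_i `|v 0 i|)).
      by rewrite [leRHS](bigD1 i)//= /v !mxE lerDl sumr_ge0.
    by move: s0; set s := \sum_i _; lra.
  have := Kv _ hz; rewrite dotpDl dotpZl (Kv z); last exact: interior_subset.
  by move/eqP; rewrite add0r mulf_eq0 gt_eqF//= dotp_eq0 (negbTE jn0).
move=> [e de]; set Y := \matrix_i x (e i) in de.
have uY : Y \in unitmx by rewrite unitmxE unitfE.
exists 0.
have cn : nbhs (0 : V) (box_rV (n%:R + 1)^-1).
  apply/nbhs_ballP; exists (n%:R + 1)^-1 => /=; first by rewrite invr_gt0 ltr_wpDl.
  move=> z [_ zb] i; have := zb 0 i; rewrite /ball /= mxE sub0r normrN => /ltW.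
  exact.
have cont : {for 0, continuous (fun z : V => 0 + z *m invmx Y)} by move=> ?; exact: continuous_affine.
have : nbhs (0 : V) ((fun z : V => 0 + z *m invmx Y) @^-1` box_rV (n%:R + 1)^-1).
  by apply: cont; rewrite mul0mx addr0.
apply: filterS => z /=; rewrite add0r => zb.
rewrite -(mulmxKV uY z) (_ : _ *m Y = \sum_i (z *m invmx Y) 0 i *: x (e i)); last first.
  by rewrite mulmx_sum_row; apply: eq_bigr => i _; rewrite rowK.
apply: abs_convex_sum.
- exact: convex_abs_hull.
- exact: abs_hull0.
- by move=> i; exact: abs_hull_pt.
- by move=> i; apply: abs_hullN; exact: abs_hull_pt.
apply: (@le_trans _ _ (\sum_(i < n) (n%:R + 1)^-1)); first by apply: ler_sum => i _; exact: zb.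
rewrite sumr_const card_ord -[leLHS]mulr_natl ler_pdivrMr ?ltr_wpDl//.
by rewrite mul1r lerDl.
Qed.

Lemma symmetric_convex_body_hull x : (0 < N)%N ->
  symmetric_convex_body (symmetric_hull x) <->
  exists e : 'I_n -> 'I_N, \det (\matrix_i x (e i)) != 0.
Proof.
move=> N0; rewrite symmetric_hullE//; split.
  by move=> [_ _ /abs_hull_interior].
move=> /abs_hull_interior h; split => //.
- exact: convex_abs_hull.
- exact: compact_abs_hull.
- exact: abs_hullN.
Qed.

End hulls.

Section cramer.
Context {R : realType} {n : nat}.

Lemma det_replace_row (B : 'M[R]_n) (z : 'rV[R]_n) (r : 'I_n) :
  \det (\matrix_i (if i == r then z else row i B)) = (z *m \adj B) 0 r.
Proof.
rewrite (expand_det_row _ r) mxE; apply: eq_bigr => j _.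
rewrite !mxE eqxx; congr (_ * _); rewrite /cofactor; congr (_ * \det _).
by apply/matrixP => a b; rewrite !mxE eq_sym (negbTE (neq_lift r a)) mxE.
Qed.

End cramer.

Section covering.
Context {d : measure_display} {T : measurableType d} {R : realType}.
Context (m : {measure set T -> \bar R}).

Lemma bigsetU_null (I : choiceType) (s : seq I) (A : I -> set T) :
  (forall i, measurable (A i)) -> (forall i, i \in s -> m (A i) = 0%E) ->
  m (\big[setU/set0]_(i <- s) A i) = 0%E.
Proof.
move=> mA; elim: s => [|i s IH] A0; first by rewrite big_nil measure0.
apply/eqP; rewrite big_cons eq_le measure_ge0 andbT.
have mU : measurable (\big[setU/set0]_(j <- s) A j) by apply: bigsetU_measurable.
apply: le_trans (measureU2 m (mA i) mU) _.
rewrite [X in (X + _)%E](A0 i) ?mem_head// [X in (_ + X)%E]IH ?adde0// => j js.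
by rewrite A0// inE js orbT.
Qed.

(** Equal sets are allowed because facets are encoded by ordered families of vertices, so the same
    simplex occurs several times in the list. *)
Lemma integral_cover (I : choiceType) (s : seq I) (A : I -> set T) (q : T -> \bar R) (c : R) :
  (forall i, measurable (A i)) -> measurable_fun setT q -> (forall x, 0 <= q x)%E -> 0 <= c ->
  (forall i, i \in s -> \int[m]_(x in A i) q x <= c%:E * m (A i))%E ->
  (forall i j, i \in s -> j \in s -> A i = A j \/ m (A i `&` A j) = 0%E) ->
  (\int[m]_(x in \big[setU/set0]_(i <- s) A i) q x <= c%:E * m (\big[setU/set0]_(i <- s) A i))%E.
Proof.
move=> mA mq q0 c0; elim: s => [|i s IH] qA AA.
  by rewrite big_nil integral_set0 mule_ge0.
have {}IH : (\int[m]_(x in \big[setU/set0]_(i <- s) A i) q x <= c%:E * m (\big[setU/set0]_(i <- s) A i))%E.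
  by apply: IH => [j js|j k js ks]; [apply: qA|apply: AA]; rewrite inE ?js ?ks orbT.
rewrite big_cons; set U := \big[setU/set0]_(j <- s) A j in IH *.
have mU : measurable U by apply: bigsetU_measurable.
have UE y : U y <-> exists2 j, j \in s & A j y.
  by rewrite /U -bigcup_seq; split => [[j js Aj]|[j js Aj]]; exists j.
have [[j js Aij]|none] := pselect (exists2 j, j \in s & A i = A j).
  rewrite (_ : A i `|` U = U)//; apply/seteqP; split=> y; [case=> //|by right].
  by rewrite Aij => Aj; apply/UE; exists j.
have mI : m (U `&` A i) = 0%E.
  apply/eqP; rewrite eq_le measure_ge0 andbT.
  rewrite (_ : U `&` A i = \big[setU/set0]_(j <- s) (A i `&` A j)); last first.
    rewrite -bigcup_seq; apply/seteqP; split => [y [/UE [j js Aj] Ai]|y [j js [Ai Aj]]]; first by exists j.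
    by split=> //; apply/UE; exists j.
  rewrite (@bigsetU_null _ s (fun j => A i `&` A j))// => [j|j js]; first exact: measurableI.
  have js' : j \in i :: s by rewrite inE js orbT.
  have [Aij|//] := AA i j (mem_head _ _) js'.
  by exfalso; apply: none; exists j.
have mUE : m U = m (U `\` A i) by rewrite (measureDI m mU (mA i)) [X in (_ + X)%E]mI adde0.
have -> : A i `|` U = A i `|` (U `\` A i) by rewrite setUDr setDv setD0.
have mD : measurable (U `\` A i) by exact: measurableD.
have dis : [disjoint A i & U `\` A i] by apply/disj_setPS => y [Ay [_ /(_ Ay)]].
rewrite ge0_integral_setU//; last exact: measurable_funS mq.
have -> : m (A i `|` U `\` A i) = (m (A i) + m U)%E.
  rewrite mUE; apply: (measureU m (mA i) mD).
  by apply/seteqP; split => y // [Ay [_ /(_ Ay)]].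
rewrite ge0_muleDr//; apply: leeD; first by apply: qA; rewrite mem_head.
apply: le_trans IH; apply: ge0_subset_integral => //; exact: measurable_funS mq.
Qed.

End covering.

(** * Triangulation of the hull by supporting simplices *)

Section triangulation.
Context {R : realType} {n N : nat}.
Notation V := 'rV[R]_n.
Notation leb := (@lebesgue_rV R n).
Variable (x : 'I_N -> V).
Notation facet := {ffun 'I_n -> bool * 'I_N}.
Implicit Types (f g : facet) (z : V) (c : bool * 'I_N).

Definition signed_pt c : V := (-1) ^+ c.1 *: x c.2.
Definition facet_mx f : 'M[R]_n := \matrix_i signed_pt (f i).
Definition bary f z : V := z *m invmx (facet_mx f).
Definition gauge_of f z : R := \sum_i bary f z 0 i.
Definition facet_simplex f : set V := [set l *m facet_mx f | l in std_simplex].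
(* [f] selects n signed sample points; it is supporting when the hyperplane through them has all
   of the hull on one side, i.e. when it is a feasible dual point of the linear program which
   computes the gauge of the hull. *)
Definition supporting f := \det (facet_mx f) != 0 /\ forall k, `|gauge_of f (x k)| <= 1.
Definition general_position := forall f k, \det (facet_mx f) != 0 ->
  (forall i, (f i).2 != k) -> `|gauge_of f (x k)| != 1.
Definition generic_pt z := forall f i, \det (facet_mx f) != 0 -> bary f z 0 i != 0.

Lemma row_facet f i : row i (facet_mx f) = signed_pt (f i).
Proof. by rewrite rowK. Qed.

Lemma mul_facet (l : V) f : l *m facet_mx f = \sum_i l 0 i *: signed_pt (f i).
Proof. exact: mulmx_rows. Qed.

Lemma unit_facet f : \det (facet_mx f) != 0 -> facet_mx f \in unitmx.
Proof. by rewrite unitmxE unitfE. Qed.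

Lemma baryK f z : \det (facet_mx f) != 0 -> bary f z *m facet_mx f = z.
Proof. by move=> /unit_facet u; rewrite mulmxKV. Qed.

Lemma bary_mul f (l : V) : \det (facet_mx f) != 0 -> bary f (l *m facet_mx f) = l.
Proof. by move=> /unit_facet u; rewrite /bary mulmxK. Qed.

Lemma bary_vertex f i : \det (facet_mx f) != 0 -> bary f (signed_pt (f i)) = delta_mx 0 i.
Proof. by move=> d; rewrite -row_facet rowE bary_mul. Qed.

Lemma gauge_of_sum f (I : finType) (l : I -> R) (y : I -> V) :
  gauge_of f (\sum_j l j *: y j) = \sum_j l j * gauge_of f (y j).
Proof.
have bs : bary f (\sum_j l j *: y j) = \sum_j l j *: bary f (y j).
  by rewrite /bary mulmx_suml; apply: eq_bigr => j _; rewrite scalemxAl.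
rewrite /gauge_of bs; under eq_bigr do rewrite summxE.
rewrite exchange_big /=; apply: eq_bigr => j _; rewrite mulr_sumr.
by apply: eq_bigr => i _; rewrite mxE.
Qed.

Lemma gauge_of_vertex f i : \det (facet_mx f) != 0 -> gauge_of f (signed_pt (f i)) = 1.
Proof.
move=> d; rewrite /gauge_of bary_vertex// (bigD1 i)//= big1 ?addr0 => [|j /negbTE ji].
  by rewrite mxE !eqxx.
by rewrite mxE eqxx ji.
Qed.

Lemma gauge_ofZ f a z : gauge_of f (a *: z) = a * gauge_of f z.
Proof. by rewrite /gauge_of /bary -scalemxAl mulr_sumr; apply: eq_bigr => i _; rewrite mxE. Qed.

Lemma facet_simplexE f z : \det (facet_mx f) != 0 -> facet_simplex f z <-> std_simplex (bary f z).
Proof.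
move=> d; split=> [[l hl <-]|h]; first by rewrite bary_mul.
by exists (bary f z) => //; rewrite baryK.
Qed.

Lemma supporting_pt f c : supporting f -> gauge_of f (signed_pt c) <= 1.
Proof.
move=> [_ /(_ c.2) h]; apply: le_trans (ler_norm _) _.
by rewrite gauge_ofZ normrM normr_sign mul1r.
Qed.

Lemma facet_simplex_sub f : facet_simplex f `<=` abs_hull x.
Proof.
move=> _ [l [l0 l1] <-]; rewrite mul_facet.
have h c : abs_hull x (signed_pt c).
  rewrite /signed_pt; case: c => [[] i] /=; rewrite ?expr1 ?expr0 ?scaleN1r ?scale1r.
    by apply: abs_hullN; exact: abs_hull_pt.
  exact: abs_hull_pt.
apply: abs_convex_sum.
- exact: convex_abs_hull.
- exact: abs_hull0.
- by move=> i; exact: h.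
- by move=> i; apply: abs_hullN; exact: h.
- by apply: le_trans l1; apply: ler_sum => i _; rewrite ger0_norm.
Qed.

Lemma abs_hull_gauge f z : supporting f -> abs_hull x z -> gauge_of f z <= 1.
Proof.
move=> [_ sf] [q q1 <-]; rewrite mulmx_rows gauge_of_sum; apply: le_trans q1.
apply: ler_sum => i _; apply: le_trans (ler_norm _) _; rewrite normrM.
by rewrite ler_piMr.
Qed.

(* Both gauges agree at a common generic point, so each vertex of [g] lies on the facet of [f]. *)
Lemma facet_simplex_sub_generic f g z : general_position -> supporting f -> supporting g ->
  generic_pt z -> facet_simplex f z -> facet_simplex g z -> facet_simplex g `<=` facet_simplex f.
Proof.
move=> gp sf sg gz fz gz'.
have [df _] := sf; have [dg _] := sg.
have gle f' g' : supporting f' -> supporting g' -> facet_simplex g' z -> gauge_of f' z <= gauge_of g' z.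
  move=> sf' sg' /(facet_simplexE _ sg'.1) [l0 l1].
  rewrite -{1}(baryK z sg'.1) mul_facet gauge_of_sum; apply: ler_sum => j _.
  by rewrite ler_piMr// supporting_pt.
have eqg : gauge_of f z = gauge_of g z by apply/eqP; rewrite eq_le !gle.
have [l0 l1] : std_simplex (bary g z) by apply/facet_simplexE.
have one j : gauge_of f (signed_pt (g j)) = 1.
  have : \sum_j bary g z 0 j * (1 - gauge_of f (signed_pt (g j))) = 0.
    under eq_bigr do rewrite mulrBr mulr1.
    by rewrite sumrB -gauge_of_sum -mul_facet baryK// eqg subrr.
  move/eqP; rewrite psumr_eq0; last by move=> i _; rewrite mulr_ge0// subr_ge0 supporting_pt.
  move=> /allP/(_ j (mem_index_enum j))/=; rewrite mulf_eq0 (negbTE (gz g j dg))/= subr_eq0.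
  by move/eqP.
have vert j : exists i, signed_pt (g j) = signed_pt (f i).
  have [[i ij]|none] := pselect (exists i, (f i).2 = (g j).2); last first.
    have := gp f (g j).2 df; have := one j; rewrite gauge_ofZ => h1 h2.
    have : `|gauge_of f (x (g j).2)| = 1.
      by rewrite -(normr1 R) -h1 normrM normr_sign mul1r.
    move=> h3; move: h2; rewrite h3 eqxx => /(_ _)/negP; case=> // i.
    by apply/eqP => e; apply: none; exists i.
  exists i; have := one j; have := gauge_of_vertex i df.
  rewrite /signed_pt !gauge_ofZ ij; set a := gauge_of _ _.
  case: (f i).1; case: (g j).1; rewrite ?expr0 ?expr1 ?mul1r ?mulN1r // => h1 h2; exfalso; lra.
have [h hE] := choice vert.
move=> _ [l [m0 m1] <-]; apply/(facet_simplexE _ df).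
have -> : bary f (l *m facet_mx g) = \sum_j l 0 j *: delta_mx 0 (h j).
  rewrite mul_facet /bary mulmx_suml; apply: eq_bigr => j _.
  by rewrite -scalemxAl hE -[X in _ *: X]/(bary f (signed_pt (f (h j)))) bary_vertex.
split.
  move=> i; rewrite summxE sumr_ge0// => j _; rewrite !mxE mulr_ge0//.
under eq_bigr do rewrite summxE.
rewrite exchange_big /= (eq_bigr (fun j => l 0 j))// => j _.
rewrite (bigD1 (h j))//= big1 ?addr0 => [|i /negbTE ih]; first by rewrite !mxE !eqxx mulr1.
by rewrite !mxE eqxx ih mulr0.
Qed.

Lemma facet_simplex_generic f g z : general_position -> supporting f -> supporting g ->
  generic_pt z -> facet_simplex f z -> facet_simplex g z -> facet_simplex f = facet_simplex g.
Proof.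
by move=> gp sf sg gz fz gz'; apply/seteqP; split; [apply: (@facet_simplex_sub_generic g f z)|apply: (@facet_simplex_sub_generic f g z)].
Qed.

Lemma facet_signs (e : 'I_n -> 'I_N) z : \det (\matrix_i x (e i)) != 0 ->
  exists f, \det (facet_mx f) != 0 /\ forall i, 0 <= bary f z 0 i.
Proof.
set B := \matrix_i _ => dB; pose l := z *m invmx B.
pose f : facet := [ffun i => (l 0 i < 0, e i)].
have fE : facet_mx f = diag_mx (\row_i (-1) ^+ (l 0 i < 0)%R) *m B.
  apply/row_matrixP => i; rewrite row_facet mul_diag_mx /signed_pt ffunE /=.
  by apply/rowP => j; rewrite !mxE.
have df : \det (facet_mx f) != 0.
  rewrite fE det_mulmx mulf_neq0// det_diag; apply/prodf_neq0 => i _.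
  by rewrite mxE signr_eq0.
exists f; split => // i.
have -> : bary f z = \row_i `|l 0 i|.
  rewrite -[RHS](bary_mul (f := f))//; congr bary.
  rewrite fE mulmxA (_ : _ *m diag_mx _ = l) ?mulmxKV ?unitmxE ?unitfE//.
  apply/rowP => j; rewrite mul_mx_diag !mxE.
  by case: ltP => h; rewrite ?expr1 ?expr0 ?mulrN1 ?mulr1; [rewrite ltr0_norm ?opprK|rewrite ger0_norm].
by rewrite mxE.
Qed.

(* A simplex pivot: the signed point [c] beyond the hyperplane of [f] enters the basis and the row
   with the least ratio of coordinates leaves it. *)
Lemma pivot f c z : \det (facet_mx f) != 0 -> (forall i, 0 < bary f z 0 i) ->
  1 < gauge_of f (signed_pt c) ->
  exists g, [/\ \det (facet_mx g) != 0, forall i, 0 <= bary g z 0 i & gauge_of g z < gauge_of f z].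
Proof.
move=> df l0 c1; set l := bary f z in l0 *; set al := bary f (signed_pt c).
have [r0 r0P] : exists r, 0 < al 0 r.
  apply: contrapT => none; suff : gauge_of f (signed_pt c) <= 0 by lra.
  by apply: sumr_le0 => i _; rewrite leNgt; apply/negP => h; apply: none; exists i.
have [r rP rmin] : exists2 r, 0 < al 0 r & forall i, 0 < al 0 i -> l 0 r / al 0 r <= l 0 i / al 0 i.
  by case: (@arg_minP _ _ _ r0 (fun i => 0 < al 0 i) (fun i => l 0 i / al 0 i) r0P) => r hr hm; exists r.
set t := l 0 r / al 0 r in rmin; have t0 : 0 < t by rewrite divr_gt0.
pose g : facet := [ffun i => if i == r then c else f i].
have gE i : g i = if i == r then c else f i by rewrite ffunE.
have dg : \det (facet_mx g) != 0.
  have -> : facet_mx g = \matrix_i (if i == r then signed_pt c else row i (facet_mx f)).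
    by apply/row_matrixP => i; rewrite !rowK gE; case: ifP.
  rewrite det_replace_row.
  have : al *m (\det (facet_mx f))%:M = signed_pt c *m \adj (facet_mx f).
    by rewrite -(mul_mx_adj (facet_mx f)) mulmxA baryK.
  move=> /rowP/(_ r) <-; rewrite mul_mx_scalar mxE mulf_neq0// gt_eqF//.
pose l' : V := \row_i (if i == r then t else l 0 i - t * al 0 i).
have zE : z = l' *m facet_mx g.
  rewrite mul_facet (bigD1 r)//= mxE eqxx gE eqxx.
  rewrite (eq_bigr (fun i => (l 0 i - t * al 0 i) *: signed_pt (f i))); last first.
    by move=> i /negbTE ir; rewrite mxE gE ir.
  have -> : \sum_(i | i != r) (l 0 i - t * al 0 i) *: signed_pt (f i) =
      \sum_i (l 0 i - t * al 0 i) *: signed_pt (f i).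
    by rewrite [RHS](bigD1 r)//= /t divfK ?gt_eqF// subrr scale0r add0r.
  under eq_bigr do rewrite scalerBl -scalerA.
  by rewrite sumrB -scaler_sumr -!mul_facet !baryK// addrC subrK.
have bE : bary g z = l' by rewrite zE bary_mul.
exists g; split => //.
  move=> i; rewrite bE mxE; case: ifP => _; first exact: ltW.
  rewrite subr_ge0; have [ai|ai] := ltP 0 (al 0 i).
    by rewrite -ler_pdivlMr//; exact: rmin.
  by apply: (@le_trans _ _ 0); [rewrite mulr_ge0_le0// ltW|exact: ltW].
rewrite /gauge_of bE (bigD1 r)//= mxE eqxx.
rewrite (eq_bigr (fun i => (l 0 i - t * al 0 i))); last by move=> i /negbTE ir; rewrite mxE ir.
have -> : \sum_(i | i != r) (l 0 i - t * al 0 i) = \sum_i (l 0 i - t * al 0 i).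
  by rewrite [RHS](bigD1 r)//= /t divfK ?gt_eqF// subrr add0r.
rewrite sumrB -mulr_sumr -/l -[\sum_i al 0 i]/(gauge_of f (signed_pt c)).
have : t * 1 < t * gauge_of f (signed_pt c) by rewrite ltr_pM2l.
by lra.
Qed.

(** Among the finitely many bases in which z has nonnegative coordinates, take one that minimises
    the gauge of z. Genericity makes the coordinates positive, so a signed point beyond the
    hyperplane would allow a pivot with a strict decrease. *)
Lemma supporting_exists (e : 'I_n -> 'I_N) z : \det (\matrix_i x (e i)) != 0 ->
  generic_pt z -> exists f, supporting f /\ forall i, 0 <= bary f z 0 i.
Proof.
move=> de gz; have [f0 [d0 b0]] := facet_signs z de.
pose P f := (\det (facet_mx f) != 0) && [forall i, 0 <= bary f z 0 i].
have P0 : P f0 by rewrite /P d0; apply/forallP.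
case: (@arg_minP _ _ _ f0 P (fun f => gauge_of f z) P0) => f /andP[df /forallP bf] fmin.
exists f; split => //; split => // k.
have le1 c : gauge_of f (signed_pt c) <= 1.
  rewrite leNgt; apply/negP => c1.
  have [|g [dg bg glt]] := pivot df _ c1 (z := z).
    by move=> i; rewrite lt_neqAle eq_sym bf gz.
  have : gauge_of f z <= gauge_of g z by apply: fmin; rewrite /P dg; apply/forallP.
  by rewrite leNgt glt.
have := le1 (true, k); have := le1 (false, k).
by rewrite !gauge_ofZ expr0 expr1 ler_norml; lra.
Qed.

Lemma abs_hull_cover (e : 'I_n -> 'I_N) z : \det (\matrix_i x (e i)) != 0 ->
  generic_pt z -> abs_hull x z -> exists2 f, supporting f & facet_simplex f z.
Proof.
move=> de gz Kz; have [f [sf bf]] := supporting_exists de gz.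
exists f => //; apply/(facet_simplexE _ sf.1); split => //; exact: abs_hull_gauge.
Qed.

Lemma measurable_facet_simplex f : \det (facet_mx f) != 0 -> measurable (facet_simplex f).
Proof.
move=> d; rewrite (_ : facet_simplex f = bary f @^-1` std_simplex).
  by rewrite -[X in measurable X]setTI; apply: measurable_mulmx_rV => //; exact: measurable_std_simplex.
by apply/seteqP; split => z /(facet_simplexE _ d).
Qed.

Lemma facet_inj f : \det (facet_mx f) != 0 -> injective (fun i => (f i).2).
Proof.
move=> d i j /= ij; apply/eqP; apply: contraT => nij.
have := bary_vertex i d; rewrite /signed_pt ij.
have -> : (-1) ^+ (f i).1 *: x (f j).2 = ((-1) ^+ (f i).1 * (-1) ^+ (f j).1) *: signed_pt (f j).
  by rewrite /signed_pt scalerA -mulrA -expr2 sqrr_sign mulr1.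
rewrite {1}/bary -scalemxAl -[X in _ *: X]/(bary f (signed_pt (f j))) bary_vertex// => /rowP/(_ i).
by rewrite !mxE !eqxx (negbTE nij) mulr0 => /eqP; rewrite eq_sym oner_eq0.
Qed.

Lemma facet_second_moment f (M : R) : \det (facet_mx f) != 0 ->
  (forall (e : 'I_n -> 'I_N) (b : 'I_n -> bool), injective e ->
     dotp (\sum_i (-1) ^+ b i *: x (e i)) (\sum_i (-1) ^+ b i *: x (e i)) <= M) ->
  (\int[leb]_(z in facet_simplex f) (dotp z z)%:E <= (2 * M / n%:R ^+ 2)%:E * leb (facet_simplex f))%E.
Proof.
move=> d hM; have u := unit_facet d; have mf := measurable_facet_simplex d.
have mq : measurable_fun [set: V] (fun z : V => dotp z z).
  by apply: measurable_sum => i; apply: measurable_funM; exact: measurable_coord.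
have -> : leb (facet_simplex f) = (`|\det (facet_mx f)|%:E * leb std_simplex)%E.
  rewrite -(@lebesgue_rV_image R n (facet_mx f) 0 std_simplex u measurable_std_simplex).
  congr (leb _); apply/seteqP; split => [_ [l hl <-]|_ [l hl <-]]; exists l => //; first by rewrite add0r.
  by rewrite add0r.
rewrite integral_mkcond (eq_integral (fun z => (\1_(facet_simplex f) z * dotp z z)%:E)); last first.
  by move=> z _; rewrite patchE indicE; case: ifP => _; rewrite ?mul1r ?mul0r.
rewrite (ge0_integral_rV_linear u); last 2 first.
- by apply/measurable_EFinP; apply: measurable_funM => //; exact: measurable_indic.
- by move=> z; rewrite lee_fin mulr_ge0// dotp_ge0.
rewrite muleCA; apply: lee_wpmul2l; first by rewrite lee_fin.
rewrite (eq_integral (fun l : V => (\1_std_simplex l * dotp (l *m facet_mx f) (l *m facet_mx f))%:E)); last first.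
  move=> l _; rewrite !indicE; congr ((_%:R * _)%:E); congr nat_of_bool.
  by apply/idP/idP => /set_mem h; apply: mem_set; [move/(facet_simplexE _ d): h; rewrite bary_mul|apply/(facet_simplexE _ d); rewrite bary_mul].
apply: simplex_second_moment => b.
pose b' i := b i (+) (f i).1.
have -> : \sum_i (-1) ^+ b i *: row i (facet_mx f) = \sum_i (-1) ^+ b' i *: x (f i).2.
  by apply: eq_bigr => i _; rewrite row_facet /signed_pt scalerA signr_addb.
exact/hM/facet_inj.
Qed.

(** The exceptional points lie in finitely many hyperplanes, each the preimage of a coordinate
    hyperplane under an invertible matrix. *)
Lemma generic_null : exists2 Z, measurable Z & leb Z = 0%E /\ forall z, ~ Z z -> generic_pt z.
Proof.
pose H (fi : facet * 'I_n) : set V :=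
  if \det (facet_mx fi.1) != 0 then [set z | bary fi.1 z 0 fi.2 = 0] else set0.
have hyp i : (measurable [set z : V | z 0 i = 0]) /\ leb [set z : V | z 0 i = 0] = 0%E.
  have E : [set z : V | z 0 i = 0] = [set z : V | forall j, (if j == i then [set 0] else setT : set R) (z 0 j)].
    by apply/seteqP; split => z /= h; [move=> j; case: eqP => // ->|have := h i; rewrite eqxx].
  split.
    rewrite -[X in measurable X]setTI; exact: (@measurable_coord R n i measurableT [set 0]).
  rewrite E (@lebesgue_rV_prod R n (fun j => if j == i then [set 0] else setT)); last by move=> j; case: ifP.
  by rewrite (bigD1 i)//= eqxx lebesgue_measure_set1 mul0e.
have mH fi : measurable (H fi) /\ leb (H fi) = 0%E.
  rewrite /H; case: ifP => [d|_]; last by rewrite measure0.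
  have u := unit_facet d; have [m0 l0] := hyp fi.2.
  have uI : invmx (facet_mx fi.1) \in unitmx by rewrite unitmx_inv.
  have mm : measurable [set z : V | bary fi.1 z 0 fi.2 = 0].
    by rewrite -[X in measurable X]setTI; exact: (@measurable_mulmx_rV R n n (invmx (facet_mx fi.1)) measurableT _ m0).
  split => //.
  have := lebesgue_rV_linear uI m0; rewrite l0 => /eqP.
  have nd : \det (invmx (facet_mx fi.1)) != 0 by rewrite -unitfE -unitmxE.
  by rewrite mule_eq0 [X in _ || X]eqe normr_eq0 (negbTE nd) orbF => /eqP.
exists (\big[setU/set0]_(fi : facet * 'I_n) H fi); first by apply: bigsetU_measurable => fi _; have [] := mH fi.
split.
  apply/eqP; rewrite eq_le measure_ge0 andbT.
  by rewrite bigsetU_null// => fi; have [] := mH fi.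
move=> z nz f i d; apply/eqP => h; apply: nz.
rewrite -bigcup_seq; exists (f, i) => /=; first by rewrite mem_index_enum.
by rewrite /H /= d.
Qed.

Lemma abs_hull_second_moment (M : R) (e : 'I_n -> 'I_N) : 0 <= M -> general_position ->
  \det (\matrix_i x (e i)) != 0 ->
  (forall (e : 'I_n -> 'I_N) (b : 'I_n -> bool), injective e ->
     dotp (\sum_i (-1) ^+ b i *: x (e i)) (\sum_i (-1) ^+ b i *: x (e i)) <= M) ->
  (\int[leb]_(z in abs_hull x) (dotp z z)%:E <= (2 * M / n%:R ^+ 2)%:E * leb (abs_hull x))%E.
Proof.
move=> M0 gp de hM; set K := abs_hull x.
have mK : measurable K by apply: measurable_compact_rV; exact: compact_abs_hull.
have [Z mZ [Z0 Zg]] := generic_null.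
pose A f : set V := if \det (facet_mx f) != 0 then facet_simplex f else set0.
pose s := [seq f <- enum facet | `[< supporting f >]].
have sP f : f \in s -> supporting f by rewrite mem_filter => /andP[/asboolP].
have mA f : measurable (A f) by rewrite /A; case: ifP => // /measurable_facet_simplex.
have AE f : supporting f -> A f = facet_simplex f by move=> [d _]; rewrite /A d.
have mq : measurable_fun [set: V] (fun z : V => (dotp z z)%:E).
  by apply/measurable_EFinP; apply: measurable_sum => i; apply: measurable_funM; exact: measurable_coord.
have q0 (z : V) : (0 <= (dotp z z)%:E)%E by rewrite lee_fin dotp_ge0.
have c0 : 0 <= 2 * M / n%:R ^+ 2 by rewrite divr_ge0 ?mulr_ge0 ?exprn_ge0.
set U := \big[setU/set0]_(f <- s) A f.
have mU : measurable U by apply: bigsetU_measurable.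
have UK : U `<=` K.
  rewrite /U -bigcup_seq => z [f /= /sP sf]; rewrite AE//; exact: facet_simplex_sub.
have hU : (\int[leb]_(z in U) (dotp z z)%:E <= (2 * M / n%:R ^+ 2)%:E * leb U)%E.
  apply: integral_cover => // [f /sP sf|f g /sP sf /sP sg].
    by rewrite AE//; apply: facet_second_moment => //; exact: sf.1.
  rewrite !AE//; have [fg|fg] := pselect (facet_simplex f = facet_simplex g); [by left|right].
  apply/eqP; rewrite eq_le measure_ge0 andbT -Z0; apply: le_measure.
  - by rewrite inE; apply: measurableI; apply: measurable_facet_simplex; [exact: sf.1|exact: sg.1].
  - by rewrite inE.
  move=> z [fz gz]; apply: contrapT => /Zg gen; apply: fg.
  exact: (facet_simplex_generic gp sf sg gen fz gz).
have KUZ : K `\` U `<=` Z.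
  move=> z [Kz nU]; apply: contrapT => /Zg gen; apply: nU.
  have [f sf fz] := abs_hull_cover de gen Kz.
  rewrite /U -bigcup_seq; exists f; last by rewrite AE.
  by rewrite /= mem_filter mem_enum andbT; apply/asboolP.
have -> : K = U `|` (K `\` U) by rewrite setUDr setDv setD0; apply/seteqP; split=> z; [right|case=> // /UK].
have mD : measurable (K `\` U) by exact: measurableD.
have D0 : leb (K `\` U) = 0%E.
  by apply/eqP; rewrite eq_le measure_ge0 andbT -Z0; apply: le_measure; rewrite ?inE.
rewrite ge0_integral_setU//; last 2 first.
- exact: measurable_funS mq.
- by apply/disj_setPS => y [Uy [_ /(_ Uy)]].
rewrite [X in (_ + X)%E]null_set_integral//; last exact: measurable_funS mq.
rewrite adde0; apply: (le_trans hU); apply: lee_wpmul2l; first by rewrite lee_fin.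
by apply: le_measure; rewrite ?inE//; exact: measurableU.
Qed.

End triangulation.

(** * Almost sure general position *)

Section general_position.
Context {R : realType} {n : nat} (mu : probability 'rV[R]_n R).
Hypotheses (iso : isotropic mu) (lc : log_concave mu).
Notation V := 'rV[R]_n.

Lemma lc_hyperplane_null (v : V) (a : R) : a != 0 -> pr mu [set x | dotp x v = a] = 0.
Proof.
move=> a0; have [->|v0] := eqVneq v 0.
  rewrite (_ : [set _ | _] = set0); first by rewrite /pr measure0.
  by apply/seteqP; split => x //=; rewrite dotp0r => /esym/eqP; rewrite (negbTE a0).
have mH : measurable [set x : V | dotp x v = a].
  have mv : measurable_fun setT (fun x : V => dotp x v) := measurable_dotp v.
  rewrite (_ : [set _ | _] = (fun x : V => dotp x v) @^-1` [set a])//.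
  by rewrite -[X in measurable X]setTI; exact: mv.
have e0 : 0 < enorm v by rewrite enorm_gt0.
apply/eqP; rewrite eq_le pr_ge0 andbT leNgt; apply/negP => p0.
pose u := (enorm v)^-1 *: v.
have u1 : dotp u u = 1.
  by rewrite dotpZl dotpZr -sqr_enorm mulrA -expr2 -exprMn mulVf ?gt_eqF// expr1n.
have C0 := @Canti_ge R.
pose t := pr mu [set x | dotp x v = a] / (2 * Canti).
have t0 : 0 < t by rewrite divr_gt0//; lra.
have := lc_anticonc iso lc (a / enorm v) u1 t0.
apply/negP; rewrite -ltNge; apply: (@lt_le_trans _ _ (pr mu [set x | dotp x v = a])).
  by rewrite /t (_ : _ * _ = pr mu [set x | dotp x v = a] / 2); [lra|field; lra].
apply: pr_le => //; first by apply: measurable_closed_rV; exact: closed_dotp_le.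
by move=> x /= h; rewrite dotpZr h mulrC subrr normr0 ltW.
Qed.

(** By Cramer's rule the gauge of z is [num] divided by [den]. Both are polynomials in the points,
    which makes the exceptional set measurable without inverting matrices. *)
Let den (y : 'I_n -> V) := \det (\matrix_i y i).
Let num (y : 'I_n -> V) (z : V) := \sum_r \det (\matrix_i (if i == r then z else y i)).

Let numE y z : num y z = dotp z (\row_j \sum_r (\adj (\matrix_i y i)) j r).
Proof.
rewrite /num (eq_bigr (fun r => (z *m \adj (\matrix_i y i)) 0 r)); last first.
  move=> r _; rewrite -det_replace_row; congr (\det _).
  by apply/row_matrixP => i; rewrite !rowK.
rewrite /dotp (eq_bigr (fun r => \sum_j z 0 j * (\adj (\matrix_i y i)) j r)); last first.
  by move=> r _; rewrite mxE.
by rewrite exchange_big /=; apply: eq_bigr => j _; rewrite mxE mulr_sumr.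
Qed.

Let bad (y : 'I_n -> V) : set V := [set z | den y != 0 /\ `|num y z| = `|den y|].

Let bad_null y : measurable (bad y) /\ pr mu (bad y) = 0.
Proof.
have [d|d] := eqVneq (den y) 0.
  rewrite (_ : bad y = set0); first by rewrite /pr measure0.
  by apply/seteqP; split => z // [/negP]; rewrite d eqxx.
set v : V := \row_j \sum_r (\adj (\matrix_i y i)) j r.
have bE : bad y = [set z | dotp z v = den y] `|` [set z | dotp z v = - den y].
  apply/seteqP; split => z.
    move=> [_ /eqP]; rewrite numE eqr_norm2 => /orP[/eqP h|/eqP h]; [by left|by right].
  by case=> h; split => //; rewrite numE [dotp _ _]h ?normrN.
have mH a : measurable [set x : V | dotp x v = a].
  have mv : measurable_fun setT (fun x : V => dotp x v) := measurable_dotp v.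
  rewrite (_ : [set _ | _] = (fun x : V => dotp x v) @^-1` [set a])//.
  by rewrite -[X in measurable X]setTI; exact: mv.
have mb : measurable (bad y) by rewrite bE; exact: measurableU.
split => //; apply/eqP; rewrite eq_le pr_ge0 andbT bE.
apply: (le_trans (prU _ _ _)) => //.
by rewrite !lc_hyperplane_null ?oppr_eq0// addr0.
Qed.

Let measurable_den d (T : measurableType d) (y : T -> 'I_n -> V) :
  (forall i, measurable_fun setT (fun t => y t i)) -> measurable_fun setT (fun t => den (y t)).
Proof.
move=> my; apply: measurable_det => i j; under eq_fun do rewrite mxE.
by apply: (measurableT_comp (measurable_coord j)); exact: my.
Qed.

Let measurable_num d (T : measurableType d) (y : T -> 'I_n -> V) (z : T -> V) :
  (forall i, measurable_fun setT (fun t => y t i)) -> measurable_fun setT z ->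
  measurable_fun setT (fun t => num (y t) (z t)).
Proof.
move=> my mz; apply: measurable_sum => r; apply: measurable_den => i.
by case: (i == r) => //; exact: my.
Qed.

Let measurable_bad d (T : measurableType d) (y : T -> 'I_n -> V) (z : T -> V) :
  (forall i, measurable_fun setT (fun t => y t i)) -> measurable_fun setT z ->
  measurable [set t | bad (y t) (z t)].
Proof.
move=> my mz; have md := measurable_den my; have mn := measurable_num my mz.
rewrite (_ : [set _ | _] = (fun t => den (y t)) @^-1` (~` [set 0]) `&`
   (fun t => `|num (y t) (z t)| - `|den (y t)|) @^-1` [set 0]).
  apply: measurableI; rewrite -[X in measurable X]setTI.
    by apply: md => //; exact: measurableC.
  have ms : measurable_fun setT (fun t => `|num (y t) (z t)| - `|den (y t)|).
    by apply: measurable_funB; apply: measurableT_comp.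
  exact: ms.
apply/seteqP; split => t /=.
  by move=> [d0 e]; split; [apply/eqP|rewrite e subrr].
by move=> [/eqP d0 /eqP]; rewrite subr_eq0 => /eqP e.
Qed.

Context {N : nat}.
Notation facet := {ffun 'I_n -> bool * 'I_N}.

Let badf (f : facet) (k : 'I_N) : set (N.-tuple V) :=
  [set t | bad (fun i => signed_pt (tnth t) (f i)) (tnth t k)].

Let measurable_signed (c : bool * 'I_N) :
  measurable_fun setT (fun t : N.-tuple V => signed_pt (tnth t) c).
Proof.
apply: measurable_fun_rV => j; under eq_fun do rewrite mxE.
apply: measurable_funM => //; apply: (measurableT_comp (measurable_coord j)).
exact: measurable_tnth.
Qed.

Let measurable_badf f k : measurable (badf f k).
Proof. by apply: measurable_bad => [i|]; [exact: measurable_signed|exact: measurable_tnth]. Qed.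

(** The point k is independent of the n vertices, and for fixed vertices the condition confines it
    to two hyperplanes off the origin. If a vertex index is repeated, the determinant vanishes and
    the set is empty. *)
Let badf_null (f : facet) (k : 'I_N) : (forall i, (f i).2 != k) -> pr (mtup mu N) (badf f k) = 0.
Proof.
move=> fk; have [inj|ninj] := pselect (injective (fun i => (f i).2)); last first.
  rewrite (_ : badf f k = set0); first by rewrite /pr measure0.
  by apply/seteqP; split => t // [d _]; exfalso; apply: ninj; exact: (facet_inj (x := tnth t)).
pose iota (i : 'I_(n + 1)) := match fintype.split i with inl j => (f j).2 | inr _ => k end.
have iota_inj : injective iota.
  move=> i j; rewrite /iota; case: (split_ordP i) => i' ->; case: (split_ordP j) => j' ->.
  - by move=> /inj ->.
  - by move=> e; move: (fk i'); rewrite e eqxx.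
  - by move=> e; move: (fk j'); rewrite e eqxx.
  - by rewrite (ord1 i') (ord1 j').
pose Y (w : (n + 1).-tuple V) i := (-1) ^+ (f i).1 *: tnth w (lshift 1 i) : V.
pose B' : set ((n + 1).-tuple V) := [set w | bad (Y w) (tnth w (rshift n ord0))].
have mY i : measurable_fun setT (Y ^~ i).
  apply: measurable_fun_rV => j; under eq_fun do rewrite mxE.
  apply: measurable_funM => //; apply: (measurableT_comp (measurable_coord j)).
  exact: measurable_tnth.
have mB' : measurable B' by apply: measurable_bad => //; exact: measurable_tnth.
apply: EFin_inj; rewrite -integral_pr_indic//.
rewrite (eq_integral (fun t : N.-tuple V => (\1_B' [tuple tnth t (iota i) | i < n + 1])%:E)); last first.
  move=> t _; rewrite !indicE; congr (_%:R%:E); congr nat_of_bool.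
  have e1 : Y [tuple tnth t (iota i) | i < n + 1] = fun i => signed_pt (tnth t) (f i).
    by apply/funext => i; rewrite /Y tnth_mktuple /iota (unsplitK (inl i : 'I_n + 'I_1)).
  have e2 : tnth [tuple tnth t (iota i) | i < n + 1] (rshift n ord0) = tnth t k.
    by rewrite tnth_mktuple /iota (unsplitK (inr ord0 : 'I_n + 'I_1)).
  by apply/idP/idP => /set_mem h; apply: mem_set; move: h; rewrite /B' /badf /= e1 e2.
rewrite (@ge0_integral_mtup_inj _ _ _ mu N (n + 1) iota (fun t => (\1_B' t)%:E))//; last first.
  by apply/measurable_EFinP; exact: measurable_indic.
rewrite ge0_integral_mtup_cat//; last by apply/measurable_EFinP; exact: measurable_indic.
apply: integral0_eq => s _.
pose y i : V := (-1) ^+ (f i).1 *: tnth s i.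
have [mb b0] := bad_null y.
rewrite (eq_integral (fun t : 1.-tuple V => (\1_(bad y) (tnth t ord0))%:E)); last first.
  move=> t _; rewrite !indicE; congr (_%:R%:E); congr nat_of_bool.
  have e1 : Y [tuple of s ++ t] = y by apply/funext => i; rewrite /Y tnth_lshift.
  by apply/idP/idP => /set_mem h; apply: mem_set; move: h; rewrite /B' /= e1 tnth_rshift.
rewrite (@ge0_integral_mtup1 _ _ _ mu 1 ord0 (fun z => (\1_(bad y) z)%:E))//; last first.
  by apply/measurable_EFinP; exact: measurable_indic.
by rewrite integral_pr_indic// b0.
Qed.

Lemma general_position_as : exists B : set (N.-tuple V), [/\ measurable B,
  pr (mtup mu N) B = 0 & forall t, ~ B t -> general_position (tnth t)].
Proof.
pose Q (fk : facet * 'I_N) := [forall i, (fk.1 i).2 != fk.2].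
pose B : set (N.-tuple V) := \bigcup_(fk in [set fk | Q fk]) badf fk.1 fk.2.
have mB : measurable B.
  by apply: fin_bigcup_measurable => [|fk _]; [exact: finite_finset|exact: measurable_badf].
exists B; split => //.
  apply/eqP; rewrite eq_le pr_ge0 andbT.
  apply: (@le_trans _ _ (\sum_(fk | Q fk) pr (mtup mu N) (badf fk.1 fk.2))).
    exact: pr_le_sum.
  by rewrite big1// => fk /forallP q; exact: badf_null.
move=> t nB f k df fk; apply/eqP => h; apply: nB; exists (f, k) => /=; first by apply/forallP.
split => //=.
have := mul_mx_adj (facet_mx (tnth t) f).
have -> : num (fun i => signed_pt (tnth t) (f i)) (tnth t k) =
    gauge_of (tnth t) f (tnth t k) * \det (facet_mx (tnth t) f).
  rewrite /num /gauge_of mulr_suml; apply: eq_bigr => r _.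
  transitivity ((tnth t k *m \adj (facet_mx (tnth t) f)) 0 r).
    by rewrite -det_replace_row; congr (\det _); apply/row_matrixP => i; rewrite !rowK.
  by rewrite -{1}(baryK (tnth t k) df) -mulmxA mul_mx_adj mul_mx_scalar mxE mulrC.
by rewrite normrM h mul1r.
Qed.

End general_position.

(** * Measurability of the event *)

Section hull_measurable.
Context {R : realType} {n N : nat}.
Notation V := 'rV[R]_n.
Notation leb := (@lebesgue_rV R n).
Notation tup := (N.-tuple V).

Let near_comb (m : nat) (q : 'rV[rat]_N) : set (tup * V) :=
  [set tz : tup * V | forall j : 'I_n, `|tz.2 0 j - \sum_i ratr (q 0 i) * tnth tz.1 i 0 j| < m.+1%:R^-1].

Let measurable_near_comb m q : measurable (near_comb m q).
Proof.
have -> : near_comb m q = \bigcap_(j in [set: 'I_n])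
   ((fun tz : tup * V => `|tz.2 0 j - \sum_i ratr (q 0 i) * tnth tz.1 i 0 j|) @^-1` `]-oo, m.+1%:R^-1[%classic).
  apply/seteqP; split => tz /= h j; first by move=> _; rewrite /= in_itv /=; exact: h.
  by have := h j I; rewrite /= in_itv.
apply: fin_bigcap_measurable => [|j _]; first exact: finite_finset.
have mf : measurable_fun setT (fun tz : tup * V => `|tz.2 0 j - \sum_i ratr (q 0 i) * tnth tz.1 i 0 j|).
  apply: measurableT_comp => //; apply: measurable_funB.
    exact: (measurableT_comp (measurable_coord j) measurable_snd).
  apply: measurable_sum => i; apply: measurable_funM => //.
  apply: (measurableT_comp (measurable_coord j)).
  exact: (measurableT_comp (measurable_tnth i) measurable_fst).
by rewrite -[X in measurable X]setTI; apply: mf.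
Qed.

Let rat_approx (q : 'rV[R]_N) (d : R) : 0 < d ->
  exists p : 'rV[rat]_N, forall i, `|q 0 i - ratr (p 0 i)| < d.
Proof.
move=> d0; have /choice[p pP] : forall i, exists a : rat, `|q 0 i - ratr a| < d.
  move=> i; have /rat_in_itvoo[a] : q 0 i - d < q 0 i + d by rewrite ltrD2l; lra.
  by rewrite in_itv /= => /andP[a1 a2]; exists a; rewrite ltr_norml; lra.
by exists (\row_i p i) => i; rewrite mxE.
Qed.

(** Approximation by rational coefficients with a slack in the l1 norm describes the hull by
    countably many conditions that are measurable jointly in the sample and the point. *)
Lemma abs_hull_rat (t : tup) z : abs_hull (tnth t) z <->
  forall m : nat, exists q : 'rV[rat]_N, \sum_i `|ratr (q 0 i) : R| <= 1 + m.+1%:R^-1 /\ near_comb m q (t, z).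
Proof.
split.
  move=> [q q1 <-] m; set e : R := m.+1%:R^-1; have e0 : 0 < e by rewrite invr_gt0 ltr0n.
  pose S : R := 1 + N%:R + \sum_i \sum_j `|tnth t i 0 j|.
  have s0 : 0 <= \sum_i \sum_j `|tnth t i 0 j| by apply: sumr_ge0 => i _; exact: sumr_ge0.
  have N0 : 0 <= N%:R :> R by [].
  have S0 : 0 < S by rewrite /S; lra.
  have [p hp] := rat_approx q (divr_gt0 e0 S0); exists p; split.
    apply: (@le_trans _ _ (\sum_i (`|q 0 i| + e / S))).
      apply: ler_sum => i _; rewrite -lerBlDl; apply: le_trans (ltW (hp i)).
      by rewrite distrC; exact: lerB_dist.
    rewrite big_split /= sumr_const card_ord -[X in _ + X]mulr_natl lerD//.
    rewrite mulrCA ler_piMr ?(ltW e0)// ler_pdivrMr// mul1r /S; lra.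
  move=> j /=; rewrite mulmx_rows summxE -sumrB.
  apply: (@le_lt_trans _ _ (\sum_i (e / S) * `|tnth t i 0 j|)).
    apply: le_trans (ler_norm_sum _ _ _) _; apply: ler_sum => i _.
    by rewrite mxE -mulrBl normrM ler_wpM2r// ltW.
  rewrite -/e -mulr_sumr -mulrA gtr_pMr// mulrC ltr_pdivrMr// mul1r.
  have : \sum_i `|tnth t i 0 j| <= \sum_i \sum_j `|tnth t i 0 j|.
    by apply: ler_sum => i _; rewrite (bigD1 j)//= lerDl sumr_ge0.
  rewrite /S; lra.
move=> h; have cK : closed (abs_hull (tnth t)) by apply: compact_closed; [exact: norm_hausdorff|exact: compact_abs_hull].
apply: cK => B /nbhs_ballP[e /= e0 eB].
pose S : R := 2 + \sum_j `|z 0 j|.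
have s0 : 0 <= \sum_j `|z 0 j| by exact: sumr_ge0.
have S0 : 0 < S by rewrite /S; lra.
have [m _ /(_ _ (leqnn m)) hm] : \forall k \near \oo, (k.+1%:R^-1 : R) < e / S.
  by apply: near_infty_natSinv_lt (PosNum (divr_gt0 e0 S0)).
have [q [q1 hq]] := h m; set d : R := m.+1%:R^-1 in hm q1 hq.
have d0 : 0 < d by rewrite invr_gt0 ltr0n.
have d1 : d <= 1 by rewrite invf_le1// ler1n.
have dS : d * S < e by rewrite -ltr_pdivlMr.
pose p : 'rV[R]_N := \row_i (ratr (q 0 i) / (1 + d)).
have D0 : 0 < 1 + d by lra.
exists (p *m \matrix_i tnth t i); split.
  exists p => //; rewrite /l1ball /=.
  under eq_bigr do rewrite mxE normrM normfV (gtr0_norm D0).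
  by rewrite -mulr_suml ler_pdivrMr// mul1r.
apply: eB; split => // r j; rewrite (ord1 r) /ball /= mulmx_rows summxE.
have -> : \sum_i (p 0 i *: tnth t i) 0 j = (\sum_i ratr (q 0 i) * tnth t i 0 j) / (1 + d).
  by rewrite mulr_suml; apply: eq_bigr => i _; rewrite !mxE mulrAC.
have := hq j; rewrite /=; set w := \sum_i _ => hw.
have -> : z 0 j - w / (1 + d) = ((z 0 j - w) + d * z 0 j) / (1 + d) by field; lra.
rewrite normrM normfV (gtr0_norm D0) ltr_pdivrMr//.
apply: (le_lt_trans (ler_normD _ _)); rewrite normrM (gtr0_norm d0).
have zj : `|z 0 j| <= \sum_j `|z 0 j| by rewrite (bigD1 j)//= lerDl sumr_ge0.
have h1 : d * `|z 0 j| <= d * \sum_j `|z 0 j| by rewrite ler_pM2l.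
have h2 : e <= e * (1 + d) by rewrite ler_peMr ?(ltW e0)//; lra.
have hw' : `|z 0 j - w| < d := hw.
by move: dS; rewrite /S mulrDr; lra.
Qed.

Definition hull_graph : set (tup * V) := [set tz | abs_hull (tnth tz.1) tz.2].

Lemma measurable_hull_graph : measurable hull_graph.
Proof.
have -> : hull_graph = \bigcap_m \bigcup_(q in [set q : 'rV[rat]_N | \sum_i `|ratr (q 0 i) : R| <= 1 + m.+1%:R^-1]) near_comb m q.
  apply/seteqP; split => -[t z].
    by move=> /abs_hull_rat h m _; have [q [q1 hq]] := h m; exists q.
  by move=> h; apply/abs_hull_rat => m; have [q q1 hq] := h m I; exists q.
apply: bigcap_measurable => [|m _]; first by exists 0%N.
rewrite bigcup_mkcond; apply: countable_bigcupT_measurable; first exact: countableP.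
by move=> q; case: ifP => // _; exact: measurable_near_comb.
Qed.

Lemma measurable_int_hull (g : V -> \bar R) : measurable_fun setT g -> (forall z, 0 <= g z)%E ->
  measurable_fun setT (fun t : tup => \int[leb]_(z in abs_hull (tnth t)) g z)%E.
Proof.
move=> mg g0.
pose F (tz : tup * V) : \bar R := ((\1_hull_graph tz)%:E * g tz.2)%E.
have mF : measurable_fun setT F.
  apply: emeasurable_funM.
    by apply/measurable_EFinP; apply: measurable_indic; exact: measurable_hull_graph.
  exact: (measurableT_comp mg measurable_snd).
have F0 tz : (0 <= F tz)%E by rewrite mule_ge0.
rewrite (_ : (fun _ => _) = fubini_F leb F).
  exact: measurable_fun_fubini_tonelli_F.
apply/funext => t; transitivity (\int[leb]_z ((\1_hull_graph (t, z))%:E * g z))%E; last by [].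
rewrite [LHS]integral_mkcond; apply: eq_integral => z _.
rewrite patchE indicE; have [h|h] := boolP (z \in abs_hull (tnth t)).
  by rewrite mem_set ?mul1e//; exact: set_mem h.
by rewrite memNset ?mul0e//; move=> h'; move/negP: h; apply; exact: mem_set.
Qed.

Lemma measurable_vol_hull : measurable_fun setT (fun t : tup => vol (abs_hull (tnth t))).
Proof.
apply: (measurableT_comp (f := @fine R)) => //.
rewrite (_ : (fun _ => _) = (fun t : tup => \int[leb]_(z in abs_hull (tnth t)) 1%:E)%E).
  by apply: measurable_int_hull => //.
apply/funext => t; rewrite integral_cst ?mul1e//.
by apply: measurable_compact_rV; exact: compact_abs_hull.
Qed.

Lemma measurable_Cov_hull i j : measurable_fun setT (fun t : tup => Cov (abs_hull (tnth t)) i j).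
Proof.
under eq_fun do rewrite mxE; apply: measurable_funM.
  have vE (t : tup) : (vol (abs_hull (tnth t)))^-1 = vol (abs_hull (tnth t)) `^ (-1) by rewrite powR_inv1// fine_ge0.
  under eq_fun do rewrite vE.
  exact: (measurableT_comp (measurable_powR _) measurable_vol_hull).
have mq : measurable_fun setT (fun z : V => (z 0 i * z 0 j)%:E).
  by apply/measurable_EFinP; apply: measurable_funM; exact: measurable_coord.
apply: (measurableT_comp (f := @fine R)) => //.
under eq_fun do rewrite integralE.
apply: emeasurable_funB; apply: measurable_int_hull => //.
  exact: measurable_funepos.
exact: measurable_funeneg.
Qed.

Lemma measurable_isotropic_constant_hull :
  measurable_fun setT (fun t : tup => isotropic_constant (abs_hull (tnth t))).
Proof.
apply: measurable_funM.
  exact: (measurableT_comp (measurable_powR _) measurable_vol_hull).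
apply: (measurableT_comp (measurable_powR _)).
by apply: measurable_det => i j; exact: measurable_Cov_hull.
Qed.

Lemma measurable_hull_event (c : R) : measurable [set t : tup |
  (exists e : 'I_n -> 'I_N, \det (\matrix_i tnth t (e i)) != 0) /\
  isotropic_constant (abs_hull (tnth t)) <= c].
Proof.
have me (e : {ffun 'I_n -> 'I_N}) : measurable [set t : tup | \det (\matrix_i tnth t (e i)) != 0].
  rewrite (_ : [set _ | _] = (fun t : tup => \det (\matrix_i tnth t (e i))) @^-1` (~` [set 0])).
    have md : measurable_fun setT (fun t : tup => \det (\matrix_i tnth t (e i))).
      apply: measurable_det => i j; under eq_fun do rewrite mxE.
      apply: (measurableT_comp (measurable_coord j)); exact: measurable_tnth.
    by rewrite -[X in measurable X]setTI; apply: md => //; exact: measurableC.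
  by apply/seteqP; split => t /= /eqP.
rewrite (_ : [set _ | _] = (\bigcup_(e in [set: {ffun 'I_n -> 'I_N}]) [set t : tup | \det (\matrix_i tnth t (e i)) != 0]) `&`
   (fun t : tup => isotropic_constant (abs_hull (tnth t))) @^-1` `]-oo, c]%classic).
  apply: measurableI.
    by apply: fin_bigcup_measurable => // ; exact: finite_finset.
  by rewrite -[X in measurable X]setTI; apply: measurable_isotropic_constant_hull.
apply/seteqP; split => t /=.
  move=> [[e de] h]; split; last by rewrite in_itv.
  exists (finfun e) => //=; move: de; congr (\det _ != 0).
  by apply/row_matrixP => i; rewrite !rowK ffunE.
by move=> [[e _ de]]; rewrite in_itv /= => h; split => //; exists e.
Qed.

End hull_measurable.

(** * The isotropic constant *)

Section covariance.
Context {R : realType} {n : nat} (K : set 'rV[R]_n).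
Hypothesis cK : compact K.
Notation V := 'rV[R]_n.
Notation leb := (@lebesgue_rV R n).

Let mK : measurable K. Proof. exact: measurable_compact_rV. Qed.

Let moment i j : R := \int[leb]_(z in K) (z 0 i * z 0 j).

Let integrable_coord2 i j : leb.-integrable K (fun z : V => (z 0 i * z 0 j)%:E).
Proof.
have [r r0 Kr] := compact_sub_box cK.
have mf : measurable_fun K (fun z : V => z 0 i * z 0 j).
  by apply: measurable_funTS; apply: measurable_funM; exact: measurable_coord.
apply/integrableP; split; first exact/measurable_EFinP.
apply: (@le_lt_trans _ _ (\int[leb]_(z in K) (r ^+ 2)%:E)%E).
  apply: ge0_le_integral => //.
  - by apply/measurable_EFinP; exact: measurableT_comp.
  - move=> z Kz; rewrite lee_fin normrM expr2.
    by apply: ler_pM => //; exact: (Kr _ Kz).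
by rewrite integral_cst// lte_mul_pinfty ?lebesgue_compact_lty// lee_fin sqr_ge0.
Qed.

Lemma int_quad_form (G : 'I_n -> 'I_n -> R) :
  (\int[leb]_(z in K) (\sum_i \sum_j G i j * (z 0 i * z 0 j))%:E =
   (\sum_i \sum_j G i j * moment i j)%:E)%E.
Proof.
have mE i j : (\int[leb]_(z in K) (z 0 i * z 0 j)%:E)%E = (moment i j)%:E.
  by rewrite /moment /Rintegral (fineK (integrable_fin_num mK (integrable_coord2 i j))).
transitivity (\int[leb]_(z in K) \sum_i \sum_j ((G i j)%:E * (z 0 i * z 0 j)%:E))%E.
  by apply: eq_integral => z _; rewrite -sumEFin; apply: eq_bigr => i _; rewrite -sumEFin.
have iZ i j : leb.-integrable K (fun z : V => (G i j)%:E * (z 0 i * z 0 j)%:E)%E.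
  exact: integrableZl.
rewrite integral_sum//; last first.
  by move=> i; apply: (integrable_sum (mu := leb)) => // j; exact: iZ.
rewrite -sumEFin; apply: eq_bigr => i _.
rewrite integral_sum// -sumEFin; apply: eq_bigr => j _.
by rewrite integralZl// mE.
Qed.

Lemma Cov_quad_form_ge0 (v : V) : 0 <= (v *m Cov K *m v^T) 0 0.
Proof.
have -> : (v *m Cov K *m v^T) 0 0 = (vol K)^-1 * \sum_i \sum_j v 0 i * v 0 j * moment i j.
  rewrite mxE exchange_big mulr_sumr; apply: eq_bigr => j _.
  rewrite !mxE mulr_suml mulr_sumr; apply: eq_bigr => i _.
  by rewrite !mxE -/(moment i j); ring.
apply: mulr_ge0; first by rewrite invr_ge0 fine_ge0.
rewrite -lee_fin -int_quad_form; apply: integral_ge0 => z _; rewrite lee_fin.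
suff -> : \sum_i \sum_j v 0 i * v 0 j * (z 0 i * z 0 j) = dotp z v ^+ 2 by exact: sqr_ge0.
rewrite expr2 mulr_suml; apply: eq_bigr => i _; rewrite mulr_sumr.
by apply: eq_bigr => j _; ring.
Qed.

Lemma trace_Cov : vol K != 0 ->
  (vol K * \tr (Cov K))%:E = (\int[leb]_(z in K) (dotp z z)%:E)%E.
Proof.
move=> v0.
have := int_quad_form (fun i j => (i == j)%:R).
have pick (F : 'I_n -> 'I_n -> R) : \sum_i \sum_j (i == j)%:R * F i j = \sum_i F i i.
  apply: eq_bigr => i _; rewrite (bigD1 i)//= eqxx mul1r big1 ?addr0// => j ji.
  by rewrite eq_sym (negbTE ji) mul0r.
under eq_integral do rewrite pick.
rewrite /dotp => ->; rewrite pick /mxtrace mulr_sumr; congr EFin.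
by apply: eq_bigr => i _; rewrite mxE mulrA mulfV// mul1r.
Qed.

(** [det_le_trace] bounds the determinant of the covariance by the n-th power of m^2 / n; the power
    1 / (2n) of this is m / sqrt n. *)
Lemma isotropic_constant_le (v m : R) : (0 < n)%N -> 0 < v -> 0 <= m ->
  ((v ^+ n)%:E <= leb K)%E ->
  (\int[leb]_(z in K) (dotp z z)%:E <= (m ^+ 2)%:E * leb K)%E ->
  isotropic_constant K <= m / (v * Num.sqrt n%:R).
Proof.
move=> n0 v0 m0 hv hm; have nR : 0 < n%:R :> R by rewrite ltr0n.
have lE : leb K = (vol K)%:E by rewrite fineK// ge0_fin_numE// lebesgue_compact_lty.
have vn : v ^+ n <= vol K by rewrite -lee_fin -lE.
have V0 : 0 < vol K by apply: lt_le_trans vn; exact: exprn_gt0.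
have tr : \tr (Cov K) <= n%:R * (m ^+ 2 / n%:R).
  rewrite mulrCA mulfV ?gt_eqF// mulr1 -(ler_pM2l V0) -lee_fin trace_Cov ?gt_eqF//.
  by rewrite [X in (_ <= X%:E)%E]mulrC EFinM -lE.
have sym : (Cov K)^T = Cov K.
  apply/matrixP => i j; rewrite !mxE; congr (_ * fine _).
  by apply: eq_integral => z _; rewrite mulrC.
have /andP[d0 dle] := det_le_trace n0 sym Cov_quad_form_ge0 tr.
have h1 : vol K `^ (- n%:R^-1) <= v^-1.
  rewrite powRN lef_pV2 ?posrE ?powR_gt0//.
  have -> : v = (v ^+ n) `^ n%:R^-1 by rewrite -powR_mulrn ?(ltW v0)// -powRrM mulfV ?gt_eqF// powRr1// ltW.
  by apply: ge0_ler_powR => //; rewrite ?nnegrE ?invr_ge0 ?exprn_ge0 ?(ltW v0) ?(ltW V0).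
have h2 : \det (Cov K) `^ ((2 * n)%:R^-1) <= m / Num.sqrt n%:R.
  have t0 : 0 <= m ^+ 2 / n%:R by rewrite divr_ge0 ?sqr_ge0.
  have -> : m / Num.sqrt n%:R = ((m ^+ 2 / n%:R) ^+ n) `^ ((2 * n)%:R^-1).
    rewrite -powR_mulrn// -powRrM natrM invfM mulrCA mulfV ?gt_eqF// mulr1.
    by rewrite powR12_sqrt// sqrtrM ?sqr_ge0// sqrtr_sqr ger0_norm// sqrtrV.
  by apply: ge0_ler_powR => //; rewrite ?nnegrE ?invr_ge0 ?exprn_ge0.
rewrite /isotropic_constant invfM mulrCA.
by apply: ler_pM => //; exact: powR_ge0.
Qed.

End covariance.

Section probability_bound.
Context {R : realType} {n N : nat} (mu : probability 'rV[R]_n R).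
Hypotheses (n0 : (0 < n)%N) (iso : isotropic mu) (lc : log_concave mu).
Hypotheses (nN : (n <= N)%N) (Ne : N%:R <= expR (Num.sqrt n%:R) :> R).
Notation V := 'rV[R]_n.
Let L : R := ln ((2 * N)%:R / n%:R).

Lemma volume_lower_bound : exists (c : R) (B : set (N.-tuple V)),
  [/\ c = vol_const \/ c = small_const, measurable B, pr (mtup mu N) B <= 9 * 16^-1 ^+ n &
   forall t, ~ B t -> (((c * Num.sqrt (L / n%:R)) ^+ n)%:E <= lebesgue_rV n (abs_hull (tnth t)))%E].
Proof.
have hull (t : N.-tuple V) : compact (abs_hull (tnth t)) /\
    (forall (I : finType) (q : I -> R) (y : I -> V), (forall i, 0 <= q i) -> \sum_i q i = 1 ->
      (forall i, abs_hull (tnth t) (y i)) -> abs_hull (tnth t) (\sum_i q i *: y i)).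
  split; first exact: compact_abs_hull.
  by move=> I q y q0 q1 Ky; apply: convex_sum => //; exact: convex_abs_hull.
have pts (t : N.-tuple V) j : abs_hull (tnth t) (tnth t j) /\ abs_hull (tnth t) (- tnth t j).
  by split; [|apply: abs_hullN]; exact: abs_hull_pt.
have p0 : 0 <= 16^-1 ^+ n :> R by rewrite exprn_ge0.
have [h|h] := leqP (8 * 16 * n) N.
  have [B [mB pB hB]] := volume_large n0 iso lc h Ne.
  exists vol_const, B; split => //; first by left.
  by move=> t /hB hv; have [cK kK] := hull t; exact: hv.
have [B [mB pB hB]] := volume_small n0 iso lc nN (ltnW h).
exists small_const, B; split => //; first by right.
  by apply: (le_trans pB); apply: ler_wpM2r => //; lra.
by move=> t /hB hv; have [cK kK] := hull t; exact: hv.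
Qed.

(** The root-mean-square radius is at most 2 net_const L and the volume radius at least of order c
    sqrt (L / n); the sum of the inverses dominates 1 / c for either value of c. *)
Definition iso_const : R := 2 * net_const * (vol_const^-1 + small_const^-1).

Lemma iso_const_gt0 : 0 < iso_const.
Proof.
apply: mulr_gt0; first by rewrite /net_const !mulr_gt0.
by apply: addr_gt0; rewrite invr_gt0 ?vol_const_gt0 ?small_const_gt0.
Qed.

Definition hull_event : set (N.-tuple V) := [set t |
  (exists e : 'I_n -> 'I_N, \det (\matrix_i tnth t (e i)) != 0) /\
  isotropic_constant (abs_hull (tnth t)) <= iso_const * Num.sqrt L].

Lemma hull_event_large : 1 - 12 * 16^-1 ^+ n <= pr (mtup mu N) hull_event.
Proof.
have nR : 0 < n%:R :> R by rewrite ltr0n.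
have L2 : 1 / 2 <= L := log_ratio_ge n0 nN.
have L0 : 0 < L by lra.
have mE : measurable hull_event by exact: measurable_hull_event.
have [c [B1 [cE mB1 pB1 hB1]]] := volume_lower_bound.
have [B2 [mB2 pB2 hB2]] := det_sample_large iso lc nN.
have [B3 [mB3 pB3 hB3]] := sign_sum_bound n0 iso lc nN.
have [B4 [mB4 pB4 hB4]] := @general_position_as R n mu iso lc N.
have c0 : 0 < c by case: cE => ->; [exact: vol_const_gt0|exact: small_const_gt0].
have sub : ~` hull_event `<=` (B1 `|` B2) `|` (B3 `|` B4).
  move=> t; apply: contra_notP => nB.
  have {}hB1 := hB1 t (fun h => nB (or_introl (or_introl h))).
  have {}hB2 := hB2 t (fun h => nB (or_introl (or_intror h))).
  have {}hB3 := hB3 t (fun h => nB (or_intror (or_introl h))).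
  have {}hB4 := hB4 t (fun h => nB (or_intror (or_intror h))).
  have de : \det (\matrix_i tnth t (widen_ord nN i)) != 0.
    have -> : \matrix_i tnth t (widen_ord nN i) = sample_mx [tuple tnth t (widen_ord nN i) | i < n].
      by apply/matrixP => i j; rewrite !mxE tnth_mktuple.
    apply: contraTneq hB2 => ->; rewrite expr0n /= -ltNge.
    have f0 : 0 < n`!%:R :> R by rewrite ltr0n fact_gt0.
    have k0 : 0 < det_kappa ^+ n :> R by rewrite exprn_gt0// det_kappa_gt0.
    by rewrite divr_gt0// mulr_gt0.
  split; first by exists (widen_ord nN).
  have A0 : 0 <= net_const * n%:R * L by rewrite /net_const !mulr_ge0 ?(ltW L0).
  have sm := @abs_hull_second_moment R n N (tnth t) ((net_const * n%:R * L) ^+ 2) (widen_ord nN)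
    (sqr_ge0 _) hB4 de.
  have {}sm : (\int[lebesgue_rV n]_(z in abs_hull (tnth t)) (dotp z z)%:E <=
      ((2 * net_const * L) ^+ 2)%:E * lebesgue_rV n (abs_hull (tnth t)))%E.
    apply: le_trans (sm _) _.
      move=> e b inj; rewrite -sqr_enorm lerXn2r ?nnegrE ?enorm_ge0//; exact: hB3.
    apply: lee_wpmul2r => //; rewrite lee_fin.
    have -> : 2 * (net_const * n%:R * L) ^+ 2 / n%:R ^+ 2 = 2 * (net_const * L) ^+ 2.
      by field; rewrite gt_eqF.
    have -> : (2 * net_const * L) ^+ 2 = 4 * (net_const * L) ^+ 2 by ring.
    by apply: ler_wpM2r; [exact: sqr_ge0|lra].
  have cs0 : 0 < c * Num.sqrt (L / n%:R) by rewrite mulr_gt0// sqrtr_gt0 divr_gt0.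
  have m0 : 0 <= 2 * net_const * L by rewrite /net_const !mulr_ge0 ?(ltW L0).
  apply: (le_trans (isotropic_constant_le (@compact_abs_hull R n N _) n0 cs0 m0 hB1 sm)).
  have sn0 : 0 < Num.sqrt n%:R :> R by rewrite sqrtr_gt0.
  have sL0 : 0 < Num.sqrt L by rewrite sqrtr_gt0.
  have -> : c * Num.sqrt (L / n%:R) * Num.sqrt n%:R = c * Num.sqrt L.
    by rewrite sqrtrM ?(ltW L0)// sqrtrV ?ler0n// -!mulrA mulVf ?mulr1 ?gt_eqF.
  have -> : 2 * net_const * L / (c * Num.sqrt L) = 2 * net_const * c^-1 * Num.sqrt L.
    rewrite -{1}(sqr_sqrtr (ltW L0)); set s := Num.sqrt L in sL0 *.
    by field; rewrite !gt_eqF.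
  apply: ler_wpM2r; first exact: ltW.
  rewrite /iso_const; apply: ler_wpM2l; first by rewrite /net_const !mulr_ge0.
  by case: cE => ->; rewrite ?lerDl ?lerDr invr_ge0 ltW ?vol_const_gt0 ?small_const_gt0.
have mB : measurable ((B1 `|` B2) `|` (B3 `|` B4)) by do ! apply: measurableU.
have := pr_le (mtup mu N) (measurableC mE) mB sub; rewrite prC// => h.
have h1 := prU (mtup mu N) (measurableU _ _ mB1 mB2) (measurableU _ _ mB3 mB4).
have h2 := prU (mtup mu N) mB1 mB2; have h3 := prU (mtup mu N) mB3 mB4.
(* The four events contribute 9 + 2 + 1 + 0 = 12. *)
move: h h1 h2 h3 pB1 pB2 pB3 pB4; set q := 16^-1 ^+ n; lra.
Qed.

End probability_bound.

(** 12 / 16^n <= (3/4)^n < exp (-n / 4) <= exp (- sqrt n / 4). *)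
Lemma failure_lt (R : realType) n : (0 < n)%N ->
  12 * 16^-1 ^+ n < expR (- 4^-1 * Num.sqrt n%:R) :> R.
Proof.
move=> n0; have nR : 1 <= n%:R :> R by rewrite ler1n.
apply: (@le_lt_trans _ _ ((3 / 4) ^+ n)).
  have -> : 3 / 4 = 12 * 16^-1 :> R by lra.
  rewrite exprMn; apply: ler_wpM2r; first by rewrite exprn_ge0.
  by rewrite -{1}[12]expr1; apply: ler_weXn2l => //; rewrite ler1n.
apply: (@lt_le_trans _ _ (expR (- 4^-1) ^+ n)).
  have h : 3 / 4 < expR (- 4^-1) :> R.
    have := @expR_gt1Dx R (- 4^-1); rewrite (_ : 1 + - 4^-1 = 3 / 4); last by lra.
    by apply; rewrite oppr_eq0 invr_eq0.
  by rewrite ltrXn2r ?nnegrE ?expR_ge0 -?lt0n ?divr_ge0.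
rewrite -expRM_natr ler_expR !mulNr lerN2 ler_wpM2l//.
by rewrite -[leRHS]ger0_norm// -sqrtr_sqr ler_sqrt ?sqr_ge0// expr2 ler_peMr.
Qed.

Theorem mainTheorem6 (R : realType) :
  exists c C : R, [/\ 0 < c, 0 < C &
    forall (n N : nat) (mu : probability 'rV[R]_n R)
      (d : measure_display) (Omega : measurableType d)
      (P : probability Omega R) (x : 'I_N -> {RV P >-> 'rV[R]_n}),
    (0 < n)%N -> log_concave mu -> isotropic mu ->
    (n <= N)%N -> N%:R <= expR (Num.sqrt n%:R) :> R ->
    mutually_independent x -> (forall i, has_law (x i) mu) ->
    ((1 - expR (- c * Num.sqrt n%:R))%:E <
      P [set w | let K := symmetric_hull (fun i => x i w) in
           symmetric_convex_body K /\
           (isotropic_constant K <= C * Num.sqrt (ln ((2 * N)%:R / n%:R)))%R])%E].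
Proof.
exists 4^-1, iso_const; split; [by rewrite invr_gt0|exact: iso_const_gt0|].
move=> n N mu d Omega P x n0 lc iso nN Ne ind law.
have N0 : (0 < N)%N := leq_trans n0 nN.
have mE : measurable (@hull_event R n N) by exact: measurable_hull_event.
have -> : [set w | let K := symmetric_hull (fun i => x i w) in
     symmetric_convex_body K /\
     (isotropic_constant K <= iso_const * Num.sqrt (ln ((2 * N)%:R / n%:R)))%R] =
   (fun w => [tuple x i w | i < N]) @^-1` (@hull_event R n N).
  have tE w : tnth [tuple x i w | i < N] = (fun i => x i w).
    by apply/funext => i; rewrite tnth_mktuple.
  apply/seteqP; split => w /=; rewrite /hull_event /= tE symmetric_hullE// => -[h1 h2]; split => //.
    by apply: (symmetric_convex_body_hull (fun i => x i w) N0).1; rewrite symmetric_hullE.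
  by rewrite -symmetric_hullE//; apply: (symmetric_convex_body_hull (fun i => x i w) N0).2.
(* The event depends on the law of the sample only, so it can be evaluated under [mtup]. *)
rewrite (@tuple_law _ _ _ mu _ _ P N (fun i => x i))//; last first.
  move=> A mA; have := ind [set: 'I_N]%SET A mA.
  rewrite (_ : [set` [set: 'I_N]%SET] = [set: 'I_N]); last first.
    by apply/seteqP; split => i //= _; rewrite inE.
  move=> ->; rewrite big_set/=; apply: eq_big => // i _; exact: law.
rewrite -prK// lte_fin; apply: lt_le_trans (hull_event_large n0 iso lc nN Ne).
by have := @failure_lt R n n0; lra.
Qed.
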